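(* Assume the standing assumptions, $\alpha_0=0$, and that $(\alpha_n)$ is generic. Let $q$ be the charge associated with the initial datum $\Psi_0=\varphi_{\alpha(0)}$. Then there are constants $A\in\mathbb R$, $C$, $B>0$ such that, as $t\to\infty$, $|q(t)|\le A\,t^{-3/2}+R(t)$ with $R(t)\sim Ce^{-Bt}$.
   Context: Let $H_0=-\Delta$ on $L^2(\mathbb R^3)$, $U_0(t)=e^{-iH_0t}$ with kernel $U_0(t;\vec x)=(4\pi it)^{-3/2}e^{i|\vec x|^2/(4t)}$. For $\lambda>0$, $\mathcal G^\lambda(\vec x)=e^{-\sqrt\lambda|\vec x|}/(4\pi|\vec x|)$. For $a\in\mathbb R$, $H_a$ is the point interaction at the origin of strength $a$: domain $\{\Psi\in L^2(\mathbb R^3):\exists q\in\mathbb C,\ \Psi-q\mathcal G^\lambda\in H^2(\mathbb R^3),\ (\Psi-q\mathcal G^\lambda)(0)=(a+\sqrt\lambda/(4\pi))q\}$, $(H_a+\lambda)\Psi=(H_0+\lambda)(\Psi-q\mathcal G^\lambda)$. For $a<0$, $H_a$ has the unique eigenvalue $-(4\pi a)^2$ with normalized eigenfunction $\varphi_a(\vec x)=\sqrt{2|a|}e^{4\pi a|\vec x|}/|\vec x|$. Standing assumptions: $\alpha:\mathbb R\to\mathbb R$ continuous and $T$-periodic, $\omega=2\pi/T$, $\alpha(t)=\sum_n\alpha_ne^{-in\omega t}$, $(\alpha_n)\in\ell^1(\mathbb Z)$, $\alpha_n=\overline{\alpha_{-n}}$, $\alpha(0)<0$. Dynamics: $H_{\alpha(t)}$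 generates a unitary propagator $U(t,s)$; for initial datum $\Psi_0$, $\Psi_t=U(t,0)\Psi_0=U_0(t)\Psi_0+i\int_0^tq(\tau)U_0(t-\tau;\cdot)d\tau$, where the charge $q$ is the unique solution of $q(t)+4\sqrt{\pi i}\int_0^t\frac{\alpha(\tau)q(\tau)}{\sqrt{t-\tau}}d\tau=4\sqrt{\pi i}\int_0^t\frac{(U_0(\tau)\Psi_0)(0)}{\sqrt{t-\tau}}d\tau$. Principal branch of square roots. Genericity: with $\tilde\alpha=(\alpha_1,\alpha_2,\dots)\in\ell^1(\mathbb N)$ and the shift $(\mathcal Ta)_n=a_{n+1}$ on $\ell^1(\mathbb N)$, $(\alpha_n)$ is generic if $e_1=(1,0,0,\dots)$ lies in the $\ell^1(\mathbb N)$-closure of the linear span of $\{\mathcal T^n\tilde\alpha:n\ge0\}$. *)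

(* Defs.v *)
(* R : realType, complex numbers R[i] from real_closed. *)
From HB Require Import structures.
From mathcomp Require Import all_boot all_order all_algebra.
From mathcomp Require Import all_classical all_reals all_analysis.
From mathcomp Require Import complex.
Set Implicit Arguments. Unset Strict Implicit. Unset Printing Implicit Defensive.
Import Order.TTheory GRing.Theory Num.Theory.
Import numFieldNormedType.Exports.
Local Open Scope classical_set_scope.
Local Open Scope ring_scope.
Local Open Scope complex_scope.

Section Defs.
Variable R : realType.
Local Notation C := R[i].

(* modulus of a complex number, as a real number *)
Definition cabs (z : C) : R := Num.sqrt (complex.Re z ^+ 2 + complex.Im z ^+ 2).

(* e^{i th} *)
Definition expi (th : R) : C := cos th +i* sin th.

(* complex-valued Lebesgue integral: real and imaginary parts *)
Definition cintegrable d (T : measurableType d) (mu : {measure set T -> \bar R})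
  (D : set T) (f : T -> C) : Prop :=
  mu.-integrable D (EFin \o (fun x => complex.Re (f x))) /\
  mu.-integrable D (EFin \o (fun x => complex.Im (f x))).

Definition cintegral d (T : measurableType d) (mu : {measure set T -> \bar R})
  (D : set T) (f : T -> C) : C :=
  Rintegral mu D (fun x => complex.Re (f x)) +i* Rintegral mu D (fun x => complex.Im (f x)).

(* R^3 with Lebesgue measure *)
Definition R3 := (R * R * R)%type.
Definition leb3 := ((@lebesgue_measure R \x @lebesgue_measure R) \x @lebesgue_measure R)%E.
Definition norm3 (y : R3) : R := Num.sqrt (y.1.1 ^+ 2 + y.1.2 ^+ 2 + y.2 ^+ 2).

(* normalized eigenfunction phi_a of H_a, a < 0 *)
Definition eigfun (a : R) (y : R3) : R :=
  Num.sqrt (2 * `|a|) * expR (4 * pi * a * norm3 y) / norm3 y.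

(* kernel U_0(t; y) = (4 pi i t)^{-3/2} e^{i|y|^2/(4t)}, principal branch:
   (4 pi i t)^{-3/2} = (4 pi t)^{-3/2} e^{-3 pi i/4} for t > 0 *)
Definition U0kernel (t : R) (y : R3) : C :=
  ((4 * pi * t) `^ (- (3 / 2)))%:C * expi (- (3 * pi / 4)) *
  expi (norm3 y ^+ 2 / (4 * t)).

(* (U_0(t) Psi_0)(0) = \int U_0(t; 0 - y) Psi_0(y) dy *)
Definition freeAt0 (Psi0 : R3 -> C) (t : R) : C :=
  cintegral leb3 setT (fun y => U0kernel t (- y.1.1, - y.1.2, - y.2) * Psi0 y).

(* sqrt(pi i), principal branch *)
Definition sqrt_pi_i : C := (Num.sqrt pi)%:C * expi (pi / 4).

(* q is the charge associated with the datum Psi0 for the strength alpha: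
   it solves the Volterra equation for every t >= 0 (integrals being
   Lebesgue integrals over [0,t]) *)
Definition is_charge (alpha : R -> R) (Psi0 : R3 -> C) (q : R -> C) : Prop :=
  forall t : R, 0 <= t ->
    let kq := fun s => (alpha s)%:C * q s / (Num.sqrt (t - s))%:C in
    let kf := fun s => freeAt0 Psi0 s / (Num.sqrt (t - s))%:C in
    cintegrable lebesgue_measure `[0, t] kq /\
    q t + 4%:C * sqrt_pi_i * cintegral lebesgue_measure `[0, t] kq
    = 4%:C * sqrt_pi_i * cintegral lebesgue_measure `[0, t] kf.

(* symmetric partial Fourier sum  sum_{n=-N}^{N} a_n e^{-i n w t} *)
Definition fourier_partial (an : int -> C) (w : R) (N : nat) (t : R) : C :=
  \sum_(0 <= k < N.*2.+1)
     an (k%:Z - N%:Z) * expi (- (((k%:Z - N%:Z)%:~R : R) * w * t)).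

(* (a_n) in l^1(Z) *)
Definition l1Z (an : int -> C) : Prop :=
  (\sum_(n <oo) ((cabs (an n%:Z) + cabs (an (- n%:Z)))%:E) < +oo)%E.

(* standing assumptions on alpha and its Fourier coefficients an *)
Definition standing (T : R) (alpha : R -> R) (an : int -> C) : Prop :=
  0 < T /\ continuous alpha /\ (forall t, alpha (t + T) = alpha t) /\
      l1Z an /\
      (forall n, an n = (an (- n))^*) /\
      (forall t, ((fun N => complex.Re (fourier_partial an (2 * pi / T) N t)) @ \oo --> alpha t)
              /\ ((fun N => complex.Im (fourier_partial an (2 * pi / T) N t)) @ \oo --> (0 : R))) /\
    alpha 0 < 0.

(* genericity: e_1 in the l^1-closure of span{ T^n alpha~ : n >= 0 },
   alpha~ = (alpha_1, alpha_2, ...); position k.+1 of T^j alpha~ is alpha_{k+1+j} *)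
Definition generic (an : int -> C) : Prop :=
  forall eps : R, 0 < eps -> exists (N : nat) (c : nat -> C),
    (\sum_(k <oo)
       ((cabs ((k == 0)%:R - \sum_(j < N) c j * an (k.+1 + j)%:Z))%:E) < eps%:E)%E.

End Defs.

(* Main.v *)
Require Import Defs.
From HB Require Import structures.
From mathcomp Require Import all_boot all_order all_algebra.
From mathcomp Require Import all_classical all_reals all_analysis.
From mathcomp Require Import measurable_realfun complex.
From mathcomp Require Import ring lra zify.
Import Order.TTheory GRing.Theory Num.Theory.
Import numFieldNormedType.Exports.
Set Implicit Arguments. Unset Strict Implicit. Unset Printing Implicit Defensive.
Local Open Scope classical_set_scope.
Local Open Scope ring_scope.
Local Open Scope complex_scope.

(** Write [h u = u^(-1/2)] for [u > 0] (the kernel [hker]). The charge equation is the Volterra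
equation [q + c1 h*(alpha q) = c1 h*g] with [c1 = 4 sqrt(pi i)] and [g = (U_0(.) phi)(0) = O(t^(-3/2))],
as [phi] is integrable. The kernel [h] is not integrable at infinity; convolving with the unit mass at 0
minus the probability density [mu u = 1_(u > 1) u^(-3/2) / 2] gives [q + K q = c1 k*g], where
[k = h - mu*h] is integrable, [K q = - mu*q + c1 k*(alpha q)], and [mu], [k] are [O(t^(-3/2))].

The operator [1 + K] commutes with translation by the period. By compactness, if it were not
boundedly invertible on causal functions there would be a bounded nonzero solution of [y + K y = 0] on a
half-line; the spectrum of the period translation on the closed span of its translates being
nonempty, a second compactness argument would give a bounded Floquet solution [y (t - T) = z y t],
[0 < |z| <= 1]. Its Fourier modes [y_n] and those [w_n] of [alpha y] satisfy [M_n y_n + c1 k_n w_n = 0],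
where the symbols are such that, up to a positive factor, [k_n/M_n] is [p_n^(-1/2)], [Re p_n >= 0].
Since [alpha] is real, [sum_n Im (conj w_n y_n) = 0], which forces [y_n = w_n = 0] for [n < 0];
genericity propagates this to all [n]. So [1 + K] is boundedly invertible, and it stays so after
conjugation by the weight [(1 + delta t)^(3/2)] with [delta] small, because the commutator is small. *)

(** * Lebesgue integrals on the line *)

(** The density [muker] needs a tail of order u^(-3/2): then its symbol differs from 1 by a multiple
    of sqrt p near p = 0, which cancels the singularity p^(-1/2) of the symbol of [hker] and leaves
    for [kker] a continuous symbol without zeros in the closed half-plane. In exchange M vanishes at
    p = 0, where the mode equation gives w_n = 0 directly. The sign in the energy argument comes
    from the phase of c1: y_n = - c e^(i pi/4) N w_n with c > 0 and N a positive multiple of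
    p_n^(-1/2), whose argument lies in [- pi/4, pi/4]. So e^(i pi/4) N lies in the closed first
    quadrant and every Im (conj w_n y_n) is <= 0; equality with w_n nonzero requires arg p_n = pi/2,
    which 0 <= Im p < omega excludes for n < 0. Two obstacles shape the rest. The bound s^(-3/2) on
    the forcing is not integrable at 0, so the charge is controlled only away from 0 and stability
    is applied to its restriction to [1, +oo[. And the limit solutions satisfy the equation on t <=
    0 only, so periodicity, shifts and Fourier coefficients are set up on the past. *)

Section RealIntegral.
Context {R : realType}.
Local Notation leb := (@lebesgue_measure R).

(** All integrals are over the whole line, with indicator factors for restrictions; translations,
    reflections and Fubini then need no change of domain. *)
Definition L1 (f : R -> R) : Prop := leb.-integrable setT (EFin \o f).
Definition Lint (f : R -> R) : R := Rintegral leb setT f.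

Lemma L1_meas (f : R -> R) : L1 f -> measurable_fun setT f.
Proof. by move=> /measurable_int/measurable_EFinP. Qed.

Lemma LintE (f : R -> R) : L1 f -> (\int[leb]_x (f x)%:E = (Lint f)%:E)%E.
Proof. by move=> Lf; rewrite /Lint /Rintegral fineK//; exact: integrable_fin_num. Qed.

Lemma L1_le (f g : R -> R) : measurable_fun setT f ->
  (forall x, `|f x| <= g x) -> L1 g -> L1 f.
Proof.
move=> mf fg; apply: le_integrable => //; first exact/measurable_EFinP.
by move=> x _ /=; rewrite lee_fin (le_trans (fg x))// ler_norm.
Qed.

Lemma L1D (f g : R -> R) : L1 f -> L1 g -> L1 (fun x => f x + g x).
Proof. by move=> Lf Lg; apply: eq_integrable (integrableD measurableT Lf Lg). Qed.

Lemma L1Z (c : R) (f : R -> R) : L1 f -> L1 (fun x => c * f x).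
Proof. by move=> Lf; apply: eq_integrable (integrableZl measurableT c Lf). Qed.

Lemma L1N (f : R -> R) : L1 f -> L1 (fun x => - f x).
Proof. by move=> Lf; apply: eq_integrable (integrableN Lf). Qed.

Lemma L1B (f g : R -> R) : L1 f -> L1 g -> L1 (fun x => f x - g x).
Proof. by move=> Lf Lg; apply: L1D => //; exact: L1N. Qed.

Lemma L1_0 : L1 (fun=> 0).
Proof. exact: integrable0. Qed.

Lemma L1_abs (f : R -> R) : L1 f -> L1 (fun x => `|f x|).
Proof. by move=> Lf; apply: L1_le (integrable_norm Lf) => //=;
  [apply: measurableT_comp => //; exact: L1_meas|move=> x; rewrite normr_id]. Qed.

Lemma eq_L1 (f g : R -> R) : f =1 g -> L1 f -> L1 g.
Proof. by move=> /funext ->. Qed.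

Lemma eq_Lint (f g : R -> R) : f =1 g -> Lint f = Lint g.
Proof. by move=> /funext ->. Qed.

Lemma LintD (f g : R -> R) : L1 f -> L1 g -> Lint (fun x => f x + g x) = Lint f + Lint g.
Proof. by move=> Lf Lg; rewrite /Lint RintegralD. Qed.

Lemma LintZ (c : R) (f : R -> R) : L1 f -> Lint (fun x => c * f x) = c * Lint f.
Proof. by move=> Lf; rewrite /Lint RintegralZl. Qed.

Lemma LintN (f : R -> R) : L1 f -> Lint (fun x => - f x) = - Lint f.
Proof. by move=> Lf; rewrite -mulN1r -LintZ//; apply: eq_Lint => x; rewrite mulN1r. Qed.

Lemma LintB (f g : R -> R) : L1 f -> L1 g -> Lint (fun x => f x - g x) = Lint f - Lint g.
Proof. by move=> Lf Lg; rewrite LintD ?LintN//; exact: L1N. Qed.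

Lemma Lint0 : Lint (fun=> 0) = 0.
Proof. by rewrite /Lint /Rintegral integral0. Qed.

Lemma Lint_ge0 (f : R -> R) : (forall x, 0 <= f x) -> 0 <= Lint f.
Proof. by move=> f0; apply: Rintegral_ge0. Qed.

Lemma Lint_le (f g : R -> R) : L1 f -> L1 g -> (forall x, f x <= g x) -> Lint f <= Lint g.
Proof. by move=> Lf Lg fg; apply: le_Rintegral. Qed.

Lemma L1P (f : R -> R) : measurable_fun setT f ->
  (\int[leb]_x `|(f x)%:E| < +oo)%E -> L1 f.
Proof. by move=> mf foo; apply/integrableP; split => //; exact/measurable_EFinP. Qed.

Lemma L1_bounded (f g : R -> R) (B : R) : measurable_fun setT f ->
  (forall x, `|f x| <= B) -> L1 g -> L1 (fun x => f x * g x).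
Proof.
move=> mf fB Lg; apply: L1_le (L1Z B (L1_abs Lg)).
  by apply: measurable_funM => //; exact: L1_meas.
by move=> x; rewrite normrM ler_wpM2r.
Qed.

Lemma L1_indic (D : set R) (f : R -> R) : measurable D ->
  L1 f -> L1 (fun x => \1_D x * f x).
Proof.
move=> mD; apply: (@L1_bounded _ _ 1); first exact: measurable_indic.
by move=> x; rewrite indicE; case: (_ \in _); rewrite ?normr1 ?normr0.
Qed.

Lemma restrict_indic (D : set R) (f : R -> R) : f \_ D = (fun x => \1_D x * f x).
Proof. by apply/funext => x; rewrite patchE indicE; case: ifP; rewrite ?mul1r ?mul0r. Qed.

Lemma L1_mkcond (D : set R) (f : R -> R) : measurable D ->
  leb.-integrable D (EFin \o f) <-> L1 (fun x => \1_D x * f x).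
Proof.
move=> mD; rewrite -restrict_indic /L1 -restrict_EFin.
exact: (@integrable_mkcond _ _ _ leb D (EFin \o f) mD).
Qed.

Lemma Lint_mkcond (D : set R) (f : R -> R) :
  Rintegral leb D f = Lint (fun x => \1_D x * f x).
Proof. by rewrite Rintegral_mkcond restrict_indic. Qed.

Lemma measurable_affine (a b : R) : measurable_fun setT (fun x : R => a * x + b).
Proof. by apply: measurable_funD => //; exact: measurable_funM. Qed.

(** Lebesgue measure is determined by its values on the intervals ]u, v], so the scaled pushforward
    is compared with it there; a negative slope only moves the closed endpoint to the other side. *)
Lemma lebesgue_measure_affine (a b : R) (A : set R) : a != 0 -> measurable A ->
  leb A = (`|a|%:E * leb ((fun x => (a * x + b)%R) @^-1` A))%E.
Proof.
move=> a0 mA.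
have mphi : measurable_fun [set: measurableTypeR R] (fun x : R => a * x + b : measurableTypeR R).
  exact: measurable_affine.
pose c : {nonneg R} := NngNum (normr_ge0 a).
pose P := measure_function_pushforward__canonical__measure_function_Measure leb mphi.
apply: (@lebesgue_measure_unique R (mscale c P) _ A mA) => X [[u v] _ <-] /=.
rewrite /mscale /= /pushforward lebesgue_measure_itv /= lte_fin.
have key (x : R) : x = a * ((x - b) / a) + b.
  by rewrite mulrCA divff// mulr1 subrK.
move: (a0); rewrite neq_lt => /orP[aneg|apos].
  rewrite (_ : _ @^-1` _ = `[(v - b) / a, (u - b) / a[%classic); last first.
    apply/seteqP; split => x /=; rewrite !in_itv/= => /andP[H1 H2]; apply/andP; split.
    - by rewrite ler_ndivrMr// lerBrDr mulrC.
    - by rewrite ltr_ndivlMr// ltrBlDr mulrC.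
    - by move: H2; rewrite ltr_ndivlMr// ltrBlDr mulrC.
    - by move: H1; rewrite ler_ndivrMr// lerBrDr mulrC.
  rewrite lebesgue_measure_itv /= lte_fin ltr_nM2r ?invr_lt0// ltrD2r.
  case: ifP => uv; last by rewrite mule0.
  by rewrite -!EFinD -EFinM ltr0_norm//; congr (_%:E); field.
rewrite (_ : _ @^-1` _ = `](u - b) / a, (v - b) / a]%classic); last first.
  apply/seteqP; split => x /=; rewrite !in_itv/= => /andP[H1 H2]; apply/andP; split.
  - by rewrite ltr_pdivrMr// ltrBlDr mulrC.
  - by rewrite ler_pdivlMr// lerBrDr mulrC.
  - by move: H1; rewrite ltr_pdivrMr// ltrBlDr mulrC.
  - by move: H2; rewrite ler_pdivlMr// lerBrDr mulrC.
rewrite lebesgue_measure_itv /= lte_fin ltr_pM2r ?invr_gt0// ltrD2r.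
case: ifP => uv; last by rewrite mule0.
by rewrite -!EFinD -EFinM gtr0_norm//; congr (_%:E); field.
Qed.

Lemma ge0_integral_affine (a b : R) (f : R -> \bar R) : a != 0 -> measurable_fun setT f ->
  (forall x, 0 <= f x)%E ->
  (\int[leb]_x f x = `|a|%:E * \int[leb]_x f (a * x + b)%R)%E.
Proof.
move=> a0 mf f0.
have mphi : measurable_fun [set: measurableTypeR R] (fun x : R => a * x + b : measurableTypeR R).
  exact: measurable_affine.
pose c : {nonneg R} := NngNum (normr_ge0 a).
pose P := measure_function_pushforward__canonical__measure_function_Measure leb mphi.
have -> : (\int[leb]_x f x = \int[mscale c P]_x f x)%E.
  apply: eq_measure_integral => A mA _; exact: lebesgue_measure_affine.
rewrite ge0_integral_mscale//; congr (_ * _)%E.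
by rewrite ge0_integral_pushforward.
Qed.

Lemma L1_affine (a b : R) (f : R -> R) : a != 0 -> L1 f -> L1 (fun x => f (a * x + b)).
Proof.
move=> a0 Lf; have mf := L1_meas Lf.
apply: L1P.
  by apply: (measurableT_comp mf); exact: measurable_affine.
have /integrableP[_] := Lf.
rewrite (@ge0_integral_affine a b (fun x => `|f x|%:E) a0)//=; last first.
  by apply/measurable_EFinP; apply: measurableT_comp.
have : (0 < `|a|%:E)%E by rewrite lte_fin normr_gt0.
have : (0 <= \int[leb]_x `|f (a * x + b)%R|%:E)%E by apply: integral_ge0.
set J := integral _ _ _.
by case: J => [r||]//= _ a1; rewrite ?ltry// gt0_muley.
Qed.

Lemma Lint_affine (a b : R) (f : R -> R) : a != 0 -> L1 f ->
  Lint (fun x => f (a * x + b)) = `|a|^-1 * Lint f.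
Proof.
move=> a0 Lf; have mf := L1_meas Lf.
have pos (g : R -> R) : (forall x, 0 <= g x) -> L1 g ->
    Lint (fun x => g (a * x + b)) = `|a|^-1 * Lint g.
  move=> g0 Lg; apply: EFin_inj.
  rewrite -LintE; last exact: L1_affine.
  rewrite EFinM -[X in (_ * X)%E]LintE//.
  rewrite (@ge0_integral_affine a b (fun x => (g x)%:E) a0)//; first last.
    by apply/measurable_EFinP; exact: L1_meas.
  by rewrite muleA -EFinM mulVf ?normr_eq0// mul1e.
(* The formula is known for nonnegative functions; [f] is the difference of the nonnegative
   functions |f| + f and |f|. *)
have E x : f x = (`|f x| + f x) - `|f x| by lra.
have La := L1_abs Lf.
have Ls := L1D La Lf.
have -> : Lint f = Lint (fun x => `|f x| + f x) - Lint (fun x => `|f x|).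
  by rewrite -LintB//; apply: eq_Lint.
rewrite (eq_Lint (fun x => E (a * x + b))).
rewrite LintB; first last.
- exact: (L1_affine _ a0 La).
- exact: (L1_affine _ a0 Ls).
rewrite (pos (fun x => `|f x| + f x))//; last first.
  by move=> x; have := ler_norm (- f x); rewrite normrN; lra.
by rewrite (pos (fun x => `|f x|))// mulrBr.
Qed.

Lemma Lint_subr (t : R) (f : R -> R) : L1 f -> Lint (fun s => f (t - s)) = Lint f.
Proof.
move=> Lf; have := @Lint_affine (-1) t f; rewrite oppr_eq0 oner_eq0 => /(_ isT Lf).
rewrite normrN1 invr1 mul1r => <-; apply: eq_Lint => x; congr f; ring.
Qed.

Lemma L1_subr (t : R) (f : R -> R) : L1 f -> L1 (fun s => f (t - s)).
Proof.
move=> Lf; have := @L1_affine (-1) t f; rewrite oppr_eq0 oner_eq0 => /(_ isT Lf).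
by apply: eq_L1 => x; congr f; ring.
Qed.

Lemma Lint_shift (a : R) (f : R -> R) : L1 f -> Lint (fun s => f (s + a)) = Lint f.
Proof.
move=> Lf; have := @Lint_affine 1 a f; rewrite oner_eq0 => /(_ isT Lf).
rewrite normr1 invr1 mul1r => <-; apply: eq_Lint => x; congr f; ring.
Qed.

Lemma L1_shift (a : R) (f : R -> R) : L1 f -> L1 (fun s => f (s + a)).
Proof.
move=> Lf; have := @L1_affine 1 a f; rewrite oner_eq0 => /(_ isT Lf).
by apply: eq_L1 => x; congr f; ring.
Qed.

Lemma measurable_Lint_abs (F : R -> R -> R) :
  measurable_fun setT (fun z : R * R => F z.1 z.2) -> (forall s, L1 (F s)) ->
  measurable_fun setT (fun s => Lint (fun t => `|F s t|)).
Proof.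
move=> mF F1.
have mF' : measurable_fun setT (fun z : measurableTypeR R * measurableTypeR R => `|F z.1 z.2|%:E).
  by apply/measurable_EFinP; apply: measurableT_comp.
have H := measurable_fun_fubini_tonelli_F (m2 := leb) _ mF' (fun z => normr_ge0 _).
apply/measurable_EFinP; apply: (eq_measurable_fun _ _ H) => s _ /=.
exact: (LintE (L1_abs (F1 s))).
Qed.

Lemma tonelli_L1 (F : R -> R -> R) :
  measurable_fun setT (fun z : R * R => F z.1 z.2) ->
  (forall s, L1 (F s)) -> L1 (fun s => Lint (fun t => `|F s t|)) ->
  (leb \x leb)%E.-integrable setT (fun z : R * R => (F z.1 z.2)%:E).
Proof.
move=> mF F1 F2; apply/integrable12ltyP => /=; first exact/measurable_EFinP.
under eq_integral do rewrite (LintE (L1_abs (F1 _))).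
have /integrableP[_] := F2.
suff -> : (\int[leb]_x `|(Lint (fun t => `|F x t|))%:E| =
  \int[leb]_x (Lint (fun t => `|F x t|))%:E)%E by [].
by apply: eq_integral => s _; rewrite gee0_abs// lee_fin Lint_ge0.
Qed.

Lemma fubini_L1 (F : R -> R -> R) :
  measurable_fun setT (fun z : R * R => F z.1 z.2) ->
  (forall s, L1 (F s)) -> (forall t, L1 (F^~ t)) ->
  L1 (fun s => Lint (fun t => `|F s t|)) ->
  [/\ L1 (fun s => Lint (F s)), L1 (fun t => Lint (F^~ t)) &
  Lint (fun s => Lint (F s)) = Lint (fun t => Lint (F^~ t))].
Proof.
move=> mF F1 F1' F2; have iF := tonelli_L1 mF F1 F2.
have A1 : (fun s => (\int[leb]_t (F s t)%:E)%E) = EFin \o (fun s => Lint (F s)).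
  by apply/funext => s; rewrite LintE.
have A2 : (fun t => (\int[leb]_s (F s t)%:E)%E) = EFin \o (fun t => Lint (F^~ t)).
  by apply/funext => t; rewrite LintE.
have B1 : L1 (fun s => Lint (F s)).
  by rewrite /L1 -A1; exact: (integrable_fubini_F iF).
have B2 : L1 (fun t => Lint (F^~ t)).
  rewrite /L1 -A2; apply: (integrable_fubini_F (m1 := leb) (m2 := leb)
    (f := fun z => (F z.2 z.1)%:E)).
  have mF' : measurable_fun setT (fun z : R * R => (F z.2 z.1)%:E).
    by apply/measurable_EFinP; exact: (measurableT_comp mF (@measurable_swap _ _ R R)).
  apply/integrable12ltyP => //.
  by apply/(integrable21ltyP leb leb (f := fun z => (F z.1 z.2)%:E)) => //;
    exact/measurable_EFinP.
split; [exact: B1|exact: B2|].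
apply: EFin_inj; rewrite -(LintE B1) -(LintE B2).
have := Fubini iF => /=.
by rewrite A1 A2.
Qed.

Lemma dominated_Lint (f_ : nat -> R -> R) (f g : R -> R) :
  (forall n, measurable_fun setT (f_ n)) -> measurable_fun setT f ->
  (forall x, f_ ^~ x @ \oo --> f x) -> L1 g ->
  (forall n x, `|f_ n x| <= g x) ->
  (fun n => Lint (f_ n)) @ \oo --> Lint f.
Proof.
move=> mf_ mf cf Lg fg.
have cf' : {ae leb, forall x, setT x -> (EFin \o f_ ^~ x) @ \oo --> (EFin \o f) x}.
  by apply: aeW => x _; apply: cvg_EFin; [exact: nearW|exact: cf].
have fg' : {ae leb, forall x n, setT x -> (`|(EFin \o f_ n) x| <= (EFin \o g) x)%E}.
  by apply: aeW => x n _; rewrite /= lee_fin; exact: fg.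
have [Lf _ H] := @dominated_convergence _ _ R leb setT measurableT
  (fun n => EFin \o f_ n) (EFin \o f) (EFin \o g)
  (fun n => (measurable_EFinP _ _).2 (mf_ n)) ((measurable_EFinP _ _).2 mf)
  cf' Lg fg'.
apply: fine_cvg; rewrite /= -/(Lint f).
rewrite -[X in _ --> X]/(Lint f)%:E -LintE//.
Qed.

End RealIntegral.

(** * Modulus and exponential of complex numbers *)

Section ComplexModulus.
Context {R : realType}.
Local Notation C := R[i].
Implicit Types (z w : C) (x y : R).

Lemma cabsE z : cabs z = Normc.normc z. Proof. by case: z. Qed.

Lemma cabs_ge0 z : 0 <= cabs z. Proof. exact: sqrtr_ge0. Qed.

Lemma cabsM z w : cabs (z * w) = cabs z * cabs w.
Proof. by rewrite !cabsE Normc.normcM. Qed.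

Lemma cabsV z : cabs z^-1 = (cabs z)^-1.
Proof. by rewrite !cabsE Normc.normcV. Qed.

Lemma cabsD z w : cabs (z + w) <= cabs z + cabs w.
Proof.
have : `|z + w| <= `|z| + `|w| by exact: ler_normD.
by rewrite !normc_def -rmorphD lecR /cabs.
Qed.

Lemma cabs0 : cabs (0 : C) = 0. Proof. by rewrite cabsE Normc.normc0. Qed.

Lemma cabs1 : cabs (1 : C) = 1. Proof. by rewrite cabsE Normc.normc1. Qed.

Lemma cabs_eq0 z : (cabs z == 0) = (z == 0).
Proof.
apply/eqP/eqP => [|->]; last exact: cabs0.
by rewrite cabsE => /Normc.eq0_normc.
Qed.

Lemma cabsN z : cabs (- z) = cabs z.
Proof. by case: z => a b; rewrite /cabs /= !sqrrN. Qed.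

Lemma cabsB z w : cabs (z - w) = cabs (w - z).
Proof. by rewrite -cabsN opprB. Qed.

Lemma cabs_tri z w : cabs z <= cabs w + cabs (z - w).
Proof. by rewrite -[X in cabs X <= _](subrK w) addrC cabsD// addrC. Qed.

Lemma cabs_real x : cabs x%:C = `|x|.
Proof. by rewrite /cabs /= expr0n addr0 sqrtr_sqr. Qed.

Lemma cabs_conj z : cabs (z^*) = cabs z.
Proof. by case: z => a b; rewrite /cabs /= sqrrN. Qed.

Lemma cabs_sqr z : cabs z ^+ 2 = complex.Re z ^+ 2 + complex.Im z ^+ 2.
Proof. by rewrite sqr_sqrtr// addr_ge0// sqr_ge0. Qed.

Lemma abs_Re_le z : `|complex.Re z| <= cabs z.
Proof. by rewrite -sqrtr_sqr ler_wsqrtr// lerDl sqr_ge0. Qed.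

Lemma abs_Im_le z : `|complex.Im z| <= cabs z.
Proof. by rewrite -sqrtr_sqr ler_wsqrtr// lerDr sqr_ge0. Qed.

Lemma cabs_le_abs z : cabs z <= `|complex.Re z| + `|complex.Im z|.
Proof.
rewrite [X in cabs X]complexE.
apply: (le_trans (cabsD _ _)); rewrite cabsM !cabs_real.
have -> : cabs ('i : C) = 1 by rewrite /cabs /= expr0n add0r expr1n sqrtr1.
by rewrite mul1r.
Qed.

Lemma cabs_sum (I : Type) (s : seq I) (P : pred I) (F : I -> C) :
  cabs (\sum_(i <- s | P i) F i) <= \sum_(i <- s | P i) cabs (F i).
Proof.
elim/big_ind2 : _ => //; first by rewrite cabs0.
by move=> x1 x2 y1 y2 h1 h2; apply: (le_trans (cabsD _ _)); exact: lerD.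
Qed.

Lemma cabs_expi x : cabs (expi x : C) = 1.
Proof. by rewrite /cabs /= cos2Dsin2 sqrtr1. Qed.

Lemma expiD x y : expi (x + y) = expi x * expi y :> C.
Proof.
by rewrite /expi cosD sinD; simpc; congr (_ +i* _); ring.
Qed.

Lemma expi0 : expi (0 : R) = 1 :> C.
Proof. by rewrite /expi cos0 sin0. Qed.

Definition cexp z : C := (expR (complex.Re z))%:C * expi (complex.Im z).

Lemma cexpD z w : cexp (z + w) = cexp z * cexp w.
Proof.
by case: z w => a b [c d]; rewrite /cexp /= expRD expiD rmorphM/=; ring.
Qed.

Lemma cexp0 : cexp 0 = 1.
Proof. by rewrite /cexp /= expR0 expi0 mulr1. Qed.

Lemma cabs_cexp z : cabs (cexp z) = expR (complex.Re z).
Proof. by rewrite /cexp cabsM cabs_expi mulr1 cabs_real gtr0_norm// expR_gt0. Qed.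

Lemma cexp_neq0 z : cexp z != 0.
Proof. by rewrite -cabs_eq0 cabs_cexp gt_eqF// expR_gt0. Qed.

Lemma ReM z w : complex.Re (z * w) =
  complex.Re z * complex.Re w - complex.Im z * complex.Im w.
Proof. by case: z w => a b [c d]. Qed.

Lemma ImM z w : complex.Im (z * w) =
  complex.Re z * complex.Im w + complex.Im z * complex.Re w.
Proof. by case: z w => a b [c d]. Qed.

Lemma ReD z w : complex.Re (z + w) = complex.Re z + complex.Re w.
Proof. by case: z w => a b [c d]. Qed.

Lemma ImD z w : complex.Im (z + w) = complex.Im z + complex.Im w.
Proof. by case: z w => a b [c d]. Qed.

Lemma ReN z : complex.Re (- z) = - complex.Re z. Proof. by case: z. Qed.
Lemma ImN z : complex.Im (- z) = - complex.Im z. Proof. by case: z. Qed.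

Lemma eqC z w : complex.Re z = complex.Re w -> complex.Im z = complex.Im w -> z = w.
Proof. by case: z w => a b [c d] /= -> ->. Qed.

Lemma cabs_sqrC z : z^* * z = (cabs z ^+ 2)%:C.
Proof. by apply: eqC; rewrite cabs_sqr; case: z => a b /=; ring. Qed.

End ComplexModulus.

(** * Integration of complex-valued functions *)

Section ComplexIntegral.
Context {R : realType}.
Local Notation C := R[i].

Definition cmeas d (T : measurableType d) (f : T -> C) : Prop :=
  measurable_fun setT (fun x => complex.Re (f x)) /\
  measurable_fun setT (fun x => complex.Im (f x)).

Lemma cmeasD d (T : measurableType d) (f g : T -> C) :
  cmeas f -> cmeas g -> cmeas (fun x => f x + g x).
Proof.
move=> [f1 f2] [g1 g2]; split.
  by rewrite (_ : (fun _ => _) = (fun x => complex.Re (f x) + complex.Re (g x)));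
    [exact: measurable_funD|apply/funext => x; rewrite ReD].
by rewrite (_ : (fun _ => _) = (fun x => complex.Im (f x) + complex.Im (g x)));
  [exact: measurable_funD|apply/funext => x; rewrite ImD].
Qed.

Lemma cmeasM d (T : measurableType d) (f g : T -> C) :
  cmeas f -> cmeas g -> cmeas (fun x => f x * g x).
Proof.
move=> [f1 f2] [g1 g2]; split.
  rewrite (_ : (fun _ => _) = (fun x => complex.Re (f x) * complex.Re (g x) -
     complex.Im (f x) * complex.Im (g x))); last by apply/funext => x; rewrite ReM.
  by apply: measurable_funB; apply: measurable_funM.
rewrite (_ : (fun _ => _) = (fun x => complex.Re (f x) * complex.Im (g x) +
   complex.Im (f x) * complex.Re (g x))); last by apply/funext => x; rewrite ImM.
by apply: measurable_funD; apply: measurable_funM.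
Qed.

Lemma cmeas_cst d (T : measurableType d) (c : C) : cmeas (fun _ : T => c).
Proof. by split; exact: measurable_cst. Qed.

Lemma cmeasN d (T : measurableType d) (f : T -> C) : cmeas f -> cmeas (fun x => - f x).
Proof.
move=> mf; rewrite (_ : (fun x => - f x) = fun x => -1 * f x).
  by apply: cmeasM => //; exact: cmeas_cst.
by apply/funext => x; rewrite mulN1r.
Qed.

Lemma cmeasB d (T : measurableType d) (f g : T -> C) :
  cmeas f -> cmeas g -> cmeas (fun x => f x - g x).
Proof. by move=> mf mg; apply: cmeasD => //; exact: cmeasN. Qed.

Lemma cmeas_real d (T : measurableType d) (f : T -> R) :
  measurable_fun setT f -> cmeas (fun x => (f x)%:C).
Proof. by move=> mf; split => //=; exact: measurable_cst. Qed.

Lemma cmeas_comp d d' (T : measurableType d) (T' : measurableType d')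
  (f : T' -> C) (g : T -> T') :
  cmeas f -> measurable_fun setT g -> cmeas (fun x => f (g x)).
Proof. by move=> [f1 f2] mg; split; [apply: measurableT_comp f1 mg|apply: measurableT_comp f2 mg]. Qed.

Lemma measurable_cos : measurable_fun setT (@cos R).
Proof. by apply: continuous_measurable_fun; exact: continuous_cos. Qed.

Lemma measurable_sin : measurable_fun setT (@sin R).
Proof. by apply: continuous_measurable_fun; exact: continuous_sin. Qed.

Lemma cmeas_expi d (T : measurableType d) (f : T -> R) :
  measurable_fun setT f -> cmeas (fun x => expi (f x)).
Proof.
by move=> mf; split; [apply: measurableT_comp measurable_cos mf|
  apply: measurableT_comp measurable_sin mf].
Qed.

Lemma cmeas_cexp d (T : measurableType d) (f : T -> C) :
  cmeas f -> cmeas (fun x => cexp (f x)).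
Proof.
move=> [f1 f2]; apply: cmeasM; last exact: cmeas_expi.
by apply: cmeas_real; apply: measurableT_comp => //; exact: measurable_expR.
Qed.

Lemma measurable_cabs d (T : measurableType d) (f : T -> C) :
  cmeas f -> measurable_fun setT (fun x => cabs (f x)).
Proof.
move=> [f1 f2]; rewrite /cabs; apply: measurableT_comp.
  by apply: continuous_measurable_fun; exact: sqrt_continuous.
by apply: measurable_funD; apply: measurable_funX.
Qed.

Definition CL1 (f : R -> C) : Prop :=
  L1 (fun x => complex.Re (f x)) /\ L1 (fun x => complex.Im (f x)).

Definition Cint (f : R -> C) : C :=
  Lint (fun x => complex.Re (f x)) +i* Lint (fun x => complex.Im (f x)).

Lemma eq_Cint (f g : R -> C) : f =1 g -> Cint f = Cint g.
Proof. by move=> /funext ->. Qed.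

Lemma eq_CL1 (f g : R -> C) : f =1 g -> CL1 f -> CL1 g.
Proof. by move=> /funext ->. Qed.

Lemma CL1_meas (f : R -> C) : CL1 f -> cmeas f.
Proof. by move=> [? ?]; split; exact: L1_meas. Qed.

Lemma CL1_le (f : R -> C) (g : R -> R) : cmeas f ->
  (forall x, cabs (f x) <= g x) -> L1 g -> CL1 f.
Proof.
move=> [f1 f2] fg Lg; split.
  by apply: L1_le Lg => // x; exact: le_trans (abs_Re_le _) _.
by apply: L1_le Lg => // x; exact: le_trans (abs_Im_le _) _.
Qed.

Lemma CL1_cabs (f : R -> C) : CL1 f -> L1 (fun x => cabs (f x)).
Proof.
move=> Lf; have mf := CL1_meas Lf; case: Lf => f1 f2.
apply: L1_le (L1D (L1_abs f1) (L1_abs f2)); first exact: measurable_cabs.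
by move=> x; rewrite ger0_norm ?cabs_ge0// cabs_le_abs.
Qed.

Lemma CL1D (f g : R -> C) : CL1 f -> CL1 g -> CL1 (fun x => f x + g x).
Proof.
move=> [f1 f2] [g1 g2]; split.
  by apply: eq_L1 (L1D f1 g1) => x; rewrite ReD.
by apply: eq_L1 (L1D f2 g2) => x; rewrite ImD.
Qed.

Lemma CL1Z (c : C) (f : R -> C) : CL1 f -> CL1 (fun x => c * f x).
Proof.
move=> [f1 f2]; split.
  by apply: eq_L1 (L1B (L1Z (complex.Re c) f1) (L1Z (complex.Im c) f2)) => x; rewrite ReM.
by apply: eq_L1 (L1D (L1Z (complex.Re c) f2) (L1Z (complex.Im c) f1)) => x; rewrite ImM.
Qed.

Lemma CL1N (f : R -> C) : CL1 f -> CL1 (fun x => - f x).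
Proof. by move=> /(CL1Z (-1)); apply: eq_CL1 => x; rewrite mulN1r. Qed.

Lemma CL1B (f g : R -> C) : CL1 f -> CL1 g -> CL1 (fun x => f x - g x).
Proof. by move=> Lf Lg; apply: CL1D => //; exact: CL1N. Qed.

Lemma CL1_real_bounded (f : R -> R) (g : R -> C) (B : R) : L1 f -> cmeas g ->
  (forall x, cabs (g x) <= B) -> CL1 (fun x => (f x)%:C * g x).
Proof.
move=> Lf mg gB; apply: CL1_le (L1Z B (L1_abs Lf)).
  by apply: cmeasM => //; apply: cmeas_real; exact: L1_meas.
by move=> x; rewrite cabsM cabs_real mulrC ler_wpM2r.
Qed.

Lemma CintD (f g : R -> C) : CL1 f -> CL1 g -> Cint (fun x => f x + g x) = Cint f + Cint g.
Proof.
move=> [f1 f2] [g1 g2]; apply: eqC; rewrite /Cint ?ReD ?ImD /=.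
  by rewrite -LintD//; apply: eq_Lint => x; rewrite ReD.
by rewrite -LintD//; apply: eq_Lint => x; rewrite ImD.
Qed.

Lemma CintZ (c : C) (f : R -> C) : CL1 f -> Cint (fun x => c * f x) = c * Cint f.
Proof.
move=> [f1 f2]; apply: eqC; rewrite /Cint ?ReM ?ImM /=.
  rewrite -!LintZ// -LintB; [by apply: eq_Lint => x; rewrite ReM|exact: L1Z|exact: L1Z].
by rewrite -!LintZ// -LintD; [apply: eq_Lint => x; rewrite ImM|exact: L1Z|exact: L1Z].
Qed.

Lemma CintN (f : R -> C) : CL1 f -> Cint (fun x => - f x) = - Cint f.
Proof. by move=> Lf; rewrite -mulN1r -CintZ//; apply: eq_Cint => x; rewrite mulN1r. Qed.

Lemma CintB (f g : R -> C) : CL1 f -> CL1 g -> Cint (fun x => f x - g x) = Cint f - Cint g.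
Proof. by move=> Lf Lg; rewrite CintD ?CintN//; exact: CL1N. Qed.

Lemma Cint_real (f : R -> R) : Cint (fun x => (f x)%:C) = (Lint f)%:C.
Proof. by rewrite /Cint /= Lint0. Qed.

Lemma Cint_abs (f : R -> C) : CL1 f -> cabs (Cint f) <= Lint (fun x => cabs (f x)).
Proof.
move=> Lf; have [->|z0] := eqVneq (Cint f) 0.
  by rewrite cabs0; apply: Lint_ge0 => x; exact: cabs_ge0.
set z := Cint f in z0 *.
have a0 : 0 < cabs z by rewrite lt_neqAle cabs_ge0 eq_sym cabs_eq0 z0.
(* Rotating by the phase of the integral makes it real and nonnegative, and then only the real part
   of the rotated integrand matters. *)
pose u := z^* / (cabs z)%:C.
have cu : cabs u = 1.
  by rewrite cabsM cabsV cabs_conj cabs_real gtr0_norm// divff// gt_eqF.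
have E : u * z = (cabs z)%:C.
  rewrite /u mulrAC cabs_sqrC expr2 rmorphM mulfK//.
  by rewrite -cabs_eq0 cabs_real normr_eq0 gt_eqF.
have -> : cabs z = Lint (fun x => complex.Re (u * f x)).
  by have := CintZ u Lf; rewrite -/z E => /(congr1 (@complex.Re R)) /= <-.
apply: Lint_le.
- by have [] := CL1Z u Lf.
- exact: CL1_cabs.
- move=> x; apply: (le_trans (ler_norm _)); apply: (le_trans (abs_Re_le _)).
  by rewrite cabsM cu mul1r.
Qed.

Lemma Cint_abs_le (f : R -> C) (g : R -> R) : CL1 f -> L1 g ->
  (forall x, cabs (f x) <= g x) -> cabs (Cint f) <= Lint g.
Proof.
move=> Lf Lg fg; apply: (le_trans (Cint_abs Lf)).
by apply: Lint_le => //; exact: CL1_cabs.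
Qed.

Lemma CL1_subr (t : R) (f : R -> C) : CL1 f -> CL1 (fun s => f (t - s)).
Proof. by move=> [f1 f2]; split; [exact: (L1_subr t f1)|exact: (L1_subr t f2)]. Qed.

Lemma Cint_subr (t : R) (f : R -> C) : CL1 f -> Cint (fun s => f (t - s)) = Cint f.
Proof. by move=> [f1 f2]; rewrite /Cint (Lint_subr t f1) (Lint_subr t f2). Qed.

Lemma CL1_shift (a : R) (f : R -> C) : CL1 f -> CL1 (fun s => f (s + a)).
Proof. by move=> [f1 f2]; split; [exact: (L1_shift a f1)|exact: (L1_shift a f2)]. Qed.

Lemma Cint_shift (a : R) (f : R -> C) : CL1 f -> Cint (fun s => f (s + a)) = Cint f.
Proof. by move=> [f1 f2]; rewrite /Cint (Lint_shift a f1) (Lint_shift a f2). Qed.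

Lemma fubini_CL1 (F : R -> R -> C) :
  cmeas (fun z : R * R => F z.1 z.2) ->
  (forall s, CL1 (F s)) -> (forall t, CL1 (F^~ t)) ->
  L1 (fun s => Lint (fun t => cabs (F s t))) ->
  [/\ CL1 (fun s => Cint (F s)), CL1 (fun t => Cint (F^~ t)) &
  Cint (fun s => Cint (F s)) = Cint (fun t => Cint (F^~ t))].
Proof.
move=> mF F1 F2 F3; have [mF1 mF2] := mF.
have mA (G : R -> R -> R) : measurable_fun setT (fun z : R * R => G z.1 z.2) ->
    (forall s t, `|G s t| <= cabs (F s t)) -> (forall s, L1 (G s)) ->
    L1 (fun s => Lint (fun t => `|G s t|)).
  move=> mG GF LG; apply: L1_le F3.
    exact: measurable_Lint_abs.
  move=> s; rewrite ger0_norm ?Lint_ge0//; apply: Lint_le => //.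
  - exact: L1_abs.
  - exact: CL1_cabs.
have [A1 A2 A3] := fubini_L1 mF1 (fun s => (F1 s).1) (fun t => (F2 t).1)
  (mA _ mF1 (fun s t => abs_Re_le _) (fun s => (F1 s).1)).
have [B1 B2 B3] := fubini_L1 mF2 (fun s => (F1 s).2) (fun t => (F2 t).2)
  (mA _ mF2 (fun s t => abs_Im_le _) (fun s => (F1 s).2)).
split; [by split|by split|].
by apply: eqC; [exact: A3|exact: B3].
Qed.

End ComplexIntegral.

(** * The convolution kernels *)

Section ImproperFTC.
Context {R : realType}.
Local Notation leb := (@lebesgue_measure R).

(** For a nonnegative integrand, the fundamental theorem on compact intervals exhausting [D] and
    monotone convergence give integrability and the value at once; the endpoints may be singular or
    infinite. *)
Lemma ge0_FTC_exhaust (f F : R -> R) (u v : nat -> R) (la lb : R) (D : set R) :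
  (forall n, u n < v n) -> nonincreasing_seq u -> nondecreasing_seq v ->
  D = \bigcup_n `[u n, v n]%classic ->
  (forall x, D x -> [/\ {for x, continuous f}, 0 <= f x & is_derive x 1 F (f x)]) ->
  F (u n) @[n --> \oo] --> la -> F (v n) @[n --> \oo] --> lb ->
  L1 (fun x => \1_D x * f x) /\ Lint (fun x => \1_D x * f x) = lb - la.
Proof.
move=> uv du iv DE hf Fu Fv.
have sub n x : x \in `[u n, v n] -> D x by move=> xn; rewrite DE; exists n.
have mD : measurable D by rewrite DE; exact: bigcup_measurable.
have cfn n : {within `[u n, v n], continuous f}.
  by apply: continuous_in_subspaceT => x; rewrite inE /= => /sub/hf[].
have cF x : D x -> {for x, continuous F}.
  by case/hf => _ _ dF; apply: differentiable_continuous; apply/derivable1_diffP; exact: ex_derive.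
have In n : (\int[leb]_(x in `[u n, v n]) (f x)%:E = (F (v n))%:E - (F (u n))%:E)%E.
  apply: continuous_FTC2 => //.
  - split.
    + by move=> x /subset_itv_oo_cc/sub/hf[_ _ dF]; exact: ex_derive.
    + by apply: cvg_at_right_filter; apply: cF; apply: (sub n); rewrite in_itv/= lexx ltW.
    + by apply: cvg_at_left_filter; apply: cF; apply: (sub n); rewrite in_itv/= lexx ltW.
  - move=> x /subset_itv_oo_cc/sub/hf[_ _ dF].
    by rewrite derive1E; exact: derive_val.
have mfn n : measurable_fun `[u n, v n] (EFin \o f).
  by apply/measurable_EFinP; apply: subspace_continuous_measurable_fun.
have mf : measurable_fun D (EFin \o f).
  by rewrite DE; apply/measurable_fun_bigcup.
have lim : (\int[leb]_(x in `[u n, v n]) (f x)%:E)%E @[n --> \oo] -->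
   (\int[leb]_(x in D) (f x)%:E)%E.
  have nd : nondecreasing_seq (fun n => `[u n, v n]%classic).
    move=> m n mn; rewrite subsetEset => x /=; rewrite !in_itv/= => /andP[h1 h2].
    by rewrite (le_trans (du _ _ mn) h1) (le_trans h2 (iv _ _ mn)).
  have f0 n x : `[u n, v n]%classic x -> (0 <= (EFin \o f) x)%E.
    by move=> /sub/hf[_ + _]; rewrite /= lee_fin.
  rewrite DE.
  exact: (ge0_nondecreasing_set_cvg_integral (mu := leb) nd (fun n => measurable_itv _) mfn f0).
have lim2 : (\int[leb]_(x in `[u n, v n]) (f x)%:E)%E @[n --> \oo] --> (lb - la)%:E.
  under eq_fun do rewrite In -EFinB.
  by apply: cvg_EFin; [exact: nearW|exact: cvgB].
have I : (\int[leb]_(x in D) (f x)%:E = (lb - la)%:E)%E by exact: (cvg_unique _ lim lim2).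
split.
  apply/(L1_mkcond _ mD); apply/integrableP; split => //.
  suff -> : (\int[leb]_(x in D) `|(EFin \o f) x| = \int[leb]_(x in D) (f x)%:E)%E.
    by rewrite I ltry.
  by apply: eq_integral => x /[!inE] /hf[_ f0 _] /=; rewrite ger0_norm.
by rewrite -Lint_mkcond /Rintegral I.
Qed.

Lemma cvg_div_addn (c : R) : c / n.+3%:R @[n --> \oo] --> (0 : R).
Proof.
rewrite -[X in _ --> X](mulr0 c); apply: cvgM; first exact: cvg_cst.
have := @cvg_harmonic R; rewrite -(cvg_shiftn 2); apply: cvg_trans.
by apply: near_eq_cvg; apply: nearW => n; rewrite /= addn2.
Qed.

Lemma ge0_FTC_oo (f F : R -> R) (a b : R) : a < b ->
  (forall x, a < x -> x < b -> [/\ {for x, continuous f}, 0 <= f x & is_derive x 1 F (f x)]) ->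
  {for a, continuous F} -> {for b, continuous F} ->
  L1 (fun x => \1_`]a, b[ x * f x) /\ Lint (fun x => \1_`]a, b[ x * f x) = F b - F a.
Proof.
move=> ab hf Fa Fb.
(* Denominators of at least 3 keep [a + e n < b - e n] for every [n]. *)
pose e n := (b - a) / n.+3%:R : R.
have ba : 0 < b - a by rewrite subr_gt0.
have n3 n : 0 < n.+3%:R :> R by rewrite ltr0Sn.
have e0 n : 0 < e n by rewrite divr_gt0.
have e3 n : e n <= (b - a) / 3.
  by rewrite ler_pM2l// lef_pV2 ?posrE// ler_nat.
have elim : e n @[n --> \oo] --> (0 : R) by exact: cvg_div_addn.
have de m n : (m <= n)%N -> e n <= e m.
  by move=> mn; rewrite ler_pM2l// lef_pV2 ?posrE// ler_nat.
apply: (@ge0_FTC_exhaust f F (fun n => a + e n) (fun n => b - e n)).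
- by move=> n; have := e3 n; lra.
- by move=> m n mn; rewrite lerD2l de.
- by move=> m n mn; rewrite lerD2l lerN2 de.
- apply/seteqP; split => [x /=|x [n _] /=]; rewrite !in_itv/= => /andP[h1 h2]; last first.
    by have := e0 n; lra.
  have d0 : 0 < Num.min (x - a) (b - x) by rewrite lt_min !subr_gt0 h1 h2.
  have [N _ HN] := (cvgr_lt _ elim _ d0).
  exists N => //=; rewrite in_itv/=.
  by have := HN N (leqnn _); rewrite /= lt_min => /andP[]; lra.
- by move=> x /=; rewrite in_itv/= => /andP[]; exact: hf.
- have H : a + e n @[n --> \oo] --> a.
    by rewrite -[X in _ --> X](addr0 a); apply: cvgD => //; exact: cvg_cst.
  exact: (cvg_comp _ _ H Fa).
- have H : b - e n @[n --> \oo] --> b.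
    by rewrite -[X in _ --> X](subr0 b); apply: cvgB => //; exact: cvg_cst.
  exact: (cvg_comp _ _ H Fb).
Qed.

Lemma ge0_FTC_oy (f F : R -> R) (a l : R) :
  (forall x, a < x -> [/\ {for x, continuous f}, 0 <= f x & is_derive x 1 F (f x)]) ->
  {for a, continuous F} -> F x @[x --> +oo] --> l ->
  L1 (fun x => \1_`]a, +oo[ x * f x) /\ Lint (fun x => \1_`]a, +oo[ x * f x) = l - F a.
Proof.
move=> hf Fa Fl.
pose e n := 1 / n.+3%:R : R.
have n3 n : 0 < n.+3%:R :> R by rewrite ltr0Sn.
have e0 n : 0 < e n by rewrite divr_gt0.
have e3 n : e n <= 1 / 3.
  by rewrite ler_pM2l// lef_pV2 ?posrE// ler_nat.
have elim : e n @[n --> \oo] --> (0 : R) by exact: cvg_div_addn.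
have de m n : (m <= n)%N -> e n <= e m.
  by move=> mn; rewrite ler_pM2l// lef_pV2 ?posrE// ler_nat.
apply: (@ge0_FTC_exhaust f F (fun n => a + e n) (fun n => a + n%:R + 1)).
- by move=> n; have := e3 n; have := ler0n R n; lra.
- by move=> m n mn; rewrite lerD2l de.
- by move=> m n mn; rewrite lerD2r lerD2l ler_nat.
- apply/seteqP; split => [x /=|x [n _] /=]; rewrite !in_itv/= ?andbT; last first.
    move=> /andP[h1 h2].
    by have := e0 n; lra.
  move=> h1; have d0 : 0 < x - a by rewrite subr_gt0.
  have [N _ HN] := (cvgr_lt _ elim _ d0).
  have [M xM] : exists M, x - a <= M%:R by exists (Num.bound (x - a)); rewrite ltW// archi_boundP// ltW.
  exists (maxn N M) => //=; rewrite in_itv/=.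
  have := HN (maxn N M) (leq_maxl _ _).
  have : M%:R <= (maxn N M)%:R :> R by rewrite ler_nat leq_maxr.
  by rewrite /=; lra.
- by move=> x /=; rewrite in_itv/= andbT; exact: hf.
- have H : a + e n @[n --> \oo] --> a.
    by rewrite -[X in _ --> X](addr0 a); apply: cvgD => //; exact: cvg_cst.
  exact: (cvg_comp _ _ H Fa).
- have H : a + n%:R + 1 @[n --> \oo] --> +oo.
    apply/cvgryPge => r; near=> n.
    have : r - a <= n%:R by near: n; exact: nbhs_infty_ger.
    by lra.
  exact: (cvg_comp _ _ H Fl).
Unshelve. all: by end_near. Qed.

End ImproperFTC.

Section Kernels.
Context {R : realType}.
Local Notation leb := (@lebesgue_measure R).
Implicit Types (t u s : R).

(* [Num.sqrt] vanishes on negative numbers and [0^-1 = 0], so that all these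
   kernels vanish on the nonpositive half-line. *)
Definition hker u : R := (Num.sqrt u)^-1.
Definition mker u : R := hker u * Num.min 1 u^-1.
Definition muker u : R := \1_`]1, +oo[%classic u * (hker u / (2 * u)).
Definition kker u : R := (Num.sqrt u - Num.sqrt (u - 1)) / u.

Lemma hker_ge0 u : 0 <= hker u.
Proof. by rewrite invr_ge0 sqrtr_ge0. Qed.

Lemma hker_neg u : u <= 0 -> hker u = 0.
Proof. by move=> u0; rewrite /hker ler0_sqrtr// invr0. Qed.

Lemma measurable_sqrt : measurable_fun setT (@Num.sqrt R).
Proof. by apply: continuous_measurable_fun; exact: sqrt_continuous. Qed.

Lemma measurable_inv : measurable_fun setT (fun x : R => x^-1).
Proof.
rewrite -(setUv [set 0 : R]); apply/measurable_funU => //; first exact: measurableC.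
split; first exact: measurable_fun_set1.
apply: open_continuous_measurable_fun.
  by apply: closed_openC; exact: closed_eq.
by move=> x; rewrite inE /= => /eqP x0; exact: inv_continuous.
Qed.

Lemma measurable_hker : measurable_fun setT hker.
Proof. by apply: (measurableT_comp measurable_inv); exact: measurable_sqrt. Qed.

Lemma mker_ge0 u : 0 <= mker u.
Proof.
have [u0|u0] := leP u 0; first by rewrite /mker hker_neg// mul0r.
by rewrite mulr_ge0 ?hker_ge0// le_min ler01 invr_ge0 ltW.
Qed.

Lemma mker_neg u : u <= 0 -> mker u = 0.
Proof. by move=> u0; rewrite /mker hker_neg// mul0r. Qed.

Lemma mker_le_hker u : mker u <= hker u.
Proof. by rewrite ler_piMr ?hker_ge0// ge_min lexx. Qed.

Lemma mker_le_V u : mker u <= hker u / u.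
Proof.
have [u0|u0] := leP u 0; first by rewrite /mker hker_neg// !mul0r.
by rewrite ler_wpM2l ?hker_ge0// ge_min lexx orbT.
Qed.

Lemma measurable_mker : measurable_fun setT mker.
Proof.
apply: measurable_funM; first exact: measurable_hker.
by apply: measurable_minr => //; exact: measurable_inv.
Qed.

Lemma hker_itv_int (b : R) : 0 < b ->
  L1 (fun u => \1_`]0, b[%classic u * hker u) /\
  Lint (fun u => \1_`]0, b[%classic u * hker u) = 2 * Num.sqrt b.
Proof.
move=> b0.
have cF (x : R) : {for x, continuous (fun u : R => 2 * Num.sqrt u)}.
  by apply: cvgM; [exact: cvg_cst|exact: sqrt_continuous].
have [] := @ge0_FTC_oo _ hker (fun u => 2 * Num.sqrt u) 0 b b0 _ (cF _) (cF _).
  move=> x x0 xb; split.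
  - apply: cvgV; first by rewrite gt_eqF// sqrtr_gt0.
    exact: sqrt_continuous.
  - exact: hker_ge0.
  - apply: (is_derive_eq (is_deriveZ 2 (is_derive1_sqrt x0))).
    by rewrite /hker /GRing.scale/= invfM mulrA divff ?mul1r.
by rewrite sqrtr0 mulr0 subr0.
Qed.

Lemma hker_gt0 u : 0 < u -> 0 < hker u.
Proof. by move=> u0; rewrite invr_gt0 sqrtr_gt0. Qed.

Lemma hker_continuous u : 0 < u -> {for u, continuous hker}.
Proof.
move=> u0; apply: cvgV; first by rewrite gt_eqF// sqrtr_gt0.
exact: sqrt_continuous.
Qed.

Lemma sqrt_sqr u : 0 <= u -> Num.sqrt u * Num.sqrt u = u.
Proof. by move=> u0; rewrite -expr2 sqr_sqrtr. Qed.

Lemma is_derive_hker u : 0 < u -> is_derive u 1 hker (- (hker u / (2 * u))).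
Proof.
move=> u0; have s0 : Num.sqrt u != 0 by rewrite gt_eqF// sqrtr_gt0.
apply: (is_derive_eq (is_deriveV s0 (is_derive1_sqrt u0))).
have ur : u = Num.sqrt u ^+ 2 by rewrite sqr_sqrtr// ltW.
by rewrite /hker /GRing.scale /= [X in _ = - (_ / (2 * X))]ur; field.
Qed.

Lemma hkerV_int : L1 (fun u => \1_`]1, +oo[%classic u * (hker u / u)) /\
  Lint (fun u => \1_`]1, +oo[%classic u * (hker u / u)) = 2.
Proof.
have c1 (x : R) : 0 < x -> {for x, continuous (fun u : R => -2 * hker u)}.
  by move=> x0; apply: cvgM; [exact: cvg_cst|exact: hker_continuous].
have l0 : -2 * hker x @[x --> +oo] --> (0 : R).
  rewrite -[X in _ --> X](mulr0 (-2)); apply: cvgM; first exact: cvg_cst.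
  apply/cvgr0Pnorm_lt => e e0; near=> x.
  have x0 : (e^-1) ^+ 2 < x by near: x; apply: nbhs_pinfty_gt; exact: num_real.
  have xp : 0 < x by apply: le_lt_trans x0; exact: sqr_ge0.
  rewrite ger0_norm ?hker_ge0// /hker invf_plt ?posrE ?sqrtr_gt0//.
  by rewrite -[X in X < _]ger0_norm ?invr_ge0 ?(ltW e0)// -sqrtr_sqr ltr_sqrt.
have [] := @ge0_FTC_oy _ (fun u => hker u / u) (fun u => -2 * hker u) 1 0 _ (c1 1 ltr01) l0.
  move=> x x1; have x0 : 0 < x by lra.
  split.
  - apply: cvgM; first exact: hker_continuous.
    by apply: cvgV; [rewrite gt_eqF|exact: cvg_id].
  - by rewrite divr_ge0 ?hker_ge0// ltW.
  - apply: (is_derive_eq (is_deriveZ (-2) (is_derive_hker x0))).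
    by rewrite /GRing.scale/=; field; rewrite gt_eqF.
have h1 : hker 1 = 1 by rewrite /hker sqrtr1 invr1.
by rewrite h1 mulr1 sub0r opprK.
Unshelve. all: by end_near. Qed.

Lemma L1_mker : L1 mker.
Proof.
(* The intervals ]0, 2[ and ]1, +oo[ overlap, so every u > 0 falls under one of the two
   majorants. *)
have [L2 _] := hker_itv_int (ltr0Sn R 1).
apply: L1_le (L1D L2 hkerV_int.1); first exact: measurable_mker.
move=> u; rewrite ger0_norm ?mker_ge0// !indicE.
have [u0|u0] := leP u 0.
  rewrite mker_neg//; apply: addr_ge0; first by rewrite mulr_ge0 ?hker_ge0.
  by rewrite hker_neg// mul0r mulr0.
have g0 : 0 <= hker u / u by rewrite divr_ge0 ?hker_ge0// ltW.
have [u2|u2] := ltP u 2.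
  rewrite mem_set/= ?in_itv/= ?u0// mul1r (le_trans (mker_le_hker u))// lerDl.
  by rewrite mulr_ge0.
have m1 : u \in `]1, +oo[%classic by rewrite inE/= in_itv/= andbT; lra.
rewrite m1 mul1r (le_trans (mker_le_V u))// lerDr.
by rewrite mulr_ge0 ?hker_ge0.
Qed.

Lemma muker_ge0 u : 0 <= muker u.
Proof.
rewrite /muker indicE; have [u1|u1] := leP u 1.
  by rewrite memNset ?mul0r//= in_itv/= andbT; lra.
by rewrite mulr_ge0// divr_ge0 ?hker_ge0//; lra.
Qed.

Lemma mukerE u : 1 < u -> muker u = hker u / (2 * u).
Proof. by move=> u1; rewrite /muker indicE mem_set ?mul1r//= in_itv/= u1. Qed.

Lemma muker_le1 u : u <= 1 -> muker u = 0.
Proof. by move=> u1; rewrite /muker indicE memNset ?mul0r//= in_itv/= andbT; lra. Qed.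

Lemma muker_le_mker u : muker u <= mker u.
Proof.
have [u1|u1] := leP u 1; first by rewrite muker_le1// mker_ge0.
have u0 : 0 < u by lra.
rewrite mukerE// /mker ler_wpM2l ?hker_ge0// le_min.
rewrite lef_pV2 ?posrE; [|lra|lra].
by rewrite invf_le1; [apply/andP; split; lra|lra].
Qed.

Lemma measurable_muker : measurable_fun setT muker.
Proof.
apply: measurable_funM; first exact: measurable_indic.
apply: measurable_funM; first exact: measurable_hker.
by apply: (measurableT_comp measurable_inv); exact: measurable_funM.
Qed.

Lemma L1_muker : L1 muker.
Proof.
apply: L1_le L1_mker; first exact: measurable_muker.
by move=> u; rewrite ger0_norm ?muker_ge0// muker_le_mker.
Qed.

Lemma Lint_muker : Lint muker = 1.
Proof.
have [L e] := hkerV_int.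
rewrite (@eq_Lint _ _ (fun u => 2^-1 * (\1_`]1, +oo[%classic u * (hker u / u)))).
  by rewrite LintZ// e mulVf.
by move=> u; rewrite /muker invfM; ring.
Qed.

(** On ]1, t[ the product of u^(-3/2) / 2 and (t - u)^(-1/2) has the elementary antiderivative -
    sqrt (t / u - 1) / t; this gives [kker] its closed form. For t <= 1 both sides vanish. *)
Lemma muker_conv_hker t : L1 (fun u => muker u * hker (t - u)) /\
  Lint (fun u => muker u * hker (t - u)) = Num.sqrt (t - 1) / t.
Proof.
have [t1|t1] := leP t 1.
  have E : (fun u => muker u * hker (t - u)) = (fun=> 0).
    apply/funext => u; have [u1|u1] := leP u 1; first by rewrite muker_le1// mul0r.
    by rewrite [hker (t - u)]hker_neg ?mulr0//; lra.
  by rewrite E Lint0 ler0_sqrtr ?mul0r; [split => //; exact: L1_0|lra].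
have t0 : 0 < t by lra.
pose F u := - t^-1 * Num.sqrt (t / u - 1) : R.
have cF x : 0 < x -> {for x, continuous F}.
  move=> x0; apply: cvgM; first exact: cvg_cst.
  apply: continuous_cvg; first exact: sqrt_continuous.
  apply: cvgB; last exact: cvg_cst.
  by apply: cvgM; [exact: cvg_cst|apply: cvgV; [rewrite gt_eqF|exact: cvg_id]].
have [] := @ge0_FTC_oo _ (fun u => hker u / (2 * u) * hker (t - u)) F 1 t t1 _
  (cF 1 ltr01) (cF t t0).
  move=> x x1 xt; have x0 : 0 < x by lra.
  have tx0 : 0 < t - x by lra.
  split.
  - apply: cvgM.
      apply: cvgM; first exact: hker_continuous.
      apply: cvgV; first by rewrite gt_eqF//; lra.
      by apply: cvgM; [exact: cvg_cst|exact: cvg_id].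
    have H : t - y @[y --> x] --> t - x by apply: cvgB; [exact: cvg_cst|exact: cvg_id].
    exact: (cvg_comp _ _ H (hker_continuous tx0)).
  - by rewrite mulr_ge0 ?hker_ge0// divr_ge0 ?hker_ge0//; lra.
  - have w0 : 0 < t / x - 1 by rewrite subr_gt0 ltr_pdivlMr ?mul1r.
    have dw : is_derive x 1 (fun u : R => t / u - 1) (- t / x ^+ 2).
      have xn : x != 0 by rewrite gt_eqF.
      apply: (is_derive_eq (is_deriveB (is_deriveZ t (is_deriveV xn (is_derive_id x 1)))
        (is_derive_cst (1:R) x 1))).
      by rewrite /GRing.scale/= subr0 mulr1; field.
    have dc := is_derive1_comp (f := Num.sqrt) (g := fun u : R => t / u - 1) (is_derive1_sqrt w0) dw.
    apply: (is_derive_eq (is_deriveZ (- t^-1) dc)).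
    rewrite /GRing.scale/= /hker.
    have -> : t / x - 1 = (t - x) / x by field; rewrite gt_eqF.
    rewrite sqrtrM ?(ltW tx0)// sqrtrV ?(ltW x0)//.
    have sx : Num.sqrt x != 0 by rewrite gt_eqF// sqrtr_gt0.
    have sy : Num.sqrt (t - x) != 0 by rewrite gt_eqF// sqrtr_gt0.
    rewrite -[X in - t / X ^+ 2](sqrt_sqr (ltW x0)) -[X in _ / (2 * X)](sqrt_sqr (ltW x0)).
    by field; rewrite sx sy gt_eqF.
have E : (fun u => \1_`]1, t[%classic u * (hker u / (2 * u) * hker (t - u))) =
    (fun u => muker u * hker (t - u)).
  apply/funext => u; rewrite indicE.
  have [ut|ut] := leP t u; first by rewrite [hker (t - u)]hker_neg ?mulr0//; lra.
  have [u1|u1] := leP u 1.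
    by rewrite muker_le1// memNset ?mul0r//= in_itv/=; lra.
  by rewrite mukerE// mem_set ?mul1r//= in_itv/= u1.
rewrite E => L1E ->; split => //.
by rewrite /F divff ?gt_eqF// subrr sqrtr0 mulr0 sub0r mulNr opprK divr1 mulrC.
Qed.

Lemma kkerE t : kker t = hker t - Lint (fun u => muker u * hker (t - u)).
Proof.
rewrite (muker_conv_hker t).2 /kker mulrBl; congr (_ - _).
have [t0|t0] := leP t 0; first by rewrite hker_neg// ler0_sqrtr// mul0r.
rewrite -[X in _ / X](sqrt_sqr (ltW t0)) /hker.
by field; rewrite gt_eqF// sqrtr_gt0.
Qed.

Lemma muker_conv_hker_le t : Lint (fun u => muker u * hker (t - u)) <= hker t.
Proof.
have [t0|t0] := leP t 0.
  rewrite (muker_conv_hker t).2 ler0_sqrtr ?mul0r ?hker_ge0//; lra.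
rewrite -subr_ge0 -kkerE /kker divr_ge0 ?(ltW t0)// subr_ge0.
by rewrite ler_wsqrtr//; lra.
Qed.

Lemma kker_neg t : t <= 0 -> kker t = 0.
Proof. by move=> t0; rewrite /kker !ler0_sqrtr ?subrr ?mul0r//; lra. Qed.

Lemma kker_ge0 t : 0 <= kker t.
Proof. by rewrite kkerE subr_ge0 muker_conv_hker_le. Qed.

Lemma kker_hker t : t <= 1 -> kker t = hker t.
Proof.
move=> t1; rewrite kkerE (muker_conv_hker t).2 ler0_sqrtr ?mul0r ?subr0//; lra.
Qed.

(** Multiplying by the conjugate quantity exhibits the decay t^(-3/2), which the difference of
    square roots hides. *)
Lemma kkerV t : 1 <= t -> kker t = (t * (Num.sqrt t + Num.sqrt (t - 1)))^-1.
Proof.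
move=> t1; have t0 : 0 < t by lra.
have s0 : 0 < Num.sqrt t by rewrite sqrtr_gt0.
have p : Num.sqrt t + Num.sqrt (t - 1) != 0.
  by rewrite gt_eqF// ltr_wpDr// sqrtr_ge0.
rewrite /kker invfM mulrC; congr (_ * _).
apply: (mulIf p); rewrite mulVf// -subr_sqr !sqr_sqrtr ?(ltW t0)//; lra.
Qed.

Lemma kker_le_mker t : kker t <= mker t.
Proof.
have [t0|t0] := leP t 0; first by rewrite kker_neg// mker_ge0.
have [t1|t1] := leP t 1.
  by rewrite kker_hker// /mker min_l ?mulr1// invf_ge1.
have s0 : 0 < Num.sqrt t by rewrite sqrtr_gt0.
rewrite kkerV ?(ltW t1)// /mker min_r ?invf_le1// ?(ltW t1)//.
rewrite /hker -invfM lef_pV2 ?posrE ?mulr_gt0//; last first.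
  by rewrite ltr_wpDr// sqrtr_ge0.
by rewrite mulrC ler_wpM2l ?(ltW t0)// lerDl sqrtr_ge0.
Qed.

Lemma measurable_kker : measurable_fun setT kker.
Proof.
apply: measurable_funM; last exact: measurable_inv.
apply: measurable_funB; first exact: measurable_sqrt.
apply: (measurableT_comp measurable_sqrt).
exact: measurable_funB.
Qed.

Lemma L1_kker : L1 kker.
Proof.
apply: L1_le L1_mker; first exact: measurable_kker.
by move=> u; rewrite ger0_norm ?kker_ge0// kker_le_mker.
Qed.

(** This integral is the value at 0 of the symbol of [kker], the one point where its non-vanishing
    does not follow from that of the symbol of [muker]. *)
Lemma Lint_kker_gt0 : 0 < Lint kker.
Proof.
have [L e] := hker_itv_int (@ltr01 R).
apply: (@lt_le_trans _ _ 2) => //.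
rewrite sqrtr1 mulr1 in e; rewrite -e; apply: Lint_le => //; first exact: L1_kker.
move=> u; rewrite indicE; case: (boolP (u \in _)) => [|_]; last first.
  by rewrite mul0r kker_ge0.
by rewrite inE /= in_itv/= => /andP[u0 u1]; rewrite mul1r kker_hker// ltW.
Qed.

Lemma hker_ninc s t : 0 < s -> s <= t -> hker t <= hker s.
Proof.
move=> s0 st; rewrite lef_pV2 ?posrE ?sqrtr_gt0//; last lra.
exact: ler_wsqrtr.
Qed.

Lemma kker_ninc s t : 0 < s -> s <= t -> kker t <= kker s.
Proof.
have le1 a b : 0 < a -> a <= b -> b <= 1 -> kker b <= kker a.
  by move=> a0 ab b1; rewrite !kker_hker; [exact: hker_ninc|lra|lra].
have ge1 a b : 1 <= a -> a <= b -> kker b <= kker a.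
  move=> a1 ab; rewrite !kkerV//; last lra.
  have pos x : 1 <= x -> 0 < Num.sqrt x + Num.sqrt (x - 1).
    by move=> x1; rewrite ltr_wpDr ?sqrtr_ge0// sqrtr_gt0; lra.
  rewrite lef_pV2 ?posrE ?mulr_gt0 ?pos//; try lra.
  apply: ler_pM; rewrite ?(ltW (pos _ _))//; try lra.
  by apply: lerD; apply: ler_wsqrtr; lra.
move=> s0 st; have [t1|t1] := leP t 1; first exact: le1.
have [s1|s1] := leP 1 s; first exact: ge1.
by apply: (@le_trans _ _ (kker 1)); [apply: ge1|apply: le1]; lra.
Qed.

Lemma muker_ninc s t : 0 < s -> s <= t -> muker (t + 1) <= muker (s + 1).
Proof.
move=> s0 st; rewrite !mukerE; [|lra|lra].
apply: ler_pM; rewrite ?hker_ge0 ?invr_ge0//; try lra.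
  by apply: hker_ninc; lra.
by rewrite lef_pV2 ?posrE; lra.
Qed.

Lemma Lint_indic_hker_le (f : R -> R) e : L1 f -> (forall u, 0 <= f u) ->
  (forall u, f u <= hker u) -> 0 < e ->
  Lint (fun u => \1_`]0, e]%classic u * f u) <= 2 * Num.sqrt (2 * e).
Proof.
move=> Lf f0 fh e0.
(* The open interval ]0, 2 e[ covers ]0, e], whence the factor 2 under the root. *)
have e2 : 0 < 2 * e by lra.
have [L <-] := hker_itv_int e2.
apply: Lint_le => //; first exact: L1_indic.
move=> u; rewrite !indicE; case: (boolP (u \in `]0, e]%classic)) => [|_].
  rewrite inE /= in_itv/= => /andP[u0 ue].
  by rewrite mem_set ?mul1r//= in_itv/=; lra.
by rewrite mul0r mulr_ge0 ?hker_ge0.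
Qed.

(** For a nonincreasing kernel [f u - f (u + e)] has constant sign on u > 0 and its integral
    telescopes to the mass of ]0, e]; the points u in ]- e, 0] contribute the same mass again. The
    majorant [hker] makes this mass of order sqrt e. *)
Lemma translation_ninc (f : R -> R) e : L1 f -> (forall u, 0 <= f u) ->
  (forall u, u <= 0 -> f u = 0) -> (forall u, f u <= hker u) ->
  (forall s t, 0 < s -> s <= t -> f t <= f s) -> 0 < e ->
  Lint (fun u => `|f (u + e) - f u|) <= 4 * Num.sqrt (2 * e).
Proof.
move=> Lf f0 fn fh fd e0.
pose g u := \1_`]0, e]%classic u * f u.
have Lg : L1 g by exact: L1_indic.
have Le := L1_shift e Lf; have Lge := L1_shift e Lg.
have -> : (fun u => `|f (u + e) - f u|) =
    (fun u => (f u - f (u + e)) + 2 * g (u + e)).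
  apply/funext => u; rewrite /g indicE.
  have [u0|u0] := ltP 0 u.
    rewrite memNset/= ?in_itv/=; last lra.
    by rewrite mul0r mulr0 addr0 distrC ger0_norm// subr_ge0 fd//; lra.
  rewrite [f u]fn// subr0 sub0r ger0_norm//.
  have [ue|ue] := leP (u + e) 0; first by rewrite [f (u + e)]fn//; ring.
  by rewrite mem_set/= ?in_itv/=; [ring|lra].
rewrite LintD; [|exact: L1B|exact: L1Z].
rewrite LintB// LintZ// (Lint_shift e Lf) (Lint_shift e Lg) subrr add0r.
have := Lint_indic_hker_le Lf f0 fh e0; rewrite /g; lra.
Qed.

Lemma translation_kker e : 0 < e ->
  Lint (fun u => `|kker (u + e) - kker u|) <= 4 * Num.sqrt (2 * e).
Proof.
apply: translation_ninc; [exact: L1_kker|exact: kker_ge0|exact: kker_neg| |exact: kker_ninc].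
by move=> u; rewrite (le_trans (kker_le_mker u))// mker_le_hker.
Qed.

Lemma translation_muker e : 0 < e ->
  Lint (fun u => `|muker (u + e) - muker u|) <= 4 * Num.sqrt (2 * e).
Proof.
move=> e0; have LB : L1 (fun u => `|muker (u + e) - muker u|).
  by apply: L1_abs; apply: L1B; [exact: (L1_shift e L1_muker)|exact: L1_muker].
(* [muker] jumps at 1; shifted by 1, it is nonincreasing on the positive half-line. *)
rewrite -(Lint_shift 1 LB).
rewrite (@eq_Lint _ _ (fun u => `|muker ((u + e) + 1) - muker (u + 1)|)); last first.
  by move=> u; rewrite addrAC.
apply: (@translation_ninc (fun u => muker (u + 1))) => //.
- exact: (L1_shift 1 L1_muker).
- by move=> u; exact: muker_ge0.
- by move=> u u0; rewrite muker_le1//; lra.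
- move=> u; have [u0|u0] := leP u 0; first by rewrite muker_le1 ?hker_ge0//; lra.
  rewrite mukerE; last lra.
  apply: (@le_trans _ _ (hker (u + 1))).
    by rewrite ler_pdivrMr ?ler_peMr ?hker_ge0//; lra.
  by apply: hker_ninc; lra.
- exact: muker_ninc.
Qed.

(** The Beta value B(1/2, 1/2): [hker] convolved with itself is this constant on the positive
    half-line, so the square of its Laplace transform is a multiple of 1 / p. *)
Definition betac : R := Lint (fun u => hker u * hker (1 - u)).

Lemma L1_beta : L1 (fun u => hker u * hker (1 - u)).
Proof.
have [L _] := hker_itv_int (@ltr01 R).
have L' := L1_subr 1 L.
apply: L1_le (L1Z 2 (L1D L L')).
  apply: measurable_funM; first exact: measurable_hker.
  by apply: (measurableT_comp measurable_hker); exact: measurable_funB.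
move=> u; rewrite ger0_norm ?mulr_ge0 ?hker_ge0//.
have [u0|u0] := leP u 0.
  by rewrite [hker u]hker_neg// mul0r !mulr_ge0// addr_ge0// mulr_ge0// hker_ge0.
have [u1|u1] := leP 1 u.
  rewrite [hker (1 - u)]hker_neg; last lra.
  by rewrite mulr0 !mulr_ge0// addr_ge0// mulr_ge0// hker_ge0.
rewrite !indicE !mem_set/= ?in_itv/=; try lra.
rewrite !mul1r.
(* On each half of ]0, 1[ one of the two factors is bounded; the crude bound 2 is [hker (1 / 4)]. *)
have key x : 1 / 2 <= x -> hker x <= 2.
  move=> x2; have -> : 2 = hker (1 / 4) :> R.
    rewrite /hker (_ : 1 / 4 = (1 / 2) ^+ 2); last by field.
    by rewrite sqrtr_sqr ger0_norm//; field.
  by apply: hker_ninc; lra.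
have h0 := hker_ge0 u; have h1 := hker_ge0 (1 - u).
have [u2|u2] := leP u (1 / 2).
  have : hker (1 - u) <= 2 by apply: key; lra.
  nra.
have : hker u <= 2 by apply: key; lra.
nra.
Qed.

Lemma betac_gt0 : 0 < betac.
Proof.
have [L e] := hker_itv_int (@ltr01 R).
apply: (@lt_le_trans _ _ 2) => //.
rewrite sqrtr1 mulr1 in e; rewrite -e; apply: Lint_le => //; first exact: L1_beta.
move=> u; rewrite indicE; case: (boolP (u \in _)) => [|_]; last first.
  by rewrite mul0r mulr_ge0 ?hker_ge0.
rewrite inE /= in_itv/= => /andP[u0 u1]; rewrite mul1r ler_peMr ?hker_ge0//.
rewrite -[X in X <= _]invr1 lef_pV2 ?posrE ?sqrtr_gt0; [|lra|lra].
by rewrite -[X in _ <= X]sqrtr1 ler_wsqrtr//; lra.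
Qed.

Lemma hkerM s u : 0 < s -> hker (s * u) = hker s * hker u.
Proof. by move=> s0; rewrite /hker sqrtrM ?(ltW s0)// invfM. Qed.

Lemma hker_conv_hker t : L1 (fun u => hker u * hker (t - u)) /\
  (0 < t -> Lint (fun u => hker u * hker (t - u)) = betac).
Proof.
have [t0|t0] := leP t 0.
  split => [|]; last by move=> ?; lra.
  rewrite (_ : (fun _ => _) = (fun=> 0)); first exact: L1_0.
  apply/funext => u; have [u0|u0] := leP u 0; first by rewrite [hker u]hker_neg// mul0r.
  by rewrite [hker (t - u)]hker_neg ?mulr0//; lra.
have tV0 : t^-1 != 0 by rewrite invr_eq0 gt_eqF.
(* [hker] is homogeneous of degree -1/2, so the substitution u = t v shows that the convolution does
   not depend on t > 0. *)
have E u : hker u * hker (t - u) =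
    t^-1 * (hker (t^-1 * u + 0) * hker (1 - (t^-1 * u + 0))).
  have -> : 1 - (t^-1 * u + 0) = t^-1 * (t - u) by field; rewrite gt_eqF.
  rewrite addr0 !hkerM ?invr_gt0//.
  have -> : hker t^-1 = Num.sqrt t by rewrite /hker sqrtrV ?(ltW t0)// invrK.
  rewrite mulrACA sqrt_sqr ?(ltW t0)// mulKf// gt_eqF//.
have L := L1_affine 0 tV0 L1_beta.
split => [|_].
  by apply: (eq_L1 (fun u => esym (E u))); exact: L1Z.
rewrite (eq_Lint E) LintZ// (Lint_affine 0 tV0 L1_beta) -/betac.
by rewrite gtr0_norm ?invr_gt0// invrK mulrA mulVf ?mul1r// gt_eqF.
Qed.

End Kernels.

(** * Stability of the regularized operator *)

Section ApproximateEigenvalue.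
Context {R : realType}.
Local Notation C := R[i].

Lemma expi_nat (x : R) (n : nat) : expi x ^+ n = expi (n%:R * x) :> C.
Proof.
elim: n => [|n IH]; first by rewrite expr0 mul0r expi0.
by rewrite exprS IH -expiD -[n.+1]add1n natrD mulrDl mul1r.
Qed.

Lemma expi_neq1 (x : R) : 0 < x -> x < 2 * pi -> expi x != 1 :> C.
Proof.
move=> x0 x2; apply/eqP => /(congr1 (@complex.Re R)) /=.
rewrite [x in cos x](_ : x = x / 2 + x / 2); last by field.
rewrite cosD -!expr2 => cx.
have s0 : 0 < sin (x / 2) by apply: sin_gt0_pi; apply/andP; split; lra.
have := cos2Dsin2 (x / 2); nra.
Qed.

Lemma expi_2pi : expi (2 * pi) = 1 :> C.
Proof. by rewrite mulr_natl /expi cos2pi sin2pi. Qed.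

Definition nthroot (N : nat) : C := expi (2 * pi / N%:R).

Lemma nthroot_expN (N : nat) : (0 < N)%N -> nthroot N ^+ N = 1.
Proof.
by move=> N0; rewrite expi_nat mulrC divfK ?expi_2pi// pnatr_eq0 -lt0n.
Qed.

Lemma sum_nthroot (N k : nat) : (0 < k < N)%N ->
  \sum_(j < N) (nthroot N ^+ j) ^+ k = 0.
Proof.
move=> /andP[k0 kN]; have N0 : (0 < N)%N by exact: ltn_trans kN.
have z1 : nthroot N ^+ k - 1 != 0.
  rewrite subr_eq0 expi_nat; apply: expi_neq1.
    by rewrite mulr_gt0 ?ltr0n// divr_gt0 ?ltr0n// mulr_gt0// pi_gt0.
  rewrite mulrCA gtr_pMr ?mulr_gt0 ?pi_gt0// ltr_pdivrMr ?ltr0n// mul1r ltr_nat//.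
apply: (mulfI z1); rewrite mulr0.
under eq_bigr do rewrite exprAC.
by rewrite -subrX1 exprAC nthroot_expN// expr1n subrr.
Qed.

Lemma cabsX (z : C) n : cabs (z ^+ n) = cabs z ^+ n.
Proof. by elim: n => [|n IH]; rewrite ?expr0 ?cabs1// !exprS cabsM IH. Qed.

(* [nu_below] denies approximate eigenvalues of ['X] for the seminorm [nu]. If [rho] is the infimum
   of the [r] with [nu 'X^N = O(r^N)], averaging the resolvents over the points [r w], [w] an [N]-th
   root of unity, for [r] slightly below and slightly above [rho], lowers [rho], as in Rickart's
   elementary proof that spectra are nonempty. *)
Variables (nu : {poly C} -> R) (L c : R).
Hypothesis nuD : forall p q, nu (p + q) <= nu p + nu q.
Hypothesis nuZ : forall (z : C) p, nu (z *: p) = cabs z * nu p.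
Hypothesis nuX : forall p, nu ('X * p) <= nu p.
Hypothesis nuL : forall p, nu p <= L * nu ('X * p).
Hypothesis L0 : 0 < L.
Hypothesis nu1 : 0 < nu 1.
Hypothesis c0 : 0 < c.
Hypothesis nu_below : forall (z : C) p, cabs z <= 2 -> c * nu p <= nu (('X - z%:P) * p).

Let a N := nu 'X^N.

Let nu0 : nu 0 = 0.
Proof. by rewrite -(scale0r (0 : {poly C})) nuZ cabs0 mul0r. Qed.

Let nuN p : nu (- p) = nu p.
Proof. by rewrite -scaleN1r nuZ cabsN cabs1 mul1r. Qed.

Let nu_ge0 p : 0 <= nu p.
Proof. by have := nuD p (- p); rewrite subrr nu0 nuN; lra. Qed.

Let nu_sum (I : Type) (s : seq I) (F : I -> {poly C}) :
  nu (\sum_(i <- s) F i) <= \sum_(i <- s) nu (F i).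
Proof.
elim/big_ind2 : _ => //; first by rewrite nu0.
by move=> x1 x2 y1 y2 h1 h2; apply: (le_trans (nuD _ _)); exact: lerD.
Qed.

Let quot N (z : C) : {poly C} := \sum_(i < N) 'X ^+ (N.-1 - i) * z%:P ^+ i.

Let quotE N z : ('X - z%:P) * quot N z = 'X^N - (z ^+ N)%:P.
Proof. by rewrite -subrXX rmorphXn. Qed.

(** Summing over the roots of unity kills every power of the root except the N-th, so only the term
    i = N - 1 remains. After division by X^N - r^N this is the sum of the resolvents, each times its
    point, over a circle. *)
Let sum_quot N (r : R) : (0 < N)%N ->
  \sum_(j < N) (r%:C * nthroot N ^+ j)%:P * quot N (r%:C * nthroot N ^+ j)
  = (N%:R * (r ^+ N)%:C)%:P.
Proof.
move=> N0.
under eq_bigr do rewrite mulr_sumr.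
rewrite exchange_big /=.
have E (i : 'I_N) : \sum_(j < N) (r%:C * nthroot N ^+ j)%:P *
    ('X ^+ (N.-1 - i) * (r%:C * nthroot N ^+ j)%:P ^+ i) =
    (r%:C ^+ i.+1 * \sum_(j < N) (nthroot N ^+ j) ^+ i.+1)%:P * 'X ^+ (N.-1 - i).
  rewrite rmorphM /= rmorph_sum /= mulr_sumr mulr_suml; apply: eq_bigr => j _.
  by rewrite -rmorphXn /= mulrCA -rmorphM /= -exprS exprMn rmorphM /=; ring.
under eq_bigr do rewrite E.
case: N N0 E => // n _ E; rewrite big_ord_recr /= big1 ?add0r; last first.
  move=> i _; have hi : (0 < i.+1 < n.+1)%N by rewrite /= ltnS.
  by rewrite sum_nthroot// mulr0 mul0r.
rewrite subnn expr0 mulr1; congr (_%:P).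
under eq_bigr do rewrite exprAC nthroot_expN// expr1n.
by rewrite sumr_const card_ord mulrC rmorphXn.
Qed.

Let v N (r1 r2 : R) : {poly C} := ('X^N - (r1 ^+ N)%:C%:P) * ('X^N - (r2 ^+ N)%:C%:P).

Let nu_v N (r1 r2 : R) : 0 < r1 -> 0 < r2 ->
  nu (v N r1 r2) <= a (N + N) + (r1 ^+ N + r2 ^+ N) * a N + r1 ^+ N * r2 ^+ N * a 0.
Proof.
move=> r10 r20.
have -> : v N r1 r2 = ('X^(N + N) + (- (r1 ^+ N + r2 ^+ N)%:C) *: 'X^N)
   + (r1 ^+ N * r2 ^+ N)%:C *: 'X^0.
  rewrite /v -!mul_polyC exprD expr0 mulr1 !rmorphD /= !rmorphN /= !rmorphD !rmorphM /=; ring.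
apply: (le_trans (nuD _ _)); rewrite nuZ cabs_real ger0_norm ?mulr_ge0 ?exprn_ge0 ?(ltW r10) ?(ltW r20)//.
rewrite lerD2r; apply: (le_trans (nuD _ _)); rewrite nuZ cabsN cabs_real.
by rewrite ger0_norm// addr_ge0// exprn_ge0// ltW.
Qed.

(** A resolvent identity: the sums over the circles of radii [r1] and [r2] differ by products of two
    resolvents, each bounded by 1 / c, with a factor z_j - w_j of modulus r2 - r1. A small gap
    between the radii thus bounds nu at X^N through its values at X^(2N), X^N and 1. *)
Let nu_quot N (r1 r2 : R) : (0 < N)%N -> 0 < r1 -> r1 < r2 -> r2 <= 2 ->
  (r2 ^+ N - r1 ^+ N) * a N <= (r2 - r1) / c ^+ 2 * nu (v N r1 r2).
Proof.
move=> N0 r10 r12 r22.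
pose z j := r1%:C * nthroot N ^+ j; pose w j := r2%:C * nthroot N ^+ j.
have rootN j : (nthroot N ^+ j) ^+ N = 1 by rewrite exprAC nthroot_expN// expr1n.
have zN j : z j ^+ N = (r1 ^+ N)%:C by rewrite exprMn rootN mulr1 rmorphXn.
have wN j : w j ^+ N = (r2 ^+ N)%:C by rewrite exprMn rootN mulr1 rmorphXn.
have croot j : cabs (nthroot N ^+ j) = 1 by rewrite cabsX cabs_expi expr1n.
have cz j : cabs (z j) = r1 by rewrite cabsM croot mulr1 cabs_real gtr0_norm.
have cw j : cabs (w j) = r2 by rewrite cabsM croot mulr1 cabs_real gtr0_norm//; lra.
have key : (N%:R * (r1 ^+ N - r2 ^+ N)%:C) *: 'X^N =
    \sum_(j < N) (z j - w j) *: ('X * (quot N (z j) * quot N (w j))).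
  transitivity (\sum_(j < N) ((z j)%:P * quot N (z j) * ('X^N - (r2 ^+ N)%:C%:P)
      - (w j)%:P * quot N (w j) * ('X^N - (r1 ^+ N)%:C%:P))).
    rewrite sumrB -!mulr_suml !sum_quot// -!mul_polyC.
    by rewrite !rmorphM /= !rmorphB /=; ring.
  apply: eq_bigr => j _; rewrite -(wN j) -(zN j) -!quotE -mul_polyC rmorphB /=; ring.
have quot_le j : nu ('X * (quot N (z j) * quot N (w j))) <= (c ^+ 2)^-1 * nu (v N r1 r2).
  apply: (le_trans (nuX _)); rewrite -[X in X <= _](@mulKf _ (c ^+ 2)) ?expf_neq0 ?gt_eqF//.
  rewrite ler_wpM2l ?invr_ge0 ?exprn_ge0 ?(ltW c0)//.
  have b1 := nu_below (quot N (z j) * quot N (w j)) (z := z j).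
  have b2 := nu_below (('X - (z j)%:P) * (quot N (z j) * quot N (w j))) (z := w j).
  have -> : v N r1 r2 = ('X - (w j)%:P) * (('X - (z j)%:P) * (quot N (z j) * quot N (w j))).
    by rewrite /v -(wN j) -(zN j) -!quotE; ring.
  apply: le_trans (b2 _); last by rewrite cw.
  by rewrite expr2 -mulrA ler_wpM2l ?(ltW c0)// b1// cz; lra.
have : nu ((N%:R * (r1 ^+ N - r2 ^+ N)%:C) *: 'X^N) <=
    N%:R * ((r2 - r1) / c ^+ 2 * nu (v N r1 r2)).
  rewrite key; apply: (le_trans (nu_sum _ _)).
  apply: (@le_trans _ _ (\sum_(j < N) (r2 - r1) / c ^+ 2 * nu (v N r1 r2))); last first.
    by rewrite sumr_const card_ord mulr_natl.
  apply: ler_sum => j _; rewrite nuZ -mulrBl -rmorphB cabsM croot mulr1 cabs_real distrC.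
  by rewrite gtr0_norm ?subr_gt0// -mulrA ler_wpM2l// subr_ge0 ltW.
rewrite nuZ cabsM -[N%:R : C](rmorph_nat (real_complex R)) !cabs_real -mulrA.
rewrite ger0_norm// ler_pM2l ?ltr0n// distrC ger0_norm// subr_ge0.
by apply: lerXn2r; rewrite ?nnegrE; lra.
Qed.

Let a_le N : a N <= a 0.
Proof.
elim: N => // n IH; apply: le_trans IH.
by rewrite /a exprS nuX.
Qed.

Let a0 : 0 < a 0. Proof. by rewrite /a expr0. Qed.

Let a_lower N : a 0 <= L ^+ N * a N.
Proof.
elim: N => [|n IH]; first by rewrite expr0 mul1r.
apply: (le_trans IH); rewrite exprSr -mulrA ler_wpM2l ?exprn_ge0 ?(ltW L0)//.
by rewrite /a exprS nuL.
Qed.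

Let S : set R := [set r | 0 < r /\ exists D, forall N, a N <= D * r ^+ N].

Let S1 : S 1.
Proof. by split => //; exists (a 0) => N; rewrite expr1n mulr1. Qed.

Lemma expr_small (x e : R) : 0 <= x -> x < 1 -> 0 < e ->
  exists N0, forall N, (N0 <= N)%N -> x ^+ N <= e.
Proof.
move=> x0 x1 e0; have xn : `|x| < 1 by rewrite ger0_norm.
have [N0 _ H] := cvgr_le _ (cvg_expr xn) _ e0.
by exists N0 => N NN; exact: H.
Qed.

(** The lower bound [nuL] on the shift keeps all growth rates above 1 / L, so that there is a circle
    of positive radius below their infimum. *)
Let S_lower r : S r -> L^-1 <= r.
Proof.
move=> [r0 [D HD]]; rewrite leNgt; apply/negP => rL.
have Lr : L * r < 1 by rewrite mulrC -ltr_pdivlMr// mul1r.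
have D0 : 0 < D.
  by have := HD 0%N; rewrite expr0 mulr1 => h; exact: lt_le_trans h.
have e0 : 0 < a 0 / (2 * D) by rewrite divr_gt0// mulr_gt0.
have [N0 H] := expr_small (mulr_ge0 (ltW L0) (ltW r0)) Lr e0.
have := H N0 (leqnn _); have := a_lower N0; have := HD N0.
rewrite exprMn ler_pdivlMr ?mulr_gt0// => h1 h2 h3.
have LN : 0 <= L ^+ N0 by rewrite exprn_ge0 ?ltW.
have := ler_wpM2l LN h1.
have -> : L ^+ N0 * (D * r ^+ N0) = L ^+ N0 * r ^+ N0 * (2 * D) / 2 by field.
by have := a0; lra.
Qed.

Lemma no_uniform_lower_bound : False.
Proof.
have hS : has_inf S by split; [exists 1|exists L^-1 => r /S_lower].
pose rho := inf S.
have rho0 : 0 < rho.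
  apply: (@lt_le_trans _ _ L^-1); first by rewrite invr_gt0.
  by apply: lb_le_inf; [exists 1|move=> r /S_lower].
have rho1 : rho <= 1 by apply: ge_inf => //; case: hS.
(* The bound c^2 / 4 makes the factor (r2 - r1) / c^2 of [nu_quot] at most 1/4, so that the term in
   [a N] on the right can be absorbed; the bound rho / 2 keeps [r1] positive and [r2] below 2. *)
pose d := Num.min (rho / 2) (c ^+ 2 / 4).
have c2 : 0 < c ^+ 2 by rewrite exprn_gt0.
have d0 : 0 < d by rewrite lt_min !divr_gt0.
have d1 : d <= rho / 2 by rewrite ge_min lexx.
have d2 : d / c ^+ 2 <= 1 / 4.
  by rewrite ler_pdivrMr// mulrC mulrA mulr1 ge_min lexx orbT.
pose r1 := rho - d / 2; pose r2 := rho + d / 2.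
have r10 : 0 < r1 by rewrite /r1; lra.
have r20 : 0 < r2 by rewrite /r2; lra.
have r12 : r1 < r2 by rewrite /r1 /r2; lra.
have r22 : r2 <= 2 by rewrite /r2; lra.
(* A rate so close to rho that r^2 / r2 < rho: after division by r2^N, the term in X^(2N) decays
   faster than rho^N. *)
have [r Sr rs] : exists2 r, S r & r < rho + d / 8.
  have e8 : 0 < d / 8 by lra.
  by have [r Sr rs] := inf_adherent e8 hS; exists r.
have [r0 [D HD]] := Sr.
have rr : r ^+ 2 / r2 < rho.
  by rewrite ltr_pdivrMr// /r2; nra.
pose rho' := Num.max (r ^+ 2 / r2) r1.
have rho'lt : rho' < rho by rewrite gt_max rr /r1; lra.
have rho'0 : 0 < rho' by rewrite lt_max r10 orbT.
suff : S rho' by move=> /(ge_inf hS.2); rewrite -/rho; lra.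
split => //.
have q1 : r1 / r2 < 1 by rewrite ltr_pdivrMr// mul1r.
have q0 : 0 <= r1 / r2 by rewrite divr_ge0// ltW.
have t0 : 0 < 1 / 10 :> R by lra.
have [N0 HN0] := expr_small q0 q1 t0.
have D0 : 0 < D.
  by have := HD 0%N; rewrite expr0 mulr1 => h; exact: lt_le_trans h.
exists (D + a 0 + a 0 / rho' ^+ N0.+1) => N.
have p0 M : 0 < rho' ^+ M by rewrite exprn_gt0.
have [NN|NN] := ltnP N0 N; last first.
  apply: (le_trans (a_le N)).
  apply: (@le_trans _ _ (a 0 / rho' ^+ N0.+1 * rho' ^+ N)); last first.
    by rewrite ler_wpM2r ?(ltW (p0 _))// lerDr addr_ge0 ?ltW.
  rewrite -mulrA ler_peMr ?(ltW a0)// mulrC ler_pdivlMr// mul1r.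
  by apply: ler_wiXn2l; rewrite ?(ltW rho'0)//; [lra|rewrite ltnW].
have Npos : (0 < N)%N by exact: leq_ltn_trans NN.
have h := nu_quot Npos r10 r12 r22.
have hv := nu_v N r10 r20.
have hq : r1 ^+ N <= 1 / 10 * r2 ^+ N.
  have := HN0 N (ltnW NN); rewrite expr_div_n ler_pdivrMr// exprn_gt0//.
have P2 : 0 < r2 ^+ N by rewrite exprn_gt0.
have P1 : 0 < r1 ^+ N by rewrite exprn_gt0.
have h4 : (r2 ^+ N - r1 ^+ N) * a N <= 1 / 4 * nu (v N r1 r2).
  apply: (le_trans h); rewrite ler_wpM2r ?nu_ge0//.
  by rewrite (_ : r2 - r1 = d)//; rewrite /r2 /r1; lra.
have aN := nu_ge0 'X^N; rewrite -/(a N) in aN.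
(* With r1^N <= r2^N / 10 the left side keeps at least 9/10 of r2^N [a N], while the right side
   contains at most 11/40 of it. *)
have h5 : a N <= a (N + N) / r2 ^+ N + r1 ^+ N * a 0.
  rewrite -(ler_pM2r P2) mulrDl divfK ?gt_eqF//; nra.
have h6 : a (N + N) / r2 ^+ N <= D * rho' ^+ N.
  rewrite ler_pdivrMr// -mulrA -exprMn; apply: (le_trans (HD _)).
  rewrite ler_wpM2l ?(ltW D0)// addnn -mul2n exprM; apply: lerXn2r; rewrite ?nnegrE.
  - by rewrite exprn_ge0 ?ltW.
  - by rewrite mulr_ge0 ?ltW.
  - by rewrite -ler_pdivrMr// le_max lexx.
have h7 : r1 ^+ N <= rho' ^+ N.
  by apply: lerXn2r; rewrite ?nnegrE ?(ltW r10) ?(ltW rho'0)// le_max lexx orbT.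
have h8 : 0 <= a 0 / rho' ^+ N0.+1 * rho' ^+ N by rewrite mulr_ge0 ?divr_ge0 ?ltW.
have h9 : r1 ^+ N * a 0 <= a 0 * rho' ^+ N by rewrite mulrC ler_wpM2l ?(ltW a0).
rewrite !mulrDl; lra.
Qed.

End ApproximateEigenvalue.

(** * Causal convolutions with dominated kernels *)

Section Convolution.
Context {R : realType}.
Local Notation C := R[i].
Implicit Types (f g y : R -> C) (k : R -> R) (s t u : R).

Definition conv k f t : C := Cint (fun s => (k (t - s))%:C * f s).

(** The majorant [mker] is of order u^(-1/2) at 0 and u^(-3/2) at infinity and vanishes for u <= 0:
    these kernels are causal, and bounds for [muker] and [kker] reduce to bounds for [mker]. *)
Definition dominated_kernel k : Prop :=
  [/\ measurable_fun setT k, forall u, 0 <= k u & forall u, k u <= mker u].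

Lemma dominated_kker : dominated_kernel (@kker R).
Proof. by split; [exact: measurable_kker|exact: kker_ge0|exact: kker_le_mker]. Qed.

Lemma dominated_muker : dominated_kernel (@muker R).
Proof. by split; [exact: measurable_muker|exact: muker_ge0|exact: muker_le_mker]. Qed.

Lemma measurable_subr (k : R -> R) t : measurable_fun setT k ->
  measurable_fun setT (fun s => k (t - s)).
Proof. by move=> mk; apply: (measurableT_comp mk); exact: measurable_funB. Qed.

Lemma L1_mker_subr (B : R) t : L1 (fun s => mker (t - s) * B).
Proof.
by under eq_fun do rewrite mulrC; apply: L1Z; exact: (L1_subr t L1_mker).
Qed.

Lemma Lint_mker_subr (B : R) t : Lint (fun s => mker (t - s) * B) = Lint mker * B.
Proof.
rewrite mulrC -(Lint_subr t L1_mker) -LintZ; last exact: (L1_subr t L1_mker).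
by apply: eq_Lint => s; rewrite mulrC.
Qed.

Lemma Lint_mker_ge0 : 0 <= Lint (@mker R).
Proof. by apply: Lint_ge0 => u; exact: mker_ge0. Qed.

Let conv_ptwise k f t (G : R -> R) s : dominated_kernel k ->
  (forall s, s < t -> cabs (f s) <= G s) ->
  cabs ((k (t - s))%:C * f s) <= mker (t - s) * G s.
Proof.
move=> [_ k0 km] fG; rewrite cabsM cabs_real ger0_norm//.
have [st|st] := ltP s t; first by apply: ler_pM; rewrite ?cabs_ge0// fG.
have m0 : mker (t - s) = 0 by apply: mker_neg; rewrite subr_le0.
by rewrite (_ : k _ = 0) ?m0 ?mul0r//; apply/eqP; rewrite eq_le k0 andbT -m0 km.
Qed.

Lemma CL1_conv k f t (G : R -> R) : dominated_kernel k -> cmeas f ->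
  (forall s, s < t -> cabs (f s) <= G s) -> L1 (fun s => mker (t - s) * G s) ->
  CL1 (fun s => (k (t - s))%:C * f s).
Proof.
move=> dk mf fG LG; have [mk _ _] := dk.
apply: CL1_le LG.
  by apply: cmeasM => //; apply: cmeas_real; exact: measurable_subr.
by move=> s; exact: conv_ptwise.
Qed.

Lemma conv_le k f t (G : R -> R) : dominated_kernel k -> cmeas f ->
  (forall s, s < t -> cabs (f s) <= G s) -> L1 (fun s => mker (t - s) * G s) ->
  cabs (conv k f t) <= Lint (fun s => mker (t - s) * G s).
Proof.
move=> dk mf fG LG; apply: Cint_abs_le => //; first exact: CL1_conv LG.
by move=> s; exact: conv_ptwise.
Qed.

(** By causality the value of a convolution at [t] depends on the past only, so boundedness is asked
    there alone. *)
Definition bdd_before f t : Prop := exists B, forall s, s < t -> cabs (f s) <= B.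

Lemma CL1_conv_bdd k f t : dominated_kernel k -> cmeas f -> bdd_before f t ->
  CL1 (fun s => (k (t - s))%:C * f s).
Proof.
move=> dk mf [B fB].
by apply: (CL1_conv (G := fun=> B)) => //; exact: L1_mker_subr.
Qed.

Lemma conv_lin k f g (a b : C) t : dominated_kernel k -> cmeas f -> cmeas g ->
  bdd_before f t -> bdd_before g t ->
  conv k (fun s => a * f s + b * g s) t = a * conv k f t + b * conv k g t.
Proof.
move=> dk mf mg bf bg; have Lf := CL1_conv_bdd dk mf bf; have Lg := CL1_conv_bdd dk mg bg.
rewrite /conv -!CintZ// -CintD; [|exact: CL1Z|exact: CL1Z].
by apply: eq_Cint => s; ring.
Qed.

Lemma conv_shift k f (a t : R) : dominated_kernel k -> cmeas f -> bdd_before f (t + a) ->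
  conv k (fun s => f (s + a)) t = conv k f (t + a).
Proof.
move=> dk mf bf; rewrite /conv -(Cint_shift a (CL1_conv_bdd dk mf bf)).
by apply: eq_Cint => s; congr ((k _)%:C * _); ring.
Qed.

Lemma conv_modulus k f (B t e : R) : dominated_kernel k ->
  (forall e, 0 < e -> Lint (fun u => `|k (u + e) - k u|) <= 4 * Num.sqrt (2 * e)) ->
  cmeas f -> (forall s, s < t + e -> cabs (f s) <= B) -> 0 < e ->
  cabs (conv k f (t + e) - conv k f t) <= 4 * Num.sqrt (2 * e) * B.
Proof.
move=> dk tk mf fB e0; have [mk k0 km] := dk.
have b1 : bdd_before f (t + e) by exists B.
have b2 : bdd_before f t by exists B => s st; apply: fB; lra.
have B0 : 0 <= B by apply: le_trans (fB t _); [exact: cabs_ge0|lra].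
have Lk : L1 k.
  by apply: L1_le L1_mker => // u; rewrite ger0_norm.
have Ld : L1 (fun u => `|k (u + e) - k u|).
  by apply: L1_abs; apply: L1B => //; exact: (L1_shift e Lk).
have Ld' := L1_subr t Ld.
rewrite /conv -CintB; [|exact: CL1_conv_bdd|exact: CL1_conv_bdd].
apply: (@le_trans _ _ (Lint (fun s => B * `|k (t - s + e) - k (t - s)|))).
  apply: Cint_abs_le; [|exact: L1Z|].
    by apply: CL1B; exact: CL1_conv_bdd.
  move=> s; rewrite -mulrBl -rmorphB cabsM cabs_real mulrC.
  rewrite (_ : t + e - s = t - s + e); last by ring.
  have [se|se] := ltP s (t + e); first by rewrite ler_wpM2r// fB.
  have z u : u <= 0 -> k u = 0.
    by move=> u0; apply/eqP; rewrite eq_le k0 andbT -(mker_neg u0) km.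
  by rewrite !z ?subrr ?normr0 ?mulr0//; lra.
rewrite LintZ// (Lint_subr t Ld) mulrC ler_wpM2r//; exact: tk.
Qed.

End Convolution.

(** * The regularized operator and growth over one period *)

Section Operator.
Context {R : realType}.
Local Notation C := R[i].
Variables (T Am : R) (al : R -> R) (c1 : C).
Hypothesis T0 : 0 < T.
Hypothesis mal : measurable_fun setT al.
Hypothesis alT : forall t, al (t + T) = al t.
Hypothesis alA : forall t, `|al t| <= Am.
Implicit Types (f g y : R -> C) (s t u : R).

Definition Kop y t : C := - conv muker y t + c1 * conv kker (fun s => (al s)%:C * y s) t.

Definition Kcst : R := 1 + cabs c1 * Am.

Lemma Am_ge0 : 0 <= Am. Proof. exact: le_trans (normr_ge0 _) (alA 0). Qed.

Lemma Kcst_ge1 : 1 <= Kcst.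
Proof. by rewrite lerDl mulr_ge0 ?cabs_ge0// Am_ge0. Qed.

Lemma cmeas_al y : cmeas y -> cmeas (fun s => (al s)%:C * y s).
Proof. by move=> my; apply: cmeasM => //; exact: cmeas_real. Qed.

Lemma al_bdd y t : bdd_before y t -> bdd_before (fun s => (al s)%:C * y s) t.
Proof.
move=> [B yB]; exists (Am * B) => s st; rewrite cabsM cabs_real.
by apply: ler_pM; rewrite ?cabs_ge0// yB.
Qed.

Lemma Kop_le y t (G : R -> R) : cmeas y ->
  (forall s, s < t -> cabs (y s) <= G s) -> L1 (fun s => mker (t - s) * G s) ->
  cabs (Kop y t) <= Kcst * Lint (fun s => mker (t - s) * G s).
Proof.
move=> my yG LG; rewrite /Kop /Kcst mulrDl mul1r.
apply: (le_trans (cabsD _ _)); rewrite cabsN; apply: lerD.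
  by apply: conv_le => //; exact: dominated_muker.
rewrite cabsM -mulrA ler_wpM2l ?cabs_ge0// -LintZ//.
rewrite (@eq_Lint _ _ (fun s => mker (t - s) * (Am * G s))); last by move=> s; ring.
apply: conv_le; [exact: dominated_kker|exact: cmeas_al| |].
  move=> s st; rewrite cabsM cabs_real; apply: ler_pM; rewrite ?cabs_ge0//.
  exact: yG.
by apply: (eq_L1 _ (L1Z Am LG)) => s; ring.
Qed.

Lemma Kop_le_bdd y t (B : R) : cmeas y -> (forall s, s < t -> cabs (y s) <= B) ->
  cabs (Kop y t) <= Kcst * Lint mker * B.
Proof.
move=> my yB; rewrite -mulrA -(Lint_mker_subr _ t).
by apply: Kop_le => //; exact: L1_mker_subr.
Qed.

Lemma Kop_lin f g (a b : C) t : cmeas f -> cmeas g ->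
  bdd_before f t -> bdd_before g t ->
  Kop (fun s => a * f s + b * g s) t = a * Kop f t + b * Kop g t.
Proof.
move=> mf mg bf bg; rewrite /Kop conv_lin//; last exact: dominated_muker.
have -> : (fun s => (al s)%:C * (a * f s + b * g s)) =
  (fun s => a * ((al s)%:C * f s) + b * ((al s)%:C * g s)) by apply/funext => s; ring.
rewrite conv_lin; [ring|exact: dominated_kker|exact: cmeas_al|exact: cmeas_al| |].
- exact: al_bdd.
- exact: al_bdd.
Qed.

Lemma alZ (k : int) t : al (t + k%:~R * T) = al t.
Proof.
have alN (n : nat) s : al (s + n%:R * T) = al s.
  elim: n => [|n IH]; first by rewrite mul0r addr0.
  by rewrite -natr1 mulrDl mul1r addrA alT.
case: k => n; first exact: alN.
by rewrite NegzE mulrNz mulNr -(alN n.+1 (t - _)) subrK.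
Qed.

Lemma cmeas_shift y (a : R) : cmeas y -> cmeas (fun s => y (s + a)).
Proof. by move=> my; apply: (cmeas_comp my); exact: measurable_funD. Qed.

Lemma Kop_shift y (k : int) t : cmeas y -> bdd_before y (t + k%:~R * T) ->
  Kop (fun s => y (s + k%:~R * T)) t = Kop y (t + k%:~R * T).
Proof.
move=> my by_; rewrite /Kop conv_shift//; last exact: dominated_muker.
rewrite -(conv_shift dominated_kker (cmeas_al my) (al_bdd by_)).
by under [in RHS]eq_fun do rewrite alZ.
Qed.

Lemma Kop_modulus y (B t e : R) : cmeas y ->
  (forall s, s < t + e -> cabs (y s) <= B) -> 0 < e ->
  cabs (Kop y (t + e) - Kop y t) <= 4 * Num.sqrt (2 * e) * (Kcst * B).
Proof.
move=> my yB e0; rewrite /Kop.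
set p := conv muker y (t + e); set p' := conv muker y t.
set r := conv kker _ _; set r' := conv kker _ t.
have -> : - p + c1 * r - (- p' + c1 * r') = - (p - p') + c1 * (r - r') by ring.
apply: (le_trans (cabsD _ _)); rewrite cabsN cabsM /Kcst.
have h1 : cabs (p - p') <= 4 * Num.sqrt (2 * e) * B.
  by apply: conv_modulus => //; [exact: dominated_muker|exact: translation_muker].
have h2 : cabs (r - r') <= 4 * Num.sqrt (2 * e) * (Am * B).
  apply: conv_modulus => //; [exact: dominated_kker|exact: translation_kker|exact: cmeas_al|].
  by move=> s st; rewrite cabsM cabs_real; apply: ler_pM; rewrite ?cabs_ge0// yB.
have h3 := ler_wpM2l (cabs_ge0 c1) h2; lra.
Qed.

(** The bound [S0] makes the supremum finite; the step applied to the supremum itself then gives sup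
    <= c + sup / 2. *)
Lemma half_bound (D : set R) (f : R -> R) (c S0 : R) :
  (forall t, D t -> f t <= S0) ->
  (forall S, (forall t, D t -> f t <= S) -> forall t, D t -> f t <= c + S / 2) ->
  forall t, D t -> f t <= 2 * c.
Proof.
move=> fS0 step t Dt.
have hs : has_sup (f @` D).
  by split; [exists (f t), t|exists S0 => _ [s Ds <-]; exact: fS0].
have fM s : D s -> f s <= sup (f @` D).
  by move=> Ds; apply: ub_le_sup; [exact: hs.2|exists s].
have : sup (f @` D) <= c + sup (f @` D) / 2.
  by apply: ge_sup => [|_ [s Ds <-]]; [exact: hs.1|exact: step].
by have := fM t Dt; lra.
Qed.

(** On a window of length at most [h0] the operator contracts by 1/2, since its kernel has little
    mass on ]0, h0]; the new values are then bounded by the residual and the past. *)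
Lemma short_growth : exists2 h0 : R, 0 < h0 & forall (h : R) y (a B eta B0 : R),
  0 < h -> h <= h0 -> cmeas y ->
  (forall t, t <= a + h -> cabs (y t) <= B0) ->
  (forall t, t <= a + h -> cabs (y t + Kop y t) <= eta) ->
  (forall t, t <= a -> cabs (y t) <= B) ->
  forall t, t <= a + h -> cabs (y t) <= 2 * (eta + (1 + Kcst * Lint mker) * B).
Proof.
have K1 := Kcst_ge1; have m0 := @Lint_mker_ge0 R.
(* [Kcst * e = 1 / 2] is the contraction factor, and h0 = e^2 / 8 solves 2 sqrt (2 h0) = e, where
   the left side bounds the mass of [mker] on ]0, h0]. *)
pose e := (2 * Kcst)^-1; have e0 : 0 < e by rewrite invr_gt0; lra.
have e1 : Kcst * e = 1 / 2 by rewrite /e; field; rewrite gt_eqF//; lra.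
pose h0 := e ^+ 2 / 8.
have h00 : 0 < h0 by rewrite divr_gt0// exprn_gt0.
have sh0 : 2 * Num.sqrt (2 * h0) = e.
  have -> : 2 * h0 = (e / 2) ^+ 2 by rewrite /h0; field.
  by rewrite sqrtr_sqr ger0_norm; [field|lra].
exists h0 => // h y a B eta B0 hp hh my yB0 res yB.
apply: (half_bound (D := [set t | t <= a + h]) (f := fun t => cabs (y t)) yB0) => S yS t /= tah.
have B_0 : 0 <= B by apply: le_trans (yB a (lexx a)); exact: cabs_ge0.
have S_0 : 0 <= S by apply: le_trans (yS a _); [exact: cabs_ge0|rewrite /=; lra].
have eta_0 : 0 <= eta by apply: le_trans (res a _); [exact: cabs_ge0|lra].
have [ta|ta] := leP t a.
  apply: (le_trans (yB t ta)).
  have : 0 <= Kcst * Lint mker * B by rewrite !mulr_ge0//; lra.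
  lra.
(* Values before [a] are bounded by [B]; those after it lie within [h0] of [t] and are bounded by
   [S]. *)
pose G s := B + \1_`]0, h0]%classic (t - s) * S.
have LI : L1 (fun s => \1_`]0, h0]%classic (t - s) * mker (t - s)).
  by apply: (L1_subr t (L1_indic _ L1_mker)).
have E s : mker (t - s) * G s = mker (t - s) * B + S * (\1_`]0, h0]%classic (t - s) * mker (t - s)).
  by rewrite /G; ring.
have LG : L1 (fun s => mker (t - s) * G s).
  by apply: (eq_L1 (fun s => esym (E s))); apply: L1D; [exact: L1_mker_subr|exact: L1Z].
have yG s : s < t -> cabs (y s) <= G s.
  move=> st; rewrite /G indicE.
  have [sa|sa] := leP s a.
    by apply: (le_trans (yB s sa)); rewrite lerDl mulr_ge0.
  rewrite mem_set/= ?in_itv/=; last lra.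
  rewrite mul1r; have := yS s; rewrite /=; lra.
have := Kop_le my yG LG.
rewrite (eq_Lint E) LintD; [|exact: L1_mker_subr|exact: L1Z].
rewrite Lint_mker_subr LintZ// (Lint_subr t (f := fun u => \1_`]0, h0]%classic u * mker u)); last first.
  exact: L1_indic L1_mker.
have h1 := Lint_indic_hker_le L1_mker mker_ge0 mker_le_hker h00.
rewrite sh0 in h1.
have h2 := ler_wpM2l S_0 h1.
have h3 : Kcst * (Lint mker * B + S * Lint (fun u => \1_`]0, h0]%classic u * mker u)) <=
  Kcst * Lint mker * B + S / 2.
  have -> : S / 2 = Kcst * (S * e) by rewrite mulrCA e1; lra.
  rewrite -mulrA -mulrDr; apply: ler_wpM2l; lra.
move=> h4; have h5 := le_trans h4 h3.
have h6 : cabs (y t) <= cabs (y t + Kop y t) + cabs (Kop y t).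
  by rewrite -[X in cabs X <= _](addrK (Kop y t)); apply: (le_trans (cabsD _ _)); rewrite cabsN.
have := res t tah; lra.
Qed.

(** Finitely many windows of [short_growth] cover one period. The constant is uniform in [a], so for
    solutions this is a lower bound for translation by a period. *)
Lemma growth : exists2 L : R, 0 < L & forall y (a B eta B0 : R), cmeas y ->
  (forall t, t <= a + T -> cabs (y t) <= B0) ->
  (forall t, t <= a + T -> cabs (y t + Kop y t) <= eta) ->
  (forall t, t <= a -> cabs (y t) <= B) ->
  forall t, t <= a + T -> cabs (y t) <= L * (B + eta).
Proof.
have [h0 h00 H] := short_growth.
pose N := (Num.bound (T / h0)).+1; pose h := T / N%:R.
have N0 : 0 < N%:R :> R by rewrite ltr0n.
have hp : 0 < h by rewrite divr_gt0.
have hh : h <= h0.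
  rewrite ler_pdivrMr// mulrC -ler_pdivrMr// ltW//.
  apply: (lt_le_trans (archi_boundP _)); first by rewrite divr_ge0 ?ltW.
  by rewrite ler_nat.
have K1 := Kcst_ge1; have m0 := @Lint_mker_ge0 R.
pose q := 2 * (1 + (1 + Kcst * Lint mker)).
have Km : 0 <= Kcst * Lint mker by rewrite mulr_ge0//; lra.
have q1 : 1 <= q by rewrite /q; lra.
exists ((q + 1) ^+ N); first by rewrite exprn_gt0//; lra.
move=> y a B eta B0 my yB0 res yB t tT.
have B_0 : 0 <= B by apply: le_trans (yB a (lexx a)); exact: cabs_ge0.
have eta_0 : 0 <= eta by apply: le_trans (res a _); [exact: cabs_ge0|have := T0; lra].
have TN : T = N%:R * h by rewrite /h mulrC divfK// gt_eqF.
suff main n : (n <= N)%N -> forall t, t <= a + n%:R * h -> cabs (y t) <= (q + 1) ^+ n * (B + eta).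
  by apply: (main N) => //; rewrite -TN.
elim: n => [_ s|n IH nN s sn].
  by rewrite mul0r addr0 expr0 mul1r => /yB; lra.
have nT : a + n%:R * h + h <= a + T.
  rewrite TN -addrA lerD2l -[X in _ + X]mul1r -mulrDl ler_wpM2r ?(ltW hp)//.
  by rewrite natr1 ler_nat.
have IHn := IH (ltnW nN).
have := H h y (a + n%:R * h) _ eta B0 hp hh my _ _ IHn s.
have sn' : s <= a + n%:R * h + h by move: sn; rewrite -natr1 mulrDl mul1r addrA.
move=> /(_ (fun t tn => yB0 t (le_trans tn nT)) (fun t tn => res t (le_trans tn nT)) sn').
move/le_trans; apply; rewrite exprS -mulrA.
set x := (q + 1) ^+ n * (B + eta).
have xe : eta <= x.
  have x1 : 1 <= (q + 1) ^+ n by rewrite exprn_ege1//; lra.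
  have := ler_wpM2r (addr_ge0 B_0 eta_0) x1; rewrite -/x; lra.
have x0 : 0 <= x by lra.
have -> : 2 * (eta + (1 + Kcst * Lint mker) * x) = 2 * eta + (q - 2) * x by rewrite /q; ring.
by nra.
Qed.

End Operator.

(** * Limits along an ultrafilter *)

Section UltrafilterLimits.
Context {R : realType}.
Local Notation C := R[i].

(** The limit is the supremum of the x that lie, along [U], below the sequence. One ultrafilter
    provides limits at all times at once, in place of a diagonal extraction of subsequences. *)
Lemma ulim_real (U : set_system nat) (b : R) (v : nat -> R) : UltraFilter U ->
  (forall n, `|v n| <= b) -> exists l, forall e, 0 < e -> U [set n | `|v n - l| < e].
Proof.
move=> UU vb; have FU : ProperFilter U := @ultra_proper _ U UU.
pose S := [set x | U [set n | x <= v n]].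
have Sb : S (- b).
  by apply: (@filterS _ _ _ setT) => [n _|]; [have := vb n; rewrite ler_norml => /andP[]|exact: filterT].
have ubS : ubound S b.
  move=> x Sx; have [n /= xn] := filter_ex Sx.
  by apply: (le_trans xn); apply: (le_trans (ler_norm _)).
have hS : has_sup S by split; [exists (- b)|exists b].
exists (sup S) => e e0.
have [x Sx xe] := sup_adherent e0 hS.
have nS : ~ S (sup S + e).
  move=> h; have := ub_le_sup hS.2 h; lra.
have [//|h] := in_ultra_setVsetC [set n | sup S + e <= v n] UU.
apply: filterS (filterI Sx h) => n /= [h1 /negP]; rewrite -ltNge => h2.
by rewrite ltr_norml; apply/andP; split; lra.
Qed.

Lemma ulim_complex (U : set_system nat) (b : R) (v : nat -> C) : UltraFilter U ->
  (forall n, cabs (v n) <= b) -> exists l, forall e, 0 < e -> U [set n | cabs (v n - l) < e].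
Proof.
move=> UU vb.
have [l1 h1] := @ulim_real U b (fun n => complex.Re (v n)) UU
  (fun n => le_trans (abs_Re_le _) (vb n)).
have [l2 h2] := @ulim_real U b (fun n => complex.Im (v n)) UU
  (fun n => le_trans (abs_Im_le _) (vb n)).
exists (l1 +i* l2) => e e0; have e2 : 0 < e / 2 by lra.
apply: filterS (filterI (h1 _ e2) (h2 _ e2)) => n /= [a1 a2].
apply: (le_lt_trans (cabs_le_abs _)).
by move: a1 a2; case: (v n) => p q /=; lra.
Qed.

Lemma forall_leq_filter (U : set_system nat) (P : nat -> nat -> Prop) (N : nat) :
  Filter U -> (forall j, U [set n | P j n]) ->
  U [set n | forall j, (j <= N)%N -> P j n].
Proof.
move=> FU h; elim: N => [|N IH].
  by apply: filterS (h 0%N) => n /= p j; rewrite leqn0 => /eqP ->.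
apply: filterS (filterI IH (h N.+1)) => n /= [p1 p2] j.
by rewrite leq_eqVlt => /orP[/eqP ->//|]; rewrite ltnS => /p1.
Qed.

Definition ccontinuous (y : R -> C) : Prop :=
  forall t e, 0 < e -> exists2 d, 0 < d & forall s, `|s - t| < d -> cabs (y s - y t) < e.

Lemma ccontinuous_Re (y : R -> C) : ccontinuous y -> continuous (fun t => complex.Re (y t)).
Proof.
move=> cy t; apply/cvgrPdist_lt => /= e e0; have [d d0 H] := cy t e e0.
near=> s; rewrite -ReN -ReD; apply: (le_lt_trans (abs_Re_le _)); rewrite cabsB.
by apply: H; rewrite distrC; near: s; exact: cvgr_dist_lt.
Unshelve. all: by end_near. Qed.

Lemma ccontinuous_Im (y : R -> C) : ccontinuous y -> continuous (fun t => complex.Im (y t)).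
Proof.
move=> cy t; apply/cvgrPdist_lt => /= e e0; have [d d0 H] := cy t e e0.
near=> s; rewrite -ImN -ImD; apply: (le_lt_trans (abs_Im_le _)); rewrite cabsB.
by apply: H; rewrite distrC; near: s; exact: cvgr_dist_lt.
Unshelve. all: by end_near. Qed.

Lemma ccontinuous_cmeas (y : R -> C) : ccontinuous y -> cmeas y.
Proof.
by move=> cy; split; apply: continuous_measurable_fun;
  [exact: ccontinuous_Re|exact: ccontinuous_Im].
Qed.

Lemma mker_tail (e : R) : 0 < e ->
  exists2 A : R, 0 <= A & Lint (fun u => \1_`]A, +oo[%classic u * mker u) <= e.
Proof.
move=> e0.
have H : (fun n : nat => Lint (fun u => \1_`](n%:R : R), +oo[%classic u * mker u)) @ \oo --> (0 : R).
  rewrite -[X in _ --> X](@Lint0 R).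
  apply: (@dominated_Lint _ _ _ mker) => //.
  - by move=> n; apply: measurable_funM; [exact: measurable_indic|exact: measurable_mker].
  - move=> u; apply: cvg_near_cst; near=> n.
    rewrite indicE memNset ?mul0r//= in_itv/= andbT; apply/negP; rewrite -leNgt.
    by near: n; exact: nbhs_infty_ger.
  - exact: L1_mker.
  - move=> n u; rewrite indicE; case: (_ \in _); rewrite ?mul1r ?mul0r ?normr0 ?mker_ge0//.
    by rewrite ger0_norm// mker_ge0.
have [N _ HN] := cvgr_le _ H _ e0.
by exists N%:R => //; apply: (HN N) => /=.
Unshelve. all: by end_near. Qed.

Lemma cabs_le_small (z : C) : (forall e, 0 < e -> cabs z <= e) -> z = 0.
Proof.
move=> h; apply/eqP; rewrite -cabs_eq0 eq_le cabs_ge0 andbT leNgt; apply/negP => z0.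
have : 0 < cabs z / 2 by lra.
by move/h; lra.
Qed.

End UltrafilterLimits.

(** * Compactness of bounded approximate solutions *)

Section Compactness.
Context {R : realType}.
Local Notation C := R[i].
Variables (T Am : R) (al : R -> R) (c1 : C).
Hypothesis T0 : 0 < T.
Hypothesis mal : measurable_fun setT al.
Hypothesis alT : forall t, al (t + T) = al t.
Hypothesis alA : forall t, `|al t| <= Am.
Local Notation K := (Kop al c1).
Local Notation Kc := (Kcst Am c1).
Implicit Types (y : R -> C) (s t : R).

(** [y] is its residual minus [K y]; the residual is small, and [K] maps bounded functions to
    functions with a Hoelder modulus of exponent 1/2. *)
Lemma near_solution_modulus y (eps s t : R) : cmeas y ->
  (forall t, t <= 0 -> cabs (y t) <= 1) ->
  (forall t, t <= 0 -> cabs (y t + K y t) <= eps) -> s <= t -> t <= 0 ->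
  cabs (y t - y s) <= 2 * eps + 4 * Kc * Num.sqrt (2 * (t - s)).
Proof.
move=> my y1 res st t0.
have e0 : 0 <= eps by apply: le_trans (res 0 (lexx 0)); exact: cabs_ge0.
have K1 := Kcst_ge1 c1 alA.
move: st; rewrite le_eqVlt => /orP[/eqP ->|st].
  rewrite !subrr cabs0 mulr0 sqrtr0 mulr0; lra.
have d0 : 0 < t - s by lra.
have := @Kop_modulus _ Am al c1 mal alA y 1 s (t - s) my.
have -> : s + (t - s) = t by ring.
move=> /(_ (fun u ut => y1 u (le_trans (ltW ut) t0)) d0).
rewrite mulr1 => h.
have -> : y t - y s = (y t + K y t) - (y s + K y s) - (K y t - K y s) by ring.
apply: (le_trans (cabsD _ _)); rewrite cabsN.
have h1 := res t t0; have h2 := res s (le_trans (ltW st) t0).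
have := cabsD (y t + K y t) (- (y s + K y s)); rewrite cabsN.
lra.
Qed.

(** The common modulus makes the pointwise limit along an ultrafilter locally uniform, and the
    integrable tail of [mker] lets [K] pass to the limit. The multipliers [zs] are carried along so
    that they converge along the same ultrafilter. *)
Lemma compactness (ys : nat -> R -> C) (zs : nat -> C) (eps : nat -> R) :
  (forall n, cmeas (ys n)) -> (forall n t, t <= 0 -> cabs (ys n t) <= 1) ->
  (forall n t, t <= 0 -> cabs (ys n t + K (ys n) t) <= eps n) ->
  eps n @[n --> \oo] --> (0 : R) -> (forall n, cabs (zs n) <= 2) ->
  exists y z, [/\ ccontinuous y, forall t, cabs (y t) <= 1,
    forall t, t <= 0 -> y t + K y t = 0 &
    forall e A, 0 < e -> exists n, [/\ eps n <= e, cabs (zs n - z) <= e &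
      forall t, - A <= t -> t <= 0 -> cabs (ys n t - y t) <= e]].
Proof.
move=> mys ys1 res epsl zs2.
have [U [UU subU]] := ultraFilterLemma (F := \oo) _.
have FU : ProperFilter U := @ultra_proper _ U UU.
have epsU e : 0 < e -> U [set n | eps n <= e].
  by move=> e0; apply: subU; exact: (cvgr_le _ epsl _ e0).
have K1 := Kcst_ge1 c1 alA.
have hmin t : Num.min t 0 <= 0 :> R by rewrite ge_min lexx orbT.
(* Evaluating at min t 0 extends the limit past 0 by its value at 0: it is continuous on the whole
   line although the data are controlled for t <= 0 only. *)
have /choice[y hy] : forall t : R, exists l, forall e, 0 < e ->
    U [set n | cabs (ys n (Num.min t 0) - l) < e].
  by move=> t; apply: (@ulim_complex _ U 1) => // n; exact: ys1.
have [z hz] := @ulim_complex _ U 2 zs UU zs2.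
pose W := 4 * Kc; have W0 : 0 < W by rewrite /W; lra.
have ymod s t : s <= t -> cabs (y t - y s) <= W * Num.sqrt (2 * (t - s)).
  move=> st; apply/ler_addgt0Pr => e e0.
  have e8 : 0 < e / 8 by lra.
  have [n /= [[h1 h2] h3]] := filter_ex (filterI (filterI (hy t _ e8) (hy s _ e8)) (epsU _ e8)).
  have st' : Num.min s 0 <= Num.min t 0 by rewrite le_min !ge_min st lexx orbT.
  have h4 := near_solution_modulus (mys n) (ys1 n) (res n) st' (hmin t).
  have h5 : Num.sqrt (2 * (Num.min t 0 - Num.min s 0)) <= Num.sqrt (2 * (t - s)).
    apply: ler_wsqrtr; rewrite ler_pM2l//.
    by case: (leP t 0) => ?; case: (leP s 0) => ?; lra.
  have h6 := ler_wpM2l (ltW W0) h5.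
  rewrite cabsB in h1.
  have -> : y t - y s = (y t - ys n (Num.min t 0)) + (ys n (Num.min t 0) - ys n (Num.min s 0))
    + (ys n (Num.min s 0) - y s) by ring.
  have := cabsD (y t - ys n (Num.min t 0)) (ys n (Num.min t 0) - ys n (Num.min s 0)).
  have := cabsD ((y t - ys n (Num.min t 0)) + (ys n (Num.min t 0) - ys n (Num.min s 0)))
     (ys n (Num.min s 0) - y s).
  rewrite -/W in h4; lra.
have ymod' s t : cabs (y t - y s) <= W * Num.sqrt (2 * `|t - s|).
  have [st|/ltW ts] := leP s t; first by rewrite ger0_norm ?subr_ge0// ymod.
  by rewrite cabsB distrC ger0_norm ?subr_ge0// ymod.
have sqrt_small e : 0 < e -> exists2 d, 0 < d & forall x, x <= d -> W * Num.sqrt (2 * x) <= e.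
  move=> e0; exists ((e / W) ^+ 2 / 2); first by rewrite divr_gt0// exprn_gt0// divr_gt0.
  move=> x xd; rewrite mulrC -ler_pdivlMr//.
  have -> : e / W = Num.sqrt ((e / W) ^+ 2).
    by rewrite sqrtr_sqr ger0_norm// divr_ge0// ltW.
  apply: ler_wsqrtr; lra.
have cy : ccontinuous y.
  move=> t e e0; have e2 : 0 < e / 2 by lra.
  have [d d0 hd] := sqrt_small _ e2; exists d => // s std.
  by apply: (le_lt_trans (ymod' _ _)); have := hd _ (ltW std); lra.
have my := ccontinuous_cmeas cy.
have y1 t : cabs (y t) <= 1.
  apply/ler_addgt0Pr => e e0.
  have [n /= h] := filter_ex (hy t _ e0); rewrite cabsB in h.
  have := cabs_tri (y t) (ys n (Num.min t 0)); have := ys1 n _ (hmin t); lra.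
have unif e A : 0 < e -> exists n, [/\ eps n <= e, cabs (zs n - z) <= e &
      forall t, - A <= t -> t <= 0 -> cabs (ys n t - y t) <= e].
  move=> e0.
  have e4 : 0 < e / 4 by lra.
  have e8 : 0 < e / 8 by lra.
  have [d d0 hd] := sqrt_small _ e4.
  (* A grid of step [d] on [- A, 0]: finitely many pointwise approximations hold at one common
     index, and the moduli of continuity fill the gaps. *)
  pose M := Num.bound (`|A| / d); pose p j : R := - (j%:R * d).
  have p0 j : p j <= 0 by rewrite oppr_le0 mulr_ge0 ?(ltW d0).
  have hp : U [set n | forall j, (j <= M)%N -> cabs (ys n (p j) - y (p j)) < e / 4].
    apply: forall_leq_filter => j; apply: filterS (hy (p j) _ e4) => n /=.
    by rewrite (min_l (p0 j)).
  have [n /= [[h1 h2] h3]] := filter_ex (filterI (filterI (epsU _ e8) (hz _ e0)) hp).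
  exists n; split => [||t At t0]; [lra|exact: ltW|].
  pose j := Num.truncn (- t / d).
  have td : 0 <= - t / d by rewrite divr_ge0 ?oppr_ge0 ?(ltW d0).
  have /andP[j1 j2] := truncn_itv td.
  rewrite -/j in j1 j2.
  have jM : (j <= M)%N.
    rewrite -(ler_nat R); apply: (le_trans j1); apply: (@le_trans _ _ (`|A| / d)).
      rewrite ler_pM2r ?invr_gt0//; have := ler_norm A; lra.
    by apply/ltW/archi_boundP; rewrite divr_ge0 ?normr_ge0 ?(ltW d0).
  have tp : t <= p j by move: j1; rewrite ler_pdivlMr// /p; lra.
  have tp2 : p j - t <= d.
    by move: j2; rewrite ltr_pdivrMr// /p -natr1 mulrDl mul1r; lra.
  have h4 := near_solution_modulus (mys n) (ys1 n) (res n) tp (p0 j).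
  have h5 := ymod _ _ tp.
  have h6 := hd _ tp2; have h7 := h3 j jM.
  rewrite -/W in h4; rewrite cabsB in h4.
  have -> : ys n t - y t = (ys n t - ys n (p j)) + (ys n (p j) - y (p j)) + (y (p j) - y t) by ring.
  have := cabsD (ys n t - ys n (p j)) (ys n (p j) - y (p j)).
  have := cabsD ((ys n t - ys n (p j)) + (ys n (p j) - y (p j))) (y (p j) - y t).
  lra.
exists y, z; split => // t t0; apply: cabs_le_small => e e0.
have m0 := @Lint_mker_ge0 R.
(* The error is counted in units of e / q: one for the difference at t, one for the residual, and
   the rest for [K] of the difference, which is at most e / q on a window of length [A] and at most
   2 beyond it, where the kernel has mass at most e / q. *)
pose q := 2 + Kc * (Lint mker + 2); have q0 : 0 < q by rewrite /q; nra.
have eq0 : 0 < e / q by rewrite divr_gt0.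
have [A A0 hA] := mker_tail eq0.
have [n [h1 _ h3]] := unif _ (A - t) eq0.
have by_ : bdd_before y t by exists 1.
have bys : bdd_before (ys n) t by exists 1 => s st; apply: ys1; lra.
have E : y t + K y t = (y t - ys n t) + K (fun s => 1 * y s + (-1) * ys n s) t + (ys n t + K (ys n) t).
  by rewrite (Kop_lin c1 mal alA)//; ring.
have LI : L1 (fun s => \1_`]A, +oo[%classic (t - s) * mker (t - s)).
  exact: (L1_subr t (L1_indic (measurable_itv _) L1_mker)).
pose G s := e / q + 2 * \1_`]A, +oo[%classic (t - s).
have EG s : mker (t - s) * G s = mker (t - s) * (e / q) + 2 * (\1_`]A, +oo[%classic (t - s) * mker (t - s)).
  by rewrite /G; ring.
have LG : L1 (fun s => mker (t - s) * G s).
  by apply: (eq_L1 (fun s => esym (EG s))); apply: L1D; [exact: L1_mker_subr|exact: L1Z].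
have yG s : s < t -> cabs (1 * y s + (-1) * ys n s) <= G s.
  move=> st; rewrite mul1r mulN1r /G indicE cabsB.
  have [sA|sA] := leP (t - A) s.
    have := h3 s; have : 0 <= (t - s \in `]A, +oo[%classic)%:R :> R by [].
    lra.
  rewrite mem_set/= ?in_itv/= ?andbT; last lra.
  have := cabsD (ys n s) (- y s); rewrite cabsN; have := y1 s; have := ys1 n s; lra.
have myn : cmeas (fun s => 1 * y s + (-1) * ys n s).
  by apply: cmeasD; apply: cmeasM => //; exact: cmeas_cst.
have h4 := Kop_le c1 mal alA myn yG LG.
rewrite (eq_Lint EG) LintD ?Lint_mker_subr ?LintZ// in h4; [|exact: L1_mker_subr|exact: L1Z].
rewrite (Lint_subr t (f := fun u => \1_`]A, +oo[%classic u * mker u)) in h4; last first.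
  exact: (L1_indic (measurable_itv _) L1_mker).
have h5 := res n t t0.
have h6 : cabs (y t - ys n t) <= e / q by rewrite cabsB; apply: h3; lra.
rewrite E; have := cabsD ((y t - ys n t) + K (fun s => 1 * y s + (-1) * ys n s) t) (ys n t + K (ys n) t).
have := cabsD (y t - ys n t) (K (fun s => 1 * y s + (-1) * ys n s) t).
have h7 : e = 2 * (e / q) + Kc * (Lint mker * (e / q) + 2 * (e / q)).
  by rewrite /q; field; rewrite -/q gt_eqF.
have h8 : Kc * (Lint mker * (e / q) + 2 * Lint (fun u => \1_`]A, +oo[%classic u * mker u)) <=
  Kc * (Lint mker * (e / q) + 2 * (e / q)) by apply: ler_wpM2l; lra.
lra.
Qed.

End Compactness.

(** * From the absence of Floquet solutions to bounded invertibility *)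

Section Stability.
Context {R : realType}.
Local Notation C := R[i].
Variables (T Am : R) (al : R -> R) (c1 : C).
Hypothesis T0 : 0 < T.
Hypothesis mal : measurable_fun setT al.
Hypothesis alT : forall t, al (t + T) = al t.
Hypothesis alA : forall t, `|al t| <= Am.
Local Notation K := (Kop al c1).
Local Notation Kc := (Kcst Am c1).
Implicit Types (y : R -> C) (s t : R).

Hypothesis noFloquet : forall y z, ccontinuous y -> (forall t, cabs (y t) <= 1) ->
  (forall t, t <= 0 -> y t + K y t = 0) -> (forall t, t <= 0 -> y (t - T) = z * y t) ->
  z != 0 -> cabs z <= 1 -> forall t, t <= 0 -> y t = 0.

Lemma Kop0 t : K (fun=> 0) t = 0.
Proof.
apply: cabs_le_small => e e0.
have := @Kop_le_bdd _ Am al c1 mal alA (fun=> 0) t 0 (cmeas_cst _ _).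
rewrite mulr0 => h; apply: (le_trans (h _)); last exact: ltW.
by move=> s _; rewrite cabs0.
Qed.

(* The translates [y (t - i T)] of a solution combined with the coefficients
   of a polynomial: multiplication by ['X] is translation by one period. *)
Definition trans_poly y (p : {poly C}) t : C :=
  \sum_(i < size p) p`_i * y (t - i%:R * T).

Lemma trans_polyE y (p : {poly C}) n t : (size p <= n)%N ->
  trans_poly y p t = \sum_(i < n) p`_i * y (t - i%:R * T).
Proof.
move=> pn; rewrite /trans_poly (big_ord_widen n (fun i => p`_i * y (t - i%:R * T)) pn).
rewrite big_mkcond /=; apply: eq_bigr => i _; case: ifPn => //.
by rewrite -leqNgt => h; rewrite nth_default ?mul0r.
Qed.

Lemma trans_polyD y p q t : trans_poly y (p + q) t = trans_poly y p t + trans_poly y q t.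
Proof.
rewrite (trans_polyE _ _ (size_polyD p q)) (trans_polyE _ _ (leq_maxl (size p) (size q))).
rewrite (trans_polyE _ _ (leq_maxr (size p) (size q))) -big_split /=.
by apply: eq_bigr => i _; rewrite coefD mulrDl.
Qed.

Lemma trans_polyZ y (a : C) p t : trans_poly y (a *: p) t = a * trans_poly y p t.
Proof.
rewrite (trans_polyE _ _ (size_scale_leq a p)) mulr_sumr.
by apply: eq_bigr => i _; rewrite coefZ mulrA.
Qed.

Lemma trans_polyX y p t : trans_poly y ('X * p) t = trans_poly y p (t - T).
Proof.
have sz : (size ('X * p)%R <= (size p).+1)%N.
  by apply: (leq_trans (size_polyMleq _ _)); rewrite size_polyX.
rewrite (trans_polyE _ _ sz).
rewrite big_ord_recl coefXM mul0r add0r; apply: eq_bigr => i _.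
rewrite coefXM /= /bump /= add1n; congr (_ * y _).
by rewrite -natr1; ring.
Qed.

Lemma trans_poly1 y t : trans_poly y 1 t = y t.
Proof.
by rewrite /trans_poly size_poly1 big_ord1 coef1 mul1r mul0r subr0.
Qed.

Lemma hom_comb y (c : nat -> C) n : cmeas y -> (forall t, t <= 0 -> cabs (y t) <= 1) ->
  (forall t, t <= 0 -> y t + K y t = 0) ->
  let f t := \sum_(i < n) c i * y (t - i%:R * T) in
  [/\ cmeas f, exists B, forall t, t <= 0 -> cabs (f t) <= B &
   forall t, t <= 0 -> f t + K f t = 0].
Proof.
move=> my y1 hy; elim: n => [|n [mf [B fB] hf]] /=.
  have E : (fun t => \sum_(i < 0) c i * y (t - i%:R * T)) = fun=> 0.
    by apply/funext => t; rewrite big_ord0.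
  split; first by rewrite E; exact: cmeas_cst.
    by exists 0 => t _; rewrite big_ord0 cabs0.
  by move=> t _; rewrite E Kop0 big_ord0 addr0.
set f := fun t => \sum_(i < n) c i * y (t - i%:R * T) in mf fB hf.
pose g t := y (t + (- n%:Z)%:~R * T).
have iE : (- n%:Z)%:~R = - n%:R :> R by rewrite mulrNz.
have nT : n%:R * T >= 0 by rewrite mulr_ge0// ltW.
have Ep t : \sum_(i < n.+1) c i * y (t - i%:R * T) = 1 * f t + c n * g t.
  by rewrite big_ord_recr /= mul1r /g iE mulNr.
have E := funext Ep.
have mg : cmeas g by exact: cmeas_shift.
have g1 t : t <= 0 -> cabs (g t) <= 1 by move=> t0; apply: y1; rewrite iE mulNr; lra.
have bg t : t <= 0 -> bdd_before g t by move=> t0; exists 1 => s st; apply: g1; lra.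
have bf t : t <= 0 -> bdd_before f t by move=> t0; exists B => s st; apply: fB; lra.
split.
- by rewrite E; apply: cmeasD; apply: cmeasM => //; exact: cmeas_cst.
- exists (B + cabs (c n)) => t t0; rewrite Ep mul1r; apply: (le_trans (cabsD _ _)).
  apply: lerD; first exact: fB.
  by rewrite cabsM ler_piMr ?cabs_ge0// g1.
- move=> t t0.
  have hg : g t + K g t = 0.
    rewrite /g (Kop_shift c1 mal alT alA my) ?hy//; first by rewrite iE mulNr; lra.
    by exists 1 => s st; apply: y1; move: st; rewrite iE mulNr; lra.
  rewrite Ep E (Kop_lin c1 mal alA 1 (c n) mf mg (bf t t0) (bg t t0)).
  have -> : 1 * f t + c n * g t + (1 * K f t + c n * K g t)
    = (f t + K f t) + c n * (g t + K g t) by ring.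
  by rewrite hg mulr0 addr0; exact: hf.
Qed.

Lemma trans_nat t : t <= 0 -> exists k : nat, - T <= t + k%:R * T <= 0.
Proof.
move=> t0; have tT : 0 <= - t / T by rewrite divr_ge0 ?oppr_ge0 ?(ltW T0).
exists (Num.truncn (- t / T)); have /andP[] := truncn_itv tT.
rewrite ler_pdivlMr// ltr_pdivrMr// -natr1 mulrDl mul1r => h1 h2.
by apply/andP; split; lra.
Qed.

Lemma bounded_homogeneous_zero y : cmeas y -> (forall t, t <= 0 -> cabs (y t) <= 1) ->
  (forall t, t <= 0 -> y t + K y t = 0) -> forall t, t <= 0 -> y t = 0.
Proof.
move=> my y1 hy t1 t10; apply/eqP/negPn/negP => yt1.
have [L L0 HL] := growth c1 T0 mal alA.
pose P p := trans_poly y p.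
have mP p : cmeas (P p) by have [] := hom_comb (fun i => p`_i) (size p) my y1 hy.
have bP p : exists B, forall t, t <= 0 -> cabs (P p t) <= B.
  by have [] := hom_comb (fun i => p`_i) (size p) my y1 hy.
have hP p t : t <= 0 -> P p t + K (P p) t = 0.
  by move=> t0; have [_ _ ->] := hom_comb (fun i => p`_i) (size p) my y1 hy.
pose D : set R := [set t | t <= 0].
(* The approximate eigenvectors of ['X] for this seminorm yield, by compactness, Floquet solutions. *)
pose nu p := sup ((fun t => cabs (P p t)) @` D).
have hs p : has_sup ((fun t => cabs (P p t)) @` D).
  have [B HB] := bP p; split; first by exists (cabs (P p 0)), 0 => //; rewrite /D /=.
  by exists B => _ [t t0 <-]; exact: HB.
have nu_ub p t : t <= 0 -> cabs (P p t) <= nu p.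
  by move=> t0; apply: ub_le_sup; [exact: (hs p).2|exists t].
have nu_le p b : (forall t, t <= 0 -> cabs (P p t) <= b) -> nu p <= b.
  by move=> h; apply: ge_sup => [|_ [t t0 <-]]; [exact: (hs p).1|exact: h].
have nuD p q : nu (p + q) <= nu p + nu q.
  apply: nu_le => t t0; rewrite /P trans_polyD; apply: (le_trans (cabsD _ _)).
  by apply: lerD; exact: nu_ub.
have nuZle (a : C) p : nu (a *: p) <= cabs a * nu p.
  by apply: nu_le => t t0; rewrite /P trans_polyZ cabsM ler_wpM2l ?cabs_ge0// nu_ub.
have nuZ (a : C) p : nu (a *: p) = cabs a * nu p.
  apply/eqP; rewrite eq_le nuZle /=.
  have [->|a0] := eqVneq a 0.
    rewrite cabs0 mul0r; apply: le_trans (nu_ub _ 0 (lexx 0)); exact: cabs_ge0.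
  have := nuZle a^-1 (a *: p); rewrite scalerA mulVf// scale1r cabsV.
  have ca : 0 < cabs a by rewrite lt_neqAle cabs_ge0 andbT eq_sym cabs_eq0.
  by rewrite -(ler_pM2l ca) mulVKf// gt_eqF.
have nuX p : nu ('X * p) <= nu p.
  by apply: nu_le => t t0; rewrite /P trans_polyX; apply: nu_ub; have := T0; lra.
(* By [growth] the past before - T controls the last period. *)
have nuL p : nu p <= L * nu ('X * p).
  have [B HB] := bP p.
  have := HL (P p) (- T) (nu ('X * p)) 0 B (mP p); rewrite addNr addr0 => h.
  apply: nu_le => t t0; apply: (h HB _ _ t t0).
    by move=> s s0; rewrite hP// cabs0.
  move=> s sT; have -> : P p s = P ('X * p) (s + T) by rewrite /P trans_polyX addrK.
  by apply: nu_ub; lra.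
have nu1 : 0 < nu 1.
  apply: (lt_le_trans _ (nu_ub 1 t1 t10)).
  by rewrite /P trans_poly1 lt_neqAle cabs_ge0 andbT eq_sym cabs_eq0.
(* Approximate eigenvectors, normalized to supremum at most 1 and translated by whole periods so
   that a value of modulus at least 1/2 is taken in [- T, 0]; this keeps the limit nonzero. *)
have approx n : exists Yzt : (R -> C) * C * R, [/\ cmeas Yzt.1.1,
    forall t, t <= 0 -> cabs (Yzt.1.1 t) <= 1,
    forall t, t <= 0 -> Yzt.1.1 t + K Yzt.1.1 t = 0, cabs Yzt.1.2 <= 2 &
    [/\ forall t, t <= 0 -> cabs (Yzt.1.1 (t - T) - Yzt.1.2 * Yzt.1.1 t) <= n.+1%:R^-1,
    - T <= Yzt.2 <= 0 & 1 / 2 <= cabs (Yzt.1.1 Yzt.2)]].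
  have n0 : 0 < n.+1%:R^-1 :> R by rewrite invr_gt0.
  have [[z p] /= [z2 zp]] : exists zp : C * {poly C}, cabs zp.1 <= 2 /\
      nu (('X - zp.1%:P) * zp.2) < n.+1%:R^-1 * nu zp.2.
    apply: contrapT => /forallNP H.
    apply: (no_uniform_lower_bound nuD nuZ nuX nuL L0 nu1 n0) => z p z2.
    by rewrite leNgt; apply/negP => h; apply: (H (z, p)).
  have nup : 0 < nu p.
    have : 0 <= nu (('X - z%:P) * p) by apply: le_trans (nu_ub _ 0 (lexx 0)); exact: cabs_ge0.
    by move=> h; have := le_lt_trans h zp; rewrite pmulr_rgt0.
  have nup2 : 0 < nu p / 2 by lra.
  have [_ [t t0 <-] tp] := sup_adherent nup2 (hs p).
  rewrite -/(nu p) in tp.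
  have [k /andP[k1 k2]] := trans_nat t0.
  have kT : 0 <= k%:R * T by rewrite mulr_ge0// ltW.
  pose c : C := ((nu p)^-1)%:C.
  have cc : cabs c = (nu p)^-1 by rewrite cabs_real gtr0_norm// invr_gt0.
  have YE s : P (c *: ('X^k * p)) s = c * P p (s - k%:R * T).
    rewrite /P trans_polyZ; congr (_ * _).
    have trX (j : nat) r : trans_poly y ('X^j * p) r = trans_poly y p (r - j%:R * T).
      elim: j r => [|j IH] r; first by rewrite mul1r mul0r subr0.
      by rewrite exprS -mulrA trans_polyX IH -natr1; congr trans_poly; ring.
    exact: trX.
  exists (P (c *: ('X^k * p)), z, t + k%:R * T); split => /=.
  - exact: mP.
  - move=> s s0; rewrite YE cabsM cc mulrC ler_pdivrMr// mul1r.
    by apply: nu_ub; lra.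
  - by move=> s s0; exact: hP.
  - exact: z2.
  - split; last 1 first.
    + by rewrite YE cabsM cc addrK [X in _ <= X]mulrC ler_pdivlMr//; lra.
    + move=> s s0; rewrite !YE.
      have -> : c * P p (s - T - k%:R * T) - z * (c * P p (s - k%:R * T)) =
         c * P (('X - z%:P) * p) (s - k%:R * T).
        have -> : ('X - z%:P) * p = 'X * p + (- z) *: p.
          by rewrite mulrBl -mul_polyC rmorphN /= mulNr.
        by rewrite /P trans_polyD trans_polyX trans_polyZ addrAC; ring.
      rewrite cabsM cc mulrC ler_pdivrMr//; apply: le_trans (ltW zp).
      by apply: nu_ub; lra.
    + by rewrite k1 k2.
have /choice[Y HY] := approx.
(* The residuals are 0; the null sequence [harmonic] is taken as their bound because it also bounds
   the Floquet defect. *)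
have res (n : nat) t : t <= 0 -> cabs ((Y n).1.1 t + K (Y n).1.1 t) <= harmonic n.
  by move=> t0; case: (HY n) => _ _ -> //; rewrite cabs0 invr_ge0.
have [w [z [cw w1 hw unif]]] := @compactness _ Am al c1 mal alA
  (fun n => (Y n).1.1) (fun n => (Y n).1.2) harmonic
  (fun n => let: And5 h _ _ _ _ := HY n in h)
  (fun n => let: And5 _ h _ _ _ := HY n in h)
  res cvg_harmonic
  (fun n => let: And5 _ _ _ h _ := HY n in h).
have wz t : t <= 0 -> w (t - T) = z * w t.
  move=> t0; apply/eqP; rewrite -subr_eq0; apply/eqP; apply: cabs_le_small => e e0.
  have e5 : 0 < Num.min 1 (e / 6) by rewrite lt_min ltr01 divr_gt0.
  have [n [h1 h2 h3]] := unif _ (T - t) e5.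
  have e51 : Num.min 1 (e / 6) <= e / 6 by rewrite ge_min lexx orbT.
  case: (HY n) => _ Y1 _ z2 [YT _ _].
  have a1 : cabs ((Y n).1.1 (t - T) - w (t - T)) <= e / 6 by apply: le_trans e51; apply: h3; have := T0; lra.
  have a2 : cabs ((Y n).1.1 t - w t) <= e / 6 by apply: le_trans e51; apply: h3; have := T0; lra.
  have a3 := le_trans (YT t t0) (le_trans h1 e51).
  have a4 : cabs ((Y n).1.2 - z) * cabs (w t) <= e / 6.
    by apply: (le_trans _ e51); apply: (le_trans _ h2); rewrite ler_piMr ?cabs_ge0.
  have a5 : cabs (Y n).1.2 * cabs ((Y n).1.1 t - w t) <= 2 * (e / 6).
    by apply: ler_pM; rewrite ?cabs_ge0.
  have -> : w (t - T) - z * w t = - ((Y n).1.1 (t - T) - w (t - T)) +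
    (((Y n).1.1 (t - T) - (Y n).1.2 * (Y n).1.1 t) + ((Y n).1.2 * ((Y n).1.1 t - w t) +
     ((Y n).1.2 - z) * w t)) by ring.
  apply: (le_trans (cabsD _ _)); rewrite cabsN.
  have b1 := cabsD ((Y n).1.1 (t - T) - (Y n).1.2 * (Y n).1.1 t)
    ((Y n).1.2 * ((Y n).1.1 t - w t) + ((Y n).1.2 - z) * w t).
  have b2 := cabsD ((Y n).1.2 * ((Y n).1.1 t - w t)) (((Y n).1.2 - z) * w t).
  rewrite !cabsM in b2.
  apply: (le_trans (lerD a1 (le_trans b1 (lerD a3 (le_trans b2 (lerD a5 a4)))))); lra.
have [s s0 ws] : exists2 s, s <= 0 & w s != 0.
  have q0 : 0 < 1 / 4 :> R by lra.
  have [n [_ _ h3]] := unif _ T q0.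
  case: (HY n) => _ _ _ _ [_ /andP[t1' t2] Yt].
  exists (Y n).2 => //; rewrite -cabs_eq0 gt_eqF//.
  have := h3 _ t1' t2; have := cabs_tri ((Y n).1.1 (Y n).2) (w (Y n).2); lra.
have mw := ccontinuous_cmeas cw.
(* If [z] were 0, the limit would vanish up to - T, and then on the last period by [growth]. *)
have z0 : z != 0.
  apply/eqP => z0; move/eqP: ws; apply; apply/eqP; rewrite -cabs_eq0 eq_le cabs_ge0 andbT.
  have := HL w (- T) 0 0 1 mw; rewrite addNr addr0 mulr0; apply => //.
  - by move=> t t0; rewrite hw// cabs0.
  - move=> t tT; have -> : t = (t + T) - T by ring.
    by rewrite wz; [rewrite z0 mul0r cabs0|lra].
(* A multiplier of modulus greater than 1 would make [w] unbounded in the past. *)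
have z1 : cabs z <= 1.
  rewrite leNgt; apply/negP => z1.
  have wn n : w (s - n%:R * T) = z ^+ n * w s.
    elim: n => [|n IH]; first by rewrite mul0r subr0 expr0 mul1r.
    have -> : s - n.+1%:R * T = s - n%:R * T - T by rewrite -natr1; ring.
    rewrite wz ?IH ?exprS ?mulrA//.
    have : 0 <= n%:R * T by rewrite mulr_ge0// ltW.
    by lra.
  have ws0 : 0 < cabs (w s) by rewrite lt_neqAle cabs_ge0 andbT eq_sym cabs_eq0.
  have zV0 : 0 <= (cabs z)^-1 by rewrite invr_ge0 cabs_ge0.
  have zV1 : (cabs z)^-1 < 1 by rewrite invf_lt1//; lra.
  have w2 : 0 < cabs (w s) / 2 by lra.
  have [n Hn] := expr_small zV0 zV1 w2.
  have := w1 (s - n%:R * T); rewrite wn cabsM cabsX.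
  have := Hn n (leqnn n); rewrite exprVn.
  have zn : 0 < cabs z ^+ n by rewrite exprn_gt0//; lra.
  rewrite -(ler_pM2l zn) mulfV ?gt_eqF//; lra.
by move/eqP: ws; apply; exact: (noFloquet cw w1 hw wz z0 z1).
Qed.

Lemma trans_int t : exists k : int, - T < t - k%:~R * T <= 0.
Proof.
exists (Num.ceil (t / T)); have /andP[] := ceil_itv (t / T).
rewrite ltr_pdivlMr// ler_pdivrMr// rmorphB /= mulrBl mul1r => h1 h2.
by apply/andP; split; lra.
Qed.

(** If no constant worked, normalized counterexamples with residuals tending to 0 would converge to
    a nonzero bounded solution on t <= 0. The constant depends neither on [X] nor on [B0], so the
    estimate applies to functions cut at an arbitrary time. *)
Theorem stability : exists2 M : R, 0 < M & forall y (X eta B0 : R), cmeas y ->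
  (forall t, t <= X -> cabs (y t) <= B0) ->
  (forall t, t <= X -> cabs (y t + K y t) <= eta) ->
  forall t, t <= X -> cabs (y t) <= M * eta.
Proof.
apply: contrapT => H.
have [L L0 HL] := growth c1 T0 mal alA.
have approx n : exists Yt : (R -> C) * R, [/\ cmeas Yt.1,
    forall t, t <= 0 -> cabs (Yt.1 t) <= 1,
    forall t, t <= 0 -> cabs (Yt.1 t + K Yt.1 t) <= n.+1%:R^-1,
    - T <= Yt.2 <= 0 & (8 * L)^-1 <= cabs (Yt.1 Yt.2)].
  (* The first summand makes the normalized residual at most 1 / (n + 1); the second makes it small
     against the growth constant [L]. *)
  pose m := n.+1%:R + 8 * L : R.
  have n0 : 0 < n.+1%:R :> R by rewrite ltr0n.
  have m0 : 0 < m by rewrite /m; lra.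
  have [y [X [eta [B0 [my yB0 res [t tX yt]]]]]] : exists y X eta B0, [/\ cmeas y,
     (forall t, t <= X -> cabs (y t) <= B0),
     (forall t, t <= X -> cabs (y t + K y t) <= eta) &
     exists2 t, t <= X & m * eta < cabs (y t)].
    apply: contrapT => G; apply: H; exists m => // y X eta B0 my yB0 res t tX.
    by rewrite leNgt; apply/negP => h; apply: G; exists y, X, eta, B0; split => //; exists t.
  have eta0 : 0 <= eta by apply: le_trans (res t tX); exact: cabs_ge0.
  pose E := (fun t => cabs (y t)) @` [set t | t <= X].
  have hs : has_sup E.
    by split; [exists (cabs (y t)), t|exists B0 => _ [s sX <-]; exact: yB0].
  pose B := sup E.
  have yB s : s <= X -> cabs (y s) <= B by move=> sX; apply: ub_le_sup; [exact: hs.2|exists s].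
  have B_0 : 0 < B.
    by apply: lt_le_trans (yB t tX); apply: le_lt_trans yt; rewrite mulr_ge0// ltW.
  have etaB : m * eta < B by apply: lt_le_trans (yB t tX).
  (* By [growth] a large value also occurs before X - T; such a point can be moved into ]- T, 0] by
     a multiple of the period while t <= 0 stays inside t <= X. *)
  have [s sX ys] : exists2 s, s <= X - T & B / (8 * L) < cabs (y s).
    apply: contrapT => G.
    have yG s : s <= X - T -> cabs (y s) <= B / (8 * L).
      by move=> sX; rewrite leNgt; apply/negP => h; apply: G; exists s.
    have := HL y (X - T) (B / (8 * L)) eta B my; rewrite subrK => /(_ yB res yG) h.
    have : B <= L * (B / (8 * L) + eta).
      by apply: ge_sup => [|_ [r rX <-]]; [exact: hs.1|exact: h].
    have -> : L * (B / (8 * L) + eta) = B / 8 + L * eta by field; rewrite gt_eqF.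
    have : 8 * L * eta <= m * eta by rewrite ler_wpM2r// /m; lra.
    by lra.
  have [k /andP[k1 k2]] := trans_int s.
  pose c : C := (B^-1)%:C.
  have cc : cabs c = B^-1 by rewrite cabs_real gtr0_norm// invr_gt0.
  pose g r := y (r + k%:~R * T).
  have mg : cmeas g by exact: cmeas_shift.
  have gX r : r <= 0 -> r + k%:~R * T <= X by move=> r0; lra.
  have bg r : r <= 0 -> bdd_before g r.
    by move=> r0; exists B => u ur; apply: yB; apply: gX; lra.
  have E' r : c * g r = c * g r + 0 * g r by rewrite mul0r addr0.
  exists (fun r => c * g r, s - k%:~R * T); split => /=.
  - by apply: cmeasM => //; exact: cmeas_cst.
  - move=> r r0; rewrite cabsM cc mulrC ler_pdivrMr// mul1r; exact/yB/gX.
  - move=> r r0; under eq_fun do rewrite E'.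
    rewrite (Kop_lin c1 mal alA c 0 mg mg (bg r r0) (bg r r0)) mul0r addr0 -mulrDr cabsM cc.
    rewrite mulrC ler_pdivrMr// /g (Kop_shift c1 mal alT alA my); last first.
      by exists B => u ur; apply: yB; apply: le_trans (ltW ur) (gX r r0).
    apply: (le_trans (res _ (gX r r0))).
    rewrite mulrC ler_pdivlMr//.
    have : eta * n.+1%:R <= m * eta by rewrite mulrC ler_wpM2r// /m; lra.
    by lra.
  - by rewrite (ltW k1) k2.
  - by rewrite /g subrK cabsM cc [X in _ <= X]mulrC ler_pdivlMr// [X in X <= _]mulrC ltW.
have /choice[Y HY] := approx.
have zs2 : cabs (0 : C) <= 2 by rewrite cabs0.
have [w [z [cw w1 hw unif]]] := @compactness _ Am al c1 mal alA
  (fun n => (Y n).1) (fun=> 0) harmonic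
  (fun n => let: And5 h _ _ _ _ := HY n in h)
  (fun n => let: And5 _ h _ _ _ := HY n in h)
  (fun n => let: And5 _ _ h _ _ := HY n in h) cvg_harmonic (fun=> zs2).
have q0 : 0 < (16 * L)^-1 by rewrite invr_gt0; lra.
have [n [_ _ h3]] := unif _ T q0.
case: (HY n) => _ _ _ /andP[t1 t2] Yt.
have := h3 _ t1 t2.
rewrite (bounded_homogeneous_zero (ccontinuous_cmeas cw) (fun t _ => w1 t) hw t2) subr0.
have : (16 * L)^-1 < (8 * L)^-1 by rewrite ltf_pV2 ?posrE; lra.
lra.
Qed.

End Stability.

(** * Absence of Floquet solutions *)

Section ComplexLimits.
Context {R : realType}.
Local Notation C := R[i].

Definition ccvg (u : nat -> C) (l : C) : Prop :=
  (fun n => complex.Re (u n)) @ \oo --> complex.Re l /\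
  (fun n => complex.Im (u n)) @ \oo --> complex.Im l.

Lemma ccvgM u v a b : ccvg u a -> ccvg v b -> ccvg (fun n => u n * v n) (a * b).
Proof.
move=> [u1 u2] [v1 v2]; split.
  by under eq_fun do rewrite ReM; rewrite ReM; apply: cvgB; apply: cvgM.
by under eq_fun do rewrite ImM; rewrite ImM; apply: cvgD; apply: cvgM.
Qed.

Lemma ccvgB u v a b : ccvg u a -> ccvg v b -> ccvg (fun n => u n - v n) (a - b).
Proof.
move=> [u1 u2] [v1 v2]; split.
  by under eq_fun do rewrite ReD ReN; rewrite ReD ReN; apply: cvgB.
by under eq_fun do rewrite ImD ImN; rewrite ImD ImN; apply: cvgB.
Qed.

Lemma ccvg_cst a : ccvg (fun=> a) a.
Proof. by split; exact: cvg_cst. Qed.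

Lemma ccvg_unique u a b : ccvg u a -> ccvg u b -> a = b.
Proof.
by move=> [u1 u2] [v1 v2]; apply: (@eqC R); [exact: (cvg_unique _ u1 v1)|exact: (cvg_unique _ u2 v2)].
Qed.

Lemma eq_ccvg u v a : u =1 v -> ccvg u a -> ccvg v a.
Proof. by move=> /funext ->. Qed.

Lemma ccvg_conj u a : ccvg u a -> ccvg (fun n => (u n)^*) (a^*).
Proof.
have cR (z : C) : complex.Re z^* = complex.Re z by case: z.
have cI (z : C) : complex.Im z^* = - complex.Im z by case: z.
move=> [u1 u2]; split; first by under eq_fun do rewrite cR; rewrite cR.
by under eq_fun do rewrite cI; rewrite cI; exact: cvgN.
Qed.

Lemma ccvg_cexp u a : ccvg u a -> ccvg (fun n => cexp (u n)) (cexp a).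
Proof.
move=> [u1 u2]; apply: ccvgM; split => /=; try exact: cvg_cst.
- by apply: continuous_cvg => //; exact: continuous_expR.
- by apply: continuous_cvg => //; exact: continuous_cos.
- by apply: continuous_cvg => //; exact: continuous_sin.
Qed.

Lemma ccvg_real (u : nat -> R) (a : R) : u @ \oo --> a -> ccvg (fun n => (u n)%:C) a%:C.
Proof. by move=> h; split => //=; exact: cvg_cst. Qed.

Lemma dominated_ccvg (f_ : nat -> R -> C) (f : R -> C) (g : R -> R) :
  (forall n, cmeas (f_ n)) -> cmeas f ->
  (forall x, ccvg (f_ ^~ x) (f x)) -> L1 g ->
  (forall n x, cabs (f_ n x) <= g x) ->
  ccvg (fun n => Cint (f_ n)) (Cint f).
Proof.
move=> mf_ mf cf Lg fg; split => /=.
  apply: (@dominated_Lint _ _ _ g) => //.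
  - by move=> n; case: (mf_ n).
  - by case: mf.
  - by move=> x; case: (cf x).
  - by move=> n x; apply: (le_trans (abs_Re_le _)).
apply: (@dominated_Lint _ _ _ g) => //.
- by move=> n; case: (mf_ n).
- by case: mf.
- by move=> x; case: (cf x).
- by move=> n x; apply: (le_trans (abs_Im_le _)).
Qed.

Lemma Cint_conv (f g : R -> C) : CL1 f -> CL1 g ->
  (forall t, CL1 (fun s => f s * g (t - s))) ->
  CL1 (fun t => Cint (fun s => f s * g (t - s))) /\
  Cint (fun t => Cint (fun s => f s * g (t - s))) = Cint f * Cint g.
Proof.
move=> Lf Lg Ls; have mf := CL1_meas Lf; have mg := CL1_meas Lg.
have Lgs s : CL1 (fun t => g (t - s)).
  exact: (CL1_shift (- s) Lg).
have mF : cmeas (fun z : R * R => f z.1 * g (z.2 - z.1)).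
  apply: cmeasM; first exact: (cmeas_comp mf).
  by apply: (cmeas_comp mg); exact: measurable_funB.
have nF s : Lint (fun t => cabs (f s * g (t - s))) = Lint (fun t => cabs (g t)) * cabs (f s).
  rewrite -(Lint_shift (- s) (CL1_cabs Lg)) mulrC -LintZ; last first.
    exact: (L1_shift (- s) (CL1_cabs Lg)).
  by apply: eq_Lint => t; rewrite cabsM.
have [L1F L2F eF] := @fubini_CL1 _ (fun s t => f s * g (t - s)) mF
  (fun s => CL1Z (f s) (Lgs s)) Ls
  (eq_L1 (fun s => esym (nF s)) (L1Z _ (CL1_cabs Lf))).
split; first exact: L2F.
rewrite -eF [RHS]mulrC -(CintZ _ Lf); apply: eq_Cint => s.
by rewrite (CintZ (f s) (Lgs s)) (Cint_shift (- s) Lg) mulrC.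
Qed.

End ComplexLimits.

(** * Laplace symbols *)

Section Symbols.
Context {R : realType}.
Local Notation C := R[i].
Local Notation leb := (@lebesgue_measure R).
Implicit Types (p : C) (k : R -> R) (t u s : R).

Definition lapf k p u : C := (k u)%:C * cexp (- (p * u%:C)).
Definition Lap k p : C := Cint (lapf k p).

Lemma Re_pu p u : complex.Re (- (p * u%:C)) = - (complex.Re p * u).
Proof. by rewrite ReN ReM /= mulr0 subr0. Qed.

Lemma Im_pu p u : complex.Im (- (p * u%:C)) = - (complex.Im p * u).
Proof. by rewrite ImN ImM /= mulr0 add0r. Qed.

Lemma cmeas_lapf k p : measurable_fun setT k -> cmeas (lapf k p).
Proof.
move=> mk; apply: cmeasM; first exact: cmeas_real.
apply: cmeas_cexp; apply: cmeasN; apply: cmeasM; first exact: cmeas_cst.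
exact: cmeas_real.
Qed.

Lemma cabs_lapf k p u : cabs (lapf k p u) = `|k u| * expR (- (complex.Re p * u)).
Proof. by rewrite cabsM cabs_real cabs_cexp Re_pu. Qed.

Lemma cabs_lapf_le k p u : dominated_kernel k -> 0 <= complex.Re p ->
  cabs (lapf k p u) <= mker u.
Proof.
move=> [mk k0 km] p0; rewrite cabs_lapf ger0_norm//.
have [u0|u0] := leP u 0.
  have -> : k u = 0 by apply/eqP; rewrite eq_le k0 andbT -(mker_neg u0) km.
  by rewrite mul0r mker_ge0.
apply: le_trans (km u); rewrite ler_piMr// -expR0 ler_expR oppr_le0.
by rewrite mulr_ge0// ltW.
Qed.

Lemma CL1_lapf k p : dominated_kernel k -> 0 <= complex.Re p -> CL1 (lapf k p).
Proof.
move=> dk p0; have [mk _ _] := dk; apply: CL1_le L1_mker; first exact: cmeas_lapf.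
by move=> u; exact: cabs_lapf_le.
Qed.

Lemma Lap_cvg k (pn : nat -> C) p : dominated_kernel k ->
  (forall n, 0 <= complex.Re (pn n)) -> ccvg pn p -> ccvg (fun n => Lap k (pn n)) (Lap k p).
Proof.
move=> dk pn0 pnp; have [mk _ _] := dk.
apply: (dominated_ccvg _ _ _ L1_mker).
- by move=> n; exact: cmeas_lapf.
- exact: cmeas_lapf.
- move=> u; apply: ccvgM; first exact: ccvg_cst.
  apply: ccvg_cexp; rewrite -[X in ccvg _ X]sub0r.
  apply: (@eq_ccvg _ (fun n => 0 - pn n * u%:C)); first by move=> n; rewrite sub0r.
  by apply: ccvgB; [exact: ccvg_cst|apply: ccvgM => //; exact: ccvg_cst].
- by move=> n u; exact: cabs_lapf_le.
Qed.

Lemma expR_le_min (sg u : R) : 0 < sg -> 0 < u ->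
  expR (- (sg * u)) <= (1 + sg^-1) * Num.min 1 u^-1.
Proof.
move=> s0 u0; have s1 : 0 < sg^-1 by rewrite invr_gt0.
have su : 0 < sg * u by rewrite mulr_gt0.
have e1 : expR (- (sg * u)) <= 1 by rewrite -expR0 ler_expR; lra.
case: (leP 1 u^-1) => h.
  by rewrite mulr1; lra.
have e2 : expR (- (sg * u)) <= (sg * u)^-1.
  rewrite expRN lef_pV2 ?posrE ?expR_gt0//.
  by have := expR_ge1Dx (sg * u); lra.
apply: (le_trans e2); rewrite invfM ler_wpM2r ?invr_ge0 ?ltW//; lra.
Qed.

Lemma CL1_lapf_hker p : 0 < complex.Re p -> CL1 (lapf hker p).
Proof.
move=> p0; apply: CL1_le (L1Z (1 + (complex.Re p)^-1) L1_mker).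
  by apply: cmeas_lapf; exact: measurable_hker.
move=> u; rewrite cabs_lapf ger0_norm ?hker_ge0//.
have [u0|u0] := leP u 0; first by rewrite hker_neg// mul0r mulr_ge0 ?mker_ge0// addr_ge0// invr_ge0 ltW.
rewrite /mker mulrCA ler_wpM2l ?hker_ge0//; exact: expR_le_min.
Qed.

Lemma lapf_conv (k1 k2 : R -> R) p t s :
  lapf k1 p s * lapf k2 p (t - s) = (k1 s * k2 (t - s))%:C * cexp (- (p * t%:C)).
Proof.
rewrite /lapf mulrACA -cexpD -rmorphM; congr (_ * cexp _).
by rewrite rmorphB /=; ring.
Qed.

Lemma CL1_lapf_conv (k1 k2 : R -> R) p t : L1 (fun s => k1 s * k2 (t - s)) ->
  CL1 (fun s => lapf k1 p s * lapf k2 p (t - s)) /\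
  Cint (fun s => lapf k1 p s * lapf k2 p (t - s)) = lapf (fun t => Lint (fun s => k1 s * k2 (t - s))) p t.
Proof.
move=> L; pose c := cexp (- (p * t%:C)).
have LC : CL1 (fun s => (k1 s * k2 (t - s))%:C) by split => //=; exact: L1_0.
have E s : lapf k1 p s * lapf k2 p (t - s) = c * (k1 s * k2 (t - s))%:C.
  by rewrite lapf_conv mulrC.
split; first by apply: (eq_CL1 (fun s => esym (E s))); exact: CL1Z.
by rewrite (eq_Cint E) CintZ// Cint_real mulrC.
Qed.

Definition step u : R := \1_`]0, +oo[%classic u.

(** [hker] convolved with itself is constant on the positive half-line. This gives only the square
    of the symbol p^(-1/2); the branch is selected by [Re_Khat_Msym]. *)
Lemma Lap_hker_sqr p : 0 < complex.Re p ->
  CL1 (lapf step p) /\ Lap hker p * Lap hker p = betac%:C * Lap step p.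
Proof.
move=> p0; have Lh := CL1_lapf_hker p0.
have conv t := CL1_lapf_conv p (hker_conv_hker t).1.
have [L <-] := Cint_conv Lh Lh (fun t => (conv t).1).
have E t : Cint (fun s => lapf hker p s * lapf hker p (t - s)) = betac%:C * lapf step p t.
  rewrite (conv t).2 /lapf /step indicE mulrA -rmorphM; congr (_%:C * _).
  have [t0|t0] := ltP 0 t.
    by rewrite mem_set ?mulr1 ?(hker_conv_hker t).2//= in_itv/= t0.
  rewrite memNset ?mulr0; last by rewrite /= in_itv/= andbT; lra.
  rewrite -[RHS](@Lint0 R); apply: eq_Lint => s.
  have [s0|s0] := leP s 0; first by rewrite hker_neg// mul0r.
  by rewrite [hker (t - s)]hker_neg ?mulr0//; lra.
have LS : CL1 (lapf step p).
  have := CL1Z (betac^-1)%:C (eq_CL1 E L); apply: eq_CL1 => t.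
  by rewrite mulrA -rmorphM mulVf ?mul1r// gt_eqF// betac_gt0.
by split => //; rewrite (eq_Cint E) CintZ.
Qed.

(** The family e^(- sg t) (A cos + B sin) is stable under differentiation; it covers the real and
    the imaginary part of e^(- p t) and gives the continuity of the derivative as well. *)
Lemma is_derive_exp_trig (sg ta A B x : R) :
  is_derive x 1 (fun t => expR (- (sg * t)) * (A * cos (ta * t) + B * sin (ta * t)))
   (expR (- (sg * x)) * ((ta * B - sg * A) * cos (ta * x) - (ta * A + sg * B) * sin (ta * x))).
Proof.
have dl (a : R) : is_derive x 1 (fun t : R => a * t) a.
  by apply: (is_derive_eq (is_deriveZ a (is_derive_id x 1))); rewrite /GRing.scale/= mulr1.
have de : is_derive x 1 (fun t => expR (- (sg * t))) (expR (- (sg * x)) * - sg).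
  have dN : is_derive x 1 (fun t => - (sg * t)) (- sg) by apply: is_deriveN.
  exact: (is_derive1_comp (f := expR) (g := fun t : R => - (sg * t)) (is_derive_expR _) dN).
have dc := is_derive1_comp (f := cos) (g := fun t : R => ta * t) (is_derive_cos _) (dl ta).
have ds := is_derive1_comp (f := sin) (g := fun t : R => ta * t) (is_derive_sin _) (dl ta).
have dAB : is_derive x 1 (fun t => A * cos (ta * t) + B * sin (ta * t))
    (A * (- sin (ta * x) * ta) + B * (cos (ta * x) * ta)).
  exact: is_deriveD (is_deriveZ A dc) (is_deriveZ B ds).
apply: (is_derive_eq (is_deriveM de dAB)).
rewrite /GRing.scale /=; ring.
Qed.

Lemma FTC_exp_trig (sg ta A B b : R) : 0 < b ->
  Lint (fun t => \1_`[0, b]%classic t * (expR (- (sg * t)) *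
     ((ta * B - sg * A) * cos (ta * t) - (ta * A + sg * B) * sin (ta * t)))) =
  expR (- (sg * b)) * (A * cos (ta * b) + B * sin (ta * b)) - A.
Proof.
move=> b0; pose F t := expR (- (sg * t)) * (A * cos (ta * t) + B * sin (ta * t)).
pose f t := expR (- (sg * t)) * ((ta * B - sg * A) * cos (ta * t) - (ta * A + sg * B) * sin (ta * t)).
have dF (x : R) : is_derive x 1 F (f x) := is_derive_exp_trig sg ta A B x.
have cF (x : R) : {for x, continuous F}.
  by apply: differentiable_continuous; apply/derivable1_diffP; exact: ex_derive.
have cf (x : R) : {for x, continuous f}.
  have := is_derive_exp_trig sg ta (ta * B - sg * A) (- (ta * A + sg * B)) x.
  have -> : (fun t => expR (- (sg * t)) * ((ta * B - sg * A) * cos (ta * t) +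
      - (ta * A + sg * B) * sin (ta * t))) = f.
    by apply/funext => t; rewrite /f mulNr.
  by move=> df; apply: differentiable_continuous; apply/derivable1_diffP; exact: ex_derive.
rewrite -Lint_mkcond /Rintegral (@continuous_FTC2 _ f F 0 b b0).
- by rewrite /= /F !mulr0 oppr0 expR0 cos0 sin0 mulr1 mulr0 addr0 mul1r.
- by apply: continuous_subspaceT => x; exact: cf.
- split.
  + by move=> x _; exact: ex_derive.
  + exact/cvg_at_right_filter/cF.
  + exact/cvg_at_left_filter/cF.
- by move=> x _; rewrite derive1E; exact: derive_val.
Qed.

End Symbols.

(** * The square root of 1 / p and the sign of one mode *)

Section SymbolIdentities.
Context {R : realType}.
Local Notation C := R[i].
Local Notation leb := (@lebesgue_measure R).
Implicit Types (p : C) (k : R -> R) (t u s : R).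

Lemma Lint_itv_cst (a b c : R) : a <= b ->
  L1 (fun u => \1_`]a, b]%classic u * c) /\ Lint (fun u => \1_`]a, b]%classic u * c) = c * (b - a).
Proof.
move=> ab.
have fin : (leb `]a, b]%classic < +oo)%E by rewrite lebesgue_measure_itv/= lte_fin; case: ifP => // _; rewrite -EFinB ltry.
split.
  apply/(@L1_mkcond _ _ (fun=> c)) => //.
  by apply: (measurable_bounded_integrable _ fin) => //; exists `|c|; split=> [|x cx y _]; rewrite ?num_real// ltW.
rewrite -(@Lint_mkcond _ _ (fun=> c)) Rintegral_cst//=; congr (_ * _).
rewrite lebesgue_measure_itv/= lte_fin; case: ifP => [_|]//=.
by move=> /negbT; rewrite -leNgt; lra.
Qed.

(** The integral of p e^(- p u) over ]0, n + 1] is 1 - e^(- p (n + 1)), computed in real and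
    imaginary parts; the truncation is removed by dominated convergence. *)
Lemma Lap_step p : 0 < complex.Re p -> p * Lap step p = 1.
Proof.
move=> p0; have [LS _] := Lap_hker_sqr p0.
pose D n : set R := `]0, n.+1%:R]%classic.
pose f n u : C := p * lapf (\1_(D n)) p u.
have ind_step n u : `|\1_(D n) u : R| <= `|step u|.
  rewrite /D /step !indicE [X in X <= _]ger0_norm ?ler0n// ger0_norm ?ler0n// ler_nat.
  apply: (@leq_trans (nat_of_bool (0 < u))).
    by case: (boolP (u \in _)) => //; rewrite inE/= in_itv/= => /andP[->].
  by case: (boolP (0 < u)) => // u0; rewrite mem_set//= in_itv/= u0.
have mf n : cmeas (f n).
  by apply: cmeasM; [exact: cmeas_cst|apply: cmeas_lapf; apply: measurable_indic; exact: measurable_itv].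
have Lim : ccvg (fun n => Cint (f n)) (Cint (fun u => p * lapf step p u)).
  apply: (dominated_ccvg _ _ _ (CL1_cabs (CL1Z p LS))) => //.
  - by apply: cmeasM; [exact: cmeas_cst|exact: CL1_meas LS].
  - move=> u; apply: ccvgM; first exact: ccvg_cst.
    apply: ccvgM; last exact: ccvg_cst.
    apply: ccvg_real; apply: cvg_near_cst.
    exists (Num.truncn u) => // n /= nu; rewrite /D /step !indicE; congr (_%:R).
    congr (nat_of_bool _); apply/idP/idP; rewrite !inE /= !in_itv/= andbT.
      by move=> /andP[].
    move=> u0; rewrite u0/=.
    have /andP[_ h] := truncn_itv (ltW u0); apply: ltW; apply: (lt_le_trans h).
    by rewrite ler_nat.
  - move=> n u; rewrite /f cabsM [X in _ <= X]cabsM !cabs_lapf.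
    apply: ler_wpM2l; first exact: cabs_ge0.
    apply: ler_wpM2r; first exact: expR_ge0.
    exact: ind_step.
set sg := complex.Re p in p0 *; set ta := complex.Im p.
have Val n : Cint (f n) = (1 - expR (- (sg * n.+1%:R)) * cos (ta * n.+1%:R)) +i*
    (expR (- (sg * n.+1%:R)) * sin (ta * n.+1%:R)).
  have b0 : (0 : R) < n.+1%:R by rewrite ltr0n.
  have oc (g : R -> R) : leb.-integrable (D n) (EFin \o g) -> Lint (fun t => \1_(D n) t * g t) =
      Lint (fun t => \1_`[0, n.+1%:R]%classic t * g t).
    move=> ig; rewrite -!Lint_mkcond Rintegral_itv_obnd_cbnd//.
  have me : measurable_fun setT (fun t : R => expR (- (sg * t))).
    have -> : (fun t => expR (- (sg * t))) = expR \o (fun t => - sg * t + 0).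
      by apply/funext => t /=; rewrite addr0 mulNr.
    by apply: measurableT_comp => //; exact: measurable_affine.
  have mc : measurable_fun setT (fun t : R => cos (ta * t)).
    by apply: (measurableT_comp measurable_cos); exact: measurable_funM.
  have ms : measurable_fun setT (fun t : R => sin (ta * t)).
    by apply: (measurableT_comp measurable_sin); exact: measurable_funM.
  have bdi (a1 a2 : R) : leb.-integrable (D n) (EFin \o
      (fun t => expR (- (sg * t)) * (a1 * cos (ta * t) - a2 * sin (ta * t)))).
    apply/L1_mkcond; first exact: measurable_itv.
    apply: L1_le (L1Z (`|a1| + `|a2|) (CL1_cabs LS)).
      apply: measurable_funM; first by apply: measurable_indic; exact: measurable_itv.
      by apply: measurable_funM => //; apply: measurable_funB; apply: measurable_funM => //.
    move=> t; rewrite cabs_lapf normrM normrM (ger0_norm (expR_ge0 _)) mulrA mulrC.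
    apply: ler_pM => //.
      apply: (le_trans (ler_normB _ _)); rewrite !normrM.
      by apply: lerD; rewrite ler_piMr// ler_norml ?cos_geN1 ?sin_geN1 ?cos_le1 ?sin_le1.
    by rewrite -/sg; apply: ler_wpM2r; [exact: expR_ge0|exact: ind_step].
  apply: (@eqC R) => /=.
    transitivity (expR (- (sg * n.+1%:R)) *
        (-1 * cos (ta * n.+1%:R) + 0 * sin (ta * n.+1%:R)) - -1); last by ring.
    rewrite -(FTC_exp_trig sg ta (-1) 0 b0).
    rewrite -(oc _ (bdi _ _)).
    apply: eq_Lint => t; rewrite /f /lapf /cexp Re_pu Im_pu ReM ReM ImM ReM ImM /= cosN sinN.
    rewrite -/sg -/ta; ring.
  transitivity (expR (- (sg * n.+1%:R)) *
      (0 * cos (ta * n.+1%:R) + 1 * sin (ta * n.+1%:R)) - 0); last by ring.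
  rewrite -(FTC_exp_trig sg ta 0 1 b0).
  rewrite -(oc _ (bdi _ _)).
  apply: eq_Lint => t; rewrite /f /lapf /cexp Re_pu Im_pu ImM ReM ImM ReM ImM /= cosN sinN.
  rewrite -/sg -/ta; ring.
have e0 (g : nat -> R) : (forall n, `|g n| <= 1) ->
    (fun n => expR (- (sg * n.+1%:R)) * g n) @ \oo --> (0 : R).
  move=> g1; apply/cvgrPdist_le => e ep.
  have cz : (sg^-1 * (n.+1%:R)^-1) @[n --> \oo] --> sg^-1 * 0.
    by apply: cvgM; [exact: cvg_cst|exact: cvg_harmonic].
  rewrite mulr0 in cz; have [N _ HN] := cvgr_le _ cz _ ep.
  exists N => // n /HN /= h; rewrite sub0r normrN normrM ger0_norm ?expR_ge0//.
  have n0 : (0 : R) < n.+1%:R by rewrite ltr0n.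
  have sn : 0 < sg * n.+1%:R by rewrite mulr_gt0.
  have ex : expR (- (sg * n.+1%:R)) <= sg^-1 * n.+1%:R^-1.
    rewrite -invfM expRN lef_pV2 ?posrE ?expR_gt0//.
    by have := expR_ge1Dx (sg * n.+1%:R); lra.
  rewrite (le_trans (ler_wpM2l (expR_ge0 _) (g1 n)))// mulr1; exact: le_trans ex h.
have Lim2 : ccvg (fun n => Cint (f n)) 1.
  apply: (eq_ccvg (fun n => esym (Val n))); split => /=.
    rewrite -[X in _ --> X]subr0; apply: cvgB; first exact: cvg_cst.
    by apply: e0 => n; rewrite ler_norml cos_geN1 cos_le1.
  by apply: e0 => n; rewrite ler_norml sin_geN1 sin_le1.
by rewrite -(CintZ p LS); exact: ccvg_unique Lim Lim2.
Qed.

Definition Msym p : C := 1 - Lap muker p.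
Definition Khat p : C := Lap kker p.

Lemma Khat_hker p : 0 < complex.Re p -> Khat p = Msym p * Lap hker p.
Proof.
move=> p0; have Lh := CL1_lapf_hker p0; have Lm := CL1_lapf dominated_muker (ltW p0).
have conv t := CL1_lapf_conv p (muker_conv_hker t).1.
have [L E] := Cint_conv Lm Lh (fun t => (conv t).1).
rewrite /Msym mulrBl mul1r -E -(CintB Lh L); apply: eq_Cint => t.
by rewrite (conv t).2 /lapf -mulrBl -rmorphB kkerE.
Qed.

(** For Re p > 0 this is the square of [Khat_hker]. On the imaginary axis the integral for the
    symbol of [hker] does not converge absolutely, but that symbol has been eliminated: the
    remaining ones are continuous up to the axis, which p + 1 / (n + 1) approaches from inside. *)
Lemma Khat_sqr p : 0 <= complex.Re p -> Khat p * Khat p * p = betac%:C * (Msym p * Msym p).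
Proof.
move=> p0.
have pos q : 0 < complex.Re q -> Khat q * Khat q * q = betac%:C * (Msym q * Msym q).
  move=> q0; rewrite (Khat_hker q0) mulrACA.
  rewrite (Lap_hker_sqr q0).2 -!mulrA [_ * q]mulrC (Lap_step q0) mulr1.
  by rewrite mulrA mulrC.
pose pn n : C := p + (n.+1%:R^-1)%:C.
have pn0 n : 0 < complex.Re (pn n) by rewrite ReD /= ltr_wpDl// invr_gt0 ltr0n.
have cp : ccvg pn p.
  split; rewrite /pn.
    under eq_fun do rewrite ReD /=.
    by have := cvgD (cvg_cst (complex.Re p)) (@cvg_harmonic R); rewrite addr0; apply.
  by under eq_fun do rewrite ImD /= addr0; exact: cvg_cst.
have cK := Lap_cvg dominated_kker (fun n => ltW (pn0 n)) cp.
have cM := ccvgB (ccvg_cst 1) (Lap_cvg dominated_muker (fun n => ltW (pn0 n)) cp).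
apply: (@ccvg_unique _ (fun n => Khat (pn n) * Khat (pn n) * pn n)).
  by apply: ccvgM => //; exact: ccvgM.
apply: (eq_ccvg (fun n => esym (pos _ (pn0 n)))).
by apply: ccvgM; [exact: ccvg_cst|exact: ccvgM].
Qed.

(** The interval must lie beyond 1, where [muker] is positive; adding the full turns c >= |ta| moves
    a half-period of nonpositive cosine there. *)
Lemma cos_nonpos_interval (ta : R) : ta != 0 ->
  exists a b : R, [/\ 1 <= a, a < b & forall u, a < u -> u <= b -> cos (ta * u) <= 0].
Proof.
move=> ta0; have t0 : 0 < `|ta| by rewrite normr_gt0.
have pi0 := @pi_gt0 R.
pose k := Num.truncn `|ta|.
have kt : `|ta| < k.+1%:R by have /andP[] := truncn_itv (ltW t0).
pose c : R := k.+1%:R * pi *+ 2.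
have pi1 : 1 <= pi :> R by have := @pi_ge2 R; lra.
have ck : `|ta| <= c.
  rewrite /c mulr2n; have : k.+1%:R <= k.+1%:R * pi :> R by rewrite ler_peMr.
  by move: kt; lra.
exists ((pi / 2 + c) / `|ta|), ((pi / 2 + pi + c) / `|ta|); split.
- by rewrite ler_pdivlMr// mul1r; lra.
- by rewrite ltr_pM2r ?invr_gt0//; lra.
move=> u; rewrite ltr_pdivrMr// ler_pdivlMr// => h1 h2.
have -> : cos (ta * u) = cos (`|ta| * u).
  by case: (ler0P ta) => _; rewrite ?mulNr ?cosN.
have -> : `|ta| * u = (`|ta| * u - pi / 2 - c) + pi / 2 + c by ring.
set x := `|ta| * u - pi / 2 - c.
have x0 : 0 <= x by rewrite /x mulrC; lra.
have x1 : x <= pi by rewrite /x mulrC; lra.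
have -> : cos (x + pi / 2 + c) = cos (x + pi / 2).
  have -> : c = (pi *+ 2) *+ k.+1 by rewrite /c -mulrnAr mulr_natl.
  elim: k.+1 (x + pi / 2) => [|n IH] z; first by rewrite mulr0n addr0.
  by rewrite mulrS addrA IH cosD2pi.
rewrite cosDpihalf oppr_le0; apply: sin_ge0_pi; lra.
Qed.

(** As [muker] has mass 1, Re M is the integral of mu (1 - e^(- sg u) cos (ta u)), whose integrand
    is nonnegative. For sg > 0 the exponential is at most e^(- sg) where mu lives; on the imaginary
    axis the cosine is nonpositive on an interval of positive mass. *)
Lemma Re_Msym_gt0 p : 0 <= complex.Re p -> p != 0 -> 0 < complex.Re (Msym p).
Proof.
move=> p0 pn0; have Lm := CL1_lapf dominated_muker p0.
have Lmu := @L1_muker R.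
set sg := complex.Re p in p0 *; set ta := complex.Im p.
pose f u := muker u * (1 - expR (- (sg * u)) * cos (ta * u)).
have ReE u : muker u - complex.Re (lapf muker p u) = f u.
  rewrite /f /lapf /cexp Re_pu Im_pu ReM ReM /= cosN -/sg -/ta; ring.
have Lf : L1 f by apply: (eq_L1 ReE); apply: L1B => //; exact: Lm.1.
have -> : complex.Re (Msym p) = Lint f.
  rewrite ReD ReN /= -(@Lint_muker R) -(LintB Lmu Lm.1); exact: eq_Lint.
have e1 u : 0 <= u -> expR (- (sg * u)) <= 1.
  by move=> u0; rewrite -expR0 ler_expR oppr_le0 mulr_ge0.
have [s0|] := ltP 0 sg; last first.
  move=> s0; have {s0} sE : sg = 0 by apply: le_anti; rewrite s0 p0.
  have ta0 : ta != 0.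
    by apply: contra_neq pn0 => t0; apply: eqC.
  have [a [b [a1 ab cab]]] := cos_nonpos_interval ta0.
  have b1 : 1 < b by lra.
  have [LI EI] := Lint_itv_cst (muker b) (ltW ab).
  have mb : 0 < muker b by rewrite mukerE// divr_gt0 ?hker_gt0//; lra.
  have lo : 0 < Lint (fun u => \1_`]a, b]%classic u * muker b).
    by rewrite EI mulr_gt0// subr_gt0.
  apply: (lt_le_trans lo); apply: Lint_le => // u.
  rewrite /f sE mul0r oppr0 expR0 mul1r indicE.
  have [hu|hu] := boolP (u \in `]a, b]%classic); last first.
    by rewrite mul0r mulr_ge0 ?muker_ge0// subr_ge0 cos_le1.
  rewrite mul1r; move: hu; rewrite inE/= in_itv/= => /andP[au ub].
  have c0 := cab _ au ub.
  have h : muker b <= muker u.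
    have := @muker_ninc R (u - 1) (b - 1); rewrite !subrK; apply; lra.
  rewrite (le_trans h)// ler_peMr ?muker_ge0//; lra.
have es : expR (- sg) < 1 by rewrite -expR0 ltr_expR oppr_lt0.
apply: (@lt_le_trans _ _ (Lint (fun u => (1 - expR (- sg)) * muker u))).
  by rewrite (LintZ _ Lmu) Lint_muker mulr1 subr_gt0.
apply: Lint_le => //; first exact: L1Z.
move=> u; rewrite /f mulrC.
have [u1|u1] := leP u 1; first by rewrite muker_le1// !mul0r.
rewrite ler_wpM2l ?muker_ge0// lerB//.
apply: (@le_trans _ _ (expR (- (sg * u)))).
  by rewrite ler_piMr ?expR_ge0// cos_le1.
by rewrite ler_expR lerN2 ler_peMr// ltW.
Qed.

Lemma Lap0 k : Lap k 0 = (Lint k)%:C.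
Proof.
rewrite -Cint_real; apply: eq_Cint => u.
by rewrite /lapf mul0r oppr0 cexp0 mulr1.
Qed.

Lemma Khat_neq0 p : 0 <= complex.Re p -> Khat p != 0.
Proof.
move=> p0; have [->|pn0] := eqVneq p 0.
  by rewrite /Khat Lap0 fmorph_eq0 gt_eqF// Lint_kker_gt0.
apply/eqP => K0; have := Khat_sqr p0; rewrite K0 !mul0r => /esym/eqP.
have M0 : Msym p != 0.
  apply/eqP => M0; have := Re_Msym_gt0 p0 pn0; rewrite M0 /=; lra.
by rewrite !mulf_eq0 (negPf M0) !orbF fmorph_eq0 gt_eqF// betac_gt0.
Qed.

Lemma Msym0 : Msym 0 = 0.
Proof.
by rewrite /Msym Lap0 Lint_muker subrr.
Qed.

Let cabs_sqrc (z : C) : conjc z * z = (cabs z ^+ 2)%:C.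
Proof. exact: cabs_sqrC. Qed.

Let conjc0 : conjc (0 : C) = 0.
Proof. by apply: eqC => /=; rewrite ?oppr0. Qed.

Let num p : R := complex.Re (Khat p * conjc (Msym p)).

Let sqr_imag (n p : C) : complex.Re n = 0 ->
  complex.Re (n * n * p) = - (complex.Im n * complex.Im n) * complex.Re p.
Proof. by move=> n0; rewrite ReM ReM ImM n0; ring. Qed.

(** If n = K conj M were imaginary, n^2 p would have real part <= 0; but n^2 p = betac |M|^4 > 0. *)
Let num_neq0 p : 0 <= complex.Re p -> p != 0 -> num p != 0.
Proof.
move=> p0 pn0; have K2 := Khat_sqr p0; have Mp := Re_Msym_gt0 p0 pn0.
have bp := @betac_gt0 R.
have M2 : 0 < complex.Re (Msym p) ^+ 2 + complex.Im (Msym p) ^+ 2.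
  by rewrite ltr_wpDr ?sqr_ge0// exprn_gt0.
apply/eqP => n0.
have E : (Khat p * conjc (Msym p)) * (Khat p * conjc (Msym p)) * p =
    (betac * (complex.Re (Msym p) ^+ 2 + complex.Im (Msym p) ^+ 2) ^+ 2)%:C.
  have -> : Khat p * conjc (Msym p) * (Khat p * conjc (Msym p)) * p =
    Khat p * Khat p * p * (conjc (Msym p) * conjc (Msym p)) by ring.
  rewrite K2 -mulrA mulrACA ![_ * conjc (Msym p)]mulrC cabs_sqrc cabs_sqr.
  by rewrite -!rmorphM expr2.
have /(congr1 (@complex.Re R)) := E.
rewrite (sqr_imag _ n0) [complex.Re _%:C]/=; set b := complex.Im _ => h.
have : - (b * b) * complex.Re p <= 0.
  by rewrite mulNr oppr_le0 mulr_ge0// -expr2 sqr_ge0.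
rewrite h leNgt mulr_gt0//; exact: exprn_gt0.
Qed.

Let num_real (x : R) : 0 < x -> 0 <= num x%:C.
Proof.
move=> x0; have x0' : 0 <= complex.Re (x%:C) by exact: ltW.
have real k u : complex.Im (lapf k x%:C u) = 0 /\ complex.Re (lapf k x%:C u) = k u * expR (- (x * u)).
  rewrite /lapf /cexp Re_pu Im_pu /= mul0r oppr0 /expi cos0 sin0.
  by split; rewrite /=; ring.
have KI : complex.Im (Khat x%:C) = 0.
  by rewrite /Khat /= -[RHS](@Lint0 R); apply: eq_Lint => u; have [] := real kker u.
have MI : complex.Im (Msym x%:C) = 0.
  by rewrite ImD ImN /= (_ : Lint _ = 0) ?subr0// -[RHS](@Lint0 R); apply: eq_Lint => u; have [] := real muker u.
have conjR (z : C) : complex.Re (conjc z) = complex.Re z by case: z.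
rewrite /num ReM KI mul0r subr0 conjR mulr_ge0//.
  by apply: Lint_ge0 => u; have [_ ->] := real kker u; rewrite mulr_ge0 ?kker_ge0 ?expR_ge0.
apply: ltW; apply: Re_Msym_gt0 => //.
by apply/eqP => /(congr1 (@complex.Re R)) /=; lra.
Qed.

Let IVT01 (g : R -> R) : continuous g -> 0 <= g 0 -> g 1 < 0 -> exists s, g s = 0.
Proof.
move=> cg g0 g1.
have [s _ gs] : exists2 s, s \in `[0, 1] & g s = 0.
  apply: (IVT ler01); first exact: continuous_subspaceT.
  by rewrite ge_min (ltW g1) orbT le_max g0.
by exists s.
Qed.

(** K conj M has the argument of K / M, a square root of betac / p. Its real part is nonnegative at
    1 and has no zero on the segment from 1 to p, so by the intermediate value theorem the root is
    the principal one. *)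
Lemma Re_Khat_Msym p : 0 <= complex.Re p -> 0 <= complex.Re (Khat p * conjc (Msym p)).
Proof.
move=> p0; have [->|pn0] := eqVneq p 0.
  have -> : conjc (Msym 0) = 0 :> C by rewrite Msym0 conjc0.
  by rewrite mulr0.
rewrite leNgt; apply/negP => neg.
(* The parameter is clamped to [0, 1], so that the path is continuous on the whole line and stays in
   the half-plane, away from 0. *)
pose cl (s : R) : R := Num.max 0 (Num.min 1 s).
have cl01 s : 0 <= cl s <= 1 by rewrite /cl le_max lexx ge_max ler01 ge_min lexx.
pose z (s : R) : C := 1 + (cl s)%:C * (p - 1).
have Rz s : complex.Re (z s) = (1 - cl s) + cl s * complex.Re p.
  by rewrite /z ReD ReM ReD /=; ring.
have Iz s : complex.Im (z s) = cl s * complex.Im p.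
  by rewrite /z ImD ImM ReD ImD /=; ring.
have z0 s : 0 <= complex.Re (z s).
  by have /andP[c0 c1] := cl01 s; rewrite Rz addr_ge0 ?mulr_ge0// subr_ge0.
have zn0 s : z s != 0.
  have /andP[c0 c1] := cl01 s.
  apply: contra_neq pn0 => zs; have := Rz s; have := Iz s; rewrite zs /= => h1 h2.
  have cp : 0 <= cl s * complex.Re p by rewrite mulr_ge0.
  have c1' : cl s = 1 by lra.
  by rewrite c1' in h1 h2; apply: eqC => /=; lra.
have ccl : continuous cl.
  move=> s; apply: continuous_max; first exact: cvg_cst.
  by apply: continuous_min; [exact: cvg_cst|exact: cvg_id].
have cnum : continuous (num \o z).
  move=> s; apply: (cvg_nbhsP (V := R^o) (num \o z) s _).2 => u us; rewrite /comp.
  have zu : ccvg (fun n => z (u n)) (z s).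
    have cu : (cl (u n)) @[n --> \oo] --> cl s.
      exact: (cvg_comp _ _ us (ccl s)).
    split.
      under eq_fun do rewrite Rz; rewrite Rz; apply: cvgD.
        by apply: cvgB => //; exact: cvg_cst.
      by apply: cvgM => //; exact: cvg_cst.
    by under eq_fun do rewrite Iz; rewrite Iz; apply: cvgM => //; exact: cvg_cst.
  have [] // : ccvg (fun n => Khat (z (u n)) * conjc (Msym (z (u n)))) (Khat (z s) * conjc (Msym (z s))).
  apply: ccvgM; first exact: (Lap_cvg dominated_kker).
  apply: ccvg_conj; apply: ccvgB; first exact: ccvg_cst.
  exact: (Lap_cvg dominated_muker).
have z1 : z 1 = p.
  have c1 : cl 1 = 1 by rewrite /cl minxx max_r.
  by apply: eqC; rewrite ?Rz ?Iz c1; ring.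
have zz : z 0 = 1%:C.
  have c0 : cl 0 = 0 by rewrite /cl min_r// maxxx.
  by apply: eqC; rewrite ?Rz ?Iz c0 /=; ring.
have num0 : 0 <= num (z 0) by rewrite zz; exact: num_real.
have num1 : num (z 1) < 0 by rewrite z1.
have [s ns] := IVT01 cnum num0 num1.
by have := num_neq0 (z0 s) (zn0 s); rewrite -[num _]/((num \o z) s) ns eqxx.
Qed.

(* If N^2 = c / p with c > 0 and Re p, Re N >= 0, then |arg N| <= pi/4. *)
Lemma inv_sqr_sector (N p : C) (c : R) : 0 < c -> N * N * p = c%:C -> 0 <= complex.Re N ->
  0 <= complex.Re p ->
  0 <= complex.Re N + complex.Im N /\
  (complex.Re N + complex.Im N = 0 -> complex.Re p = 0 /\ 0 <= complex.Im p).
Proof.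
case: N p => a b [x y] c0 /= E a0 x0.
have h1 : (a * a - b * b) * x - 2 * a * b * y = c.
  by have := congr1 (@complex.Re R) E => /= <-; ring.
have h2 : (a * a - b * b) * y + 2 * a * b * x = 0.
  by have := congr1 (@complex.Im R) E => /= h; rewrite -[RHS]h; ring.
have r1 : (a * a + b * b) ^+ 2 * x = c * (a * a - b * b).
  rewrite -h1.
  have : ((a * a - b * b) * y + 2 * a * b * x) * (2 * a * b) = 0 by rewrite h2 mul0r.
  by lra.
have r2 : (a * a + b * b) ^+ 2 * y = - c * (2 * a * b).
  rewrite -h1.
  have : ((a * a - b * b) * y + 2 * a * b * x) * (a * a - b * b) = 0 by rewrite h2 mul0r.
  by lra.
have ab2 : 0 <= a * a - b * b.
  by rewrite -(pmulr_rge0 _ c0) -r1 mulr_ge0// sqr_ge0.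
split; first by nra.
move=> abz; have bE : b = - a by lra.
have a0' : a != 0.
  by apply/eqP => az; move: h1; rewrite bE az; lra.
have aa : 0 < (a * a + b * b) ^+ 2.
  have a2 : 0 < a * a by rewrite -expr2 exprn_even_gt0.
  by rewrite exprn_gt0//; rewrite bE; lra.
split.
  have : (a * a + b * b) ^+ 2 * x == 0 by rewrite r1 bE mulrNN subrr mulr0.
  by rewrite mulf_eq0 (gt_eqF aa) => /eqP.
by rewrite -(pmulr_rge0 _ aa) r2 bE; nra.
Qed.

Let Im_rot (c th w : R) (N : C) : complex.Im (c%:C * (expi th * N) * w%:C) =
  c * (cos th * complex.Im N + sin th * complex.Re N) * w.
Proof. by case: N => a b /=; ring. Qed.

(** With N = K / M the relation becomes Y = - c e^(i pi/4) N W, whence Im (conj W Y) = - c cos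
    (pi/4) (Re N + Im N) |W|^2; [inv_sqr_sector] gives the sign and the case of equality. At p = 0,
    where M = 0, the relation forces W = 0 and leaves Y free. *)
Lemma channel p (c : R) (Y W : C) : 0 <= complex.Re p -> 0 < c ->
  Msym p * Y + c%:C * expi (pi / 4) * (Khat p * W) = 0 ->
  [/\ complex.Im (conjc W * Y) <= 0,
      complex.Im (conjc W * Y) = 0 -> ~ (complex.Re p = 0 /\ 0 <= complex.Im p) -> W = 0 /\ Y = 0
    & Y = 0 -> W = 0].
Proof.
move=> p0 c0 E; have K0 := Khat_neq0 p0.
have e0 : c%:C * expi (pi / 4) != 0 :> C.
  by rewrite -cabs_eq0 cabsM cabs_expi cabs_real mulr1 normr_eq0 gt_eqF.
have YW : Y = 0 -> W = 0.
  move=> Y0; move: E; rewrite Y0 mulr0 add0r => /eqP.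
  by rewrite mulf_eq0 (negPf e0)/= mulf_eq0 (negPf K0)/= => /eqP.
have [pz|pn0] := eqVneq p 0.
  have W0 : W = 0.
    move: E; have -> : Msym p = 0 by rewrite pz Msym0.
    rewrite mul0r add0r => /eqP.
    by rewrite mulf_eq0 (negPf e0)/= mulf_eq0 (negPf K0)/= => /eqP.
  have W0' : conjc W = 0 by rewrite W0 conjc0.
  by rewrite W0' mul0r; split => // _ []; rewrite pz.
have Mp := Re_Msym_gt0 p0 pn0; have P := Re_Khat_Msym p0; have K2 := Khat_sqr p0.
have M0 : Msym p != 0.
  by apply/eqP => M0; move: Mp; rewrite M0 /=; lra.
pose N : C := Khat p / Msym p.
have NE : Y = - (c%:C * expi (pi / 4) * N * W).
  have KN : Khat p = N * Msym p by rewrite divfK.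
  apply: (mulfI M0); move/eqP: E; rewrite addr_eq0 => /eqP ->.
  by rewrite KN; ring.
have N2 : N * N * p = betac%:C.
  apply: (mulfI (mulf_neq0 M0 M0)); rewrite [RHS]mulrC -K2 /N.
  rewrite -[Khat p * Khat p * p](mulr1) -[in RHS](@mulfV _ (Msym p * Msym p)) ?mulf_neq0//.
  rewrite invfM; ring.
have bp := @betac_gt0 R.
have ReN0 : 0 <= complex.Re N.
  have h : complex.Re (Khat p * conjc (Msym p)) = complex.Re N * (cabs (Msym p) ^+ 2).
    have -> : Khat p * conjc (Msym p) = N * (cabs (Msym p) ^+ 2)%:C.
      by rewrite -cabs_sqrc /N mulrCA divfK// mulrC.
    by rewrite ReM /= mulr0 subr0.
  have c2 : 0 < cabs (Msym p) ^+ 2.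
    by rewrite exprn_gt0// lt_neqAle cabs_ge0 eq_sym cabs_eq0 M0.
  by move: P; rewrite h pmulr_lge0.
set a := complex.Re N in ReN0; pose b := complex.Im N.
have [ab sep] := inv_sqr_sector bp N2 ReN0 p0.
have ImWY : complex.Im (conjc W * Y) = - (c * cos (pi / 4) * (a + b) * cabs W ^+ 2).
  rewrite NE mulrN ImN; congr (- _).
  have -> : conjc W * (c%:C * expi (pi / 4) * N * W) = c%:C * (expi (pi / 4) * N) * (cabs W ^+ 2)%:C.
    by rewrite -cabs_sqrc; ring.
  rewrite Im_rot -/a -/b.
  have -> : sin (pi / 4) = cos (pi / 4) :> R.
    have := @sinBpihalf R (pi / 4).
    have -> : pi / 4 - pi / 2 = - (pi / 4) :> R by lra.
    by rewrite sinN => /oppr_inj.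
  ring.
have cg : 0 < cos (pi / 4) :> R.
  by apply: cos_gt0_pihalf; have := @pi_gt0 R; lra.
split => //.
  rewrite ImWY oppr_le0 mulr_ge0 ?sqr_ge0// mulr_ge0// ltW// mulr_gt0//.
rewrite ImWY => /eqP; rewrite oppr_eq0 !mulf_eq0 (gt_eqF c0) (gt_eqF cg)/=.
move=> /orP[/eqP abz hp|]; first by case: hp; exact: sep.
rewrite orbb cabs_eq0 => /eqP W0 _; split => //.
by rewrite NE W0 mulr0 oppr0.
Qed.

End SymbolIdentities.

(** * Fourier coefficients of functions periodic in the past *)

Section PeriodicFourier.
Context {R : realType}.
Local Notation C := R[i].
Variable T : R.
Hypothesis T0 : 0 < T.
Local Notation w := (2 * pi / T).
Implicit Types (f g : R -> C) (t u s a b c : R) (n m : int).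

Definition bmeas f : Prop := cmeas f /\ exists B, forall t, cabs (f t) <= B.

Lemma bmeasD f g : bmeas f -> bmeas g -> bmeas (fun t => f t + g t).
Proof.
move=> [mf [B fB]] [mg [B' gB]]; split; first exact: cmeasD.
by exists (B + B') => t; apply: (le_trans (cabsD _ _)); exact: lerD.
Qed.

Lemma bmeasM f g : bmeas f -> bmeas g -> bmeas (fun t => f t * g t).
Proof.
move=> [mf [B fB]] [mg [B' gB]]; split; first exact: cmeasM.
by exists (B * B') => t; rewrite cabsM; apply: ler_pM; rewrite ?cabs_ge0.
Qed.

Lemma bmeas_cst (z : C) : bmeas (fun=> z).
Proof. by split; [exact: cmeas_cst|exists (cabs z)]. Qed.

Lemma bmeasN f : bmeas f -> bmeas (fun t => - f t).
Proof.
by move=> [mf [B fB]]; split; [exact: cmeasN|exists B => t; rewrite cabsN].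
Qed.

Lemma bmeas_conj f : bmeas f -> bmeas (fun t => conjc (f t)).
Proof.
move=> [[m1 m2] [B fB]]; split; last by exists B => t; rewrite cabs_conj.
have cR (z : C) : complex.Re (conjc z) = complex.Re z by case: z.
have cI (z : C) : complex.Im (conjc z) = - complex.Im z by case: z.
split; first by under eq_fun do rewrite cR.
by under eq_fun do rewrite cI; exact: measurableT_comp.
Qed.

Lemma bmeas_sum (I : Type) (r : seq I) (F : I -> R -> C) : (forall i, bmeas (F i)) ->
  bmeas (fun t => \sum_(i <- r) F i t).
Proof.
move=> bF; elim: r => [|i r IH].
  by under eq_fun do rewrite big_nil; exact: bmeas_cst.
by under eq_fun do rewrite big_cons; exact: bmeasD.
Qed.

Lemma bmeas_shift f a : bmeas f -> bmeas (fun t => f (t - a)).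
Proof. by move=> [mf [B fB]]; split; [exact: (cmeas_shift (- a))|exists B]. Qed.

(** Half-open intervals split without overlap, so additivity over adjacent intervals holds pointwise
    for the integrands. *)
Definition itvint a b f : C := Cint (fun t => (\1_`]a, b]%classic t)%:C * f t).

Lemma CL1_itv a b f : bmeas f -> CL1 (fun t => (\1_`]a, b]%classic t)%:C * f t).
Proof.
move=> [mf [B fB]]; apply: CL1_real_bounded fB => //.
have [ab|ab] := leP a b.
  have [+ _] := Lint_itv_cst 1 ab; apply: eq_L1 => t; exact: mulr1.
have -> : `]a, b]%classic = set0 :> set R by apply: set_itv_ge; rewrite bnd_simp -leNgt ltW.
by apply: eq_L1 (@L1_0 R) => t; rewrite indic0.
Qed.

Lemma eq_itvint a b f g : (forall t, a < t -> t <= b -> f t = g t) ->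
  itvint a b f = itvint a b g.
Proof.
move=> fg; apply: eq_Cint => t; rewrite indicE.
case: (boolP (t \in _)) => [|_]; last by rewrite !mul0r.
by rewrite inE/= in_itv/= => /andP[at' tb]; rewrite fg.
Qed.

Lemma itvint_split a b c f : bmeas f -> a <= b -> b <= c ->
  itvint a c f = itvint a b f + itvint b c f.
Proof.
move=> bf ab bc; rewrite /itvint -CintD; [|exact: CL1_itv|exact: CL1_itv].
apply: eq_Cint => t; rewrite -mulrDl -rmorphD !indicE; congr (_%:C * _).
rewrite -natrD; congr (_%:R); apply/eqP.
have m x y : (t \in `]x, y]%classic) = (x < t <= y) by apply/idP/idP; rewrite inE/= in_itv/=.
by rewrite !m; case: (leP t b); case: (leP t c); case: (leP t a) => //; lra.
Qed.

Lemma itvint_shift a b u f : bmeas f ->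
  itvint a b (fun t => f (t - u)) = itvint (a - u) (b - u) f.
Proof.
move=> bf; rewrite /itvint -(Cint_shift (- u) (CL1_itv _ _ bf)).
apply: eq_Cint => t; congr (_%:C * _); rewrite !indicE; congr (_%:R); congr nat_of_bool.
by apply/idP/idP; rewrite !inE/= !in_itv/= => /andP[h1 h2]; apply/andP; split; lra.
Qed.

(** The integral over one period, without the factor 1 / T. *)
Definition avg f : C := itvint (- T) 0 f.
(** Periodicity is asked on the past only, where the Floquet relation holds; shifts are accordingly
    made to the left. *)
Definition lperiodic f : Prop := forall t, t <= 0 -> f (t - T) = f t.

Lemma eq_avg f g : (forall t, - T < t -> t <= 0 -> f t = g t) -> avg f = avg g.
Proof. exact: eq_itvint. Qed.

Lemma avgD f g : bmeas f -> bmeas g -> avg (fun t => f t + g t) = avg f + avg g.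
Proof.
move=> bf bg; rewrite /avg/itvint -CintD; [|exact: CL1_itv|exact: CL1_itv].
by apply: eq_Cint => t; rewrite mulrDr.
Qed.

Lemma avgZ (z : C) f : bmeas f -> avg (fun t => z * f t) = z * avg f.
Proof.
move=> bf; rewrite /avg/itvint -(CintZ z (CL1_itv _ _ bf)).
by apply: eq_Cint => t; rewrite mulrCA.
Qed.

Lemma avg0 : avg (fun=> 0) = 0.
Proof. by have := @avgZ 0 (fun=> 0) (bmeas_cst _); rewrite !mul0r. Qed.

Lemma avg_sum (I : Type) (r : seq I) (F : I -> R -> C) : (forall i, bmeas (F i)) ->
  avg (fun t => \sum_(i <- r) F i t) = \sum_(i <- r) avg (F i).
Proof.
move=> bF; elim: r => [|i r IH].
  by rewrite big_nil -[RHS]avg0; apply: eq_avg => t _ _; rewrite big_nil.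
rewrite big_cons -IH -avgD//; last exact: bmeas_sum.
by apply: eq_avg => t _ _; rewrite big_cons.
Qed.

Lemma avg_cst (z : C) : avg (fun=> z) = T%:C * z.
Proof.
rewrite mulrC (@eq_avg _ (fun=> z * 1)) => [|t _ _]; last by rewrite mulr1.
rewrite avgZ; last exact: bmeas_cst.
congr (_ * _); rewrite /avg /itvint.
rewrite (@eq_Cint _ _ (fun t => (\1_`]-T, 0]%classic t * 1)%:C)) => [|t]; last by rewrite rmorphM.
have T0' : - T <= 0 by have := T0; lra.
by rewrite Cint_real (Lint_itv_cst 1 T0').2 mul1r sub0r opprK.
Qed.

Lemma cabs_avg f (B : R) : bmeas f -> (forall t, - T < t -> t <= 0 -> cabs (f t) <= B) ->
  cabs (avg f) <= B * T.
Proof.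
move=> bf fB; have T0' : - T <= 0 by have := T0; lra.
have [L E] := Lint_itv_cst B T0'.
have -> : B * T = Lint (fun t => \1_`]-T, 0]%classic t * B) by rewrite E sub0r opprK.
apply: Cint_abs_le => //; first exact: CL1_itv.
move=> t; rewrite cabsM cabs_real indicE.
case: (boolP (t \in _)) => [|_]; last by rewrite normr0 !mul0r.
by rewrite normr1 !mul1r inE/= in_itv/= => /andP[h1 h2]; exact: fB.
Qed.

Lemma avg_Re_ge0 f : bmeas f -> (forall t, - T < t -> t <= 0 -> 0 <= complex.Re (f t)) ->
  0 <= complex.Re (avg f).
Proof.
move=> bf f0; apply: Lint_ge0 => t; rewrite ReM /= mul0r subr0 indicE.
case: (boolP (t \in _)) => [|_]; last by rewrite mul0r.
by rewrite mul1r inE/= in_itv/= => /andP[h1 h2]; exact: f0.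
Qed.

Lemma avg_shift f u : bmeas f -> lperiodic f -> 0 <= u -> avg (fun t => f (t - u)) = avg f.
Proof.
move=> bf pf.
have small v : 0 <= v -> v <= T -> avg (fun t => f (t - v)) = avg f.
  move=> v0 vT; rewrite /avg itvint_shift// sub0r.
  have h1 : - T - v <= - T by lra.
  have h2 : - T <= - v by lra.
  have h3 : - v <= 0 by lra.
  rewrite (itvint_split bf h1 h2) (itvint_split bf h2 h3) addrC; congr (_ + _).
  rewrite [RHS](@eq_itvint _ _ _ (fun t => f (t - T))) => [|t _ t0]; last by rewrite pf.
  by rewrite itvint_shift// sub0r addrC.
have step k v : 0 <= v -> v <= T -> avg (fun t => f (t - (v + k%:R * T))) = avg f.
  move=> v0 vT; elim: k => [|k IH].
    by rewrite -[RHS](small v)//; apply: eq_avg => t _ _; rewrite mul0r addr0.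
  rewrite -IH; apply: eq_avg => t _ t0.
  have kT : 0 <= k%:R * T by rewrite mulr_ge0// ltW.
  have -> : t - (v + k.+1%:R * T) = (t - (v + k%:R * T)) - T by rewrite -addn1 natrD; ring.
  by rewrite pf//; lra.
move=> u0; have uT : 0 <= u / T by rewrite divr_ge0// ltW.
have /andP[h1 h2] := truncn_itv uT; rewrite ler_pdivlMr// in h1; rewrite ltr_pdivrMr// in h2.
rewrite -(step (Num.truncn (u / T)) (u - (Num.truncn (u / T))%:R * T)); last 2 first.
- lra.
- by move: h2; rewrite -addn1 natrD mulrDl mul1r; lra.
by apply: eq_avg => t _ _; rewrite subrK.
Qed.

(** By Fubini and the invariance of [avg] under shifts to the left, convolution acts on a mode as
    multiplication by the symbol. The integrability over a period allows the mode equation to be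
    integrated term by term. *)
Lemma avg_conv (k : R -> R) (p : C) f : dominated_kernel k -> 0 <= complex.Re p ->
  bmeas f -> lperiodic f ->
  CL1 (fun t => (\1_`]-T, 0]%classic t)%:C * Cint (fun u => lapf k p u * f (t - u))) /\
  avg (fun t => Cint (fun u => lapf k p u * f (t - u))) = Lap k p * avg f.
Proof.
move=> dk p0 bf pf; have [mf [B fB]] := bf; have [mk k0 km] := dk.
have Lk := CL1_lapf dk p0.
have T0' : - T <= 0 by have := T0; lra.
have [LI EI] := Lint_itv_cst 1 T0'.
have B0 : 0 <= B by exact: le_trans (cabs_ge0 _) (fB 0).
pose F u t : C := (\1_`]-T, 0]%classic t)%:C * (lapf k p u * f (t - u)).
have m1 : measurable_fun setT (fun z : R * R => z.2 - z.1) by exact: measurable_funB.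
have mI : measurable_fun setT (\1_`]-T, 0]%classic : R -> R).
  by apply: measurable_indic; exact: measurable_itv.
have mF : cmeas (fun z : R * R => F z.1 z.2).
  apply: cmeasM; first by apply: cmeas_real; exact: measurableT_comp mI _.
  apply: cmeasM; first by apply: (cmeas_comp (CL1_meas Lk)).
  exact: (cmeas_comp mf m1).
have bl u : bmeas (fun t => lapf k p u * f (t - u)).
  by apply: bmeasM; [exact: bmeas_cst|exact: bmeas_shift].
have L1F u : CL1 (F u) by exact: CL1_itv.
have cf u : cabs (lapf k p u) <= mker u by exact: cabs_lapf_le.
have Lin t : CL1 (fun u => lapf k p u * f (t - u)).
  apply: CL1_le (L1Z B (@L1_mker R)).
    apply: cmeasM; first exact: CL1_meas Lk.
    by apply: (cmeas_comp mf); exact: measurable_funB.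
  by move=> u; rewrite cabsM mulrC; apply: ler_pM; rewrite ?cabs_ge0.
have L2F t : CL1 (F^~ t) by exact: CL1Z.
have cF u t : cabs (F u t) <= \1_`]-T, 0]%classic t * (mker u * B).
  rewrite cabsM cabs_real ger0_norm; last by rewrite indicE.
  apply: ler_wpM2l; first by rewrite indicE.
  by rewrite cabsM; apply: ler_pM; rewrite ?cabs_ge0.
have LF : L1 (fun u => Lint (fun t => cabs (F u t))).
  apply: L1_le (L1Z (B * T) (@L1_mker R)).
    have := @measurable_Lint_abs _ (fun u t => cabs (F u t)) (measurable_cabs mF) (fun u => CL1_cabs (L1F u)).
    apply: eq_measurable_fun => u _; apply: eq_Lint => t.
    by rewrite ger0_norm// cabs_ge0.
  move=> u; rewrite ger0_norm; last by apply: Lint_ge0 => t; exact: cabs_ge0.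
  have [LI' EI'] := Lint_itv_cst (mker u * B) T0'.
  apply: (@le_trans _ _ (Lint (fun t => \1_`]-T, 0]%classic t * (mker u * B)))).
    by apply: Lint_le => //; exact: CL1_cabs.
  by rewrite EI' sub0r opprK mulrC mulrA [T * _]mulrC -mulrA mulrC -mulrA [B * T]mulrC mulrA.
have [_ LF2 eF] := fubini_CL1 mF L1F L2F LF.
have E2 t : Cint (F^~ t) = (\1_`]-T, 0]%classic t)%:C * Cint (fun u => lapf k p u * f (t - u)).
  by rewrite CintZ.
split; first exact: eq_CL1 LF2.
rewrite -[LHS](eq_Cint E2).
rewrite -eF mulrC -(CintZ _ Lk); apply: eq_Cint => u.
rewrite -[LHS]/(avg (fun t => lapf k p u * f (t - u))) avgZ; last exact: bmeas_shift.
have [u0|u0] := leP u 0; last by rewrite (avg_shift bf pf (ltW u0)) mulrC.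
suff -> : lapf k p u = 0 by rewrite mul0r mulr0.
by apply/eqP; rewrite -cabs_eq0 eq_le cabs_ge0 andbT -(mker_neg u0).
Qed.

Definition fexp n t : C := expi (- (n%:~R * w * t)).

Lemma bmeas_fexp n : bmeas (fexp n).
Proof.
split; last by exists 1 => t; rewrite cabs_expi.
apply: cmeas_expi; apply: (eq_measurable_fun (fun t => - (n%:~R * w) * t + 0)).
  by move=> t _; rewrite addr0 mulNr.
exact: measurable_affine.
Qed.

Lemma fexpD n m t : fexp (n + m) t = fexp n t * fexp m t.
Proof. by rewrite /fexp -expiD intrD; congr expi; ring. Qed.

Lemma fexp0 t : fexp 0 t = 1.
Proof. by rewrite /fexp !mul0r oppr0 expi0. Qed.

Lemma fexp_sub n t s : fexp n (t - s) = fexp n t * fexp n (- s).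
Proof. by rewrite /fexp -expiD; congr expi; ring. Qed.

Lemma conj_fexp n t : conjc (fexp n t) = fexp (- n) t.
Proof. by rewrite /fexp /expi /= intrN !mulNr !opprK cosN sinN opprK. Qed.

Lemma fexp_period n : lperiodic (fexp n).
Proof.
move=> t _; rewrite fexp_sub.
suff nat_period (k : nat) : fexp k (- T) = 1 /\ fexp (- k%:Z) (- T) = 1.
  by case: n => k; rewrite ?NegzE; have [h1 h2] := nat_period k; have [h3 h4] := nat_period k.+1; rewrite ?h1 ?h4 mulr1.
have wT : w * T = 2 * pi by rewrite divfK// gt_eqF.
have nT (j : nat) : expi (j%:R * (2 * pi)) = 1 :> C.
  by rewrite -expi_nat expi_2pi expr1n.
have h1 : fexp k (- T) = 1.
  by rewrite /fexp mulrN opprK -mulrA wT; exact: nT.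
split => //; rewrite -conj_fexp h1; apply: eqC => //=; exact: oppr0.
Qed.

(** A shift by half a wavelength T / (2 |n|) changes the sign of the exponential but not its
    integral. *)
Lemma avg_fexp n : avg (fexp n) = if n == 0 then T%:C else 0.
Proof.
case: eqP => [->|/eqP n0].
  rewrite (@eq_avg _ (fun=> 1)) => [|t _ _]; last exact: fexp0.
  by rewrite avg_cst mulr1.
pose u := T / (2 * `|n|%:~R).
have nn : (`|n|%:~R : R) != 0 by rewrite intr_eq0 normr_eq0.
have n1 : 0 < (`|n|%:~R : R) by rewrite ltr0z normr_gt0.
have u0 : 0 <= u by rewrite divr_ge0 ?(ltW T0)// mulr_ge0// ltW.
have := avg_shift (bmeas_fexp n) (fexp_period n) u0.
rewrite (@eq_avg _ (fun t => - fexp n t)); last first.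
  move=> t _ _; rewrite fexp_sub; suff -> : fexp n (- u) = -1 by rewrite mulrN1.
  have wu : w * u = pi / `|n|%:~R.
    rewrite /u; field; by rewrite ?nn ?(gt_eqF T0)// andbT.
  rewrite /fexp mulrN opprK -mulrA wu.
  have [np|np] := lerP 0 n.
    by rewrite ger0_norm// mulrCA divff ?mulr1 ?intr_eq0// /expi cospi sinpi; apply: eqC => //=; rewrite oppr0.
  rewrite ltr0_norm// intrN invrN mulrN mulrN mulrCA divff ?mulr1 ?intr_eq0//.
  by rewrite /expi cosN sinN cospi sinpi; apply: eqC => //=; rewrite oppr0.
rewrite (@eq_avg _ (fun t => -1 * fexp n t)) => [|t _ _]; last by rewrite mulN1r.
rewrite avgZ; last exact: bmeas_fexp.
by rewrite mulN1r => /eqP; rewrite eq_sym -subr_eq0 opprK -mulr2n mulrn_eq0 /= => /eqP.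
Qed.

(** The coefficient of e^(i n w t), up to the factor T. With this sign, multiplication by alpha =
    sum a_k e^(- i k w t) sends the coefficients Y to sum_k a_k Y (n + k). *)
Definition fcoef f n : C := avg (fun t => fexp n t * f t).

Lemma conjc_mul (x y : C) : conjc (x * y) = conjc x * conjc y.
Proof. by case: x y => x1 x2 [y1 y2]; apply: eqC => /=; ring. Qed.

Lemma conjc_add (x y : C) : conjc (x + y) = conjc x + conjc y.
Proof. by case: x y => x1 x2 [y1 y2]; apply: eqC => //=; rewrite opprD. Qed.

Lemma conjc_sum (I : Type) (r : seq I) (P : pred I) (F : I -> C) :
  conjc (\sum_(i <- r | P i) F i) = \sum_(i <- r | P i) conjc (F i).
Proof.
apply: (big_morph (@conjc R)); first exact: conjc_add.
by apply: eqC => /=; rewrite ?oppr0.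
Qed.

Lemma conjc_sqr (z : C) : conjc z * z = (cabs z ^+ 2)%:C.
Proof. by apply: eqC; rewrite cabs_sqr; case: z => a b /=; ring. Qed.

Lemma realC_sum (I : Type) (r : seq I) (F : I -> R) :
  (\sum_(i <- r) F i)%:C = \sum_(i <- r) (F i)%:C :> C.
Proof. by apply: (big_morph (fun x : R => x%:C)) => // x y; rewrite rmorphD. Qed.

(** Expand the nonnegative integral of |T f - S|^2, where S is the trigonometric sum with the
    coefficients of [f]; the factor T makes up for the missing normalization of [avg]. *)
Lemma bessel f (B : R) (r : seq int) : bmeas f -> (forall t, cabs (f t) <= B) -> uniq r ->
  \sum_(n <- r) cabs (fcoef f n) ^+ 2 <= (B * T) ^+ 2.
Proof.
move=> bf fB ur; pose Y := fcoef f.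
pose S t := \sum_(n <- r) Y n * fexp (- n) t.
have bS : bmeas S by apply: bmeas_sum => n; apply: bmeasM; [exact: bmeas_cst|exact: bmeas_fexp].
have sq g : bmeas g -> avg (fun t => conjc (S t) * g t) = \sum_(n <- r) conjc (Y n) * fcoef g n.
  move=> bg; rewrite (@eq_avg _ (fun t => \sum_(n <- r) conjc (Y n) * (fexp n t * g t))).
    have bb n : bmeas (fun t => fexp n t * g t) by apply: bmeasM => //; exact: bmeas_fexp.
    rewrite avg_sum; last by move=> n; apply: bmeasM => //; exact: bmeas_cst.
    by apply: eq_bigr => n _; rewrite avgZ.
  move=> t _ _; rewrite /S conjc_sum mulr_suml; apply: eq_bigr => n _.
  by rewrite conjc_mul conj_fexp opprK mulrA.
have cS n : n \in r -> fcoef S n = T%:C * Y n.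
  move=> nr; rewrite /fcoef (@eq_avg _ (fun t => \sum_(m <- r) Y m * fexp (n - m) t)); last first.
    by move=> t _ _; rewrite /S mulr_sumr; apply: eq_bigr => m _; rewrite fexpD mulrCA.
  rewrite avg_sum; last by move=> m; apply: bmeasM; [exact: bmeas_cst|exact: bmeas_fexp].
  rewrite (bigD1_seq n)//= big1 ?addr0 => [|m mn].
    by rewrite avgZ; [rewrite subrr avg_fexp eqxx mulrC|exact: bmeas_fexp].
  rewrite avgZ; last exact: bmeas_fexp.
  by rewrite avg_fexp subr_eq0 eq_sym (negPf mn) mulr0.
pose V : R := \sum_(n <- r) cabs (Y n) ^+ 2.
have sV : \sum_(n <- r) conjc (Y n) * Y n = V%:C.
  by rewrite /V realC_sum; apply: eq_bigr => n _; exact: conjc_sqr.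
have SS : avg (fun t => conjc (S t) * S t) = (T * V)%:C.
  transitivity (T%:C * V%:C); last by rewrite rmorphM.
  rewrite (sq S bS) -sV mulr_sumr; apply: eq_big_seq => n nr.
  by rewrite cS// mulrCA.
have Sf : avg (fun t => conjc (S t) * f t) = V%:C by rewrite sq.
have T2 : 0 < T * T by rewrite mulr_gt0.
pose G t := T%:C * f t + - S t.
have bG : bmeas G by apply: bmeasD; [apply: bmeasM => //; exact: bmeas_cst|exact: bmeasN].
pose N2 t := (cabs (f t) ^+ 2)%:C.
have bN2 : bmeas N2.
  have [mf _] := bf; split; first by apply: cmeas_real; apply: measurable_funX; exact: measurable_cabs.
  exists (B ^+ 2) => t; rewrite cabs_real ger0_norm ?sqr_ge0// ler_sqr ?nnegrE ?cabs_ge0//.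
  exact: le_trans (cabs_ge0 _) (fB t).
have bSf : bmeas (fun t => conjc (S t) * f t) by apply: bmeasM => //; exact: bmeas_conj.
have bSS : bmeas (fun t => conjc (S t) * S t) by apply: bmeasM => //; exact: bmeas_conj.
pose Q t := (T * T)%:C * N2 t + ((- (2 * T))%:C * (conjc (S t) * f t) + conjc (S t) * S t).
have Q0 : 0 <= complex.Re (avg Q).
  apply: avg_Re_ge0.
    apply: bmeasD; first by apply: bmeasM => //; exact: bmeas_cst.
    by apply: bmeasD => //; apply: bmeasM => //; exact: bmeas_cst.
  move=> t _ _.
  have -> : complex.Re (Q t) = cabs (G t) ^+ 2.
    rewrite /Q /N2 /G !cabs_sqr; case: (S t) (f t) => s1 s2 [f1 f2] /=; ring.
  exact: sqr_ge0.
have cZ z f' : bmeas f' -> bmeas (fun t => z * f' t) by move=> b'; apply: bmeasM => //; exact: bmeas_cst.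
move: Q0; rewrite /Q avgD; [|exact: cZ|by apply: bmeasD => //; exact: cZ].
rewrite avgD//; last exact: cZ.
have ReZ (a : R) (z : C) : complex.Re (a%:C * z) = a * complex.Re z.
  by case: z => z1 z2 /=; ring.
have ReC (a : R) : complex.Re (a%:C : C) = a by [].
rewrite (avgZ _ bN2) (avgZ _ bSf) Sf SS !ReD !ReZ (ReC V) (ReC (T * V)) => Q0.
have N2B : complex.Re (avg N2) <= B ^+ 2 * T.
  apply: (le_trans (ler_norm _)); apply: (le_trans (abs_Re_le _)).
  apply: cabs_avg => // t _ _; rewrite cabs_real ger0_norm ?sqr_ge0// ler_sqr ?nnegrE ?cabs_ge0//.
  exact: le_trans (cabs_ge0 _) (fB t).
have : T * V <= T * ((B * T) ^+ 2).
  have h : T * T * complex.Re (avg N2) <= T * T * (B ^+ 2 * T) by rewrite ler_wpM2l// ltW.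
  by move: Q0 h; lra.
by rewrite ler_pM2l.
Qed.

End PeriodicFourier.

(** * Uniqueness of Fourier coefficients *)

Section FourierUniqueness.
Context {R : realType}.
Local Notation C := R[i].
Variable T : R.
Hypothesis T0 : 0 < T.
Local Notation w := (2 * pi / T).
Implicit Types (f g : R -> C) (t u s : R) (n m : int).

(** A trigonometric polynomial with values in [0, 1] whose only maximum over a period is at - T / 2,
    the midpoint of ]- T, 0]; its powers concentrate there. *)
Let peak t : R := (1 - cos (w * t)) / 2.

Let peakE t : (peak t)%:C = 2^-1%:C - 4^-1%:C * (fexp T 1 t + fexp T (-1) t).
Proof.
apply: eqC; rewrite /peak /fexp /expi /= !(mulN1r, mul1r, mulNr, opprK) ?cosN ?sinN; [by field|ring].
Qed.

Let w0 : 0 < w. Proof. by rewrite divr_gt0// mulr_gt0// pi_gt0. Qed.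

Let wT2 : w * (T / 2) = pi.
Proof. by field; rewrite gt_eqF. Qed.

Let cosw u : R := (1 + cos (w * u)) / 2.

Let peak_cosw t : peak t = cosw `|t + T / 2|.
Proof.
rewrite /peak /cosw; congr ((1 + _) / _).
have -> : cos (w * `|t + T / 2|) = cos (w * (t + T / 2)).
  by case: (ler0P (t + T / 2)) => _ //; rewrite mulrN cosN.
have -> : w * (t + T / 2) = w * t + pi by field; rewrite gt_eqF.
by rewrite cosDpi.
Qed.

Let cosw_lt u s : 0 <= u -> u < s -> s <= T / 2 -> cosw s < cosw u.
Proof.
move=> u0 us sT; rewrite /cosw ltr_pM2r// ltrD2l.
rewrite ltr_cos ?in_itv/=; first by rewrite ltr_pM2l.
  have h : w * u <= w * (T / 2) by rewrite ler_pM2l//; lra.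
  by rewrite wT2 in h; rewrite h mulr_ge0 ?(ltW w0).
have h : w * s <= w * (T / 2) by rewrite ler_pM2l.
by rewrite wT2 in h; rewrite h mulr_ge0 ?(ltW w0)//; lra.
Qed.

Let cosw_le u s : 0 <= u -> u <= s -> s <= T / 2 -> cosw s <= cosw u.
Proof.
move=> u0; rewrite le_eqVlt => /orP[/eqP -> //|us] sT; exact/ltW/cosw_lt.
Qed.

Let cosw_ge0 u : 0 <= cosw u.
Proof. by rewrite divr_ge0//; have := cos_geN1 (w * u); lra. Qed.

Let bmeas_peak k : bmeas (fun t => (peak t ^+ k)%:C).
Proof.
have b1 : bmeas (fun t => (peak t)%:C).
  have -> : (fun t => (peak t)%:C) = fun t => 2^-1%:C + - 4^-1%:C * (fexp T 1 t + fexp T (-1) t).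
    by apply/funext => t; rewrite peakE mulNr.
  apply: bmeasD; first exact: bmeas_cst.
  apply: bmeasM; first exact: bmeas_cst.
  by apply: bmeasD; exact: bmeas_fexp.
elim: k => [|k IH].
  by have -> : (fun t => (peak t ^+ 0)%:C) = fun=> 1 :> C; [exact/funext|exact: bmeas_cst].
have -> : (fun t => (peak t ^+ k.+1)%:C) = fun t => (peak t)%:C * (peak t ^+ k)%:C.
  by apply/funext => t; rewrite exprS rmorphM.
exact: bmeasM.
Qed.

Let peak_avg f k n : bmeas f -> (forall n, fcoef T f n = 0) ->
  avg T (fun t => (peak t ^+ k)%:C * (fexp T n t * f t)) = 0.
Proof.
move=> bf f0; elim: k n => [|k IH] n.
  by rewrite -[RHS](f0 n); apply: eq_avg => t _ _; rewrite expr0 mul1r.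
pose F m t : C := (peak t ^+ k)%:C * (fexp T m t * f t).
have bF m : bmeas (F m).
  by apply: bmeasM; [exact: bmeas_peak|apply: bmeasM => //; exact: bmeas_fexp].
rewrite (@eq_avg _ _ _ (fun t => 2^-1%:C * F n t + (- 4^-1%:C * F (1 + n) t + - 4^-1%:C * F (-1 + n) t))).
  have cF z m : bmeas (fun t => z * F m t) by apply: bmeasM => //; exact: bmeas_cst.
  by rewrite avgD//; [rewrite avgD// !avgZ// !IH !mulr0 !addr0|exact: bmeasD].
by move=> t _ _; rewrite exprS rmorphM /= peakE /F !fexpD; ring.
Qed.

(** All integrals of [f] against powers of [peak] vanish, whereas for a high power a nonzero value
    at the maximum would dominate. The shift by u >= 0 brings [t1], up to one period, to that
    maximum. *)
Lemma fourier_unique f : bmeas f -> lperiodic T f ->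
  continuous (fun t => complex.Re (f t)) -> continuous (fun t => complex.Im (f t)) ->
  (forall n, fcoef T f n = 0) -> forall t, t <= 0 -> f t = 0.
Proof.
move=> bf pf cR cI f0 t1 t10.
pose u := T / 2 - t1.
have u0 : 0 <= u by rewrite /u; have := T0; lra.
pose z := f t1; pose h t := conjc z * f (t - u).
have hz : complex.Re (h (- (T / 2))) = cabs z ^+ 2.
  have -> : h (- (T / 2)) = (cabs z ^+ 2)%:C.
    rewrite -conjc_sqr /h; congr (_ * _); rewrite /z -(pf t1 t10); congr f.
    by rewrite /u; lra.
  by [].
have bh : bmeas h by apply: bmeasM; [exact: bmeas_cst|exact: bmeas_shift].
have h0 n : fcoef T h n = 0.
  have bnf : bmeas (fun t => fexp T n t * f t) by apply: bmeasM => //; exact: bmeas_fexp.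
  have pnf : lperiodic T (fun t => fexp T n t * f t).
    by move=> t t0; rewrite pf// fexp_period.
  have := avg_shift T0 bnf pnf u0; rewrite [RHS]f0 => E.
  rewrite /fcoef (@eq_avg _ _ _ (fun t => (fexp T n u * conjc z) * (fexp T n (t - u) * f (t - u)))).
    by rewrite avgZ ?E ?mulr0//; exact: (bmeas_shift u bnf).
  move=> t _ _; have -> : fexp T n t = fexp T n u * fexp T n (t - u).
    by rewrite /fexp -expiD; congr expi; ring.
  by rewrite /h; ring.
pose g t := complex.Re (h t).
have cg : continuous g.
  have -> : g = fun t => complex.Re z * complex.Re (f (t - u)) + complex.Im z * complex.Im (f (t - u)).
    by apply/funext => t; rewrite /g /h; case: (z) (f _) => z1 z2 [f1 f2] /=; ring.
  have cs : continuous (fun t : R => t - u) by move=> t; apply: cvgB; [exact: cvg_id|exact: cvg_cst].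
  move=> t; apply: cvgD; (apply: cvgM; first exact: cvg_cst).
    exact: (cvg_comp (fun t => t - u) (fun t => complex.Re (f t)) (cs t) (cR (t - u))).
  exact: (cvg_comp (fun t => t - u) (fun t => complex.Im (f t)) (cs t) (cI (t - u))).
apply/eqP; apply/negPn/negP => zn0.
have z2 : 0 < cabs z ^+ 2.
  by rewrite exprn_gt0// lt_neqAle cabs_ge0 eq_sym cabs_eq0 zn0.
pose c := cabs z ^+ 2 / 2.
have c0 : 0 < c by rewrite /c; lra.
have [d d0 gd] : exists2 d, 0 < d & forall t, `|t + T / 2| < d -> c <= g t.
  have /cvgrPdist_lt /(_ c c0) [d /= d0 Hd] := cg (- (T / 2)).
  exists d => // t td; have := Hd t; rewrite /ball_/= distrC opprK => /(_ td).
  by rewrite {1}/g hz ltr_norml /c => /andP[_]; lra.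
have [_ [B hB]] := bh.
have gB t : - B <= g t.
  by have := hB t; have := abs_Re_le (h t); rewrite ler_norml => /andP[]; rewrite -/(g t); lra.
have B0 : 0 <= B by exact: le_trans (cabs_ge0 _) (hB 0).
pose e := Num.min d (T / 4).
have e0 : 0 < e by rewrite lt_min d0; have := T0; lra.
have eT : e <= T / 4 by rewrite ge_min lexx orbT.
have ed : e <= d by rewrite ge_min lexx.
pose r1 := cosw e; pose r2 := cosw (e / 2).
have r10 : 0 <= r1 := cosw_ge0 e.
have r12 : r1 < r2 by apply: cosw_lt; lra.
have r20 : 0 < r2 by lra.
(* Within e / 2 of the maximum the power is at least r2^k, farther than e from it at most r1^k, with
   r1 < r2; in between the integrand is nonnegative. *)
have key k : r2 ^+ k * c * (e / 2) <= r1 ^+ k * B * T.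
  have TN : - T <= 0 by have := T0; lra.
  have e2 : - (T / 2) <= - (T / 2) + e / 2 by lra.
  have [L1' E1] := Lint_itv_cst (r2 ^+ k * c) e2.
  have [L2' E2] := Lint_itv_cst (r1 ^+ k * B) TN.
  have E : Lint (fun t => \1_`]-T, 0]%classic t * (peak t ^+ k * g t)) = 0.
    have := congr1 (@complex.Re R) (peak_avg k 0 bh h0).
    rewrite [in RHS]/= => E; rewrite -[RHS]E; apply: eq_Lint => t.
    by rewrite fexp0 mul1r /g; case: (h t) => h1 h2 /=; ring.
  have LE : L1 (fun t => \1_`]-T, 0]%classic t * (peak t ^+ k * g t)).
    have b : bmeas (fun t => (peak t ^+ k)%:C * h t) by exact: bmeasM.
    have [L _] := CL1_itv (- T) 0 b; apply: eq_L1 L => t.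
    by rewrite /g; case: (h t) => h1 h2 /=; ring.
  have : Lint (fun t => \1_`]- (T / 2), - (T / 2) + e / 2]%classic t * (r2 ^+ k * c)
      - \1_`]-T, 0]%classic t * (r1 ^+ k * B)) <= 0.
    rewrite -[X in _ <= X]E; apply: (Lint_le (L1B L1' L2') LE) => t; rewrite !indicE.
    have m x y : (t \in `]x, y]%classic) = (x < t <= y) by apply/idP/idP; rewrite inE/= in_itv/=.
    rewrite !m; have [/andP[t3 t4]|ht] := boolP (- T < t <= 0); last first.
      have [/andP[t3 t4]|_] := boolP (- (T / 2) < t <= - (T / 2) + e / 2).
        by move: ht => /negP[]; apply/andP; split; have := T0; lra.
      by rewrite !mul0r subr0.
    rewrite !mul1r peak_cosw.
    have tT : `|t + T / 2| <= T / 2 by rewrite ler_norml; apply/andP; split; lra.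
    have [te|te] := ltP `|t + T / 2| e.
      have gc := gd t (lt_le_trans te ed).
      have q0 : 0 <= r1 ^+ k * B by rewrite mulr_ge0// exprn_ge0.
      have [/andP[t5 t6]|_] := boolP (- (T / 2) < t <= - (T / 2) + e / 2); last first.
        rewrite mul0r sub0r; apply: (@le_trans _ _ 0); first by rewrite oppr_le0.
        by rewrite mulr_ge0 ?exprn_ge0 ?cosw_ge0//; lra.
      rewrite mul1r; apply: (@le_trans _ _ (r2 ^+ k * c)); first by rewrite lerBlDr lerDl.
      apply: ler_pM; rewrite ?exprn_ge0 ?(ltW r20) ?(ltW c0)//.
      apply: lerXn2r; rewrite ?nnegrE ?cosw_ge0 ?(ltW r20)//.
      by apply: cosw_le => //; rewrite ?ger0_norm; lra.
    have -> : (- (T / 2) < t <= - (T / 2) + e / 2) = false.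
      apply/negP => /andP[t5 t6]; move: te; rewrite ger0_norm; lra.
    rewrite mul0r sub0r -mulrN.
    have p1 : cosw `|t + T / 2| ^+ k <= r1 ^+ k.
      apply: lerXn2r; rewrite ?nnegrE ?cosw_ge0//; apply: cosw_le => //; exact: ltW.
    have p0 : 0 <= cosw `|t + T / 2| ^+ k by rewrite exprn_ge0.
    apply: (@le_trans _ _ (cosw `|t + T / 2| ^+ k * - B)).
      by rewrite !mulrN lerN2 ler_wpM2r.
    by rewrite ler_wpM2l.
  rewrite LintB// E1 E2; lra.
have q0 : 0 <= r1 / r2 by rewrite divr_ge0// ltW.
have q1 : r1 / r2 < 1 by rewrite ltr_pdivrMr// mul1r.
have BT : 0 <= B * T by rewrite mulr_ge0// ltW.
have ce : 0 < c * (e / 2) by rewrite mulr_gt0// divr_gt0.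
have ep : 0 < c * (e / 2) / (2 * (B * T + 1)).
  by rewrite divr_gt0// mulr_gt0// ltr_wpDl.
have [N0 /(_ N0 (leqnn _))] := expr_small q0 q1 ep.
rewrite expr_div_n ler_pdivrMr ?exprn_gt0// => hN.
have rN : 0 < r2 ^+ N0 by rewrite exprn_gt0.
have hk : r2 ^+ N0 * (c * (e / 2)) <= r1 ^+ N0 * (B * T).
  by rewrite [X in X <= _]mulrA [X in _ <= X]mulrA; exact: key.
have : r1 ^+ N0 * (B * T) <= (c * (e / 2) / (2 * (B * T + 1)) * r2 ^+ N0) * (B * T) by rewrite ler_wpM2r.
have q : c * (e / 2) / (2 * (B * T + 1)) * (B * T) < c * (e / 2).
  rewrite -mulrA -[X in _ < X]mulr1 ltr_pM2l// mulrC ltr_pdivrMr; lra.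
move=> h1; have : r2 ^+ N0 * (c * (e / 2)) <= r2 ^+ N0 * (c * (e / 2) / (2 * (B * T + 1)) * (B * T)).
  by apply: (le_trans hk); apply: (le_trans h1); rewrite mulrAC mulrC.
by rewrite ler_pM2l// leNgt q.
Qed.

End FourierUniqueness.

(** * The energy identity and the propagation of zeros on the lattice *)

Section LatticeSums.
Context {R : realType}.
Local Notation C := R[i].
Implicit Types (v : int -> R) (s r : seq int) (n m k : int) (N M : nat).

(** The integers of modulus at most N, in the order of summation of [fourier_partial]. *)
Definition zwin N : seq int := [seq (j%:Z - N%:Z) | j <- iota 0 N.*2.+1].

Lemma mem_zwin N n : (n \in zwin N) = (`|n| <= N)%N.
Proof.
apply/mapP/idP => [[j] | nN].
  by rewrite mem_iota => /andP[_ +] ->; lia.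
exists `|(n + N%:Z)%R|%N; last lia.
by rewrite mem_iota; lia.
Qed.

Lemma zwin_uniq N : uniq (zwin N).
Proof. by rewrite map_inj_uniq ?iota_uniq// => i j; lia. Qed.

Lemma sub_zwin s : exists N, {subset s <= zwin N}.
Proof.
elim: s => [|n s [N IH]]; first by exists 0%N.
exists (maxn N `|n|) => m; rewrite inE mem_zwin => /orP[/eqP ->|/IH]; first exact: leq_maxr.
by rewrite mem_zwin => h; rewrite (leq_trans h)// leq_maxl.
Qed.

Lemma sum_uniq_sub v s r : (forall n, 0 <= v n) -> uniq s -> uniq r -> {subset s <= r} ->
  \sum_(n <- s) v n <= \sum_(n <- r) v n.
Proof.
move=> v0 us ur sr.
have p : perm_eq s [seq n <- r | n \in s].
  apply: uniq_perm => //; first exact: filter_uniq.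
  by move=> n; rewrite mem_filter; case: (boolP (n \in s)) => // /sr ->.
rewrite (perm_big _ p) big_filter [X in _ <= X](bigID (mem s)) /=.
by rewrite lerDl sumr_ge0.
Qed.

(** A finite set nearly attaining the supremum of the finite sums leaves little for the sets
    disjoint from it. *)
Lemma tail_small v (A e : R) : (forall n, 0 <= v n) ->
  (forall s, uniq s -> \sum_(n <- s) v n <= A) -> 0 < e ->
  exists N0, forall s, uniq s -> (forall n, n \in s -> n \notin zwin N0) -> \sum_(n <- s) v n <= e.
Proof.
move=> v0 vA e0; pose S : set R := [set x | exists s, uniq s /\ x = \sum_(n <- s) v n].
have hS : has_sup S.
  split; first by exists 0, [::]; rewrite big_nil.
  by exists A => x [s [us ->]]; exact: vA.
have [x [s0 [us0 ->]] hx] := sup_adherent e0 hS.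
have [N0 hN] := sub_zwin s0; exists N0 => s us sN.
have uc : uniq (s0 ++ s).
  rewrite cat_uniq us0 us andbT; apply/hasPn => n /sN; apply: contra; exact: hN.
have : \sum_(n <- s0 ++ s) v n <= sup S by apply: (sup_upper_bound hS); exists (s0 ++ s).
by rewrite big_cat /=; lra.
Qed.

Lemma ccvg_sum (I : Type) (r : seq I) (F : I -> nat -> C) (l : I -> C) :
  (forall i, ccvg (F i) (l i)) -> ccvg (fun N => \sum_(i <- r) F i N) (\sum_(i <- r) l i).
Proof.
move=> Fl; elim: r => [|i r IH].
  by rewrite big_nil; apply: (eq_ccvg _ (ccvg_cst 0)) => N; rewrite big_nil.
rewrite big_cons; have [h1 h2] := Fl i; have [h3 h4] := IH.
apply: (@eq_ccvg _ (fun N => F i N + \sum_(j <- r) F j N)) => [N|]; first by rewrite big_cons.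
split; first by under eq_fun do rewrite ReD; rewrite ReD; exact: cvgD.
by under eq_fun do rewrite ImD; rewrite ImD; exact: cvgD.
Qed.

Variables (a Y W : int -> C) (A1 C2 : R).
Hypothesis herm : forall n, a n = conjc (a (- n)).
Hypothesis suma : forall s, uniq s -> \sum_(n <- s) cabs (a n) <= A1.
Hypothesis sumY : forall s, uniq s -> \sum_(n <- s) cabs (Y n) ^+ 2 <= C2.
Hypothesis limW : forall n, ccvg (fun N => \sum_(k <- zwin N) a k * Y (n + k)) (W n).

(** The finite matrix a (m - n) is Hermitian, so its quadratic form is real. *)
Let herm_sum N : complex.Im (\sum_(n <- zwin N)
  (conjc (\sum_(m <- zwin N) a (m - n) * Y m)) * Y n) = 0.
Proof.
set S := \sum_(n <- _) _.
have SE : S = \sum_(n <- zwin N) \sum_(m <- zwin N) conjc (a (m - n)) * conjc (Y m) * Y n.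
  apply: eq_bigr => n _; rewrite conjc_sum mulr_suml; apply: eq_bigr => m _.
  by rewrite conjc_mul.
have cK (z : C) : conjc (conjc z) = z by case: z => x y; apply: eqC => //=; rewrite opprK.
have : conjc S = S.
  rewrite {1}SE conjc_sum SE exchange_big /=; apply: eq_bigr => n _.
  rewrite conjc_sum; apply: eq_bigr => m _.
  rewrite !conjc_mul !cK -opprB [a (- _)]herm opprK.
  by rewrite mulrAC.
case: (S) => x y [] /eqP; rewrite -subr_eq0 -opprD oppr_eq0 -mulr2n mulrn_eq0 /=.
by move=> /eqP.
Qed.

Let shift_split N M n : n \in zwin N -> (N.*2 <= M)%N ->
  \sum_(k <- zwin M) a k * Y (n + k) =
  \sum_(m <- zwin N) a (m - n) * Y m + \sum_(k <- zwin M | n + k \notin zwin N) a k * Y (n + k).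
Proof.
move=> nN NM; rewrite (bigID (fun k => n + k \in zwin N)) /=; congr (_ + _).
rewrite -big_filter.
have p : perm_eq [seq k <- zwin M | n + k \in zwin N] [seq m - n | m <- zwin N].
  apply: uniq_perm.
  - by rewrite filter_uniq// zwin_uniq.
  - by rewrite map_inj_uniq ?zwin_uniq// => i j; lia.
  move=> k; rewrite mem_filter; apply/idP/mapP => [/andP[kN _]|[m mN ->]].
    by exists (n + k) => //; lia.
  by move: mN nN; rewrite !mem_zwin; lia.
rewrite (perm_big _ p) big_map; apply: eq_bigr => m _.
by congr (_ * Y _); lia.
Qed.

(** On a finite window the Hermitian form is real, so the imaginary part of the sum comes only from
    the coupling of modes inside the window with modes outside it; this is small because Y is square
    summable and a is summable. As all terms have one sign, none can be strictly negative. *)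
Lemma energy : (forall n, complex.Im (conjc (W n) * Y n) <= 0) ->
  forall n, complex.Im (conjc (W n) * Y n) = 0.
Proof.
move=> neg n0; apply/eqP; rewrite eq_le neg/= leNgt; apply/negP => lt0.
have A0 : 0 <= A1 by have := @suma [::] isT; rewrite big_nil.
have C0 : 0 <= C2 by have := @sumY [::] isT; rewrite big_nil.
(* Chosen so that the error A1 th (C2 + 1) is strictly less than the supposed defect at [n0]. *)
pose th := - complex.Im (conjc (W n0) * Y n0) / (A1 * (C2 + 1) + 1).
have D0 : 0 < A1 * (C2 + 1) + 1.
  by have : 0 <= A1 * (C2 + 1); [rewrite mulr_ge0//; lra|lra].
have th0 : 0 < th by rewrite divr_gt0//; lra.
have th2 : 0 < th ^+ 2 by rewrite exprn_gt0.
have [N0 tailN] := tail_small (fun n => sqr_ge0 (cabs (Y n))) sumY th2.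
pose N := maxn N0 `|n0|.
pose D M := \sum_(n <- zwin N) conjc (\sum_(k <- zwin M) a k * Y (n + k)) * Y n.
(* For M >= 2 N every difference of two points of the window occurs in the sum over [k], so the
   Hermitian part is complete. *)
have bound M : (N.*2 <= M)%N -> - (A1 * (th * (C2 + 1))) <= complex.Im (D M).
  move=> NM.
  have -> : D M = \sum_(n <- zwin N) conjc (\sum_(m <- zwin N) a (m - n) * Y m) * Y n +
      \sum_(n <- zwin N) \sum_(k <- zwin M | n + k \notin zwin N) conjc (a k * Y (n + k)) * Y n.
    rewrite -big_split /= /D big_seq [RHS]big_seq; apply: eq_bigr => n nN.
    rewrite (shift_split nN NM) -mulr_suml -mulrDl; congr (_ * _).
    by rewrite -conjc_sum -conjc_add.
  rewrite ImD herm_sum add0r; set E := \sum_(n <- _) _.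
  suff hE : cabs E <= A1 * (th * (C2 + 1)).
    by have := le_trans (abs_Im_le E) hE; rewrite ler_norml => /andP[].
  apply: (@le_trans _ _ (\sum_(n <- zwin N) \sum_(k <- zwin M | n + k \notin zwin N)
      cabs (a k) * (cabs (Y (n + k)) * cabs (Y n)))).
    apply: (le_trans (cabs_sum _ _ _)); apply: ler_sum => n _.
    apply: (le_trans (cabs_sum _ _ _)); apply: ler_sum => k _.
    by rewrite cabsM cabs_conj cabsM mulrA.
  rewrite (exchange_big_dep predT) //=.
  apply: (@le_trans _ _ (\sum_(k <- zwin M) cabs (a k) * (th * (C2 + 1)))); last first.
    rewrite -mulr_suml ler_wpM2r//; last exact/suma/zwin_uniq.
    by rewrite mulr_ge0 ?(ltW th0)//; lra.
  apply: ler_sum => k _; rewrite -mulr_sumr ler_wpM2l ?cabs_ge0//.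
  (* The inner mode receives the weight th and the outer one 1 / th; as the outer tail is at most
     th^2, both contributions are of order th. *)
  have AG (x y : R) : 0 <= x -> 0 <= y -> x * y <= th * y ^+ 2 + th^-1 * x ^+ 2.
    move=> x0 y0.
    have h : 0 <= th * (y - th^-1 * x) ^+ 2 by rewrite mulr_ge0 ?(ltW th0)// sqr_ge0.
    have e1 : th * (y - th^-1 * x) ^+ 2 = th * y ^+ 2 - 2 * (x * y) + th^-1 * x ^+ 2.
      by field; rewrite gt_eqF.
    have xy : 0 <= x * y by rewrite mulr_ge0.
    by rewrite e1 in h; lra.
  apply: (@le_trans _ _ (\sum_(n <- zwin N | n + k \notin zwin N)
      (th * cabs (Y n) ^+ 2 + th^-1 * cabs (Y (n + k)) ^+ 2))).
    by apply: ler_sum => n _; apply: AG; exact: cabs_ge0.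
  rewrite big_split /= -!mulr_sumr mulrDr mulr1; apply: lerD.
    rewrite ler_wpM2l ?(ltW th0)// -big_filter; apply: sumY.
    by rewrite filter_uniq// zwin_uniq.
  apply: (@le_trans _ _ (th^-1 * th ^+ 2)); last by rewrite expr2 mulrA mulVf ?mul1r// gt_eqF.
  rewrite ler_wpM2l ?invr_ge0 ?(ltW th0)// -big_filter.
  rewrite -(big_map (fun n => n + k) predT (fun n => cabs (Y n) ^+ 2)).
  apply: tailN.
    by rewrite map_inj_uniq ?filter_uniq ?zwin_uniq// => i j; lia.
  move=> m /mapP[n]; rewrite mem_filter => /andP[+ _] ->.
  by apply: contra; rewrite !mem_zwin => h; rewrite (leq_trans h)// leq_maxl.
have cD : ccvg D (\sum_(n <- zwin N) conjc (W n) * Y n).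
  apply: (ccvg_sum _ (F := fun n M => conjc (\sum_(k <- zwin M) a k * Y (n + k)) * Y n)) => n.
  by apply: ccvgM; [exact: ccvg_conj (limW n)|exact: ccvg_cst].
have low : - (A1 * (th * (C2 + 1))) <= complex.Im (\sum_(n <- zwin N) conjc (W n) * Y n).
  apply: (ler_cvg_to (cvg_cst _) cD.2); exists N.*2 => // M /= NM; exact: bound.
have up : complex.Im (\sum_(n <- zwin N) conjc (W n) * Y n) <= complex.Im (conjc (W n0) * Y n0).
  have -> : complex.Im (\sum_(n <- zwin N) conjc (W n) * Y n) =
      \sum_(n <- zwin N) complex.Im (conjc (W n) * Y n).
    by apply: (big_morph (@complex.Im R)) => // x y; rewrite ImD.
  rewrite (bigD1_seq n0) ?zwin_uniq//=; last by rewrite mem_zwin leq_maxr.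
  by rewrite gerDl sumr_le0.
have : th * (A1 * (C2 + 1) + 1) = - complex.Im (conjc (W n0) * Y n0) by rewrite divfK// gt_eqF.
by move: low up; lra.
Qed.

Let bdY n : cabs (Y n) <= C2 + 1.
Proof.
have := @sumY [:: n] isT; rewrite big_seq1 => h.
have := sqr_ge0 (cabs (Y n) - 1); rewrite sqrrB1; have := cabs_ge0 (Y n); lra.
Qed.

(** Suppose Y vanishes below j. Then so does W, and its value at j - 1 - i reads sum_k a_(k+1+i)
    Y_(j+k) = 0: the bounded sequence (Y_j, Y_(j+1), ...) is annihilated by all shifts of alpha~,
    hence by their l^1-closure, which contains e_1; so Y_j = 0. *)
Lemma generic_zero : generic a -> (forall n, n < 0 -> Y n = 0 /\ W n = 0) ->
  (forall n, Y n = 0 -> W n = 0) -> forall n, Y n = 0.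
Proof.
move=> gen neg YW.
suff pos (j : nat) : Y j%:Z = 0.
  by move=> n; have [n0|n0] := ltP n 0; [have [] := neg n n0|rewrite -(gez0_abs n0)].
elim/ltn_ind: j => j IH.
have Ylt n : n < j%:Z -> Y n = 0.
  have [n0 _|n0 nj] := ltP n 0; first by have [] := neg n n0.
  by rewrite -(gez0_abs n0); apply: IH; lia.
pose U (i K : nat) : C := \sum_(0 <= k < K) a (k.+1 + i)%:Z * Y (j%:Z + k%:Z).
have cU i : ccvg (U i) 0.
  have <- : W (j%:Z - 1 - i%:Z) = 0 by apply: YW; apply: Ylt; lia.
  have E (K : nat) : \sum_(k <- zwin (K + i)) a k * Y (j%:Z - 1 - i%:Z + k) = U i K.
    rewrite big_map /U -/(index_iota 0 (K + i).*2.+1).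
    rewrite (@big_cat_nat _ _ _ (K + i + i).+1) //=; last by lia.
    rewrite big1_seq ?add0r; last first.
      move=> k; rewrite mem_index_iota => /andP[_ /andP[_ h]].
      by rewrite [Y _]Ylt ?mulr0//; lia.
    rewrite -{1}[(K + i + i).+1]add0n big_addn.
    have -> : ((K + i).*2.+1 - (K + i + i).+1 = K)%N by lia.
    by apply: eq_bigr => k _; congr (a _ * Y _); lia.
  have [h1 h2] := limW (j%:Z - 1 - i%:Z).
  rewrite -(cvg_shiftn i) in h1; rewrite -(cvg_shiftn i) in h2.
  by apply: (eq_ccvg E); split.
apply: cabs_le_small => e e0.
have C0 : 0 <= C2 by have := @sumY [::] isT; rewrite big_nil.
have e1 : 0 < e / (2 * (C2 + 1)) by rewrite divr_gt0//; lra.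
have [N [c hc]] := gen _ e1.
pose d (k : nat) : C := (k == 0%N)%:R - \sum_(l < N) c l * a (k.+1 + l)%:Z.
have dsum K : \sum_(0 <= k < K) cabs (d k) <= e / (2 * (C2 + 1)).
  rewrite -lee_fin; apply: le_trans (ltW hc); rewrite -sumEFin.
  by apply: nneseries_lim_ge => k _ _; rewrite lee_fin cabs_ge0.
(* The first K terms of the pairing of (Y_j, Y_(j+1), ...) with e_1, written as [d] plus the
   combination of shifts. *)
have split K : (0 < K)%N -> Y j%:Z =
    \sum_(0 <= k < K) d k * Y (j%:Z + k%:Z) + \sum_(l < N) c l * U l K.
  move=> K0.
  have -> : \sum_(l < N) c l * U l K = \sum_(0 <= k < K) (\sum_(l < N) c l * a (k.+1 + l)%:Z) * Y (j%:Z + k%:Z).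
    under eq_bigr => l _ do rewrite mulr_sumr.
    rewrite exchange_big /=; apply: eq_bigr => k _; rewrite mulr_suml.
    by apply: eq_bigr => l _; rewrite mulrA.
  rewrite -big_split /=; under eq_bigr => k _ do rewrite -mulrDl subrK.
  rewrite -[in RHS](prednK K0) big_nat_recl//= mul1r addr0 big1 ?addr0// => k _.
  by rewrite mul0r.
have small : exists K, (0 < K)%N /\ cabs (\sum_(l < N) c l * U l K) <= e / 2.
  have cS : ccvg (fun K => \sum_(l < N) c l * U l K) (\sum_(l < N) c l * 0).
    apply: (ccvg_sum _ (F := fun (l : 'I_N) K => c l * U l K)) => l.
    by apply: ccvgM; [exact: ccvg_cst|exact: cU].
  rewrite big1 in cS; last by move=> l _; rewrite mulr0.
  have e4 : 0 < e / 4 by rewrite divr_gt0.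
  have [h1 h2] := cS.
  have /cvgrPdist_le /(_ _ e4) [N1 _ H1] := h1.
  have /cvgrPdist_le /(_ _ e4) [N2 _ H2] := h2.
  exists (maxn N1 N2).+1; split => //.
  apply: (le_trans (cabs_le_abs _)).
  have := H1 (maxn N1 N2).+1; have := H2 (maxn N1 N2).+1.
  rewrite /= !sub0r !normrN => /(_ (leqW (leq_maxr _ _))) h4 /(_ (leqW (leq_maxl _ _))) h3; lra.
have [K [K0 hK]] := small.
rewrite (split K K0); apply: (le_trans (cabsD _ _)).
have : cabs (\sum_(0 <= k < K) d k * Y (j%:Z + k%:Z)) <= e / 2.
  apply: (le_trans (cabs_sum _ _ _)).
  apply: (@le_trans _ _ (\sum_(0 <= k < K) cabs (d k) * (C2 + 1))).
    by apply: ler_sum => k _; rewrite cabsM ler_wpM2l ?cabs_ge0.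
  rewrite -mulr_suml; apply: (@le_trans _ _ (e / (2 * (C2 + 1)) * (C2 + 1))).
    by rewrite ler_wpM2r//; lra.
  rewrite invfM mulrA divfK//; lra.
lra.
Qed.

End LatticeSums.

(** * Floquet solutions vanish *)

Section NoFloquet.
Context {R : realType}.
Local Notation C := R[i].
Implicit Types (y : R -> C) (s t : R) (n k : int).

Lemma l1Z_bound (a : int -> C) : l1Z a ->
  exists A1, forall s : seq int, uniq s -> \sum_(n <- s) cabs (a n) <= A1.
Proof.
move=> la; pose u (n : nat) : \bar R := ((cabs (a n%:Z) + cabs (a (- n%:Z)))%:E)%E.
have u0 (n : nat) : (0 <= u n)%E by rewrite lee_fin addr_ge0 ?cabs_ge0.
have fin : (\sum_(n <oo) u n)%E \is a fin_num by rewrite ge0_fin_numE//; exact: nneseries_ge0.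
exists (fine (\sum_(n <oo) u n)%E) => s us.
have [N sN] := sub_zwin s.
apply: (le_trans (sum_uniq_sub (fun n => cabs_ge0 (a n)) us (zwin_uniq N) sN)).
apply: (@le_trans _ _ (\sum_(0 <= n < N.+1) (cabs (a n%:Z) + cabs (a (- n%:Z))))).
  rewrite big_map -/(index_iota 0 N.*2.+1) (@big_cat_nat _ _ _ N) //=; last by lia.
  rewrite big_split /= addrC; apply: lerD.
    rewrite -{1}[N]add0n big_addn (_ : N.*2.+1 - N = N.+1)%N; last by lia.
    by rewrite le_eqVlt; apply/orP; left; apply/eqP; apply: eq_bigr => j _; congr (cabs (a _)); lia.
  rewrite big_nat_recl// [X in _ <= _ + X]big_nat_rev /= add0n.
  rewrite (@eq_big_nat _ _ _ 0 N _ (fun i => cabs (a (- (N - i.+1).+1%:Z)))).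
    by rewrite lerDr cabs_ge0.
  by move=> j /andP[_ jN]; congr (cabs (a _)); lia.
rewrite -lee_fin fineK// -sumEFin.
by apply: nneseries_lim_ge => k _ _; exact: u0.
Qed.

Lemma unit_arg (z : C) : cabs z = 1 -> exists2 th, 0 <= th < 2 * pi & z = expi (- th).
Proof.
case: z => x y h; have := cabs_sqr (x +i* y); rewrite h expr1n /= => e.
have x1 : -1 <= x <= 1.
  have := sqr_ge0 y => y2; apply/andP; split; nra.
have ay : Num.sqrt (1 - x ^+ 2) = `|y| by rewrite e addrAC subrr add0r sqrtr_sqr.
have c := acosK x1; have s := sin_acos x1; rewrite ay in s.
have a0 := acos_ge0 x1; have a1 := acos_lepi x1; have p0 := @pi_gt0 R.
have [y0|y0] := leP y 0.
  exists (acos x); first by apply/andP; split=> //; lra.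
  by rewrite /expi cosN sinN c s ler0_norm// opprK.
have x1' : x < 1.
  have y2 : 0 < y ^+ 2 by rewrite exprn_gt0.
  have /andP[_ x2] := x1; rewrite lt_neqAle x2 andbT; apply/eqP => xe; rewrite xe in e; lra.
have a2 : 0 < acos x by apply: acos_gt0; case/andP: x1 => -> _.
exists (2 * pi - acos x); first by apply/andP; split; lra.
rewrite opprB /expi; have -> : 2 * pi = pi *+ 2 :> R by rewrite mulr_natl.
by rewrite cosB sinB cos2pi sin2pi c s gtr0_norm//; apply: eqC => /=; ring.
Qed.

Variables (T Am c : R) (al : R -> R) (an : int -> C).
Hypothesis T0 : 0 < T.
Hypothesis mal : measurable_fun setT al.
Hypothesis alT : forall t, al (t + T) = al t.
Hypothesis alA : forall t, `|al t| <= Am.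
Hypothesis c0 : 0 < c.
Hypothesis lan : l1Z an.
Hypothesis herm : forall n, an n = conjc (an (- n)).
Hypothesis four : forall t,
  ccvg (fun N => fourier_partial an (2 * pi / T) N t) (al t)%:C.
Hypothesis gen : generic an.
Local Notation c1 := (c%:C * expi (pi / 4) : C).
Local Notation w := (2 * pi / T).

Let w0 : 0 < w. Proof. by rewrite divr_gt0// mulr_gt0// pi_gt0. Qed.

Lemma fourier_partialE N t : fourier_partial an w N t = \sum_(k <- zwin N) an k * fexp T k t.
Proof. by rewrite big_map. Qed.

(** Exponents differ by multiples of i w; with the representative 0 <= Im p < w, the imaginary part
    of p + i n w is negative exactly for n < 0. *)
Lemma floquet_exponent (z : C) : z != 0 -> cabs z <= 1 -> exists p : C,
  [/\ 0 <= complex.Re p, 0 <= complex.Im p, complex.Im p < w & cexp (- (p * T%:C)) = z].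
Proof.
move=> z0 z1; have a0 : 0 < cabs z by rewrite lt_neqAle cabs_ge0 eq_sym cabs_eq0 z0.
have u1 : cabs (z / (cabs z)%:C) = 1.
  by rewrite cabsM cabsV cabs_real gtr0_norm// divff// gt_eqF.
have [th /andP[th0 th1] ze] := unit_arg u1.
exists ((- ln (cabs z) / T) +i* (th / T)); split => /=.
- by rewrite divr_ge0 ?(ltW T0)// oppr_ge0 ln_le0.
- by rewrite divr_ge0// ltW.
- by rewrite ltr_pM2r// invr_gt0.
rewrite /cexp Re_pu Im_pu /= !divfK ?gt_eqF// opprK lnK ?posrE//.
by rewrite -ze mulrC divfK// fmorph_eq0 gt_eqF.
Qed.

Section Solution.
Variables (y : R -> C) (p : C).
Hypothesis cy : ccontinuous y.
Hypothesis y1 : forall t, cabs (y t) <= 1.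
Hypothesis yK : forall t, t <= 0 -> y t + Kop al c1 y t = 0.
Hypothesis p0 : 0 <= complex.Re p.
Hypothesis pw : complex.Im p < w.
Hypothesis yT : forall t, t <= 0 -> y (t - T) = cexp (- (p * T%:C)) * y t.

Let my : cmeas y. Proof. exact: ccontinuous_cmeas. Qed.

(** The periodic factor of the Floquet solution y = e^(p t) Phi. *)
Let Phi t : C := cexp (- (p * t%:C)) * y t.

Let per : lperiodic T Phi.
Proof.
move=> t t0; rewrite /Phi yT// mulrA -cexpD; congr (cexp _ * _).
by rewrite rmorphB /=; ring.
Qed.

Let mcexp (q : C) : cmeas (fun t : R => cexp (- (q * t%:C))).
Proof.
apply: cmeas_cexp; apply: cmeasN; apply: cmeasM; first exact: cmeas_cst.
exact: cmeas_real.
Qed.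

(** For t >= - T the bound on [y] suffices; farther in the past, where the exponential alone may
    grow, periodicity takes over. *)
Let bPhi : bmeas Phi.
Proof.
split; first exact: cmeasM.
exists (expR (complex.Re p * T)) => t.
have ge t' : - T <= t' -> cabs (Phi t') <= expR (complex.Re p * T).
  move=> h; rewrite /Phi cabsM cabs_cexp Re_pu -[X in _ <= X]mulr1.
  apply: ler_pM; rewrite ?cabs_ge0 ?expR_ge0// ler_expR -mulrN.
  by apply: ler_wpM2l => //; lra.
have [h|h] := leP (- T) t; first exact: ge.
have t0 : t <= 0 by have := T0; lra.
have [k /andP[k1 k2]] := trans_nat T0 t0.
suff -> : Phi t = Phi (t + k%:R * T) by exact: ge.
have tk : t + k%:R * T <= 0 by [].
elim: k {k1 k2} tk => [|k IH] tk; first by rewrite mul0r addr0.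
have e : t + k.+1%:R * T - T = t + k%:R * T by rewrite -addn1 natrD; ring.
rewrite IH; first by rewrite -(per tk) e.
by rewrite -e; have := T0; lra.
Qed.

Let pn n : C := p + 0 +i* (n%:~R * w).

Let cexp_pn n t : cexp (- (pn n * t%:C)) = fexp T n t * cexp (- (p * t%:C)).
Proof.
have -> : - (pn n * t%:C) = - (p * t%:C) + (0 +i* (- (n%:~R * w * t))).
  by apply: eqC; rewrite /pn !(ReD, ImD, ReN, ImN, ReM, ImM) /=; ring.
by rewrite cexpD mulrC; congr (_ * _); rewrite /cexp /= expR0 mul1r.
Qed.

Let Re_pn n : complex.Re (pn n) = complex.Re p.
Proof. by rewrite ReD /= addr0. Qed.

Let Im_pn n : complex.Im (pn n) = complex.Im p + n%:~R * w.
Proof. by rewrite ImD. Qed.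

Let Y n := fcoef T Phi n.
Let W n := fcoef T (fun t => (al t)%:C * Phi t) n.

Let al_per : lperiodic T (fun t => (al t)%:C).
Proof. by move=> t _; rewrite -[in RHS](subrK T t) alT. Qed.

Let bal : bmeas (fun t => (al t)%:C).
Proof. by split; [exact: cmeas_real|exists Am => t; rewrite cabs_real]. Qed.

Let lapf_convE (k : R -> R) (f : R -> C) n t : dominated_kernel k -> cmeas f ->
  bdd_before f t ->
  Cint (fun u => lapf k (pn n) u * (fexp T n (t - u) * (cexp (- (p * (t - u)%:C)) * f (t - u)))) =
  cexp (- (pn n * t%:C)) * conv k f t.
Proof.
move=> dk mf bf; have L := CL1_conv_bdd dk mf bf.
rewrite /conv -(Cint_subr t L) -CintZ; last exact: CL1_subr L.
apply: eq_Cint => u; rewrite [fexp T n _ * _]mulrA -cexp_pn /lapf subKr.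
have -> : (k u)%:C * cexp (- (pn n * u%:C)) * (cexp (- (pn n * (t - u)%:C)) * f (t - u)) =
  (cexp (- (pn n * u%:C)) * cexp (- (pn n * (t - u)%:C))) * ((k u)%:C * f (t - u)) by ring.
rewrite -cexpD; congr (cexp _ * _); rewrite rmorphB /=; ring.
Qed.

(** The equation is multiplied by e^(- p_n t) and integrated over a period, which turns each
    convolution into multiplication by its symbol at p_n. *)
Let relation n : Msym (pn n) * Y n + c1 * (Khat (pn n) * W n) = 0.
Proof.
pose F t := fexp T n t * Phi t; pose G t := fexp T n t * ((al t)%:C * Phi t).
have bF : bmeas F by apply: bmeasM => //; exact: bmeas_fexp.
have bG : bmeas G by apply: bmeasM; [exact: bmeas_fexp|exact: bmeasM].
have pF : lperiodic T F by move=> t t0; rewrite /F per// fexp_period.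
have pG : lperiodic T G by move=> t t0; rewrite /G al_per// per// fexp_period.
have q0 : 0 <= complex.Re (pn n) by rewrite Re_pn.
have [LA EA] := avg_conv T0 dominated_muker q0 bF pF.
have [LB EB] := avg_conv T0 dominated_kker q0 bG pG.
have LY := CL1_itv (- T) 0 bF.
have mh t : bdd_before y t by exists 1 => s _.
pose I t : C := (\1_`]- T, 0]%classic t)%:C.
pose A t := Cint (fun u => lapf muker (pn n) u * F (t - u)).
pose B t := Cint (fun u => lapf kker (pn n) u * G (t - u)).
have Z t : I t * F t - I t * A t + c1 * (I t * B t) = 0.
  have -> : I t * F t - I t * A t + c1 * (I t * B t) = I t * (F t - A t + c1 * B t) by ring.
  rewrite /I indicE; case: (boolP (t \in _)) => [|_]; last by rewrite mul0r.
  rewrite inE/= in_itv/= => /andP[_ t0].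
  have -> : A t = cexp (- (pn n * t%:C)) * conv muker y t.
    by rewrite -lapf_convE//; exact: dominated_muker.
  have -> : B t = cexp (- (pn n * t%:C)) * conv kker (fun s => (al s)%:C * y s) t.
    rewrite -lapf_convE; [|exact: dominated_kker|exact: cmeas_al|exact: (al_bdd alA)].
    apply: eq_Cint => u; rewrite /G /Phi; ring.
  have -> : F t = cexp (- (pn n * t%:C)) * y t by rewrite /F /Phi cexp_pn mulrA.
  transitivity (1%:C * (cexp (- (pn n * t%:C)) * (y t + Kop al c1 y t))).
    by rewrite /Kop; ring.
  by rewrite yK// !mulr0.
have E : Cint (fun t => I t * F t - I t * A t + c1 * (I t * B t)) = 0.
  by rewrite (eq_Cint Z) -[RHS](mulr0 (0 : C)); have := @Cint_real R (fun=> 0); rewrite Lint0 mulr0; apply.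
have LYA : CL1 (fun t => I t * F t - I t * A t) by exact: CL1B.
have LcB : CL1 (fun t => c1 * (I t * B t)) by exact: CL1Z.
rewrite (CintD LYA LcB) (CintB LY LA) (CintZ c1 LB) in E.
move: E; rewrite -[Cint (fun t => I t * F t)]/(Y n) -[Cint (fun t => I t * A t)]/(avg T A) EA.
rewrite -[Cint (fun t => I t * B t)]/(avg T B) EB -[avg T F]/(Y n) -[avg T G]/(W n) => E.
by rewrite -[RHS]E /Msym /Khat mulrBl mul1r.
Qed.

(** The Fourier sums of alpha are bounded by the l^1-norm of its coefficients, so they can be
    replaced by their limit under the period integral. *)
Let limW (A1 : R) : (forall s : seq int, uniq s -> \sum_(n <- s) cabs (an n) <= A1) ->
  forall n, ccvg (fun N => \sum_(k <- zwin N) an k * Y (n + k)) (W n).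
Proof.
move=> hA n; have A10 : 0 <= A1 by have := hA [::] isT; rewrite big_nil.
pose g t := (\1_`]- T, 0]%classic t)%:C * (fexp T n t * Phi t).
have bF k : bmeas (fun t => fexp T k t * Phi t) by apply: bmeasM => //; exact: bmeas_fexp.
have Lg : CL1 g by exact: CL1_itv.
pose S N t := \sum_(k <- zwin N) an k * fexp T k t.
have bS N : bmeas (S N) by apply: bmeas_sum => k; apply: bmeasM; [exact: bmeas_cst|exact: bmeas_fexp].
have SA N t : cabs (S N t) <= A1.
  apply: (le_trans (cabs_sum _ _ _)); apply: le_trans (hA _ (zwin_uniq N)).
  by apply: ler_sum => k _; rewrite cabsM cabs_expi mulr1.
apply: (@eq_ccvg _ (fun N => Cint (fun t => S N t * g t))).
  move=> N; transitivity (avg T (fun t => \sum_(k <- zwin N) an k * (fexp T (n + k) t * Phi t))).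
    apply: eq_Cint => t; rewrite /g mulrCA /S mulr_suml; congr (_ * _).
    apply: eq_bigr => k _; rewrite fexpD; ring.
  rewrite avg_sum; last by move=> k; apply: bmeasM => //; exact: bmeas_cst.
  by apply: eq_bigr => k _; rewrite avgZ.
rewrite (_ : W n = Cint (fun t => (al t)%:C * g t)); last first.
  by apply: eq_Cint => t; rewrite /g; ring.
apply: (dominated_ccvg _ _ _ (L1Z A1 (CL1_cabs Lg))).
- by move=> N; apply: cmeasM; [case: (bS N)|exact: CL1_meas Lg].
- by apply: cmeasM; [case: bal|exact: CL1_meas Lg].
- move=> t; apply: ccvgM; last exact: ccvg_cst.
  by apply: (@eq_ccvg _ (fun N => fourier_partial an w N t)) => // N; exact: fourier_partialE.
- by move=> N t; rewrite cabsM ler_wpM2r ?cabs_ge0.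
Qed.

Let cPhi : continuous (fun t => complex.Re (Phi t)) /\ continuous (fun t => complex.Im (Phi t)).
Proof.
have ct A B : continuous (fun t : R => expR (- (complex.Re p * t)) *
    (A * cos (complex.Im p * t) + B * sin (complex.Im p * t))).
  move=> t; apply: differentiable_continuous; apply/derivable1_diffP.
  by have D := is_derive_exp_trig (complex.Re p) (complex.Im p) A B t; exact: ex_derive.
have cR : continuous (fun t : R => complex.Re (cexp (- (p * t%:C)))).
  have -> : (fun t : R => complex.Re (cexp (- (p * t%:C)))) = fun t => expR (- (complex.Re p * t)) *
      (1 * cos (complex.Im p * t) + 0 * sin (complex.Im p * t)).
    by apply/funext => t; rewrite /cexp Re_pu Im_pu /= cosN sinN; ring.
  exact: ct.
have cI : continuous (fun t : R => complex.Im (cexp (- (p * t%:C)))).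
  have -> : (fun t : R => complex.Im (cexp (- (p * t%:C)))) = fun t => expR (- (complex.Re p * t)) *
      (0 * cos (complex.Im p * t) + -1 * sin (complex.Im p * t)).
    by apply/funext => t; rewrite /cexp Re_pu Im_pu /= cosN sinN; ring.
  exact: ct.
have yR := ccontinuous_Re cy; have yI := ccontinuous_Im cy.
split => t.
  under eq_fun do rewrite ReM; apply: cvgB; apply: cvgM; [exact: cR|exact: yR|exact: cI|exact: yI].
under eq_fun do rewrite ImM; apply: cvgD; apply: cvgM; [exact: cR|exact: yI|exact: cI|exact: yR].
Qed.

Lemma floquet_zero : forall t, t <= 0 -> y t = 0.
Proof.
have [A1 hA] := l1Z_bound lan.
have [mP [B hB]] := bPhi.
have q0 n : 0 <= complex.Re (pn n) by rewrite Re_pn.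
have ch n := channel (q0 n) c0 (relation n).
have bs (s : seq int) : uniq s -> \sum_(n <- s) cabs (Y n) ^+ 2 <= (B * T) ^+ 2.
  by move=> us; exact: (bessel T0 bPhi hB us).
have en := energy herm hA bs (limW hA) (fun n => let: And3 h _ _ := ch n in h).
have neg n : n < 0 -> Y n = 0 /\ W n = 0.
  move=> n0; have [_ h _] := ch n.
  have [] := h (en n) => [[_]|-> ->] //; rewrite Im_pn.
  have : (n%:~R : R) <= (-1)%:~R by rewrite ler_int; lia.
  rewrite intrN => n1 I0; have : n%:~R * w <= -1 * w by rewrite ler_pM2r.
  by have := pw; lra.
have Y0 : forall n, Y n = 0.
  apply: (generic_zero bs (limW hA) gen neg) => n.
  by have [_ _] := ch n.
have [cR cI] := cPhi.
move=> t t0; have := fourier_unique T0 bPhi per cR cI Y0 t0.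
by rewrite /Phi => /eqP; rewrite mulf_eq0 (negPf (cexp_neq0 _)) => /eqP.
Qed.

End Solution.

Theorem no_floquet y (z : C) : ccontinuous y -> (forall t, cabs (y t) <= 1) ->
  (forall t, t <= 0 -> y t + Kop al c1 y t = 0) -> (forall t, t <= 0 -> y (t - T) = z * y t) ->
  z != 0 -> cabs z <= 1 -> forall t, t <= 0 -> y t = 0.
Proof.
move=> cy y1 yK yT z0 z1; have [p [p0 _ pw pz]] := floquet_exponent z0 z1.
by apply: (floquet_zero cy y1 yK p0 pw); rewrite pz.
Qed.

End NoFloquet.

(** * Weighted decay *)

Section Weights.
Context {R : realType}.
Local Notation C := R[i].
Implicit Types (y : R -> C) (s t u d : R).

Let aff d t : R := 1 + d * Num.max 0 t.
(** The weight (1 + d t)^(3/2) on t >= 0, frozen at 1 on the past. *)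
Definition wt d t : R := aff d t * Num.sqrt (aff d t).

Let aff_ge1 d t : 0 <= d -> 1 <= aff d t.
Proof. by move=> d0; rewrite /aff lerDl mulr_ge0// le_max lexx. Qed.

Lemma wt_gt0 d t : 0 <= d -> 0 < wt d t.
Proof.
by move=> d0; have := aff_ge1 t d0 => h; rewrite mulr_gt0 ?sqrtr_gt0//; lra.
Qed.

Lemma wt_ninc d d' s t : 0 <= d -> d <= d' -> s <= t -> wt d s <= wt d' t.
Proof.
move=> d0 dd st; have a1 := aff_ge1 s d0.
have le : aff d s <= aff d' t.
  rewrite /aff lerD2l; apply: ler_pM => //; first by rewrite le_max lexx.
  by rewrite ge_max le_max lexx /= le_max st orbT.
by rewrite /wt; apply: ler_pM => //; [lra|exact: ler_wsqrtr].
Qed.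

Lemma wt_pos d t : 0 <= t -> wt d t = (1 + d * t) * Num.sqrt (1 + d * t).
Proof. by move=> t0; rewrite /wt /aff max_r. Qed.

Lemma measurable_wt d : measurable_fun setT (wt d).
Proof.
have ma : measurable_fun setT (aff d).
  apply: measurable_funD => //; apply: measurable_funM => //.
  exact: measurable_maxr.
by apply: measurable_funM => //; exact: (measurableT_comp measurable_sqrt).
Qed.

(** Controls the commutator at distances t - s up to (1 + d s) / d; its integral tends to 0 with
    [d]. *)
Let cap d u : R := mker u * Num.min 1 (d * u).

Let cap_le d u : 0 <= d -> 0 <= cap d u <= mker u.
Proof.
move=> d0; have [u0|u0] := leP u 0; first by rewrite /cap mker_neg// mul0r lexx.
have m0 : 0 <= Num.min 1 (d * u) by rewrite le_min ler01 mulr_ge0// ltW.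
by rewrite mulr_ge0 ?mker_ge0//= ler_piMr ?mker_ge0// ge_min lexx.
Qed.

Let measurable_cap d : measurable_fun setT (cap d).
Proof.
apply: measurable_funM; first exact: measurable_mker.
by apply: measurable_minr => //; exact: measurable_funM.
Qed.

Let L1_cap d : 0 <= d -> L1 (cap d).
Proof.
move=> d0; apply: L1_le L1_mker; first exact: measurable_cap.
by move=> u; have /andP[h1 h2] := cap_le u d0; rewrite ger0_norm.
Qed.

Let cap_small e : 0 < e -> exists d, [/\ 0 < d, d <= e, d <= 1 & Lint (cap d) <= e].
Proof.
move=> e0; pose dn n : R := n.+1%:R^-1.
have dn0 n : 0 <= dn n by rewrite invr_ge0.
have lim : (fun n => Lint (cap (dn n))) @ \oo --> (Lint (fun=> 0) : R).
  apply: (@dominated_Lint _ _ _ mker) => //; last 2 first.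
  - exact: L1_mker.
  - by move=> n u; have /andP[h1 h2] := cap_le u (dn0 n); rewrite ger0_norm.
  move=> u; rewrite -[X in _ --> X](mulr0 (mker u)); apply: cvgM; first exact: cvg_cst.
  have cf : {for 0, continuous (fun x : R => Num.min 1 (x * u))}.
    by apply: continuous_min; [exact: cvg_cst|apply: cvgM; [exact: cvg_id|exact: cvg_cst]].
  have := cvg_comp dn (fun x : R => Num.min 1 (x * u)) (@cvg_harmonic R) cf.
  by rewrite mul0r min_r.
rewrite Lint0 in lim.
have [N1 _ H1] := cvgr_le _ lim _ e0.
have [N2 _ H2] := cvgr_le _ (@cvg_harmonic R) _ e0.
pose N := maxn N1 N2; exists (dn N); split.
- by rewrite invr_gt0.
- by apply: H2; exact: leq_maxr.
- by rewrite invf_le1// ler1n.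
- by apply: H1; exact: leq_maxl.
Qed.

Let ratio_bound (r : R) : 0 <= r ->
  (r <= 1 -> (1 + r) * Num.sqrt (1 + r) - 1 <= 2 * r) /\
  (1 <= r -> (1 + r) * Num.sqrt (1 + r) - 1 <= 3 * (r * Num.sqrt r)).
Proof.
move=> r0; split => r1.
  have h : Num.sqrt (1 + r) <= 1 + r / 2.
    rewrite -[X in _ <= X]ger0_norm -?sqrtr_sqr; last lra.
    by apply: ler_wsqrtr; have := sqr_ge0 r; lra.
  have := ler_wpM2l (_ : 0 <= 1 + r) h; nra.
have s1 : 1 <= Num.sqrt r by rewrite -sqrtr1; exact: ler_wsqrtr.
have h : Num.sqrt (1 + r) <= 3 / 2 * Num.sqrt r.
  have q0 : 0 <= 3 / 2 * Num.sqrt r by rewrite mulr_ge0 ?sqrtr_ge0//; lra.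
  rewrite -[X in _ <= X]ger0_norm// -sqrtr_sqr; apply: ler_wsqrtr.
  by rewrite exprMn sqr_sqrtr//; lra.
have h2 := ler_pM (_ : 0 <= 1 + r) (sqrtr_ge0 (1 + r)) (_ : 1 + r <= 2 * r) h.
by have := h2 _ _; lra.
Qed.

(** With r = d (t - s) / (1 + d s) the ratio of the weights is (1 + r)^(3/2). It exceeds 1 by at
    most 2 r for r <= 1 and by at most 3 r^(3/2) for r >= 1, and the latter power is compensated
    exactly by the tail (t - s)^(-3/2) of [mker]. *)
Let ratio_wt d s t : 0 < d -> 0 < s -> s < t ->
  mker (t - s) * (wt d t / wt d s - 1) <=
  2 * cap d (t - s) + 3 * (d * Num.sqrt d) * (hker (d * s + 1) / (d * s + 1)).
Proof.
move=> d0 s0 st; rewrite !wt_pos; [|lra..].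
pose b := d * s + 1; pose r := d * (t - s) / b.
have ds : 0 < d * s by rewrite mulr_gt0.
have b1 : 1 < b by rewrite /b; lra.
have b0 : 0 < b by lra.
have du : 0 < d * (t - s) by rewrite mulr_gt0//; lra.
have r0 : 0 <= r by rewrite divr_ge0// ltW.
have -> : 1 + d * s = b by rewrite addrC.
have -> : 1 + d * t = b * (1 + r) by rewrite /r mulrDr mulr1 mulrCA divff ?gt_eqF// /b; ring.
have sb : 0 < Num.sqrt b by rewrite sqrtr_gt0.
have -> : b * (1 + r) * Num.sqrt (b * (1 + r)) / (b * Num.sqrt b) = (1 + r) * Num.sqrt (1 + r).
  by rewrite sqrtrM ?(ltW b0)//; field; rewrite !gt_eqF.
have k0 : 0 <= hker b / b by rewrite divr_ge0 ?hker_ge0// ltW.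
have dd : 0 <= d * Num.sqrt d by rewrite mulr_ge0 ?sqrtr_ge0// ltW.
have c0 : 0 <= cap d (t - s) by have /andP[] := cap_le (t - s) (ltW d0).
have [h1 h2] := ratio_bound r0; have m0 := mker_ge0 (t - s).
have [r1|r1] := leP r 1.
  have hr : r <= Num.min 1 (d * (t - s)).
    by rewrite le_min r1 /r ler_pdivrMr// ler_peMr// ltW.
  have := ler_wpM2l m0 (h1 r1); have := ler_wpM2l m0 hr; rewrite -/(cap d (t - s)).
  have : 0 <= d * Num.sqrt d * (hker b / b) by rewrite mulr_ge0.
  lra.
have {}h2 := ler_wpM2l m0 (h2 (ltW r1)).
have tr0 : 0 <= r * Num.sqrt r by rewrite mulr_ge0 ?sqrtr_ge0.
have e : mker (t - s) * (r * Num.sqrt r) <= d * Num.sqrt d * (hker b / b).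
  apply: le_trans (ler_wpM2r tr0 (mker_le_V (t - s))) _.
  have u0 : 0 < t - s by lra.
  have su : 0 < Num.sqrt (t - s) by rewrite sqrtr_gt0.
  rewrite /r /hker sqrtrM ?(ltW du)// sqrtrV ?(ltW b0)// sqrtrM ?(ltW d0)//.
  rewrite le_eqVlt; apply/orP; left; apply/eqP; field.
  by rewrite !gt_eqF.
lra.
Qed.

Let tail_int d : 0 < d -> let f s := \1_`]1, +oo[%classic (d * s + 1) * (hker (d * s + 1) / (d * s + 1)) in
  L1 f /\ Lint f = 2 / d.
Proof.
move=> d0 f; have [L E] := @hkerV_int R; have dn : d != 0 by rewrite gt_eqF.
split; first exact: (L1_affine 1 dn L).
have := Lint_affine 1 dn L; rewrite E gtr0_norm// mulrC; exact.
Qed.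

Variables (T Am M : R) (al : R -> R) (c1 : C).
Hypothesis T0 : 0 < T.
Hypothesis mal : measurable_fun setT al.
Hypothesis alA : forall t, `|al t| <= Am.
Hypothesis M0 : 0 < M.
Local Notation K := (Kop al c1).
Local Notation Kc := (Kcst Am c1).
Hypothesis stab : forall y (X eta B0 : R), cmeas y ->
  (forall t, t <= X -> cabs (y t) <= B0) ->
  (forall t, t <= X -> cabs (y t + K y t) <= eta) ->
  forall t, t <= X -> cabs (y t) <= M * eta.

(** The first term of [ratio_wt] has an integral tending to 0 with [d]; the second contributes at
    most 6 sqrt d, since its profile has integral 2 / d against the prefactor 3 d^(3/2). Both bounds
    are uniform in t. *)
Lemma commutator_small e : 0 < e -> exists d, [/\ 0 < d, d <= 1 &
  forall t, let G s := \1_`]0, t[%classic s * (wt d t / wt d s - 1) in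
    L1 (fun s => mker (t - s) * G s) /\ Lint (fun s => mker (t - s) * G s) <= e].
Proof.
move=> e0; pose e' := Num.min (e / 4) ((e / 12) ^+ 2).
have e'0 : 0 < e' by rewrite lt_min divr_gt0//= exprn_gt0// divr_gt0.
have [d [d0 de d1 hd]] := cap_small e'0.
have [Lt Et] := tail_int d0; exists d; split => // t G.
have dd : 0 <= d * Num.sqrt d by rewrite mulr_ge0 ?sqrtr_ge0// ltW.
pose f s := \1_`]1, +oo[%classic (d * s + 1) * (hker (d * s + 1) / (d * s + 1)).
have Lc : L1 (fun s => cap d (t - s)) by apply: L1_subr; apply: L1_cap; exact: ltW.
have LB : L1 (fun s => 2 * cap d (t - s) + 3 * (d * Num.sqrt d) * f s).
  by apply: L1D; exact: L1Z.
have f0 s : 0 <= f s.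
  rewrite /f indicE; case: (boolP (_ \in _)) => [|_]; last by rewrite mul0r.
  by rewrite inE/= in_itv/= andbT => h; rewrite mul1r divr_ge0 ?hker_ge0//; lra.
have c0 s : 0 <= cap d (t - s) by have /andP[] := cap_le (t - s) (ltW d0).
have G0 s : 0 <= G s.
  rewrite /G indicE; case: (boolP (_ \in _)) => [|_]; last by rewrite mul0r.
  rewrite inE/= in_itv/= => /andP[_ st]; rewrite mul1r subr_ge0 ler_pdivlMr ?wt_gt0 ?(ltW d0)//.
  by rewrite mul1r; apply: wt_ninc => //; exact: ltW.
have bnd s : mker (t - s) * G s <= 2 * cap d (t - s) + 3 * (d * Num.sqrt d) * f s.
  rewrite /G indicE; case: (boolP (_ \in _)) => [|_]; last first.
    by rewrite mul0r mulr0 addr_ge0// mulr_ge0// mulr_ge0.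
  rewrite inE/= in_itv/= => /andP[s0 st]; rewrite mul1r.
  apply: le_trans (ratio_wt d0 s0 st) _; rewrite /f indicE mem_set ?mul1r//=.
  by rewrite in_itv/= andbT; have := mulr_gt0 d0 s0; lra.
have mG : measurable_fun setT (fun s => mker (t - s) * G s).
  apply: measurable_funM; first by apply: measurable_subr; exact: measurable_mker.
  apply: measurable_funM; first by apply: measurable_indic; exact: measurable_itv.
  apply: measurable_funB => //; apply: measurable_funM => //.
  by apply: (measurableT_comp measurable_inv); exact: measurable_wt.
have LG : L1 (fun s => mker (t - s) * G s).
  apply: L1_le mG _ LB => s; rewrite ger0_norm; [exact: bnd|].
  by rewrite mulr_ge0// mker_ge0.
split => //; apply: (le_trans (Lint_le LG LB bnd)).
rewrite LintD ?(LintZ _ Lc) ?(LintZ _ Lt) ?Et; [|exact: L1Z|exact: L1Z].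
rewrite (Lint_subr t (L1_cap (ltW d0))).
have h1 : 2 * Lint (cap d) <= e / 2.
  have : e' <= e / 4 by rewrite ge_min lexx.
  by move: hd; lra.
have h2 : 3 * (d * Num.sqrt d) * (2 / d) <= e / 2.
  have -> : 3 * (d * Num.sqrt d) * (2 / d) = 6 * Num.sqrt d by field; rewrite gt_eqF.
  have : Num.sqrt d <= e / 12.
    have q0 : 0 <= e / 12 by rewrite divr_ge0// ltW.
    rewrite -[X in _ <= X]ger0_norm// -sqrtr_sqr; apply: ler_wsqrtr.
    by apply: (le_trans de); rewrite ge_min lexx orbT.
  lra.
lra.
Qed.

Theorem weighted_decay : exists2 d, 0 < d & forall y F, cmeas y ->
  (forall t, t <= 0 -> y t = 0) ->
  (forall X, exists B, forall t, t <= X -> cabs (y t) <= B) ->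
  (forall t, cabs (y t + K y t) * wt 1 t <= F) ->
  forall t, cabs (y t) * wt d t <= 2 * (M * F).
Proof.
have K1 : 1 <= Kc by exact: Kcst_ge1.
(* A commutator of this size contributes S / 2 after multiplication by M Kc S, which [half_bound]
   absorbs. *)
have e0 : 0 < (2 * M * Kc)^-1.
  by rewrite invr_gt0 mulr_gt0 ?mulr_gt0//; lra.
have [d [d0 d1 com]] := commutator_small e0.
exists d => // y F my y0 yB yF t1.
have F0 : 0 <= F by apply: le_trans (yF 0); rewrite mulr_ge0 ?cabs_ge0// ltW// wt_gt0.
have d0' := ltW d0.
have [B hB] := yB t1.
(* The cut at [t1] provides the a priori bound needed by [stab] and [half_bound]; by causality it
   does not affect the equation up to [t1]. *)
pose z s := (\1_`]-oo, t1]%classic s * wt d s)%:C * y s.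
have mz : cmeas z.
  apply: cmeasM => //; apply: cmeas_real; apply: measurable_funM; last exact: measurable_wt.
  by apply: measurable_indic; exact: measurable_itv.
have zE s : s <= t1 -> z s = (wt d s)%:C * y s.
  by move=> st; rewrite /z indicE mem_set ?mul1r//= in_itv.
have zc s : s <= t1 -> cabs (z s) = cabs (y s) * wt d s.
  by move=> st; rewrite zE// cabsM cabs_real ger0_norm 1?mulrC// ltW// wt_gt0.
have zB s : s <= t1 -> cabs (z s) <= B * wt d t1.
  move=> st; rewrite zc//; apply: ler_pM; rewrite ?cabs_ge0 ?hB//.
    by rewrite ltW// wt_gt0.
  exact: wt_ninc.
suff : forall s, s <= t1 -> cabs (z s) <= 2 * (M * F).
  by move=> /(_ t1 (lexx _)); rewrite zc.
apply: (half_bound (D := [set s | s <= t1]) (f := fun s => cabs (z s)) zB) => S zS t /= tt1.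
have S0 : 0 <= S by apply: le_trans (zS t tt1); exact: cabs_ge0.
suff res s : s <= t1 -> cabs (z s + K z s) <= F + Kc * (S * (2 * M * Kc)^-1).
  apply: (le_trans (stab mz zB res tt1)).
  have -> : M * (F + Kc * (S * (2 * M * Kc)^-1)) = M * F + S / 2.
    by field; rewrite !gt_eqF//; lra.
  by [].
move=> st1; pose G u := \1_`]0, s[%classic u * (wt d s / wt d u - 1).
have [L I] : L1 (fun u => mker (s - u) * G u) /\
  Lint (fun u => mker (s - u) * G u) <= (2 * M * Kc)^-1 := com s.
(* [K f] at time s is the commutator of [K] with the weight; [f] vanishes on u <= 0 because [y]
   does. *)
pose f u := 1 * z u + (- (wt d s)%:C) * y u.
have bz : bdd_before z s by exists (B * wt d t1) => u us; apply: zB; lra.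
have by' : bdd_before y s by exists B => u us; apply: hB; lra.
have Kf : K f s = K z s - (wt d s)%:C * K y s.
  by rewrite (Kop_lin c1 mal alA 1 (- (wt d s)%:C) mz my bz by') mul1r mulNr.
have mf : cmeas f.
  by apply: cmeasD; apply: cmeasM => //; exact: cmeas_cst.
have fG u : u < s -> cabs (f u) <= S * G u.
  move=> us; rewrite /f zE; last by lra.
  have ut1 : u <= t1 by lra.
  have -> : 1 * ((wt d u)%:C * y u) + - (wt d s)%:C * y u = (wt d u - wt d s)%:C * y u.
    by rewrite rmorphB /=; ring.
  have [u0|u0] := leP u 0.
    by rewrite y0// mulr0 cabs0 /G indicE memNset ?mul0r ?mulr0//= in_itv/=; lra.
  rewrite /G indicE mem_set ?mul1r/=; last by rewrite in_itv/= u0 us.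
  have wu := wt_gt0 u d0'; have ws := wt_ninc d0' (lexx d) (ltW us).
  rewrite cabsM cabs_real ler0_norm ?subr_le0// opprB.
  have -> : S * (wt d s / wt d u - 1) = (wt d s - wt d u) * (S / wt d u).
    by field; rewrite gt_eqF.
  apply: ler_wpM2l; first by rewrite subr_ge0.
  by rewrite ler_pdivlMr// -zc//; exact: zS.
have LG : L1 (fun u => mker (s - u) * (S * G u)).
  by apply: (eq_L1 _ (L1Z S L)) => u; ring.
have hK := Kop_le c1 mal alA mf fG LG.
have E : Lint (fun u => mker (s - u) * (S * G u)) = S * Lint (fun u => mker (s - u) * G u).
  by rewrite -(LintZ S L); apply: eq_Lint => u; ring.
rewrite E in hK.
have -> : z s + K z s = (wt d s)%:C * (y s + K y s) + K f s.
  by rewrite Kf zE//; ring.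
apply: (le_trans (cabsD _ _)); apply: lerD.
  rewrite cabsM cabs_real ger0_norm ?(ltW (wt_gt0 s d0'))// mulrC.
  apply: le_trans (yF s); rewrite ler_wpM2l ?cabs_ge0//; exact: wt_ninc.
apply: (le_trans hK); apply: ler_wpM2l; first lra.
exact: ler_wpM2l.
Qed.

End Weights.

(** * The free evolution of the bound state *)

Section SigmaFiniteProduct.
Context {R : realType} d1 d2 (S1 : measurableType d1) (S2 : measurableType d2)
  (m1 : {sigma_finite_measure set S1 -> \bar R}) (m2 : {sigma_finite_measure set S2 -> \bar R}).

Lemma sigma_finite_prod : sigma_finite setT (m1 \x m2)%E.
Proof.
have /sigma_finiteP[F [TF ndF hF]] := sigma_finiteT m1.
have /sigma_finiteP[G [TG ndG hG]] := sigma_finiteT m2.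
exists (fun n => F n `*` G n) => [|n]; last first.
  have [mF fF] := hF n; have [mG fG] := hG n; split; first exact: measurableX.
  by rewrite product_measure1E// lte_mul_pinfty// ge0_fin_numE.
apply/seteqP; split => // -[x y] _.
have [i _ Fi] : (\bigcup_n F n) x by rewrite -TF.
have [j _ Gj] : (\bigcup_n G n) y by rewrite -TG.
exists (i + j)%N => //; split => /=.
  by move: x Fi; exact/subsetPset/ndF/leq_addr.
by move: y Gj; exact/subsetPset/ndG/leq_addl.
Qed.

(** The product measure packed with its sigma-finite structure, so that it can be the left factor of
    the product defining [leb3]. *)
Definition sigma_finite_prod_measure : {sigma_finite_measure set (S1 * S2)%type -> \bar R} :=
  HB.pack (product_measure1 m1 m2)
    (Measure_isSigmaFinite.Build _ _ _ (product_measure1 m1 m2) sigma_finite_prod).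

End SigmaFiniteProduct.

Section FreeEvolution.
Context {R : realType}.
Local Notation C := R[i].
Local Notation leb := (@lebesgue_measure R).
Local Notation leb3 := (@leb3 R).
Local Notation R3 := (@R3 R).
Implicit Types (s t u r : R) (y : R3).

Lemma integrable_prod d d' (S : measurableType d) (S' : measurableType d')
  (m : {sigma_finite_measure set S -> \bar R}) (m' : {sigma_finite_measure set S' -> \bar R})
  (F : S -> R) (G : S' -> R) :
  m.-integrable setT (EFin \o F) -> m'.-integrable setT (EFin \o G) ->
  (m \x m')%E.-integrable setT (EFin \o (fun z => F z.1 * G z.2)).
Proof.
move=> iF iG.
have mF : measurable_fun setT F by apply/measurable_EFinP; exact: measurable_int iF.
have mG : measurable_fun setT G by apply/measurable_EFinP; exact: measurable_int iG.
apply/integrable12ltyP.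
  apply/measurable_EFinP; apply: measurable_funM; first exact: (measurableT_comp mF).
  exact: (measurableT_comp mG).
have E z : (\int[m']_x `|(F z * G x)%:E| = `|(F z)%:E| * \int[m']_x `|(G x)%:E|)%E.
  rewrite -ge0_integralZl//; last exact/measurableT_comp/measurable_EFinP.
  by apply: eq_integral => x _; rewrite EFinM abseM.
rewrite /=; under eq_integral do rewrite E.
have /integrableP[_ fG] := iG.
rewrite ge0_integralZr//; last 2 first.
- exact/measurableT_comp/measurable_EFinP.
- exact: integral_ge0.
rewrite muleC lte_mul_pinfty//; first exact: integral_ge0.
  by rewrite ge0_fin_numE//; exact: integral_ge0.
by have /integrableP[] := iF.
Qed.

Lemma integrable_prod3 d1 d2 d3 (S1 : measurableType d1) (S2 : measurableType d2)
  (S3 : measurableType d3) (m1 : {sigma_finite_measure set S1 -> \bar R})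
  (m2 : {sigma_finite_measure set S2 -> \bar R}) (m3 : {sigma_finite_measure set S3 -> \bar R})
  (F1 : S1 -> R) (F2 : S2 -> R) (F3 : S3 -> R) :
  m1.-integrable setT (EFin \o F1) -> m2.-integrable setT (EFin \o F2) ->
  m3.-integrable setT (EFin \o F3) ->
  ((m1 \x m2) \x m3)%E.-integrable setT (EFin \o (fun z => F1 z.1.1 * F2 z.1.2 * F3 z.2)).
Proof.
move=> i1 i2 i3; have i12 := integrable_prod i1 i2.
exact: (@integrable_prod _ _ _ _ (sigma_finite_prod_measure m1 m2) m3 _ _ i12 i3).
Qed.

Lemma null_coordinate_planes d1 d2 d3 (S1 : measurableType d1) (S2 : measurableType d2)
  (S3 : measurableType d3) (m1 : {sigma_finite_measure set S1 -> \bar R})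
  (m2 : {sigma_finite_measure set S2 -> \bar R}) (m3 : {sigma_finite_measure set S3 -> \bar R})
  (N1 : set S1) (N2 : set S2) (N3 : set S3) :
  measurable N1 -> measurable N2 -> measurable N3 -> m1 N1 = 0 -> m2 N2 = 0 -> m3 N3 = 0 ->
  let N := (((N1 `*` setT) `*` setT) `|` ((setT `*` N2) `*` setT)) `|` (setT `*` N3) in
  measurable N /\ ((m1 \x m2) \x m3)%E N = 0.
Proof.
move=> mN1 mN2 mN3 z1 z2 z3 N.
have p1 : measurable (N1 `*` setT : set (S1 * S2)) by exact: measurableX.
have p2 : measurable (setT `*` N2 : set (S1 * S2)) by exact: measurableX.
have q1 : measurable ((N1 `*` setT) `*` setT : set (S1 * S2 * S3)) by exact: measurableX.
have q2 : measurable ((setT `*` N2) `*` setT : set (S1 * S2 * S3)) by exact: measurableX.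
have q3 : measurable (setT `*` N3 : set (S1 * S2 * S3)) by exact: measurableX.
split; first by apply: measurableU => //; exact: measurableU.
have E (A : set (S1 * S2)) (B : set S3) : measurable A -> measurable B ->
    ((m1 \x m2) \x m3)%E (A `*` B) = ((m1 \x m2)%E A * m3 B)%E by move=> mA mB; exact: product_measure1E.
have E' (A : set S1) (B : set S2) : measurable A -> measurable B ->
    (m1 \x m2)%E (A `*` B) = (m1 A * m2 B)%E by move=> mA mB; exact: product_measure1E.
rewrite /N measureU0 ?measureU0//=; first by rewrite E// E'// z1 !mul0e.
- by rewrite E// E'// z2 mule0 mul0e.
- exact: measurableU.
- by rewrite E// z3 mule0.
Qed.

(** By dominated convergence the integral is continuous in the frequency [l]; this gives
    measurability in time of the free evolution without an explicit formula. *)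
Lemma measurable_cos_integral d (S : measurableType d) (m : {measure set S -> \bar R})
  (N phi : S -> R) (c : R) : measurable_fun setT N -> m.-integrable setT (EFin \o phi) ->
  (forall x, 0 <= phi x) ->
  measurable_fun setT (fun l : R => Rintegral m setT (fun x => cos (l * N x + c) * phi x)).
Proof.
move=> mN iphi phi0; apply: continuous_measurable_fun => l.
have mphi : measurable_fun setT phi by apply/measurable_EFinP; exact: measurable_int iphi.
apply: (cvg_nbhsP (V := R^o) (fun l : R => Rintegral m setT (fun x => cos (l * N x + c) * phi x)) l _).2.
move=> u ul.
have mf (k : R) : measurable_fun setT (EFin \o (fun x => cos (k * N x + c) * phi x)).
  apply/measurable_EFinP; apply: measurable_funM => //.
  apply: (measurableT_comp measurable_cos); apply: measurable_funD => //.
  exact: measurable_funM.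
have cf : {ae m, forall x, setT x ->
    (fun n => (EFin \o (fun x => cos (u n * N x + c) * phi x)) x) @ \oo -->
    (EFin \o (fun x => cos (l * N x + c) * phi x)) x}.
  apply: aeW => x _; apply: cvg_EFin; first exact: nearW.
  apply: cvgM; last exact: cvg_cst.
  apply: continuous_cvg; first exact: continuous_cos.
  by apply: cvgD; [apply: cvgM => //; exact: cvg_cst|exact: cvg_cst].
have le (k : R) x : `|cos (k * N x + c) * phi x| <= phi x.
  by rewrite normrM (ger0_norm (phi0 x)) ler_piMl// ler_norml cos_geN1 cos_le1.
have fg : {ae m, forall x n, setT x ->
    (`|(EFin \o (fun x => (cos (u n * N x + c) * phi x)%R)) x| <= (EFin \o phi) x)%E}.
  by apply: aeW => x n _; rewrite /= lee_fin; exact: le.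
have [iL _ H] := dominated_convergence measurableT (fun n => mf (u n)) (mf l) cf iphi fg.
apply: fine_cvg; rewrite -[X in _ --> X]/(Rintegral m setT (fun x => cos (l * N x + c) * phi x))%:E.
by rewrite /Rintegral fineK//; exact: integrable_fin_num.
Qed.

(** The even extension of [mker]; the product over the three coordinates is an integrable function
    on space. *)
Let m2 x : R := mker x + mker (- x).

Let L1_m2 : L1 m2.
Proof.
apply: L1D; first exact: L1_mker.
have := L1_subr 0 (@L1_mker R); apply: eq_L1 => x; by rewrite sub0r.
Qed.

Let m2_ge0 x : 0 <= m2 x.
Proof. by rewrite addr_ge0 ?mker_ge0. Qed.

Lemma measurable_norm3 : measurable_fun setT (@norm3 R).
Proof.
apply: (measurableT_comp measurable_sqrt).
have m1 : measurable_fun setT (fun y : R3 => y.1.1) by exact: (measurableT_comp measurable_fst measurable_fst).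
have m2' : measurable_fun setT (fun y : R3 => y.1.2) by exact: (measurableT_comp measurable_snd measurable_fst).
have m3 : measurable_fun setT (fun y : R3 => y.2) by exact: measurable_snd.
by apply: measurable_funD; [apply: measurable_funD|]; apply: measurable_funX.
Qed.

Let measurable_eigfun a : measurable_fun setT (@eigfun R a).
Proof.
have mn := measurable_norm3.
apply: measurable_funM; last exact: (measurableT_comp measurable_inv).
apply: measurable_funM => //; apply: measurableT_comp => //.
exact: measurable_funM.
Qed.

Lemma eigfun_ge0 a y : 0 <= eigfun a y.
Proof. by rewrite divr_ge0 ?sqrtr_ge0// mulr_ge0 ?sqrtr_ge0 ?expR_ge0. Qed.

Lemma poly4_expR (k : R) : 0 < k -> exists2 B, 0 < B & forall r, 0 <= r ->
  (1 + r) ^+ 4 * expR (- (k * r)) <= B.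
Proof.
move=> k0; pose b := 1 + 4 / k.
have b1 : 1 <= b by rewrite lerDl divr_ge0// ltW.
exists (b ^+ 4) => [|r r0]; first by rewrite exprn_gt0//; lra.
have e1 : 1 + r <= b * expR (k * r / 4).
  have := expR_ge1Dx (k * r / 4) => h.
  apply: le_trans (ler_wpM2l (_ : 0 <= b) h); last lra.
  have -> : b * (1 + k * r / 4) = 1 + r + 4 / k + k * r / 4 by rewrite /b; field; rewrite gt_eqF.
  have : 0 <= 4 / k by rewrite divr_ge0// ltW.
  have : 0 <= k * r by rewrite mulr_ge0// ltW.
  lra.
have e2 : (1 + r) ^+ 4 <= b ^+ 4 * expR (k * r).
  have -> : expR (k * r) = expR (k * r / 4) ^+ 4.
    by rewrite -expRM_natr; congr expR; field.
  rewrite -exprMn; apply: lerXn2r; rewrite ?nnegrE//; first lra.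
  by rewrite mulr_ge0 ?expR_ge0//; lra.
rewrite expRN ler_pdivrMr ?expR_gt0//.
Qed.

Let mker_m2 x r : x != 0 -> `|x| <= r -> hker r / (1 + r) <= m2 x.
Proof.
move=> x0 xr; have a0 : 0 < `|x| by rewrite normr_gt0.
have E : m2 x = mker `|x|.
  rewrite /m2; have [x1|x1] := leP x 0.
    by rewrite [mker x]mker_neg// add0r ler0_norm.
  by rewrite [mker (- x)]mker_neg ?addr0 ?gtr0_norm// oppr_le0 ltW.
rewrite E /mker; apply: ler_pM.
- exact: hker_ge0.
- by rewrite invr_ge0; lra.
- exact: hker_ninc.
rewrite le_min invf_le1 ?lef_pV2 ?posrE//; lra.
Qed.

Let hker_cube r : 0 < r -> (hker r / (1 + r)) ^+ 3 = (r * Num.sqrt r * (1 + r) ^+ 3)^-1.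
Proof.
move=> r0; rewrite expr_div_n /hker exprVn -invfM; congr (_ * _)^-1.
by rewrite 2!exprS expr1 sqrt_sqr ?(ltW r0)// mulrC.
Qed.

(* Each coordinate is at most [r = |y|] in modulus, so each factor [m2 y_i] is at least
   [r^(-1/2) / (1 + r)]; the cube of this beats [1 / r] at 0, and the exponential wins at infinity. *)
Lemma eigfun_le a : a < 0 -> exists2 B, 0 < B & forall y : R3,
  y.1.1 != 0 -> y.1.2 != 0 -> y.2 != 0 -> eigfun a y <= B * (m2 y.1.1 * m2 y.1.2 * m2 y.2).
Proof.
move=> a0; pose k := - (4 * pi * a).
have k0 : 0 < k by rewrite oppr_gt0 pmulr_rlt0// mulr_gt0// pi_gt0.
have [B B0 hB] := poly4_expR k0; pose s := Num.sqrt (2 * `|a|).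
have s0 : 0 < s by rewrite sqrtr_gt0 mulr_gt0// normr_gt0 lt_eqF.
exists (s * B); first by rewrite mulr_gt0.
move=> [[y1 y2] y3] /= n1 n2 n3; pose r := norm3 (y1, y2, y3).
have le x z w : x ^+ 2 + z ^+ 2 + w ^+ 2 = y1 ^+ 2 + y2 ^+ 2 + y3 ^+ 2 -> `|x| <= r.
  move=> e; rewrite -sqrtr_sqr; apply: ler_wsqrtr; rewrite /= -e.
  by rewrite -addrA lerDl addr_ge0// sqr_ge0.
have r1 : `|y1| <= r by apply: (le y1 y2 y3).
have r2 : `|y2| <= r by apply: (le y2 y1 y3); ring.
have r3 : `|y3| <= r by apply: (le y3 y1 y2); ring.
have r0 : 0 < r by apply: lt_le_trans r1; rewrite normr_gt0.
rewrite /eigfun -/r -/s.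
have -> : 4 * pi * a * r = - (k * r) by rewrite /k; ring.
have h0 : 0 <= hker r / (1 + r) by rewrite divr_ge0 ?hker_ge0//; lra.
have low : (hker r / (1 + r)) ^+ 3 <= m2 y1 * m2 y2 * m2 y3.
  rewrite !exprS expr0 mulr1 mulrA; apply: ler_pM => //; first exact: mulr_ge0.
    by apply: ler_pM => //; exact: mker_m2.
  exact: mker_m2.
rewrite -[s * B * _]mulrA -[s * _ / r]mulrA; apply: ler_wpM2l; first exact: ltW.
apply: le_trans (ler_wpM2l (ltW B0) low).
have q0 : 0 < Num.sqrt r by rewrite sqrtr_gt0.
have qr : Num.sqrt r * Num.sqrt r = r by rewrite sqrt_sqr// ltW.
have q1 : Num.sqrt r <= 1 + r by have := sqr_ge0 (Num.sqrt r - 1); rewrite sqrrB1 expr2 qr; lra.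
have d1 : (hker r / (1 + r)) ^+ 3 = (r * Num.sqrt r * (1 + r) ^+ 3)^-1.
  exact: hker_cube.
have r10 : 0 < 1 + r by lra.
have p3 : 0 < (1 + r) ^+ 3 by rewrite exprn_gt0//; lra.
rewrite d1 ler_pdivlMr ?mulr_gt0//.
have -> : expR (- (k * r)) / r * (r * Num.sqrt r * (1 + r) ^+ 3) =
  Num.sqrt r * (1 + r) ^+ 3 * expR (- (k * r)) by field; rewrite gt_eqF.
apply: le_trans (hB r (ltW r0)); apply: ler_wpM2r; first exact: expR_ge0.
by rewrite [X in _ <= X]exprS; apply: ler_wpM2r => //; exact: ltW.
Qed.

Lemma integrable_eigfun a : a < 0 -> leb3.-integrable setT (EFin \o eigfun a).
Proof.
move=> a0; have [B B0 hB] := eigfun_le a0.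
have mE : measurable_fun setT (EFin \o eigfun a) by exact/measurable_EFinP.
have iF : leb3.-integrable setT (fun y => (B * (m2 y.1.1 * m2 y.1.2 * m2 y.2))%:E).
  have i3 := @integrable_prod3 _ _ _ _ _ _ leb leb leb m2 m2 m2 L1_m2 L1_m2 L1_m2.
  exact: (integrableZl measurableT B i3).
have z1 : leb [set 0] = 0 by exact: lebesgue_measure_set1.
have m1 : measurable ([set 0] : set R) by [].
(* The majorant fails on the coordinate planes, since [m2] is 0 at 0; they form a null set. *)
have [mN N0] := @null_coordinate_planes _ _ _ _ _ _ leb leb leb _ _ _ m1 m1 m1 z1 z1 z1.
set N := (_ `|` _) in mN N0.
apply/integrableP; split => //.
have -> : (\int[leb3]_y `|(EFin \o eigfun a) y| = \int[leb3]_(y in setT `\` N) `|(EFin \o eigfun a) y|)%E.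
  by apply: ge0_negligible_integral => //; exact: measurableT_comp.
have /integrableP[mG] := iF; apply: le_lt_trans.
apply: (@le_trans _ _ (\int[leb3]_(y in setT `\` N) `|(B * (m2 y.1.1 * m2 y.1.2 * m2 y.2))%:E|)%E).
  apply: ge0_le_integral => //.
  - exact: measurableD.
  - by apply: measurable_funTS; apply: measurableT_comp => //; exact: mE.
  - by apply: measurable_funTS; apply: measurableT_comp => //; exact: mG.
  move=> [[y1 y2] y3] [_ /= yN]; rewrite lee_fin !ger0_norm ?eigfun_ge0//; last first.
    by rewrite mulr_ge0 ?(ltW B0)// !mulr_ge0.
  apply: hB => /=; apply/eqP => y0; apply: yN; rewrite /N/=.
  - by left; left.
  - by left; right.
  - by right.
apply: ge0_subset_integral => //; first exact: measurableD.
by apply: measurableT_comp => //; exact: mG.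
Qed.

(** Up to the scalar factor of the kernel, the real and the imaginary part of the free evolution at
    the origin are both of this form, with phases [c] differing by pi / 2. *)
Let J (a c l : R) : R := Rintegral leb3 setT (fun y => cos (l * norm3 y ^+ 2 + c) * eigfun a y).

Let mcos c l : measurable_fun setT (fun y : R3 => cos (l * norm3 y ^+ 2 + c)).
Proof.
apply: (measurableT_comp measurable_cos); apply: measurable_funD => //.
by apply: measurable_funM => //; apply: measurable_funX; exact: measurable_norm3.
Qed.

Let cos_le_eig a c l y : `|cos (l * norm3 y ^+ 2 + c) * eigfun a y| <= eigfun a y.
Proof.
rewrite normrM (ger0_norm (eigfun_ge0 a y)) ler_piMl ?eigfun_ge0//.
by rewrite ler_norml cos_geN1 cos_le1.
Qed.

Let integrable_J a c l : a < 0 ->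
  leb3.-integrable setT (EFin \o (fun y => cos (l * norm3 y ^+ 2 + c) * eigfun a y)).
Proof.
move=> a0; apply: (le_integrable _ _ _ (integrable_eigfun a0)) => //.
  by apply/measurable_EFinP; apply: measurable_funM; [exact: mcos|exact: measurable_eigfun].
move=> y _; rewrite /= lee_fin (ger0_norm (eigfun_ge0 a y)); exact: cos_le_eig.
Qed.

Let J_le a c l : a < 0 -> `|J a c l| <= Rintegral leb3 setT (eigfun a).
Proof.
move=> a0; apply: (le_trans (le_normr_Rintegral _ (integrable_J c l a0))) => //.
apply: le_Rintegral => //.
- by have := integrable_abse (integrable_J c l a0).
- exact: integrable_eigfun.
Qed.

Let measurable_J a c : a < 0 -> measurable_fun setT (J a c).
Proof.
move=> a0; apply: (measurable_cos_integral c _ (integrable_eigfun a0)); last exact: eigfun_ge0.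
by apply: measurable_funX; exact: measurable_norm3.
Qed.

Lemma powR_hker (x : R) : 0 < x -> x `^ (- (3 / 2)) = hker x / x.
Proof.
move=> x0; have -> : - (3 / 2) = - (2^-1 + 1) :> R by lra.
rewrite powRN powRD; last by rewrite gt_eqF//; apply/implyP.
by rewrite powRr1 ?(ltW x0)// powR12_sqrt ?(ltW x0)// invfM.
Qed.

Let P s : R := (4 * pi * s) `^ (- (3 / 2)).
Let th : R := - (3 * pi / 4).

Let freeE a s : a < 0 ->
  complex.Re (freeAt0 (fun y => (eigfun a y)%:C) s) = P s * J a th (4 * s)^-1 /\
  complex.Im (freeAt0 (fun y => (eigfun a y)%:C) s) = P s * J a (th - pi / 2) (4 * s)^-1.
Proof.
move=> a0; have nE y : norm3 ((- y.1.1, - y.1.2, - y.2) : R3) = norm3 y.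
  by rewrite /norm3 /= !sqrrN.
split; rewrite /J -RintegralZl//; try exact: integrable_J.
  apply: eq_Rintegral => y _; rewrite /U0kernel nE /expi -/th -/(P s) [_^-1 * _]mulrC cosD /=; ring.
apply: eq_Rintegral => y _; rewrite /U0kernel nE /expi -/th -/(P s) [_^-1 * _]mulrC addrA cosBpihalf sinD /=; ring.
Qed.

(** By the convention for powers of 0, the kernel is 0 at time 0. *)
Lemma freeAt0_0 a : freeAt0 (fun y => (eigfun a y)%:C) 0 = 0.
Proof.
have p0 : (0 : R) `^ (- (3 / 2)) = 0 by rewrite powR0// oppr_eq0; lra.
have z : Rintegral leb3 setT (fun=> 0) = 0 by rewrite /Rintegral integral0.
by apply: eqC => /=; rewrite -[RHS]z; apply: eq_Rintegral => y _;
  rewrite /U0kernel (mulr0 (4 * pi)) p0 /=; ring.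
Qed.

Lemma cmeas_freeAt0 a : a < 0 -> cmeas (fun s => freeAt0 (fun y => (eigfun a y)%:C) s).
Proof.
move=> a0.
have mi : measurable_fun setT (fun s : R => (4 * s)^-1).
  by apply: (measurableT_comp measurable_inv); exact: measurable_funM.
have mP : measurable_fun setT P.
  apply: (measurableT_comp (measurable_powR _)); exact: measurable_funM.
have mPJ c : measurable_fun setT (fun s => P s * J a c (4 * s)^-1).
  by apply: measurable_funM => //; exact: (measurableT_comp (measurable_J c a0) mi).
split.
  by apply: eq_measurable_fun (mPJ th) => s _; rewrite (freeE s a0).1.
by apply: eq_measurable_fun (mPJ (th - pi / 2)) => s _; rewrite (freeE s a0).2.
Qed.

(** The dispersive estimate: the kernel has modulus (4 pi s)^(-3/2) and the eigenfunction is
    integrable. The bound is not integrable at s = 0, so the forcing near 0 is treated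
    separately. *)
Lemma freeAt0_bound a : a < 0 -> exists2 B, 0 <= B &
  forall s, 0 < s -> cabs (freeAt0 (fun y => (eigfun a y)%:C) s) <= B * (hker s / s).
Proof.
move=> a0; pose I := Rintegral leb3 setT (eigfun a).
have I0 : 0 <= I by apply: le_trans (J_le 0 0 a0).
exists (2 * I) => [|s s0]; first by rewrite mulr_ge0.
have pi1 : 1 <= 4 * pi :> R by have := @pi_ge2 R; lra.
have P0 : 0 <= P s by exact: powR_ge0.
have ps : s <= 4 * pi * s by rewrite ler_peMl// ltW.
have PB : P s <= hker s / s.
  rewrite /P powR_hker; last lra.
  apply: ler_pM; rewrite ?hker_ge0 ?invr_ge0//; try lra.
    exact: hker_ninc.
  by rewrite lef_pV2 ?posrE//; lra.
apply: (le_trans (cabs_le_abs _)); have [-> ->] := freeE s a0.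
rewrite !normrM (ger0_norm P0).
have h1 := ler_pM P0 (normr_ge0 _) PB (J_le th (4 * s)^-1 a0).
have h2 := ler_pM P0 (normr_ge0 _) PB (J_le (th - pi / 2) (4 * s)^-1 a0).
rewrite -/I in h1 h2; lra.
Qed.

End FreeEvolution.

(** * The Volterra equation of the charge *)

Section VolterraTools.
Context {R : realType}.
Local Notation C := R[i].
Local Notation leb := (@lebesgue_measure R).
Implicit Types (f g F : R -> C) (k v : R -> R) (s t u r X : R).

(** The positive or the negative part has infinite integral, so their difference is an infinite
    extended real, which [fine] sends to 0. *)
Lemma Lint_nonintegrable (h : R -> R) : measurable_fun setT h -> ~ L1 h -> Lint h = 0.
Proof.
move=> mh nL; have mE : measurable_fun setT (EFin \o h) by exact/measurable_EFinP.
have sumE : (\int[leb]_x `|(EFin \o h) x| =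
    \int[leb]_x ((EFin \o h)^\+ x) + \int[leb]_x ((EFin \o h)^\- x))%E.
  rewrite -ge0_integralD//; [|exact: measurable_funepos|exact: measurable_funeneg].
  by apply: eq_integral => x _; rewrite -[LHS]/((abse \o (EFin \o h)) x) fune_abse.
have inf : (\int[leb]_x `|(EFin \o h) x| = +oo)%E.
  by apply/eqP; rewrite eq_le leey leNgt; apply/negP => lt; apply: nL; apply/integrableP.
have aux (a b : \bar R) : (0 <= a)%E -> (0 <= b)%E -> (+oo = a + b)%E -> fine (a - b)%E = 0.
  by case: a b => [x||] [y||].
rewrite /Lint /Rintegral integralE; apply: aux; [exact: integral_ge0|exact: integral_ge0|].
by rewrite -inf.
Qed.

(** Fubini for k1 (t - s) k2 (s - r) F r: integrating in s first produces the convolution of the two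
    kernels at t - r, whence associativity. *)
Lemma conv_fubini k1 k2 F t : measurable_fun setT k1 -> measurable_fun setT k2 ->
  (forall u, 0 <= k1 u) -> (forall u, 0 <= k2 u) -> cmeas F ->
  (forall t, L1 (fun u => k1 u * k2 (t - u))) ->
  (forall s, CL1 (fun r => (k2 (s - r))%:C * F r)) ->
  L1 (fun r => Lint (fun u => k1 u * k2 (t - r - u)) * cabs (F r)) ->
  CL1 (fun s => (k1 (t - s))%:C * conv k2 F s) /\
  conv k1 (conv k2 F) t = conv (fun x => Lint (fun u => k1 u * k2 (x - u))) F t.
Proof.
move=> mk1 mk2 k10 k20 mF L12 L2 L3.
pose H r s : C := (k1 (t - s) * k2 (s - r))%:C * F r.
have LH1 r : L1 (fun s => k1 (t - s) * k2 (s - r)).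
  apply: (eq_L1 _ (L1_subr t (L12 (t - r)))) => s; congr (_ * k2 _); ring.
have EH1 r : Lint (fun s => k1 (t - s) * k2 (s - r)) = Lint (fun u => k1 u * k2 (t - r - u)).
  by rewrite -(Lint_subr t (L12 (t - r))); apply: eq_Lint => s; congr (_ * k2 _); ring.
have mH : cmeas (fun z : R * R => H z.1 z.2).
  apply: cmeasM; last exact: (cmeas_comp mF).
  apply: cmeas_real; apply: measurable_funM.
    by apply: (measurableT_comp mk1); exact: measurable_funB.
  by apply: (measurableT_comp mk2); exact: measurable_funB.
have CH1 r : CL1 (H r).
  have h : CL1 (fun s => F r * (k1 (t - s) * k2 (s - r))%:C).
    by apply: CL1Z; split; [exact: LH1|exact: L1_0].
  by apply: eq_CL1 h => s; rewrite mulrC.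
have EH s r : H r s = (k1 (t - s))%:C * ((k2 (s - r))%:C * F r).
  by rewrite /H rmorphM mulrA.
have CH2 s : CL1 (H^~ s) by apply: (eq_CL1 (fun r => esym (EH s r))); exact: CL1Z.
have N r : Lint (fun s => cabs (H r s)) = Lint (fun u => k1 u * k2 (t - r - u)) * cabs (F r).
  rewrite -EH1 mulrC -(LintZ _ (LH1 r)); apply: eq_Lint => s.
  by rewrite cabsM cabs_real ger0_norm ?mulr_ge0// mulrC.
have [_ A2 E] := fubini_CL1 mH CH1 CH2 (eq_L1 (fun r => esym (N r)) L3).
have E2 s : Cint (H^~ s) = (k1 (t - s))%:C * conv k2 F s.
  by rewrite (eq_Cint (EH s)) CintZ.
split; first exact: eq_CL1 E2 A2.
rewrite /conv -(eq_Cint E2) -E; apply: eq_Cint => r.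
rewrite -EH1 -Cint_real mulrC -CintZ; last by split; [exact: LH1|exact: L1_0].
by apply: eq_Cint => s; rewrite mulrC.
Qed.

Lemma sqrt_hker u : 0 < u -> Num.sqrt u * hker u = 1.
Proof. by move=> u0; rewrite mulfV// gt_eqF// sqrtr_gt0. Qed.

(** The charge is known only through its products with [hker (t - s)]; multiplying by sqrt (n - s)
    undoes this factor once n > s, so [f] is a pointwise limit of measurable functions. *)
Lemma cmeas_hker_mul f : (forall t, cmeas (fun s => (hker (t - s))%:C * f s)) -> cmeas f.
Proof.
move=> H; pose fn (n : nat) s : C := (Num.sqrt (n%:R - s))%:C * ((hker (n%:R - s))%:C * f s).
have mn n : cmeas (fn n).
  apply: cmeasM; last exact: H.
  by apply: cmeas_real; apply: (measurable_subr n%:R measurable_sqrt).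
have E s n : (Num.bound s <= n)%N -> fn n s = f s.
  move=> h; rewrite /fn mulrA -rmorphM sqrt_hker ?mul1r// subr_gt0.
  apply: (le_lt_trans (ler_norm s)); apply: (lt_le_trans (archi_boundP (normr_ge0 s))).
  by rewrite ler_nat; apply: leq_trans h; rewrite /Num.bound normr_id.
split.
  apply: (measurable_fun_cvg (fun n => (mn n).1)) => s _.
  by apply: cvg_near_cst; exists (Num.bound s) => // n /= /E ->.
apply: (measurable_fun_cvg (fun n => (mn n).2)) => s _.
by apply: cvg_near_cst; exists (Num.bound s) => // n /= /E ->.
Qed.

(** On ]0, X] the factor [hker (X + 1 - s)] is bounded below by [hker (X + 1)], so it can be divided
    out. *)
Lemma L1_hker_local v X : measurable_fun setT v -> (forall s, s <= 0 -> v s = 0) ->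
  L1 (fun s => hker (X + 1 - s) * v s) -> 0 <= X -> L1 (fun s => \1_`]-oo, X]%classic s * v s).
Proof.
move=> mv v0 L X0; apply: L1_le (L1Z (Num.sqrt (X + 1)) (L1_abs L)).
  by apply: measurable_funM => //; apply: measurable_indic; exact: measurable_itv.
move=> s; rewrite indicE; case: (boolP (s \in _)) => [|_]; last first.
  by rewrite mul0r normr0 mulr_ge0 ?sqrtr_ge0.
rewrite inE/= in_itv/= => sX; rewrite mul1r.
have [s0|s0] := leP s 0; first by rewrite v0// normr0 mulr0 normr0 mulr0.
rewrite normrM (ger0_norm (hker_ge0 _)) mulrA ler_peMl//.
rewrite -[X in X <= _](@sqrt_hker (X + 1)); last lra.
by apply: ler_wpM2l; [exact: sqrtr_ge0|apply: hker_ninc; lra].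
Qed.

Section LocalForcing.
Variables (ga : R -> R) (B : R).
Hypothesis mga : measurable_fun setT ga.
Hypothesis B0 : 0 <= B.
Hypothesis gaB : forall s, 0 < s -> `|ga s| <= B * (hker s / s).
Hypothesis ga0 : forall s, s <= 0 -> ga s = 0.
Hypothesis Lga : L1 (fun s => \1_`]-oo, 1]%classic s * ga s).

Lemma L1_forcing X : L1 (fun s => \1_`]-oo, X]%classic s * ga s).
Proof.
have h1 : 1 <= Num.max 1 X by rewrite le_max lexx.
have [LI _] := Lint_itv_cst B h1.
apply: L1_le (L1D (L1_abs Lga) LI).
  by apply: measurable_funM => //; apply: measurable_indic; exact: measurable_itv.
move=> s; rewrite !indicE.
have m x : (s \in `]-oo, x]%classic) = (s <= x) by apply/idP/idP; rewrite inE/= in_itv/=.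
have m' x z : (s \in `]x, z]%classic) = (x < s <= z) by apply/idP/idP; rewrite inE/= in_itv/=.
rewrite !m m'; have [sX|sX] := leP s X; last first.
  by rewrite mul0r normr0 addr_ge0// mulr_ge0.
have [s1|s1] := leP s 1; first by rewrite !mul1r mul0r addr0.
rewrite le_max sX orbT !mul1r mul0r normr0 add0r.
apply: (le_trans (gaB _)); first lra.
rewrite ler_piMr// ler_pdivrMr ?mul1r; last lra.
apply: (@le_trans _ _ 1); last lra.
have := @hker_ninc R 1 s ltr01 (ltW s1); by rewrite /hker sqrtr1 invr1.
Qed.

(** The integral is cut at t / 2: before it [hker (t - s)] is bounded and [ga] is integrable, after
    it [ga] is bounded and [hker (t - s)] is integrable. *)
Lemma hker_forcing t : 0 < t ->
  let G s := hker (t / 2) * `|\1_`]-oo, t]%classic s * ga s| +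
    B * (hker (t / 2) / (t / 2)) * (\1_`]0, t[%classic (t - s) * hker (t - s)) in
  [/\ L1 G, forall s, `|hker (t - s) * ga s| <= G s &
    Lint G = hker (t / 2) * Lint (fun s => `|\1_`]-oo, t]%classic s * ga s|) +
      B * (hker (t / 2) / (t / 2)) * (2 * Num.sqrt t)].
Proof.
move=> t0 G; have [Lh Eh] := hker_itv_int t0; have Lh' := L1_subr t Lh.
have La := L1_abs (L1_forcing t).
have h0 : 0 <= hker (t / 2) by exact: hker_ge0.
have k0 : 0 <= B * (hker (t / 2) / (t / 2)) by rewrite mulr_ge0// divr_ge0//; lra.
split.
- by apply: L1D; exact: L1Z.
- move=> s; rewrite /G.
  have n0 : 0 <= hker (t / 2) * `|\1_`]-oo, t]%classic s * ga s| by rewrite mulr_ge0.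
  have n1 : 0 <= \1_`]0, t[%classic (t - s) * hker (t - s) by rewrite mulr_ge0 ?hker_ge0.
  have n2 := mulr_ge0 k0 n1.
  have [s0|s0] := leP s 0; first by rewrite [X in `|X|](_ : _ = 0) ?normr0 ?addr_ge0// ga0 ?mulr0.
  have [st|st] := leP t s; first by rewrite hker_neg ?mul0r ?normr0 ?addr_ge0//; lra.
  rewrite normrM (ger0_norm (hker_ge0 _)).
  have [s2|s2] := leP s (t / 2).
    rewrite -[X in X <= _]addr0; apply: lerD => //.
    rewrite indicE mem_set ?mul1r; last by rewrite /= in_itv/=; lra.
    by apply: ler_wpM2r => //; apply: hker_ninc; lra.
  rewrite -[X in X <= _]add0r; apply: lerD => //.
  rewrite [\1_`]0, t[%classic (t - s)]indicE mem_set ?mul1r; last by rewrite /= in_itv/=; lra.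
  rewrite mulrC; apply: ler_wpM2r; first exact: hker_ge0.
  apply: (le_trans (gaB s0)); apply: ler_wpM2l => //.
  apply: ler_pM; rewrite ?hker_ge0 ?invr_ge0//; try lra.
    by apply: hker_ninc; lra.
  by rewrite lef_pV2 ?posrE//; lra.
rewrite LintD; [|exact: L1Z|exact: L1Z].
by rewrite (LintZ _ La) (LintZ _ Lh') (Lint_subr t Lh) Eh.
Qed.

Lemma L1_hker_forcing t : L1 (fun s => hker (t - s) * ga s).
Proof.
have [t0|t0] := leP t 0.
  apply: (eq_L1 _ (@L1_0 R)) => s; have [s0|s0] := leP s 0; first by rewrite ga0 ?mulr0.
  by rewrite hker_neg ?mul0r//; lra.
have [LG GB _] := hker_forcing t0; apply: L1_le GB LG.
by apply: measurable_funM => //; apply: measurable_subr; exact: measurable_hker.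
Qed.

Lemma Lint_hker_forcing t X : 1 / 2 <= t -> t <= X ->
  Lint (fun s => `|hker (t - s) * ga s|) <=
  2 * Lint (fun s => `|\1_`]-oo, X]%classic s * ga s|) + B * 8 * (2 * Num.sqrt X).
Proof.
move=> t1 tX; have t0 : 0 < t by lra.
have [LG GB EG] := hker_forcing t0.
apply: (le_trans (Lint_le (L1_abs (L1_hker_forcing t)) LG GB)); rewrite EG.
(* As t / 2 >= 1/4, the values at 1/4 give the constants: 2 for [hker] and 4 for the inverse. *)
have h2 : hker (t / 2) <= 2.
  have e2 : hker (2^-1 ^+ 2) = 2 :> R by rewrite /hker sqrtr_sqr ger0_norm ?invrK.
  rewrite -[X in _ <= X]e2.
  by apply: hker_ninc; rewrite ?exprn_gt0// expr2; lra.
have i4 : (t / 2)^-1 <= 4 by rewrite -[X in _ <= X]invrK lef_pV2 ?posrE//; lra.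
apply: lerD.
  apply: ler_pM => //; [exact: hker_ge0|exact: Lint_ge0|].
  apply: Lint_le; [exact/L1_abs/L1_forcing|exact/L1_abs/L1_forcing|].
  move=> s; rewrite !normrM; apply: ler_wpM2r => //.
  rewrite !ger0_norm ?indicE// ler_nat.
  by case: (boolP (s \in _)) => //; rewrite inE/= in_itv/= => h; rewrite mem_set//= in_itv/=; lra.
apply: ler_pM.
- by rewrite mulr_ge0// divr_ge0 ?hker_ge0//; lra.
- by rewrite mulr_ge0// sqrtr_ge0.
- apply: ler_wpM2l => //; have -> : 8 = 2 * 4 :> R by ring.
  by apply: ler_pM; rewrite ?hker_ge0 ?invr_ge0//; lra.
by rewrite ler_wpM2l//; exact: ler_wsqrtr.
Qed.

End LocalForcing.

(* If [ga] is not integrable at 0, the Lebesgue integrals in the charge equation take the junk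
   value 0 for every [t], exactly as if [ga] were 0. *)
Lemma effective_forcing (ga : R -> R) (B : R) : measurable_fun setT ga -> 0 <= B ->
  (forall s, 0 < s -> `|ga s| <= B * (hker s / s)) -> ga 0 = 0 ->
  exists ga' : R -> R, [/\ measurable_fun setT ga', forall s, s <= 0 -> ga' s = 0,
    forall s, 0 < s -> `|ga' s| <= B * (hker s / s),
    L1 (fun s => \1_`]-oo, 1]%classic s * ga' s) &
    forall t, 0 <= t -> Lint (fun s => \1_`[0, t]%classic s * (ga s * hker (t - s))) =
      Lint (fun s => hker (t - s) * ga' s)].
Proof.
move=> mga B0 gaB ga00; pose g0 s := \1_`]0, +oo[%classic s * ga s.
have mg0 : measurable_fun setT g0.
  by apply: measurable_funM => //; apply: measurable_indic; exact: measurable_itv.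
have g0E s : 0 < s -> g0 s = ga s.
  by move=> s0; rewrite /g0 indicE mem_set ?mul1r//= in_itv/= s0.
have g0n s : s <= 0 -> g0 s = 0.
  by move=> s0; rewrite /g0 indicE memNset ?mul0r//= in_itv/= andbT; lra.
have g0B s : 0 < s -> `|g0 s| <= B * (hker s / s) by move=> s0; rewrite g0E// gaB.
have m0 t s : (s \in `[0, t]%classic) = (0 <= s <= t) by apply/idP/idP; rewrite inE/= in_itv/=.
have [L|nL] := pselect (L1 (fun s => \1_`]-oo, 1]%classic s * g0 s)).
  exists g0; split => // t t0; apply: eq_Lint => s; rewrite indicE m0.
  have [s0|s0] := leP s 0.
    rewrite g0n// mulr0; have [->|sn] := eqVneq s 0; first by rewrite ga00 mul0r mulr0.
    by rewrite leNgt lt_neqAle sn s0 mul0r.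
  rewrite g0E// (ltW s0)/=; have [st|st] := leP s t; first by rewrite mul1r mulrC.
  by rewrite mul0r hker_neg ?mul0r//; lra.
exists (fun=> 0); split => //.
- by move=> s s0; rewrite normr0 mulr_ge0// divr_ge0 ?hker_ge0// ltW.
- by apply: (eq_L1 _ (@L1_0 R)) => s; rewrite mulr0.
move=> t t0; rewrite [RHS](_ : _ = 0); last first.
  by rewrite -[RHS](@Lint0 R); apply: eq_Lint => s; rewrite mulr0.
move: t0; rewrite le_eqVlt => /orP[/eqP <-|t0].
  rewrite -[RHS](@Lint0 R); apply: eq_Lint => s; rewrite indicE m0.
  have [s0|s0] := leP 0 s; last by rewrite mul0r.
  by rewrite sub0r hker_neg ?mulr0// oppr_le0.
apply: Lint_nonintegrable.
  apply: measurable_funM; first by apply: measurable_indic; exact: measurable_itv.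
  by apply: measurable_funM => //; apply: measurable_subr; exact: measurable_hker.
move=> L; apply: nL.
have [LI _] := Lint_itv_cst (B * (hker t / t)) (@ler01 R).
apply: L1_le (L1D (L1Z (Num.sqrt t) (L1_abs L)) LI).
  by apply: measurable_funM => //; apply: measurable_indic; exact: measurable_itv.
have k0 : 0 <= B * (hker t / t) by rewrite mulr_ge0// divr_ge0 ?hker_ge0// ltW.
move=> s; have n1 : 0 <= \1_`]0, 1]%classic s * (B * (hker t / t)) by rewrite mulr_ge0// indicE.
have n2 : 0 <= Num.sqrt t * `|\1_`[0, t]%classic s * (ga s * hker (t - s))|.
  by rewrite mulr_ge0 ?sqrtr_ge0.
have [s0|s0] := leP s 0; first by rewrite g0n// mulr0 normr0 addr_ge0.
rewrite g0E// [X in X <= _]normrM [\1_`]-oo, 1]%classic s]indicE.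
case: (boolP (s \in `]-oo, 1]%classic)) => [|_]; last by rewrite normr0 mul0r addr_ge0.
rewrite inE/= in_itv/= => s1; rewrite normr1 mul1r.
have [st|st] := ltP s t.
  rewrite -[X in X <= _]addr0; apply: lerD => //.
  rewrite indicE m0 (ltW s0) (ltW st) mul1r normrM (ger0_norm (hker_ge0 _)) mulrCA ler_peMr//.
  rewrite -(sqrt_hker t0); apply: ler_wpM2l; first exact: sqrtr_ge0.
  by apply: hker_ninc; lra.
rewrite -[X in X <= _]add0r; apply: lerD => //.
rewrite [\1_`]0, 1]%classic s]indicE mem_set ?mul1r; last by rewrite /= in_itv/= s0.
apply: (le_trans (gaB _ s0)); apply: ler_wpM2l => //.
apply: ler_pM; rewrite ?hker_ge0 ?invr_ge0 ?(ltW s0)//; first exact: hker_ninc.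
by rewrite lef_pV2 ?posrE.
Qed.

(** Two tails of order u^(-3/2) convolve to a tail of the same order: before t / 2 the factor
    [mker (t - s)] is already of that order in t, after it [v] is. For t >= 1 the second range lies
    in s >= 1/2, where [v] is bounded by hypothesis. *)
Lemma mker_conv_decay v (B : R) : measurable_fun setT v -> (forall s, 0 <= v s) ->
  L1 (fun s => \1_`]-oo, 1 / 2]%classic s * v s) -> 0 <= B ->
  (forall s, 1 / 2 <= s -> v s <= B * (hker s / s)) ->
  exists2 A, 0 <= A & forall t, 1 <= t ->
    L1 (fun s => mker (t - s) * v s) /\ Lint (fun s => mker (t - s) * v s) <= A * (hker t / t).
Proof.
move=> mv v0 L B0 vB.
have m x s : (s \in `]-oo, x]%classic) = (s <= x) by apply/idP/idP; rewrite inE/= in_itv/=.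
have Lv : L1 v.
  apply: L1_le (L1D L (L1Z (2 * B) (@L1_mker R))) => // s; rewrite ger0_norm// indicE m.
  have [s2|s2] := leP s (1 / 2); first by rewrite mul1r lerDl mulr_ge0 ?mker_ge0// mulr_ge0.
  rewrite mul0r add0r; apply: (le_trans (vB s (ltW s2))).
  rewrite [2 * B]mulrC -mulrA; apply: ler_wpM2l => //; rewrite /mker mulrCA.
  apply: ler_wpM2l; first exact: hker_ge0.
  have i2 : s^-1 <= 2 by rewrite -[X in _ <= X]invrK lef_pV2 ?posrE//; lra.
  have i0 : 0 <= s^-1 by rewrite invr_ge0; lra.
  by rewrite /Num.min; case: ifP => _; lra.
have A0 : 0 <= Lint v by exact: Lint_ge0.
have m0 := @Lint_mker_ge0 R.
exists (3 * (Lint v + B * Lint mker)).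
  by rewrite mulr_ge0// addr_ge0// mulr_ge0.
move=> t t1; have t0 : 0 < t by lra.
(* Halving the argument costs a factor 2^(3/2) <= 3. *)
have kE : hker (t / 2) / (t / 2) <= 3 * (hker t / t).
  have -> : hker (t / 2) = hker 2^-1 * hker t by rewrite mulrC hkerM 1?mulrC.
  have h : hker 2^-1 <= 3 / 2 :> R.
    have e2 : hker ((2 / 3) ^+ 2) = 3 / 2 :> R.
      by rewrite /hker sqrtr_sqr ger0_norm ?invf_div// divr_ge0.
    rewrite -[X in _ <= X]e2.
    by apply: hker_ninc; rewrite ?exprn_gt0 ?divr_gt0//; lra.
  have -> : hker 2^-1 * hker t / (t / 2) = 2 * hker 2^-1 * (hker t / t).
    by field; rewrite gt_eqF.
  by apply: ler_wpM2r; [rewrite divr_ge0 ?hker_ge0// ltW|lra].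
pose k := hker (t / 2) / (t / 2).
have k0 : 0 <= k by rewrite divr_ge0 ?hker_ge0//; lra.
have LB : L1 (fun s => k * v s + B * k * mker (t - s)).
  by apply: L1D; apply: L1Z => //; apply: L1_subr; exact: L1_mker.
have bnd s : mker (t - s) * v s <= k * v s + B * k * mker (t - s).
  have n1 : 0 <= B * k * mker (t - s) by rewrite mulr_ge0 ?mker_ge0// mulr_ge0.
  have n2 : 0 <= k * v s by rewrite mulr_ge0.
  have [s2|s2] := leP s (t / 2).
    rewrite -[X in X <= _]addr0; apply: lerD => //; apply: ler_wpM2r => //.
    apply: (le_trans (mker_le_V _)); apply: ler_pM; rewrite ?hker_ge0 ?invr_ge0//; try lra.
      by apply: hker_ninc; lra.
    by rewrite lef_pV2 ?posrE//; lra.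
  rewrite -[X in X <= _]add0r; apply: lerD => //; rewrite mulrC.
  apply: ler_wpM2r; first exact: mker_ge0.
  apply: (le_trans (vB s _)); first lra.
  apply: ler_wpM2l => //; apply: ler_pM; rewrite ?hker_ge0 ?invr_ge0//; try lra.
    by apply: hker_ninc; lra.
  by rewrite lef_pV2 ?posrE//; lra.
have Lm : L1 (fun s => mker (t - s) * v s).
  apply: L1_le LB; first by apply: measurable_funM => //; apply: measurable_subr; exact: measurable_mker.
  by move=> s; rewrite ger0_norm ?bnd// mulr_ge0 ?mker_ge0.
split => //; apply: (le_trans (Lint_le Lm LB bnd)).
have Lms : L1 (fun s => mker (t - s)) by apply: L1_subr; exact: L1_mker.
rewrite LintD; [|exact: L1Z|exact: L1Z].
rewrite (LintZ _ Lv) (LintZ _ Lms) (Lint_subr t (@L1_mker R)).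
have -> : k * Lint v + B * k * Lint mker = k * (Lint v + B * Lint mker) by ring.
have q0 : 0 <= Lint v + B * Lint mker by rewrite addr_ge0// mulr_ge0.
apply: (le_trans (ler_wpM2r q0 kE)); lra.
Qed.

End VolterraTools.

(** * Local bounds and truncation of the charge *)

Section ChargeDecay.
Context {R : realType}.
Local Notation C := R[i].
Variables (q0 v g : R -> C) (al : R -> R) (c1 : C) (Am B : R).
Hypothesis mal : measurable_fun setT al.
Hypothesis alA : forall t, `|al t| <= Am.
Hypothesis B0 : 0 <= B.
Hypothesis mg : cmeas g.
Hypothesis g0 : forall s, s <= 0 -> g s = 0.
Hypothesis gB : forall s, 0 < s -> cabs (g s) <= B * (hker s / s).
Hypothesis Lg : L1 (fun s => \1_`]-oo, 1]%classic s * cabs (g s)).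
Hypothesis q00 : forall s, s <= 0 -> q0 s = 0.
Hypothesis vE : forall s, v s = (al s)%:C * q0 s.
Hypothesis Lv : forall t, CL1 (fun s => (hker (t - s))%:C * v s).
Hypothesis volterra : forall t, q0 t + c1 * conv hker v t = c1 * conv hker g t.
Implicit Types (s t u r X : R).

(** With this net source the equation reads q0 = c1 h*F. *)
Let F s := g s - v s.

Let Am0 : 0 <= Am. Proof. exact: le_trans (alA 0). Qed.

Lemma cmeas_conv_arg (k : R -> R) t (f : R -> C) : measurable_fun setT k -> cmeas f ->
  cmeas (fun s => (k (t - s))%:C * f s).
Proof. by move=> mk mf; apply: cmeasM => //; apply: cmeas_real; exact: measurable_subr. Qed.

Lemma CL1_dominated_factor (k k' : R -> R) t (f : R -> C) : measurable_fun setT k ->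
  (forall u, 0 <= k u <= k' u) -> cmeas f ->
  CL1 (fun s => (k' (t - s))%:C * f s) -> CL1 (fun s => (k (t - s))%:C * f s).
Proof.
move=> mk kk mf L; apply: CL1_le (CL1_cabs L); first exact: cmeas_conv_arg.
move=> s; have /andP[k0 k1] := kk (t - s).
by rewrite !cabsM !cabs_real !ger0_norm ?(le_trans k0)// ler_wpM2r ?cabs_ge0.
Qed.

Let ga s := cabs (g s).
Let mga : measurable_fun setT ga. Proof. exact: measurable_cabs. Qed.
Let gaB s : 0 < s -> `|ga s| <= B * (hker s / s).
Proof. by move=> s0; rewrite ger0_norm ?cabs_ge0// gB. Qed.
Let ga0 s : s <= 0 -> ga s = 0.
Proof. by move=> s0; rewrite /ga g0// cabs0. Qed.

Lemma CL1_hker_g t : CL1 (fun s => (hker (t - s))%:C * g s).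
Proof.
apply: CL1_le (L1_hker_forcing mga B0 gaB ga0 Lg t).
  by apply: cmeas_conv_arg => //; exact: measurable_hker.
by move=> s; rewrite cabsM cabs_real ger0_norm ?hker_ge0.
Qed.

Let mv : cmeas v. Proof. by apply: cmeas_hker_mul => t; exact: CL1_meas. Qed.
Let mF : cmeas F. Proof. exact: cmeasB. Qed.
Let v0 s : s <= 0 -> v s = 0. Proof. by move=> s0; rewrite vE q00// mulr0. Qed.
Let F0 s : s <= 0 -> F s = 0. Proof. by move=> s0; rewrite /F g0// v0// subr0. Qed.

Let LF t : CL1 (fun s => (hker (t - s))%:C * F s).
Proof.
by apply: eq_CL1 (CL1B (CL1_hker_g t) (Lv t)) => s; rewrite mulrBr.
Qed.

Let q0E t : q0 t = c1 * conv hker F t.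
Proof.
have -> : conv hker F t = conv hker g t - conv hker v t.
  rewrite /conv -CintB//; last exact: CL1_hker_g.
  by apply: eq_Cint => s; rewrite mulrBr.
by rewrite mulrBr -volterra addrK.
Qed.

Let LaF t : L1 (fun s => hker (t - s) * cabs (F s)).
Proof.
by apply: eq_L1 (CL1_cabs (LF t)) => s; rewrite cabsM cabs_real ger0_norm ?hker_ge0.
Qed.

Let locF X : 0 <= X -> L1 (fun s => \1_`]-oo, X]%classic s * cabs (F s)).
Proof.
move=> X0; apply: L1_hker_local => //; first exact: measurable_cabs.
by move=> s s0; rewrite F0// cabs0.
Qed.

Let hh x := Lint (fun u : R => hker u * hker (x - u)).

Let hhE t r : 0 <= t -> hh (t - r) * cabs (F r) = betac * (\1_`]-oo, t[%classic r * cabs (F r)).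
Proof.
move=> t0; rewrite indicE.
have -> : (r \in `]-oo, t[%classic) = (r < t) by apply/idP/idP; rewrite inE/= in_itv/=.
have [rt|rt] := ltP r t; first by rewrite /hh (hker_conv_hker (t - r)).2 ?subr_gt0// mul1r.
rewrite /hh [Lint _](_ : _ = 0) ?mul0r ?mulr0// -[RHS](@Lint0 R); apply: eq_Lint => u.
have [u0|u0] := leP u 0; first by rewrite hker_neg// mul0r.
by rewrite [X in _ * X]hker_neg ?mulr0//; lra.
Qed.

Let LhhF t : 0 <= t -> L1 (fun r => hh (t - r) * cabs (F r)) /\
  Lint (fun r => hh (t - r) * cabs (F r)) <=
  betac * Lint (fun r => \1_`]-oo, t]%classic r * cabs (F r)).
Proof.
move=> t0; have L := locF t0.
have le r : \1_`]-oo, t[%classic r * cabs (F r) <= \1_`]-oo, t]%classic r * cabs (F r).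
  apply: ler_wpM2r; first exact: cabs_ge0.
  rewrite !indicE ler_nat; case: (boolP (r \in `]-oo, t[%classic)) => // /set_mem/=.
  by rewrite in_itv/= => rt; rewrite mem_set//= in_itv/= ltW.
have L' : L1 (fun r => \1_`]-oo, t[%classic r * cabs (F r)).
  apply: L1_le L.
    apply: measurable_funM; last exact: measurable_cabs.
    by apply: measurable_indic; exact: measurable_itv.
  by move=> r; rewrite ger0_norm ?mulr_ge0 ?cabs_ge0.
have L'' := L1Z (betac) L'.
split; first by apply: eq_L1 L'' => r; rewrite hhE.
rewrite (eq_Lint (fun r => hhE r t0)) LintZ//; apply: ler_wpM2l; first exact/ltW/betac_gt0.
exact: Lint_le.
Qed.

Let hh_neg t r : t < 0 -> hh (t - r) * cabs (F r) = 0.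
Proof.
move=> t0; have [r0|r0] := leP r 0; first by rewrite F0// cabs0 mulr0.
rewrite /hh [Lint _](_ : _ = 0) ?mul0r// -[RHS](@Lint0 R); apply: eq_Lint => u.
have [u0|u0] := leP u 0; first by rewrite hker_neg// mul0r.
by rewrite [X in _ * X]hker_neg ?mulr0//; lra.
Qed.

Let L1hhF t : L1 (fun r => hh (t - r) * cabs (F r)).
Proof.
have [t0|t0] := leP 0 t; first exact: (LhhF t0).1.
by apply: (eq_L1 _ (@L1_0 R)) => r; rewrite hh_neg.
Qed.

Let L1hh t : L1 (fun u : R => hker u * hker (t - u)). Proof. exact: (hker_conv_hker t).1. Qed.

(** Inserting q0 = c1 h*F produces h*h, which is constant on the positive half-line; what remains is
    the integrability of [F] up to t. *)
Lemma CL1_hker_q0 t : CL1 (fun s => (hker (t - s))%:C * q0 s).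
Proof.
have [L _] := conv_fubini (@measurable_hker R) (@measurable_hker R) (@hker_ge0 R) (@hker_ge0 R)
  mF L1hh LF (L1hhF t).
by apply: eq_CL1 (CL1Z c1 L) => s; rewrite q0E mulrCA.
Qed.

Lemma cmeas_q0 : cmeas q0.
Proof. by apply: cmeas_hker_mul => t; exact/CL1_meas/CL1_hker_q0. Qed.

Let P s := Lint (fun r => hker (s - r) * cabs (F r)).

Let q0P s : cabs (q0 s) <= cabs c1 * P s.
Proof.
rewrite q0E cabsM ler_wpM2l ?cabs_ge0//; apply: Cint_abs_le => // r.
by rewrite cabsM cabs_real ger0_norm ?hker_ge0.
Qed.

Let hP t : 0 <= t -> L1 (fun s => hker (t - s) * P s) /\
  Lint (fun s => hker (t - s) * P s) <=
  betac * Lint (fun r => \1_`]-oo, t]%classic r * cabs (F r)).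
Proof.
move=> t0; pose G s : C := (cabs (F s))%:C.
have mG : cmeas G by apply: cmeas_real; exact: measurable_cabs.
have cG r : cabs (G r) = cabs (F r) by rewrite cabs_real ger0_norm ?cabs_ge0.
have LG s : CL1 (fun r => (hker (s - r))%:C * G r).
  by split; [apply: eq_L1 (LaF s) => r|apply: eq_L1 (@L1_0 R) => r];
    rewrite ?ReM ?ImM/= ?mul0r ?mulr0 ?subr0 ?addr0.
have LhG : L1 (fun r => hh (t - r) * cabs (G r)).
  by apply: eq_L1 (L1hhF t) => r; rewrite cG.
have [L E] := conv_fubini (@measurable_hker R) (@measurable_hker R) (@hker_ge0 R) (@hker_ge0 R)
  mG L1hh LG LhG.
have cP s : conv hker G s = (P s)%:C.
  by rewrite /conv -Cint_real; apply: eq_Cint => r; rewrite rmorphM.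
have LP : L1 (fun s => hker (t - s) * P s).
  by apply: eq_L1 L.1 => s; rewrite cP ReM/= mul0r subr0.
split => //.
have -> : Lint (fun s => hker (t - s) * P s) = Lint (fun r => hh (t - r) * cabs (F r)).
  have E1 : conv hker (conv hker G) t = (Lint (fun s => hker (t - s) * P s))%:C.
    by rewrite -Cint_real; apply: eq_Cint => s; rewrite cP rmorphM.
  have E2 : conv hh G t = (Lint (fun r => hh (t - r) * cabs (F r)))%:C.
    by rewrite -Cint_real; apply: eq_Cint => s; rewrite rmorphM.
  by have := congr1 (@complex.Re R) E; rewrite E1 -/hh E2.
exact: (LhhF t0).2.
Qed.

(** Abel's device: |v| <= Am |c1| h*|F|, and one more convolution with h turns the right side into a
    multiple of the integral of |F| up to t, which is finite. This bounds h*v on bounded intervals;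
    h*g is bounded away from 0 only, hence t >= 1/2. *)
Lemma q0_locally_bounded X : 1 / 2 <= X ->
  exists2 Q, 0 <= Q & forall t, 1 / 2 <= t -> t <= X -> cabs (q0 t) <= Q.
Proof.
move=> X2; pose Q1 := 2 * Lint (fun s => `|\1_`]-oo, X]%classic s * ga s|) + B * 8 * (2 * Num.sqrt X).
pose Q2 := Am * (cabs c1 * (betac * Lint (fun r => \1_`]-oo, X]%classic r * cabs (F r)))).
have X0 : 0 <= X by lra.
have b0 := @betac_gt0 R.
have ind0 r : 0 <= \1_`]-oo, X]%classic r * cabs (F r) by rewrite mulr_ge0 ?cabs_ge0.
exists (cabs c1 * (Q1 + Q2)).
  rewrite mulr_ge0 ?cabs_ge0// addr_ge0//.
    by rewrite addr_ge0 ?mulr_ge0 ?sqrtr_ge0//; exact: Lint_ge0.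
  rewrite mulr_ge0// mulr_ge0 ?cabs_ge0// mulr_ge0 ?(ltW b0)//; exact: Lint_ge0.
move=> t t2 tX; have t0 : 0 <= t by lra.
have -> : q0 t = c1 * (conv hker g t - conv hker v t) by rewrite mulrBr -volterra addrK.
rewrite cabsM ler_wpM2l ?cabs_ge0//; apply: (le_trans (cabsD _ _)); rewrite cabsN; apply: lerD.
  apply: le_trans (Lint_hker_forcing mga B0 gaB ga0 Lg t2 tX).
  apply: Cint_abs_le; [exact: CL1_hker_g|exact/L1_abs/(L1_hker_forcing mga B0 gaB ga0 Lg)|].
  by move=> s; rewrite cabsM cabs_real normrM [`|ga s|]ger0_norm ?cabs_ge0.
have [LP leP] := hP t0.
apply: (@le_trans _ _ (Lint (fun s => Am * (cabs c1 * (hker (t - s) * P s))))).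
  apply: Cint_abs_le => //; first exact/L1Z/L1Z.
  move=> s; rewrite cabsM cabs_real ger0_norm ?hker_ge0// vE cabsM cabs_real.
  have -> : Am * (cabs c1 * (hker (t - s) * P s)) = hker (t - s) * (Am * (cabs c1 * P s)) by ring.
  by rewrite ler_wpM2l ?hker_ge0// ler_pM ?cabs_ge0.
rewrite LintZ; last exact: L1Z.
rewrite LintZ// ler_wpM2l// ler_wpM2l ?cabs_ge0//; apply: (le_trans leP).
rewrite ler_wpM2l ?(ltW b0)//; apply: Lint_le; [exact: locF|exact: locF|].
move=> r; rewrite ler_wpM2r ?cabs_ge0// !indicE ler_nat.
case: (boolP (r \in `]-oo, t]%classic)) => // /set_mem/=.
by rewrite in_itv/= => rt; rewrite mem_set//= in_itv/=; lra.
Qed.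

Let mh x := Lint (fun u : R => muker u * hker (x - u)).
Let mhE x : mh x = hker x - kker x. Proof. by rewrite kkerE opprB addrC subrK. Qed.
Let mmh : measurable_fun setT mh.
Proof.
rewrite (_ : mh = (fun x => hker x - kker x)); last by apply/funext => x; rewrite mhE.
by apply: measurable_funB; [exact: measurable_hker|exact: measurable_kker].
Qed.
Let mh_le u : 0 <= mh u <= hker u.
Proof.
rewrite muker_conv_hker_le andbT; apply: Lint_ge0 => r.
by rewrite mulr_ge0 ?muker_ge0 ?hker_ge0.
Qed.
Let kker_le u : 0 <= (kker u : R) <= hker u.
Proof. by rewrite kker_ge0 (le_trans (kker_le_mker u))// mker_le_hker. Qed.
Let muker_le u : 0 <= (muker u : R) <= hker u.
Proof. by rewrite muker_ge0 (le_trans (muker_le_mker u))// mker_le_hker. Qed.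

Let Lkg t : CL1 (fun s => (kker (t - s))%:C * g s).
Proof. by apply: CL1_dominated_factor (CL1_hker_g t) => //; exact: measurable_kker. Qed.
Let Lkv t : CL1 (fun s => (kker (t - s))%:C * v s).
Proof. by apply: CL1_dominated_factor (Lv t) => //; exact: measurable_kker. Qed.
Let Lmq t : CL1 (fun s => (muker (t - s))%:C * q0 s).
Proof.
apply: CL1_dominated_factor (CL1_hker_q0 t) => //; [exact: measurable_muker|exact: cmeas_q0].
Qed.

(* Convolving the equation with the unit mass at 0 minus [muker] replaces the kernel [hker], which
   is not integrable at infinity, by the integrable kernel [kker]. *)
Lemma regularized_equation t : q0 t + Kop al c1 q0 t = c1 * conv kker g t.
Proof.
have LmF : CL1 (fun s => (mh (t - s))%:C * F s) by apply: CL1_dominated_factor (LF t).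
have LmF' : L1 (fun r => mh (t - r) * cabs (F r)).
  apply: eq_L1 (CL1_cabs LmF) => r; rewrite cabsM cabs_real ger0_norm//.
  by case/andP: (mh_le (t - r)).
have [L E] := conv_fubini (@measurable_muker R) (@measurable_hker R) (@muker_ge0 R) (@hker_ge0 R)
  mF (fun x => (muker_conv_hker x).1) LF LmF'.
have Eq : conv muker q0 t = c1 * conv mh F t.
  rewrite -E /conv -CintZ//; apply: eq_Cint => s; by rewrite q0E mulrCA.
have Ek : conv kker F t = conv hker F t - conv mh F t.
  rewrite /conv -CintB//; apply: eq_Cint => s.
  by rewrite -mulrBl -rmorphB mhE subKr.
have Eg : conv kker F t = conv kker g t - conv kker v t.
  by rewrite /conv -CintB//; apply: eq_Cint => s; rewrite mulrBr.
have Ev : conv kker (fun s => (al s)%:C * q0 s) t = conv kker v t.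
  by apply: eq_Cint => s; rewrite vE.
rewrite /Kop Ev Eq {1}q0E addrA -mulrBr -Ek Eg mulrBr subrK //.
Qed.

(** The charge from time 1 on; near 0 no bound is available. The cut at 1 leaves the margin [1/2,
    1[, on which the initial part [b] is bounded. *)
Let y s : C := (\1_`[1, +oo[%classic s)%:C * q0 s.
Let b s : C := (\1_`]-oo, 1[%classic s)%:C * q0 s.

Let i1 s : (s \in `[(1:R), +oo[%classic) = (1 <= s).
Proof. by apply/idP/idP; rewrite inE/= in_itv/= andbT. Qed.
Let i2 s : (s \in `]-oo, (1:R)[%classic) = (s < 1).
Proof. by apply/idP/idP; rewrite inE/= in_itv/=. Qed.
Let y1 s : 1 <= s -> y s = q0 s. Proof. by move=> s1; rewrite /y indicE i1 s1 mul1r. Qed.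
Let y2 s : s < 1 -> y s = 0. Proof. by move=> s1; rewrite /y indicE i1 leNgt s1 mul0r. Qed.
Let b1 s : s < 1 -> b s = q0 s. Proof. by move=> s1; rewrite /b indicE i2 s1 mul1r. Qed.
Let b2 s : 1 <= s -> b s = 0. Proof. by move=> s1; rewrite /b indicE i2 ltNge s1 mul0r. Qed.
Let ybE s : q0 s = y s + b s.
Proof. by have [s1|s1] := leP 1 s; [rewrite y1// b2// addr0|rewrite y2// b1// add0r]. Qed.

Let my : cmeas y.
Proof.
apply: cmeasM; last exact: cmeas_q0.
by apply: cmeas_real; apply: measurable_indic; exact: measurable_itv.
Qed.
Let mb : cmeas b.
Proof.
apply: cmeasM; last exact: cmeas_q0.
by apply: cmeas_real; apply: measurable_indic; exact: measurable_itv.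
Qed.

(** Moving [b] to the right side gives y + K y = c1 k*g + mu*b - c1 k*(al b) for t >= 1, and
    [mker_conv_decay] bounds each term by a multiple of t^(-3/2). For t < 1 both y and K y
    vanish. *)
Lemma truncated_charge : exists E, [/\ cmeas y, forall t, t <= 0 -> y t = 0,
  forall X, exists Q, forall t, t <= X -> cabs (y t) <= Q &
  forall t, cabs (y t + Kop al c1 y t) * wt 1 t <= E].
Proof.
have ybdd X : exists Q, forall t, t <= X -> cabs (y t) <= Q.
  have [Q Q0 HQ] : exists2 Q, 0 <= Q & forall t, 1 / 2 <= t -> t <= Num.max 1 X -> cabs (q0 t) <= Q.
    by apply: q0_locally_bounded; rewrite le_max; apply/orP; left; lra.
  exists Q => t tX; have [t1|t1] := leP 1 t; last by rewrite y2// cabs0.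
  by rewrite y1//; apply: HQ; [lra|rewrite le_max tX orbT].
have [Q Q0 HQ] : exists2 Q, 0 <= Q & forall t, 1 / 2 <= t -> t <= 1 -> cabs (q0 t) <= Q.
  by apply: q0_locally_bounded; lra.
have half0 : 0 <= 1 / 2 :> R by lra.
have [A1 A10 HA1] : exists2 A, 0 <= A & forall t, 1 <= t ->
    L1 (fun s => mker (t - s) * ga s) /\ Lint (fun s => mker (t - s) * ga s) <= A * (hker t / t).
  apply: (mker_conv_decay mga _ _ B0).
  - by move=> s; exact: cabs_ge0.
  - exact: (L1_forcing mga B0 gaB Lg).
  - by move=> s s2; apply: gB; lra.
have [A2 A20 HA2] : exists2 A, 0 <= A & forall t, 1 <= t ->
    L1 (fun s => mker (t - s) * cabs (b s)) /\
    Lint (fun s => mker (t - s) * cabs (b s)) <= A * (hker t / t).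
  apply: (mker_conv_decay (measurable_cabs mb) _ _ Q0).
  - by move=> s; exact: cabs_ge0.
  - have Lq : L1 (fun s => \1_`]-oo, 1 / 2]%classic s * cabs (q0 s)).
      apply: L1_hker_local => //; first exact/measurable_cabs/cmeas_q0.
        by move=> s s0; rewrite q00// cabs0.
      apply: eq_L1 (CL1_cabs (CL1_hker_q0 (1 / 2 + 1))) => s.
      by rewrite cabsM cabs_real ger0_norm ?hker_ge0.
    apply: L1_le Lq.
      apply: measurable_funM; last exact: measurable_cabs.
      by apply: measurable_indic; exact: measurable_itv.
    move=> s; rewrite ger0_norm ?mulr_ge0 ?cabs_ge0// ler_wpM2l//.
    by have [s1|s1] := leP 1 s; [rewrite b2// cabs0 cabs_ge0|rewrite b1].
  - move=> s s2; have [s1|s1] := leP 1 s.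
      by rewrite b2// cabs0 mulr_ge0// divr_ge0 ?hker_ge0//; lra.
    rewrite b1//; apply: (le_trans (HQ s s2 (ltW s1))); apply: ler_peMr => //.
    have h1 : 1 <= hker s.
      have <- : hker 1 = 1 :> R by rewrite /hker sqrtr1 invr1.
      by apply: hker_ninc; lra.
    have s1' : 1 <= s^-1 by rewrite invf_ge1; lra.
    have := ler_pM ler01 ler01 h1 s1'; by rewrite mulr1.
exists (4 * (cabs c1 * A1 + A2 + cabs c1 * (Am * A2))).
split => // [t t0|t]; first by rewrite y2//; lra.
have K0 : 0 <= cabs c1 * A1 + A2 + cabs c1 * (Am * A2).
  by rewrite !addr_ge0// !mulr_ge0 ?cabs_ge0.
have [t1|t1] := ltP t 1.
  have c0 (k : R -> R) (f : R -> C) : (forall u, u <= 0 -> k u = 0) ->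
      (forall s, s < 1 -> f s = 0) -> conv k f t = 0.
    move=> kn fn; rewrite /conv [LHS](_ : _ = Cint (fun=> 0)); last first.
      apply: eq_Cint => s; have [s1|s1] := ltP s 1; first by rewrite fn// mulr0.
      by rewrite kn ?mul0r//; lra.
    by rewrite /Cint/= Lint0.
  have -> : y t + Kop al c1 y t = 0.
    rewrite y2// /Kop !c0 ?oppr0 ?mulr0 ?addr0//.
    - exact: kker_neg.
    - by move=> s s1; rewrite y2// mulr0.
    - by move=> u u0; apply: muker_le1; lra.
  by rewrite cabs0 mul0r mulr_ge0.
have t0 : 0 < t by lra.
have D := @dominated_muker R; have D' := @dominated_kker R.
have [Lga Hga] := HA1 t t1; have [Lb Hb] := HA2 t t1.
have Lb' : L1 (fun s => mker (t - s) * (Am * cabs (b s))).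
  by apply: eq_L1 (L1Z Am Lb) => s; rewrite mulrCA.
have albA s : s < t -> cabs ((al s)%:C * b s) <= Am * cabs (b s).
  by move=> _; rewrite cabsM cabs_real ler_wpM2r ?cabs_ge0.
have mab := cmeas_al mal mb.
have [Bt yt] := ybdd t.
have ybd : bdd_before y t by exists Bt => s st; apply: yt; exact: ltW.
have Lmy := CL1_conv_bdd D my ybd.
have Lky := CL1_conv_bdd D' (cmeas_al mal my) (al_bdd alA ybd).
have Lmb := CL1_conv D mb (fun s _ => lexx (cabs (b s))) Lb.
have Lkb := CL1_conv D' mab albA Lb'.
have Em : conv muker q0 t = conv muker y t + conv muker b t.
  by rewrite /conv -CintD//; apply: eq_Cint => s; rewrite -mulrDr ybE.
have Ek : conv kker (fun s => (al s)%:C * q0 s) t =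
    conv kker (fun s => (al s)%:C * y s) t + conv kker (fun s => (al s)%:C * b s) t.
  by rewrite /conv -CintD//; apply: eq_Cint => s; rewrite -2!mulrDr -ybE.
have -> : y t + Kop al c1 y t = c1 * conv kker g t + conv muker b t -
    c1 * conv kker (fun s => (al s)%:C * b s) t.
  by rewrite -regularized_equation /Kop Em Ek y1//; ring.
have Hg := conv_le D' mg (fun s _ => lexx (cabs (g s))) Lga.
have Hm := conv_le D mb (fun s _ => lexx (cabs (b s))) Lb.
have Hk := conv_le D' mab albA Lb'.
have Hk' : cabs (conv kker (fun s => (al s)%:C * b s) t) <= Am * (A2 * (hker t / t)).
  apply: (le_trans Hk); rewrite (eq_Lint (fun s => mulrCA _ _ _)) LintZ// ler_wpM2l//.
set z := (_ + _ - _).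
have zle : cabs z <= (cabs c1 * A1 + A2 + cabs c1 * (Am * A2)) * (hker t / t).
  apply: (le_trans (cabsD _ _)); rewrite cabsN cabsM mulrDl; apply: lerD.
    apply: (le_trans (cabsD _ _)); rewrite mulrDl; apply: lerD; last exact: le_trans Hm Hb.
    rewrite cabsM -mulrA ler_wpM2l ?cabs_ge0//; exact: le_trans Hg Hga.
  by rewrite -2!mulrA ler_wpM2l ?cabs_ge0.
have w0 : 0 <= wt 1 t by exact/ltW/wt_gt0.
have sle : Num.sqrt (1 + 1 * t) <= 2 * Num.sqrt t.
  have -> : 2 = Num.sqrt (2 ^+ 2) :> R by rewrite sqrtr_sqr ger0_norm.
  by rewrite -sqrtrM ?exprn_ge0//; apply: ler_wsqrtr; rewrite expr2; lra.
have p : wt 1 t <= (2 * t) * (2 * Num.sqrt t).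
  by rewrite (wt_pos _ (ltW t0)); apply: ler_pM; rewrite ?sqrtr_ge0//; lra.
have k0 : 0 <= hker t / t by rewrite divr_ge0 ?hker_ge0// ltW.
(* For t >= 1 one has 1 + t <= 2 t and sqrt (1 + t) <= 2 sqrt t, so the weight is at most 4
   t^(3/2). *)
have k4 : hker t / t * wt 1 t <= 4.
  apply: (@le_trans _ _ (hker t / t * (2 * t * (2 * Num.sqrt t)))); first exact: ler_wpM2l.
  have -> : hker t / t * (2 * t * (2 * Num.sqrt t)) = 4 * (Num.sqrt t * hker t).
    by field; rewrite gt_eqF.
  by rewrite sqrt_hker// mulr1.
apply: (le_trans (ler_wpM2r w0 zle)); rewrite -mulrA [X in _ <= X]mulrC.
exact: ler_wpM2l.
Qed.

End ChargeDecay.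

(** * The charge equation and the decay estimate *)

Section Charge.
Context {R : realType}.
Local Notation C := R[i].
Local Notation leb := (@lebesgue_measure R).
Implicit Types (s t : R) (z : C).

Lemma Re_scale (x : R) z : complex.Re (x%:C * z) = x * complex.Re z.
Proof. by rewrite ReM/= mul0r subr0. Qed.

Lemma Im_scale (x : R) z : complex.Im (x%:C * z) = x * complex.Im z.
Proof. by rewrite ImM/= mul0r addr0. Qed.

Lemma ReCint (f : R -> C) : complex.Re (Cint f) = Lint (fun s => complex.Re (f s)).
Proof. by []. Qed.

Lemma ImCint (f : R -> C) : complex.Im (Cint f) = Lint (fun s => complex.Im (f s)).
Proof. by []. Qed.

Lemma cintegral_mkcond (D : set R) (f : R -> C) :
  cintegral leb D f = Cint (fun s => (\1_D s)%:C * f s).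
Proof.
by rewrite /cintegral /Cint !Lint_mkcond; congr (_ +i* _); apply: eq_Lint => s;
  rewrite ?Re_scale ?Im_scale.
Qed.

Lemma cintegrable_mkcond (D : set R) (f : R -> C) : measurable D ->
  cintegrable leb D f -> CL1 (fun s => (\1_D s)%:C * f s).
Proof.
move=> mD [/(L1_mkcond _ mD) r /(L1_mkcond _ mD) i].
split; [apply: eq_L1 r => s|apply: eq_L1 i => s]; by rewrite ?Re_scale ?Im_scale.
Qed.

Lemma div_sqrt_hker t s z : z / (Num.sqrt (t - s))%:C = (hker (t - s))%:C * z.
Proof. by rewrite mulrC /hker fmorphV. Qed.

Lemma hker_causal (f : R -> C) t s : t <= 0 -> (forall r, r < 0 -> f r = 0) ->
  (hker (t - s))%:C * f s = 0.
Proof.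
move=> t0 f0; have [s0|s0] := ltP s 0; first by rewrite f0// mulr0.
by rewrite hker_neg ?mul0r//; lra.
Qed.

Lemma conv_hker_causal (f : R -> C) t : t <= 0 -> (forall r, r < 0 -> f r = 0) ->
  conv hker f t = 0.
Proof.
move=> t0 f0; rewrite /conv (eq_Cint (fun s => hker_causal s t0 f0)).
by rewrite /Cint/= Lint0.
Qed.

(** The equation on [0, t] becomes an identity of convolutions on the line for all real t: [q0] is
    the charge extended by 0, and [g] is built from [effective_forcing], applied to the real and the
    imaginary part separately because either may fail to be integrable on its own. *)
Lemma reduced_charge_equation (al : R -> R) (q : R -> C) : al 0 < 0 ->
  is_charge al (fun y => (eigfun (al 0) y)%:C) q ->
  let c1 : C := (4 * Num.sqrt pi)%:C * expi (pi / 4) in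
  let q0 s : C := (\1_`[0, +oo[%classic s)%:C * q s in
  let v s := (al s)%:C * q0 s in
  exists g B, [/\ [/\ 0 <= B, cmeas g, forall s, s <= 0 -> g s = 0,
      forall s, 0 < s -> cabs (g s) <= B * (hker s / s) &
      L1 (fun s => \1_`]-oo, 1]%classic s * cabs (g s))],
    forall s, s <= 0 -> q0 s = 0,
    forall t, CL1 (fun s => (hker (t - s))%:C * v s) &
    forall t, q0 t + c1 * conv hker v t = c1 * conv hker g t].
Proof.
move=> a0 ch c1 q0 v.
have [B B0 HB] := freeAt0_bound a0; have [mr mi] := cmeas_freeAt0 a0.
move: ch HB mr mi; rewrite /is_charge; set f := freeAt0 _ => ch HB mr mi.
have f0 : f 0 = 0 by exact: freeAt0_0.
have rB s : 0 < s -> `|complex.Re (f s)| <= B * (hker s / s).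
  by move=> s0; exact: le_trans (abs_Re_le _) (HB s s0).
have iB s : 0 < s -> `|complex.Im (f s)| <= B * (hker s / s).
  by move=> s0; exact: le_trans (abs_Im_le _) (HB s s0).
have r0 : complex.Re (f 0) = 0 by rewrite f0.
have i0 : complex.Im (f 0) = 0 by rewrite f0.
clearbody f.
have [gr [mgr gr0 grB Lgr Egr]] := effective_forcing mr B0 rB r0.
have [gi [mgi gi0 giB Lgi Egi]] := effective_forcing mi B0 iB i0.
pose g s : C := gr s +i* gi s.
have mg : cmeas g by [].
have g0 s : s <= 0 -> g s = 0 by move=> s0; rewrite /g gr0// gi0.
have i0E s : (s \in `[(0:R), +oo[%classic) = (0 <= s).
  by apply/idP/idP; rewrite inE/= in_itv/= andbT.
have q0n s : s < 0 -> q0 s = 0 by move=> s0; rewrite /q0 indicE i0E leNgt s0 mul0r.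
have q0p s : 0 <= s -> q0 s = q s by move=> s0; rewrite /q0 indicE i0E s0 mul1r.
have vn s : s < 0 -> v s = 0 by move=> s0; rewrite /v q0n// mulr0.
have gn s : s < 0 -> g s = 0 by move=> s0; rewrite g0// ltW.
have m0 t s : (s \in `[0, t]%classic) = (0 <= s <= t) by apply/idP/idP; rewrite inE/= in_itv/=.
have kqE t s : (\1_`[0, t]%classic s)%:C * ((al s)%:C * q s / (Num.sqrt (t - s))%:C) =
    (hker (t - s))%:C * v s.
  rewrite div_sqrt_hker indicE m0; have [s0|s0] := leP 0 s; last by rewrite mul0r vn// mulr0.
  have [st|st] := leP s t; first by rewrite mul1r /v q0p.
  by rewrite mul0r hker_neg ?mul0r//; lra.
have kfE t : 0 <= t -> cintegral leb `[0, t] (fun s => f s / (Num.sqrt (t - s))%:C) = conv hker g t.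
  move=> t0; rewrite cintegral_mkcond; apply: eqC; rewrite /conv ?ReCint ?ImCint.
    transitivity (Lint (fun s => \1_`[0, t]%classic s * (complex.Re (f s) * hker (t - s)))).
      by apply: eq_Lint => s; rewrite div_sqrt_hker !Re_scale [hker _ * _]mulrC.
    by rewrite Egr//; apply: eq_Lint => s; rewrite Re_scale.
  transitivity (Lint (fun s => \1_`[0, t]%classic s * (complex.Im (f s) * hker (t - s)))).
    by apply: eq_Lint => s; rewrite div_sqrt_hker !Im_scale [hker _ * _]mulrC.
  by rewrite Egi//; apply: eq_Lint => s; rewrite Im_scale.
have c1E : 4%:C * sqrt_pi_i R = c1 by rewrite /c1 /sqrt_pi_i rmorphM mulrA.
have eqp t : 0 <= t -> CL1 (fun s => (hker (t - s))%:C * v s) /\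
    q0 t + c1 * conv hker v t = c1 * conv hker g t.
  move=> t0; have [/cintegrable_mkcond L E] := ch t t0.
  split; first by apply: (eq_CL1 (kqE t)); apply: L; exact: measurable_itv.
  rewrite q0p// -kfE// -c1E -E; congr (_ + _ * _).
  by rewrite cintegral_mkcond; apply: eq_Cint => s; rewrite kqE.
(* At t = 0 both integrals vanish, so the equation itself gives q 0 = 0. *)
have q00 s : s <= 0 -> q0 s = 0.
  rewrite le_eqVlt => /orP[/eqP ->|]; last exact: q0n.
  have [_] := eqp 0 (lexx _); rewrite !conv_hker_causal// mulr0 addr0; exact.
have LI : CL1 (fun s => (\1_`]-oo, 1]%classic s)%:C * g s).
  by split; [apply: eq_L1 Lgr => s|apply: eq_L1 Lgi => s]; rewrite ?Re_scale ?Im_scale.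
exists g, (2 * B); split.
- split => //; first by rewrite mulr_ge0.
    move=> s s0; apply: (le_trans (cabs_le_abs _)); rewrite -mulrA mulr2n mulrDl mul1r /=.
    by apply: lerD; [exact: grB|exact: giB].
  apply: eq_L1 (CL1_cabs LI) => s; by rewrite cabsM cabs_real ger0_norm.
- exact: q00.
- move=> t; have [t0|t0] := leP 0 t; first exact: (eqp t t0).1.
  have E s : 0 = (hker (t - s))%:C * v s by rewrite hker_causal// ltW.
  by apply: (eq_CL1 E); split; exact: L1_0.
- move=> t; have [t0|t0] := leP 0 t; first exact: (eqp t t0).2.
  by rewrite q0n// !conv_hker_causal ?ltW// mulr0 addr0.
Qed.

(** The Fourier partial sums are bounded by the l^1-norm of the coefficients, and this bound passes
    to their limit. *)
Lemma standing_bound (T : R) (al : R -> R) (an : int -> C) : standing T al an ->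
  exists Am, forall t, `|al t| <= Am.
Proof.
move=> [_ [_ [_ [/l1Z_bound[A1 HA] [_ [four _]]]]]]; exists A1 => t.
have [cv _] := four t.
have b N : `|complex.Re (fourier_partial an (2 * pi / T) N t)| <= A1.
  apply: (le_trans (abs_Re_le _)); rewrite fourier_partialE.
  apply: (le_trans _ (HA _ (zwin_uniq N))).
  apply: (le_trans (cabs_sum _ _ _)); apply: ler_sum => n _.
  by rewrite cabsM cabs_expi mulr1.
have cvn : `|complex.Re (fourier_partial an (2 * pi / T) N t)| @[N --> \oo] --> `|al t|.
  exact: cvg_norm.
rewrite -(cvg_lim (@Rhausdorff R) cvn); apply: limr_le; first by apply/cvg_ex; exists `|al t|.
by apply: nearW => N; exact: b.
Qed.

Theorem charge_decay (T : R) (al : R -> R) (an : int -> C) (q : R -> C) :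
  standing T al an -> generic an -> is_charge al (fun y => (eigfun (al 0) y)%:C) q ->
  exists A, forall t, 1 <= t -> cabs (q t) <= A * t `^ (- (3 / 2)).
Proof.
move=> st gen ch; have [Am alA] := standing_bound st.
have [T0 [cal [alT [lan [herm [four a0]]]]]] := st.
have mal : measurable_fun setT al by exact: continuous_measurable_fun.
have c0 : 0 < 4 * Num.sqrt pi :> R by rewrite mulr_gt0// sqrtr_gt0 pi_gt0.
have nF := no_floquet T0 mal alT alA c0 lan herm four gen.
have [M M0 stab] := stability T0 mal alT alA nF.
have [d d0 wd] := weighted_decay mal alA M0 stab.
have [g [B [[B0 mg g0 gB Lg] q00 Lv eqn]]] := reduced_charge_equation a0 ch.
have [E [my y0 yb yE]] := truncated_charge mal alA B0 mg g0 gB Lg q00 (fun=> erefl) Lv eqn.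
have H := wd _ _ my y0 yb yE.
have s0 : 0 < d * Num.sqrt d by rewrite mulr_gt0// sqrtr_gt0.
(* The divisor d^(3/2) comes from (d t)^(3/2) <= [wt d t]. *)
exists (2 * (M * E) / (d * Num.sqrt d)) => t t1; have t0 : 0 < t by lra.
have := H t; rewrite !indicE !mem_set ?mul1r/= ?in_itv/= ?andbT; [|lra|lra].
move=> Ht; rewrite powR_hker// mulrAC ler_pdivlMr//.
have k0 : 0 <= hker t / t by rewrite divr_ge0 ?hker_ge0// ltW.
apply: (le_trans _ (ler_wpM2r k0 Ht)); rewrite -mulrA ler_wpM2l ?cabs_ge0//.
have -> : d * Num.sqrt d = (d * t * Num.sqrt (d * t)) * (hker t / t).
  rewrite sqrtrM ?ltW//.
  transitivity (d * Num.sqrt d * (Num.sqrt t * hker t)); first by rewrite sqrt_hker ?mulr1.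
  by field; rewrite gt_eqF.
apply: ler_wpM2r => //; rewrite (wt_pos _ (ltW t0)).
have dt0 : 0 < d * t by rewrite mulr_gt0.
apply: ler_pM; rewrite ?sqrtr_ge0 ?(ltW dt0)//; first lra.
by apply: ler_wsqrtr; lra.
Qed.

End Charge.

Unset Implicit Arguments.

Theorem mainTheorem14 (R : realType) (T : R) (alpha : R -> R)
  (an : int -> R[i]) (q : R -> R[i]) :
  standing T alpha an ->
  an 0 = 0 ->
  generic an ->
  is_charge alpha (fun y => (eigfun (alpha 0) y)%:C) q ->
  exists A Cst B : R, 0 < Cst /\ 0 < B /\
    exists Rf : R -> R,
      (Rf t / (Cst * expR (- (B * t)))) @[t --> +oo] --> (1 : R) /\
      (\forall t \near +oo, cabs (q t) <= A * t `^ (- (3 / 2)) + Rf t).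
Proof.
move=> st _ gen ch; have [A HA] := charge_decay st gen ch.
(* The power bound already dominates |q|, so the positive exponential with C = B = 1 can be added as
   R. *)
exists A, 1, 1; do 2 split => //; exists (fun t => expR (- t)); split.
  rewrite (_ : (fun t => _) = (fun=> 1)); first exact: cvg_cst.
  by apply/funext => t; rewrite !mul1r divff// gt_eqF// expR_gt0.
near=> t; apply: (le_trans (HA t _)); first by near: t; exact: nbhs_pinfty_ge.
by rewrite lerDl expR_ge0.
Unshelve. all: by end_near.
Qed.
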